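(* Let $p$ be an odd prime, let $T$ be the $p$-adic tree, let $G\le \operatorname{Aut} T$ be a multi-EGS group and let $N\trianglelefteq G$. Suppose that $[N,G]$, hence also $N$, is a congruence subgroup of $G$, and let $m\in\mathbb{N}_0$ be maximal subject to $N\subseteq \operatorname{St}_G(m)$. Then the following hold: (i) if $G$ is regular branch over $[G,G]$, then $\operatorname{St}_G(m+\dot r_G+3)\subseteq [N,G]$; (ii) if $G$ is regular branch over $\gamma_3(G)$ but not over $[G,G]$, then $\operatorname{St}_G(m+7)\subseteq [N,G]$. In the special case where $G$ is a GGS-group, the conclusion in (i) improves to $\operatorname{St}_G(m+3)\subseteq [N,G]$ and the conclusion in (ii) improves to $\operatorname{St}_G(m+4)\subseteq [N,G]$. Finally, if $G$ is the Fabrykowski--Gupta group for the prime $p$, then $\operatorname{St}_G(m+2)\subseteq [N,G]$.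
   Context: **Tree and automorphisms.** $T$ is the infinite rooted tree whose vertices are the finite words over $X=\{1,\dots,p\}$ (root: the empty word), with an edge between $u$ and $ux$ for every word $u$ and $x\in X$; the $n$th level consists of the words of length $n$. $\operatorname{Aut} T$ acts on the right, $u\mapsto u^f$. For $f\in\operatorname{Aut}T$ and a vertex $u$, the section $f_u\in \operatorname{Aut}T$ is given by $(uv)^f=u^fv^{f_u}$ for all words $v$. For $G\le\operatorname{Aut}T$ and $n\in\mathbb{N}_0$, $\operatorname{St}_G(n)$ is the subgroup of elements fixing all vertices of level $n$. The map $\psi\colon\operatorname{St}_{\operatorname{Aut}T}(1)\to \operatorname{Aut}T\times\overset{p}{\cdots}\times\operatorname{Aut}T$, $g\mapsto(g_1,\dots,g_p)$, sends $g$ to its sections at the vertices $1,\dots,p$. A subgroup $H\le G$ is a congruence subgroup of $G$ if $\operatorname{St}_G(n)\subseteq H$ for some $n\in\mathbb{N}$. **Regular branch.** $G$ is self-similar if for every vertex $u$ the sections at $u$ of the elements of $G$ fixing $u$ all lie in $G$. $G$ is regular branch over a finite-index subgroup $K\le G$ if $G$ acts transitively on every level of $T$, $G$ is self-similar, and $K\times\overset{p}{\cdots}\times K\subseteq\psi(\operatorname{St}_G(1)\cap K)$. **Multi-EGS groups.** Let $a\in\operatorname{Aut}T$ be the rooted automorphism $(xv)^a=x^{\sigma}v$, where $\sigma=(1\,2\,\cdots\,p)$. Let $r_1,\dots,r_p\in\{0,1,\dots,p-1\}$, not all zero, and for each $j\in\{1,\dots,p\}$ let $\mathbf{E}^{(j)}=(\mathbf{e}^{(j)}_1,\dots,\mathbf{e}^{(j)}_{r_j})$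 be a system of $\mathbb{F}_p$-linearly independent vectors $\mathbf{e}^{(j)}_i=(e^{(j)}_{i,1},\dots,e^{(j)}_{i,p-1})\in\mathbb{F}_p^{\,p-1}$. Define directed automorphisms $b^{(j)}_i\in\operatorname{St}_{\operatorname{Aut}T}(1)$ recursively by $$\psi(b^{(j)}_i)=\bigl(a^{e^{(j)}_{i,j}},\dots,a^{e^{(j)}_{i,p-1}},\,b^{(j)}_i,\,a^{e^{(j)}_{i,1}},\dots,a^{e^{(j)}_{i,j-1}}\bigr),$$ so $b_i^{(j)}$ is in coordinate $p-j+1$; $\mathbf{e}_i^{(j)}$ is called the defining vector of $b_i^{(j)}$. The multi-EGS group associated to these data is $G=\langle\{a\}\cup\{b^{(j)}_i\mid 1\le j\le p,\ 1\le i\le r_j\}\rangle$, and this generating set is a standard generating system for $G$. The number $\dot r_G$ is the maximal number of linearly independent defining vectors of the directed automorphisms in a standard generating system, i.e. the dimension of the $\mathbb{F}_p$-span of all the vectors $\mathbf{e}^{(j)}_i$. A GGS-group is a group $\langle a,b\rangle$ where $\psi(b)=(a^{e_1},\dots,a^{e_{p-1}},b)$ for a non-zero defining vector $(e_1,\dots,e_{p-1})\in\mathbb{F}_p^{\,p-1}$. The Fabrykowski--Gupta group for the prime $p$ is the GGS-group with defining vector $(1,0,\dots,0)$. $\gamma_i(G)$ denotes the $i$th term of the lower central series. *)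

(* Defs.v *)
From HB Require Import structures.
From mathcomp Require Import all_boot all_order all_fingroup all_algebra.
From mathcomp Require Import boolp classical_sets cardinality.

Set Implicit Arguments.
Unset Strict Implicit.
Unset Printing Implicit Defensive.

Local Open Scope classical_set_scope.
Local Open Scope group_scope.

(* The vertices of the tree are the words over 'I_p, the letter x of
   {1, ..., p} being encoded as x - 1. *)
Definition adj (p : nat) (u v : seq 'I_p) : Prop :=
  (exists x, v = rcons u x) \/ (exists x, u = rcons v x).

Record treeAut (p : nat) := TreeAut {
  aut_fun :> seq 'I_p -> seq 'I_p;
  aut_bij : bijective aut_fun;
  aut_root : aut_fun [::] = [::];
  aut_adj : forall u v, adj (aut_fun u) (aut_fun v) <-> adj u v
}.

Section TreeAutTheory.
Variable p : nat.
Implicit Types (f g h : treeAut p) (u v w : seq 'I_p) (x y : 'I_p).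

Lemma treeAutP f g : f =1 g -> f = g.
Proof.
case: f g => [f f1 f2 f3] [g g1 g2 g3] /= /funext fg.
subst g; rewrite (Prop_irrelevance f1 g1) (Prop_irrelevance f2 g2).
by rewrite (Prop_irrelevance f3 g3).
Qed.

Lemma aut_rcons f u x : exists y, f (rcons u x) = rcons (f u) y.
Proof.
elim/last_ind: u x => [|u z IHu] x.
  have: adj [::] (rcons [::] x) by left; exists x.
  case/(aut_adj f) => -[y].
  - by move=> ->; exists y.
  - by rewrite aut_root => /(congr1 size); rewrite size_rcons.
have: adj (rcons u z) (rcons (rcons u z) x) by left; exists x.
case/(aut_adj f) => -[y]; first by move=> ->; exists y.
have [t ->] := IHu z => /rcons_inj[/(bij_inj (aut_bij f))].
by move=> /(congr1 size) /eqP; rewrite !size_rcons -addn2 -{1}[size u]addn0 eqn_add2l.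
Qed.

Lemma size_aut f u : size (f u) = size u.
Proof.
elim/last_ind: u => [|u x IHu]; first by rewrite aut_root.
by have [y ->] := aut_rcons f u x; rewrite !size_rcons IHu.
Qed.

Lemma adj_of_rcons (f : seq 'I_p -> seq 'I_p) :
    injective f -> f [::] = [::] ->
    (forall u x, exists y, f (rcons u x) = rcons (f u) y) ->
  forall u v, adj (f u) (f v) <-> adj u v.
Proof.
move=> finj f0 frcons.
have child u v : (exists x, f v = rcons (f u) x) <-> (exists x, v = rcons u x).
  split=> [[y]|[x ->]]; last exact: frcons.
  case/lastP: v => [|v z]; first by rewrite f0 => /(congr1 size); rewrite size_rcons.
  by have [t ->] := frcons v z => /rcons_inj[/finj-> _]; exists z.
by move=> u v; rewrite /adj !child.
Qed.

Definition mk_treeAut (f : seq 'I_p -> seq 'I_p) (fbij : bijective f)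
    (f0 : f [::] = [::])
    (frcons : forall u x, exists y, f (rcons u x) = rcons (f u) y) : treeAut p :=
  TreeAut fbij f0 (adj_of_rcons (bij_inj fbij) f0 frcons).

Definition aut_one : treeAut p.
Proof.
apply: (@TreeAut p id); [by exists id | by [] | by []].
Defined.

(* Aut T acts on the right: u^(f * g) = (u^f)^g. *)
Definition aut_mul f g : treeAut p.
Proof.
apply: (@TreeAut p (g \o f)).
- by apply: bij_comp; exact: aut_bij.
- by rewrite /= !aut_root.
- by move=> u v /=; rewrite !aut_adj.
Defined.

Lemma aut_inv_subproof f :
  exists g : treeAut p, cancel f g /\ cancel g f.
Proof.
have [g fK gK] := aut_bij f.
have gP u v : adj (g u) (g v) <-> adj u v by rewrite -(aut_adj f) !gK.
have g0 : g [::] = [::] by rewrite -{1}(aut_root f) fK.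
by exists (TreeAut (Bijective gK fK) g0 gP).
Qed.

Definition aut_inv f : treeAut p := sval (cid (aut_inv_subproof f)).

Lemma aut_invK f : cancel f (aut_inv f).
Proof. by rewrite /aut_inv; case: cid => g []. Qed.

Lemma aut_Kinv f : cancel (aut_inv f) f.
Proof. by rewrite /aut_inv; case: cid => g []. Qed.

HB.instance Definition _ := gen_eqMixin (treeAut p).
HB.instance Definition _ := gen_choiceMixin (treeAut p).

Lemma aut_mulA : associative aut_mul.
Proof. by move=> f g h; exact: treeAutP. Qed.
Lemma aut_mul1 : left_id aut_one aut_mul.
Proof. by move=> f; exact: treeAutP. Qed.
Lemma aut_mulr1 : right_id aut_one aut_mul.
Proof. by move=> f; exact: treeAutP. Qed.
Lemma aut_mulV : left_inverse aut_one aut_inv aut_mul.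
Proof. by move=> f; apply: treeAutP => u /=; exact: aut_Kinv. Qed.
Lemma aut_mulrV : right_inverse aut_one aut_inv aut_mul.
Proof. by move=> f; apply: treeAutP => u /=; exact: aut_invK. Qed.

HB.instance Definition _ := isGroup.Build (treeAut p)
  aut_mulA aut_mul1 aut_mulr1 aut_mulV aut_mulrV.

Definition section_fun f u v := drop (size u) (f (u ++ v)).

Lemma take_aut f u v : take (size u) (f (u ++ v)) = f u.
Proof.
elim/last_ind: v => [|v x IHv].
  by rewrite cats0 -(size_aut f) take_size.
have [y] := aut_rcons f (u ++ v) x; rewrite rcons_cat => ->.
by rewrite -cats1 takel_cat // size_aut size_cat leq_addr.
Qed.

Lemma section_funE f u v : f (u ++ v) = f u ++ section_fun f u v.
Proof. by rewrite -{1}[f (u ++ v)](cat_take_drop (size u)) take_aut. Qed.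

Lemma section_bij f u : bijective (section_fun f u).
Proof.
exists (section_fun f^-1 (f u)) => v.
  rewrite /section_fun -section_funE size_aut.
  by rewrite [f^-1 _](aut_invK f) drop_size_cat.
have /= := section_funE f^-1 (f u) v; rewrite [f^-1 (f u)](aut_invK f) => E.
rewrite /section_fun -E [f (f^-1 _)](aut_Kinv f).
by rewrite drop_size_cat // size_aut.
Qed.

Lemma section_root f u : section_fun f u [::] = [::].
Proof. by rewrite /section_fun cats0 -(size_aut f) drop_size. Qed.

Lemma section_rcons f u v x :
  exists y, section_fun f u (rcons v x) = rcons (section_fun f u v) y.
Proof.
have [y] := aut_rcons f (u ++ v) x; rewrite rcons_cat => fE; exists y.
by rewrite /section_fun fE drop_rcons // size_aut size_cat leq_addr.
Qed.

Definition section f u : treeAut p :=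
  mk_treeAut (section_bij f u) (section_root f u) (section_rcons f u).

Lemma sectionE f u v : f (u ++ v) = f u ++ section f u v.
Proof. exact: section_funE. Qed.

(* Total, but only used (and only multiplicative) on the stabiliser of level 1. *)
Definition psi g : 'I_p -> treeAut p := fun x => section g [:: x].

(* The rooted automorphism a; ordS is x |-> x + 1 mod p. *)
Definition rooted_fun v : seq 'I_p := if v is x :: w then ordS x :: w else [::].

Lemma rooted_bij : bijective rooted_fun.
Proof.
exists (fun v => if v is x :: w then ord_pred x :: w else [::]).
- by case=> //= x v; rewrite ordSK.
- by case=> //= x v; rewrite ord_predK.
Qed.

Lemma rooted_rcons v x : exists y, rooted_fun (rcons v x) = rcons (rooted_fun v) y.
Proof. by case: v => [|z v] /=; [exists (ordS x) | exists x]. Qed.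

Definition rooted : treeAut p := mk_treeAut rooted_bij erefl rooted_rcons.

(* With j and the letter x both counted from 0, the section of the directed
   automorphism at x is a^(e_k) where k = j + x mod p (the coordinates of e
   being counted from 0 as well), except when k = p - 1, that is when x is the
   (p - j)th coordinate counted from 1, where it is the automorphism itself. *)
Fixpoint directed_fun (j : nat) (e : 'rV['F_p]_p.-1) v : seq 'I_p :=
  if v is x :: w then
    x :: if insub ((j + x) %% p)%N is Some k
         then (rooted ^+ nat_of_ord (e ord0 k)) w
         else directed_fun j e w
  else [::].

Lemma directed_bij j e : bijective (directed_fun j e).
Proof.
pose fix g v : seq 'I_p :=
  if v is x :: w then
    x :: if insub ((j + x) %% p)%N is Some k
         then (rooted ^- nat_of_ord (e ord0 k)) w
         else g w
  else [::].
exists g; elim=> //= x v IHv; congr cons.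
- by case: insub => [k|//]; exact: aut_invK.
- by case: insub => [k|//]; exact: aut_Kinv.
Qed.

Lemma directed_rcons j e v x :
  exists y, directed_fun j e (rcons v x) = rcons (directed_fun j e v) y.
Proof.
elim: v => [|z v [y IHv]] /=.
  by exists x; congr [:: _ & _]; case: insub => [k|//]; rewrite aut_root.
case: insub => [k|]; last by exists y; rewrite IHv.
by have [t ->] := aut_rcons (rooted ^+ nat_of_ord (e ord0 k)) v x; exists t.
Qed.

Definition directed j e : treeAut p :=
  mk_treeAut (directed_bij j e) erefl (directed_rcons j e).

Lemma psi_directed j e x :
  psi (directed j e) x =
  if insub ((j + x) %% p)%N is Some k then rooted ^+ nat_of_ord (e ord0 k)
  else directed j e.
Proof.
by apply: treeAutP => v; rewrite /psi /= /section_fun /= drop0; case: insub.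
Qed.

End TreeAutTheory.

Arguments rooted p : clear implicits.

Section Subgroups.
Variable gT : groupType.
Implicit Types A G H K N : set gT.

Definition subgroup H : Prop := group_closed [in H].

Definition generated_subgroup A : set gT := smallest subgroup A.

Definition normal_in N G : Prop :=
  [/\ subgroup N, N `<=` G & forall n g, N n -> G g -> N (n ^ g)].

Definition commutator_subgroup H K : set gT :=
  generated_subgroup [set [~ h, k] | h in H & k in K].

(* i >= 1, with lower_central 1 G = G *)
Definition lower_central (i : nat) G : set gT :=
  iter i.-1 (fun H => commutator_subgroup H G) G.

Definition finite_index K G : Prop :=
  [/\ subgroup K, K `<=` G & finite_set [set [set k * g | k in K] | g in G]].

End Subgroups.

Section TreeGroups.
Variable p : nat.
Implicit Types G H K : set (treeAut p).

Definition St G (n : nat) : set (treeAut p) :=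
  [set g | G g /\ forall u, size u = n -> g u = u].

Definition congruence_subgroup H G : Prop :=
  [/\ subgroup H, H `<=` G & exists2 n, (0 < n)%N & St G n `<=` H].

Definition level_transitive G : Prop :=
  forall u v : seq 'I_p, size u = size v -> exists2 g, G g & g u = v.

Definition self_similar G : Prop :=
  forall u (g : treeAut p), G g -> g u = u -> G (section g u).

Definition regular_branch G K : Prop :=
  [/\ finite_index K G, level_transitive G, self_similar G &
      [set k | forall x, K (k x)] `<=` [set psi g | g in St G 1 `&` K]].

(* The rows of E j are the defining vectors e^(j+1)_1, ..., e^(j+1)_(r j). *)
Definition multiEGS (r : 'I_p -> 'I_p)
    (E : forall j : 'I_p, 'M['F_p]_(r j, p.-1)) : set (treeAut p) :=
  generated_subgroup
    (rooted p |` [set b | exists (j : 'I_p) (i : 'I_(r j)),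
                            b = directed j (row i (E j))]).

Definition multiEGS_data (r : 'I_p -> 'I_p)
    (E : forall j : 'I_p, 'M['F_p]_(r j, p.-1)) : Prop :=
  (exists j, (0 < r j)%N) /\ (forall j, row_free (E j)).

(* The dimension of the span of all the defining vectors. *)
Definition rdot (r : 'I_p -> 'I_p)
    (E : forall j : 'I_p, 'M['F_p]_(r j, p.-1)) : nat :=
  \rank (\sum_j <<E j>>)%MS.

Definition GGS (e : 'rV['F_p]_p.-1) : set (treeAut p) :=
  generated_subgroup [set rooted p; directed 0 e].

Definition is_GGS G : Prop := exists2 e : 'rV['F_p]_p.-1, e <> 0%R & G = GGS e.

Definition FabrykowskiGupta : set (treeAut p) :=
  GGS (\row_(k < p.-1) (k == 0 :> nat)%:R)%R.

End TreeGroups.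

Arguments FabrykowskiGupta p : clear implicits.

(* Main.v *)
Require Import Defs.
From HB Require Import structures.
From mathcomp Require Import boolp classical_sets cardinality.
From mathcomp Require Import all_boot all_order all_fingroup all_algebra all_solvable.
From mathcomp Require Import generic_quotient ring.

Set Implicit Arguments.
Unset Strict Implicit.
Unset Printing Implicit Defensive.

Import GRing.Theory.
Local Open Scope group_scope.

(** Let A = [N,G], and choose n in N and a vertex u of level m such that the section g of n at u
    moves the letters. For a subgroup K over which G branches, let R ([red]) consist of the elements
    of K whose copies at the vertices of level m lie in A. Then [K,g] lies in R, because the
    commutator of a copy of t at u with n is a copy of [t,g] ([red_comm]). As A contains a level
    stabiliser, everything may be computed in the congruence closure [cl], and St(c) inside [cl R]
    gives St(m+c) inside A ([red_concl]).

    The core argument strengthens [K,g] <= R. Modulo R, moving a copy of t by g commutes with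
    conjugating it by an element s of St(1). Hence the sections of s at two letters that differ by
    the shift of g act alike on K, modulo the elements whose copies lie in R. If some defining
    vector is not constant, then all of [K,G] has its copies in R ([core_nonconst]); if all are
    constant, [K,[kerF]] has ([core_const]). This costs one level, and it remains to find c with
    St(c) in the closure of gamma_3, gamma_4 or [gamma_3,[kerF]].

    Branching over gamma_2 prevents the defining vectors from being multiples of one symmetric
    vector ([not_symmetric]), whereas branching over gamma_3 but not over gamma_2 forces it
    ([symmetric_dichotomy]). In case (i), St(r+2) lies in the closure of gamma_3, r being the
    dimension of the span ([stab_rank_cl3]): every further level of the stabiliser confines the
    combinations of defining vectors to a space of smaller dimension ([stab_ecomb]). With a single
    directed generator St(2) is enough ([stab2_gam3]). In case (ii), St(4) lies in the closure of
    gamma_3 ([cl3_St4]). If the common vector is not constant, St(5) lies in that of gamma_4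
    ([cl4_St5]), and even St(3) for a single generator ([cl4_St3]). If it is constant, St(6) lies in
    the closure of [gamma_3,[kerF]] ([cl_kerF_St6]), while a single generator with constant vector
    contradicts the branching ([constant_single_false]). Many memberships in closures come from
    [cl_fix]: an element congruent to its own copy one level deeper is congruent to 1.

    For the Fabrykowski-Gupta group St(2) lies in gamma_3, so it suffices that gamma_3 lies in
    [cl R]. For p different from 3 this follows from [b,[b,a]] being in the closure of gamma_4
    ([stab_fg_large]). For p = 3 and m = 0 there is a direct argument ([stab2_root]). For p = 3 and
    m > 0 a failure would produce an [obstruction], a linear form with prescribed cocycle on a
    module of functions on level m. An obstruction descends to the level above, and at the root it
    is absurd ([obstruction_false]). *)

Record nsub (gT : groupType) := NSub {
  nmem :> gT -> Prop;
  nsub1 : nmem 1;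
  nsubM : forall x y, nmem x -> nmem y -> nmem (x * y);
  nsubV : forall x, nmem x -> nmem x^-1;
  nsubJ : forall x y, nmem x -> nmem (x ^ y) }.

(** * Normal subgroups as predicates, and the lower central series *)

Section NormalSubgroups.
Variable gT : groupType.
Implicit Types (x y z g h : gT) (H J K M : nsub gT) (A : gT -> Prop).

Lemma nsubX J x n : J x -> J (x ^+ n).
Proof.
by move=> Jx; elim: n => [|n IHn]; rewrite ?expgS; [exact: nsub1 | exact: nsubM].
Qed.

Lemma nsub_prod J (I : Type) (r : seq I) (F : I -> gT) :
  (forall i, J (F i)) -> J (\prod_(i <- r) F i).
Proof. by move=> JF; apply: big_ind => // [|x y]; [exact: nsub1 | exact: nsubM]. Qed.

Lemma nsubJE J x y : J (x ^ y) -> J x.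
Proof. by move/(nsubJ y^-1); rewrite conjgK. Qed.

Lemma nsubVE J x : J x^-1 -> J x.
Proof. by move/nsubV; rewrite invgK. Qed.

Lemma nsubRl J x y : J x -> J [~ x, y].
Proof. by move=> Jx; rewrite commgEl; apply: nsubM; [exact: nsubV | exact: nsubJ]. Qed.

Lemma nsubRr J x y : J y -> J [~ x, y].
Proof. by move=> Jy; rewrite -invgR; apply: nsubV; exact: nsubRl. Qed.

Definition nfull : nsub gT.
Proof. by exists (fun=> True). Defined.

(** Subgroups cut out by a predicate follow this pattern below: the closure properties are proved
    first as one conjunction and then unpacked into an [nsub]. *)
Lemma nclo_subproof A :
  let P x := forall H, (forall y, A y -> H y) -> H x in
  [/\ P 1, forall x y, P x -> P y -> P (x * y), forall x, P x -> P x^-1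
    & forall x y, P x -> P (x ^ y)].
Proof.
split=> [H _|x y Px Py H AH|x Px H AH|x y Px H AH]; first exact: nsub1.
- by apply: nsubM; [exact: Px | exact: Py].
- by apply: nsubV; exact: Px.
- by apply: nsubJ; exact: Px.
Qed.

Definition nclo A : nsub gT :=
  let: And4 P1 PM PV PJ := nclo_subproof A in NSub P1 PM PV PJ.

Lemma ncloP A x : nclo A x <-> forall H, (forall y, A y -> H y) -> H x.
Proof. by rewrite /nclo; case: nclo_subproof. Qed.

Lemma mem_nclo A x : A x -> nclo A x.
Proof. by move=> Ax; apply/ncloP => H; apply. Qed.

Lemma nclo_min A H : (forall y, A y -> H y) -> forall x, nclo A x -> H x.
Proof. by move=> AH x /ncloP; apply. Qed.

Definition ncomm H K : nsub gT :=
  nclo (fun z => exists x y, [/\ H x, K y & z = [~ x, y]]).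

Lemma mem_ncomm H K x y : H x -> K y -> ncomm H K [~ x, y].
Proof. by move=> Hx Ky; apply: mem_nclo; exists x, y. Qed.

Lemma ncomm_min H K J :
  (forall x y, H x -> K y -> J [~ x, y]) -> forall z, ncomm H K z -> J z.
Proof. by move=> HKJ; apply: nclo_min => _ [x [y [Hx Ky ->]]]; exact: HKJ. Qed.

Lemma ncommS H K H' K' : (forall x, H x -> H' x) -> (forall x, K x -> K' x) ->
  forall x, ncomm H K x -> ncomm H' K' x.
Proof.
by move=> sH sK; apply: ncomm_min => x y Hx Ky; apply: mem_ncomm; [exact: sH|exact: sK].
Qed.

Lemma ncommSl H K x : ncomm H K x -> H x.
Proof. by apply: ncomm_min => {}x y Hx _; exact: nsubRl. Qed.

Lemma ncommSr H K x : ncomm H K x -> K x.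
Proof. by apply: ncomm_min => {}x y _ Ky; exact: nsubRr. Qed.

(* [gam k] is the lower central series, starting from [gam 0 = gam 1 = G]. *)
Definition gam (k : nat) : nsub gT := iter k.-1 (fun H => ncomm H nfull) nfull.

Lemma gamS k x y : gam k x -> gam k.+1 [~ x, y].
Proof.
by case: k => [|k]; first by []; move=> gx; exact: mem_ncomm.
Qed.

Lemma gam_sub k x : gam k.+1 x -> gam k x.
Proof. by case: k => //= k; exact: ncommSl. Qed.

Lemma gam_le i j x : i <= j -> gam j x -> gam i x.
Proof.
by move=> /subnK <-; elim: (j - i) => // d IHd; rewrite addSn => /gam_sub.
Qed.

Lemma mulns_subproof H K :
  let P x := exists h k, [/\ H h, K k & x = h * k] in
  [/\ P 1, forall x y, P x -> P y -> P (x * y), forall x, P x -> P x^-1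
    & forall x y, P x -> P (x ^ y)].
Proof.
split.
- by exists 1, 1; split; rewrite ?mulg1 //; exact: nsub1.
- move=> _ _ [h [k [Hh Kk ->]]] [h' [k' [Hh' Kk' ->]]].
  exists (h * h'), (k ^ h' * k'); split; try by apply: nsubM => //; exact: nsubJ.
  by rewrite conjgE !mulgA mulgK.
- move=> _ [h [k [Hh Kk ->]]]; exists (h^-1 ^ k), k^-1; split.
  + by apply: nsubJ; exact: nsubV.
  + exact: nsubV.
  + by rewrite invgM conjgE !mulgA mulgK.
- move=> _ y [h [k [Hh Kk ->]]]; exists (h ^ y), (k ^ y).
  by rewrite conjMg; split => //; exact: nsubJ.
Qed.

Definition mulns H K : nsub gT :=
  let: And4 P1 PM PV PJ := mulns_subproof H K in NSub P1 PM PV PJ.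

Lemma mulnsP H K x : mulns H K x <-> exists h k, [/\ H h, K k & x = h * k].
Proof. by rewrite /mulns; case: mulns_subproof. Qed.

Lemma mulnsl H K x : H x -> mulns H K x.
Proof. by move=> Hx; apply/mulnsP; exists x, 1; rewrite mulg1; split=> //; exact: nsub1. Qed.

Lemma mulnsr H K x : K x -> mulns H K x.
Proof. by move=> Kx; apply/mulnsP; exists 1, x; rewrite mul1g; split=> //; exact: nsub1. Qed.

Lemma mulns_min H K J : (forall x, H x -> J x) -> (forall x, K x -> J x) ->
  forall x, mulns H K x -> J x.
Proof. by move=> HJ KJ x /mulnsP[h [k [/HJ Hh /KJ Kk ->]]]; exact: nsubM. Qed.

End NormalSubgroups.

Arguments gam {gT} k.
Arguments nfull {gT}.

(** * Quotient groups by normal subgroups *)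

Module Quo.
Section Quo.
Local Open Scope quotient_scope.
Variables (gT : groupType) (J : nsub gT).

Definition qeq (x y : gT) : bool := `[< J (x^-1 * y) >].

Lemma qeq_refl : reflexive qeq.
Proof. by move=> x; apply/asboolP; rewrite mulVg; exact: nsub1. Qed.

Lemma qeq_sym : symmetric qeq.
Proof.
by move=> x y; apply/asboolP/asboolP => /nsubV; rewrite invgM invgK.
Qed.

Lemma qeq_trans : transitive qeq.
Proof.
move=> y x z /asboolP Jxy /asboolP Jyz; apply/asboolP.
by have := nsubM Jxy Jyz; rewrite !mulgA mulgK.
Qed.

Canonical qeq_equiv := EquivRel qeq qeq_refl qeq_sym qeq_trans.

Definition quo : Type := {eq_quot qeq_equiv}.
HB.instance Definition _ := Choice.on quo.

Definition qpi (x : gT) : quo := \pi_({eq_quot qeq_equiv}) x.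

Lemma qpiP x y : qpi x = qpi y <-> J (x^-1 * y).
Proof.
split=> [/eqquotP/asboolP //|Jxy].
by apply/eqquotP/asboolP.
Qed.

Definition qrep (u : quo) : gT := repr u.

Lemma qrepK u : qpi (qrep u) = u.
Proof. by rewrite /qpi reprK. Qed.

Definition qmul u v := qpi (qrep u * qrep v).
Definition qinv u := qpi (qrep u)^-1.

Lemma qmulE x y : qmul (qpi x) (qpi y) = qpi (x * y).
Proof.
apply/qpiP; have /qpiP Jx := qrepK (qpi x); have /qpiP Jy := qrepK (qpi y).
have -> : (qrep (qpi x) * qrep (qpi y))^-1 * (x * y) =
  ((qrep (qpi x))^-1 * x) ^ (qrep (qpi y)) * ((qrep (qpi y))^-1 * y).
  by rewrite invgM conjgE !mulgA mulgK.
by apply: nsubM => //; apply: nsubJ.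
Qed.

Lemma qinvE x : qinv (qpi x) = qpi x^-1.
Proof.
apply/qpiP; have /qpiP Jx := qrepK (qpi x); rewrite invgK.
by have := nsubJ (x^-1) (nsubV Jx); rewrite invgM conjgE !invgK !mulgA mulgV mul1g.
Qed.

Lemma qmulA : associative qmul.
Proof.
by move=> u v w; rewrite -(qrepK u) -(qrepK v) -(qrepK w) !qmulE mulgA.
Qed.
Lemma qmul1 : left_id (qpi 1) qmul.
Proof. by move=> u; rewrite -(qrepK u) qmulE mul1g. Qed.
Lemma qmulr1 : right_id (qpi 1) qmul.
Proof. by move=> u; rewrite -(qrepK u) qmulE mulg1. Qed.
Lemma qmulV : left_inverse (qpi 1) qinv qmul.
Proof. by move=> u; rewrite -(qrepK u) qinvE qmulE mulVg. Qed.
Lemma qmulrV : right_inverse (qpi 1) qinv qmul.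
Proof. by move=> u; rewrite -(qrepK u) qinvE qmulE mulgV. Qed.

HB.instance Definition _ := isGroup.Build quo qmulA qmul1 qmulr1 qmulV qmulrV.

End Quo.
End Quo.
HB.export Quo.

Notation quo := Quo.quo.

Section QuotientTheory.
Variables (gT : groupType) (J : nsub gT).

Definition qpi : gT -> quo J := @Quo.qpi gT J.

Lemma qpiP x y : qpi x = qpi y <-> J (x^-1 * y).
Proof. exact: Quo.qpiP. Qed.

Lemma qpiM x y : qpi (x * y) = qpi x * qpi y.
Proof. by rewrite /qpi -Quo.qmulE. Qed.

Lemma qpi1 : qpi 1 = 1. Proof. by []. Qed.

Lemma qpi_id x : qpi x = 1 <-> J x.
Proof.
rewrite -qpi1; split=> [/esym/qpiP|Jx]; first by rewrite invg1 mul1g.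
by apply/esym/qpiP; rewrite invg1 mul1g.
Qed.

Lemma qpiV x : qpi x^-1 = (qpi x)^-1.
Proof. by rewrite /qpi -Quo.qinvE. Qed.

Lemma qpiJ x y : qpi (x ^ y) = qpi x ^ qpi y.
Proof. by rewrite !conjgE !qpiM qpiV. Qed.

Lemma qpiR x y : qpi [~ x, y] = [~ qpi x, qpi y].
Proof. by rewrite !commgEl qpiM qpiV qpiJ. Qed.

Lemma qpiX x n : qpi (x ^+ n) = qpi x ^+ n.
Proof. by elim: n => // n IHn; rewrite !expgS qpiM IHn. Qed.

Lemma qpi_prod (I : Type) (r : seq I) (F : I -> gT) :
  qpi (\prod_(i <- r) F i) = \prod_(i <- r) qpi (F i).
Proof. exact: (big_morph qpi qpiM qpi1). Qed.

Lemma qpi_surj (u : quo J) : exists x, qpi x = u.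
Proof. by exists (Quo.qrep u); exact: Quo.qrepK. Qed.

End QuotientTheory.

Arguments qpi {gT} J x.

(** * Exponents in F_p for elements of order dividing p *)

Lemma expg_eq_mod (gT : groupType) (x : gT) p i j :
  x ^+ p = 1 -> i = j %[mod p] -> x ^+ i = x ^+ j.
Proof.
move=> xp1 ij; rewrite (divn_eq i p) (divn_eq j p) ij.
by rewrite !expgnDr !(mulnC _ p) !expgnA !xp1 !expg1n.
Qed.

Section FpPowers.
Variables (p : nat) (gT : groupType) (x : gT).
Hypotheses (p_pr : prime p) (xp1 : x ^+ p = 1).
Implicit Types s t : 'F_p.

Lemma expgF0 : x ^+ (0%R : 'F_p) = 1. Proof. by []. Qed.

Lemma expgF1 : x ^+ (1%R : 'F_p) = x.
Proof.
by [].
Qed.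

Lemma expgFnat n : x ^+ (n%:R%R : 'F_p) = x ^+ n.
Proof. by apply: (expg_eq_mod xp1); rewrite val_Fp_nat // modn_mod. Qed.

Lemma expgFD s t : x ^+ (s + t)%R = x ^+ s * x ^+ t.
Proof. by rewrite -expgnDr -[RHS]expgFnat natrD !natr_Zp. Qed.

Lemma expgFN s : x ^+ (- s)%R = (x ^+ s)^-1.
Proof. by apply/esym/mulg1_eq; rewrite -expgFD subrr. Qed.

Lemma expgFM s t : x ^+ (s * t)%R = (x ^+ s) ^+ t.
Proof. by rewrite -expgnA -[RHS]expgFnat natrM !natr_Zp. Qed.

Lemma expgF_sum (I : Type) (r : seq I) (F : I -> 'F_p) :
  x ^+ (\sum_(i <- r) F i)%R = \prod_(i <- r) x ^+ F i.
Proof. exact: (big_morph (fun s : 'F_p => x ^+ s) expgFD). Qed.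

(** A non-zero exponent can be inverted. Relations whose exponent is a label or a difference of
    exponents are turned into [x = 1] in this way. *)
Lemma expgF_inv s : s != 0%R -> x ^+ s = 1 -> x = 1.
Proof.
move=> s_neq0 xs1; rewrite -[LHS]expgF1 -(mulfV s_neq0) expgFM xs1.
by rewrite expg1n.
Qed.

End FpPowers.

(** * Self-similar groups acting on the first level by translations *)

Fixpoint fixes_level p (gT : Type) (lab : gT -> 'F_p) (sec : gT -> 'F_p -> gT)
    (n : nat) (g : gT) : Prop :=
  if n is n'.+1 then lab g = 0%R /\ forall x, fixes_level lab sec n' (sec g x) else True.

(** Abstract model of a group of tree automorphisms with cyclic first-level action: [lab] is the
    translation of the letters, [ss_res] says that the action on the tree is faithful, and [rt] is
    the rooted generator a. [fixes_level] is stated for raw functions because faithfulness is itself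
    a field. *)
Record ssgroup (p : nat) := SSGroup {
  ssgT :> groupType;
  ss_prime : prime p;
  lab : ssgT -> 'F_p;
  sec : ssgT -> 'F_p -> ssgT;
  labM : forall g h, lab (g * h) = (lab g + lab h)%R;
  secM : forall g h x, sec (g * h) x = sec g x * sec h (x + lab g)%R;
  ss_res : forall g, (forall n, fixes_level lab sec n g) -> g = 1;
  rt : ssgT;
  lab_rt : lab rt = 1%R;
  sec_rt : forall x, sec rt x = 1 }.

Section SelfSimilar.
Variables (p : nat) (S : ssgroup p).
Implicit Types (g h s t : S) (x y : 'F_p) (J K M : nsub S) (u v w : seq 'F_p).

Local Notation p_pr := (ss_prime S).
Local Notation a := (rt S).

Lemma lab1 : lab (1 : S) = 0%R.
Proof. by have := labM (1 : S) 1; rewrite mulg1 => /esym/eqP; rewrite -subr_eq0 addrK => /eqP. Qed.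

Lemma labV g : lab g^-1 = (- lab g)%R.
Proof. by apply/eqP; rewrite -addr_eq0 -labM mulVg lab1. Qed.

Lemma labJ g h : lab (g ^ h) = lab g.
Proof. by rewrite conjgE !labM labV addrCA addNr addr0. Qed.

Lemma labR g h : lab [~ g, h] = 0%R.
Proof. by rewrite commgEl labM labV labJ addNr. Qed.

Lemma labX g n : lab (g ^+ n) = (lab g *+ n)%R.
Proof. by elim: n => [|n IHn]; rewrite ?lab1 // expgS labM IHn mulrS. Qed.

Lemma sec1 x : sec (1 : S) x = 1.
Proof.
have := secM (1 : S) 1 x; rewrite mulg1 lab1 addr0 => /(congr1 (mulg (sec 1 x)^-1)).
by rewrite mulKg mulVg.
Qed.

Lemma secV g x : sec g^-1 x = (sec g (x - lab g)%R)^-1.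
Proof.
by apply/esym/mulg1_eq; rewrite -{2}[x](subrK (lab g)) -secM mulgV sec1.
Qed.

Lemma secJ g h x : lab g = 0%R ->
  sec (g ^ h) x = sec g (x - lab h)%R ^ sec h (x - lab h)%R.
Proof.
by move=> g0; rewrite !conjgE !secM secV labV g0 addr0.
Qed.

Lemma secM0 g h x : lab g = 0%R -> sec (g * h) x = sec g x * sec h x.
Proof. by move=> g0; rewrite secM g0 addr0. Qed.

Lemma secV0 g x : lab g = 0%R -> sec g^-1 x = (sec g x)^-1.
Proof. by move=> g0; rewrite secV g0 subr0. Qed.

Lemma secR0 g h x : lab g = 0%R -> lab h = 0%R ->
  sec [~ g, h] x = [~ sec g x, sec h x].
Proof. by move=> g0 h0; rewrite !commgEl secM0 ?labV ?g0 ?oppr0 // secV0 // secJ // h0 subr0. Qed.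

Lemma secJ0 g h x : lab g = 0%R -> lab h = 0%R -> sec (g ^ h) x = sec g x ^ sec h x.
Proof. by move=> g0 h0; rewrite secJ // h0 subr0. Qed.

Lemma secX0 g n x : lab g = 0%R -> sec (g ^+ n) x = sec g x ^+ n.
Proof.
move=> g0; elim: n => [|n IHn]; first by rewrite sec1.
by rewrite !expgS secM0 // IHn.
Qed.

Lemma lab_prod0 (I : Type) (r : seq I) (F : I -> S) :
  (forall i, lab (F i) = 0%R) -> lab (\prod_(i <- r) F i) = 0%R.
Proof.
move=> F0; elim: r => [|i r IHr]; first by rewrite big_nil lab1.
by rewrite big_cons labM F0 IHr addr0.
Qed.

Lemma sec_prod0 (I : Type) (r : seq I) (F : I -> S) x :
  (forall i, lab (F i) = 0%R) ->
  sec (\prod_(i <- r) F i) x = \prod_(i <- r) sec (F i) x.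
Proof.
move=> F0; elim: r => [|i r IHr]; first by rewrite !big_nil sec1.
by rewrite !big_cons secM0 // IHr.
Qed.

Definition stabP n g : Prop := fixes_level (@lab p S) (@sec p S) n g.

Lemma stab_subproof n :
  [/\ stabP n 1, forall g h, stabP n g -> stabP n h -> stabP n (g * h),
      forall g, stabP n g -> stabP n g^-1 & forall g h, stabP n g -> stabP n (g ^ h)].
Proof.
elim: n => [|n [IH1 IHM IHV IHJ]]; first by split.
split=> [|g h [g0 gn] [h0 hn]|g [g0 gn]|g h [g0 gn]] /=.
- by split=> [|x]; rewrite ?lab1 ?sec1.
- by split=> [|x]; rewrite ?labM ?g0 ?h0 ?addr0 // secM0 //; exact: IHM (gn x) (hn x).
- by split=> [|x]; rewrite ?labV ?g0 ?oppr0 // secV0 //; exact: IHV (gn x).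
- by split=> [|x]; rewrite ?labJ ?g0 // secJ //; exact: IHJ (gn _).
Qed.

Definition stab n : nsub S :=
  let: And4 P1 PM PV PJ := stab_subproof n in NSub P1 PM PV PJ.

Lemma stabE n g : stab n g <-> stabP n g.
Proof. by rewrite /stab; case: stab_subproof. Qed.

Lemma stab0 g : stab 0 g. Proof. exact/stabE. Qed.

Lemma stabS n g : stab n.+1 g <-> lab g = 0%R /\ forall x, stab n (sec g x).
Proof.
rewrite stabE; split=> -[g0 gn]; split=> // x; first by apply/stabE; exact: gn.
by have /stabE := gn x.
Qed.

Lemma stab_res g : (forall n, stab n g) -> g = 1.
Proof. by move=> gn; apply: ss_res => n; apply/stabE. Qed.

Lemma sec_ext g h : lab g = lab h -> (forall x, sec g x = sec h x) -> g = h.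
Proof.
move=> labgh secgh; apply: divg1_eq; apply: stab_res => -[|n]; first exact: stab0.
apply/stabS; rewrite labM labV labgh subrr; split=> // x.
by rewrite secM secV labgh addrK secgh mulgV; exact: nsub1.
Qed.

Lemma stab_lab n g : stab n.+1 g -> lab g = 0%R.
Proof. by case/stabS. Qed.

Lemma stab1 g : stab 1 g <-> lab g = 0%R.
Proof. by rewrite stabS; split=> [[]|g0] //; split=> // x; exact: stab0. Qed.

Lemma stab_sub n g : stab n.+1 g -> stab n g.
Proof.
elim: n g => [|n IHn] g; first by move=> _; exact: stab0.
by move=> /stabS[g0 gn]; apply/stabS; split=> // x; apply: IHn.
Qed.

Lemma stab_le i j g : i <= j -> stab j g -> stab i g.
Proof. by move=> /subnK <-; elim: (j - i) => // d IHd; rewrite addSn => /stab_sub. Qed.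

Lemma gam2_lab g : gam 2 g -> lab g = 0%R.
Proof. by move=> g2; apply/stab1; apply: ncomm_min g2 => {}g h _ _; apply/stab1; exact: labR. Qed.

Fixpoint act g u := if u is x :: v then (x + lab g)%R :: act (sec g x) v else [::].

Fixpoint secw g u := if u is x :: v then secw (sec g x) v else g.

Lemma size_act g u : size (act g u) = size u.
Proof. by elim: u g => //= x u IHu g; rewrite IHu. Qed.

Lemma act1 u : act 1 u = u.
Proof. by elim: u => //= x u IHu; rewrite lab1 sec1 addr0 IHu. Qed.

Lemma actM g h u : act (g * h) u = act h (act g u).
Proof. by elim: u g h => //= x u IHu g h; rewrite labM addrA secM IHu. Qed.

Lemma actK g : cancel (act g) (act g^-1).
Proof. by move=> u; rewrite -actM mulgV act1. Qed.

Lemma actKV g : cancel (act g^-1) (act g).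
Proof. by move=> u; rewrite -actM mulVg act1. Qed.

Lemma secw1 u : secw 1 u = 1.
Proof. by elim: u => //= x u IHu; rewrite sec1. Qed.

Lemma secwM g h u : secw (g * h) u = secw g u * secw h (act g u).
Proof. by elim: u g h => //= x u IHu g h; rewrite secM IHu. Qed.

Lemma secwV g u : secw g^-1 u = (secw g (act g^-1 u))^-1.
Proof.
apply/esym/mulg1_eq; rewrite -{2}[u](actKV g) -secwM.
by rewrite mulgV secw1.
Qed.

Lemma act_St n g u : stab n g -> size u <= n -> act g u = u.
Proof.
elim: u n g => //= x u IHu [|n] g //= /stabS[g0 gn] us.
by rewrite g0 addr0 (IHu n).
Qed.

Lemma secw_St n g u k : stab (n + k) g -> size u = n -> stab k (secw g u).
Proof.
move=> /[swap] <-; elim: u g => //= x u IHu g.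
by rewrite addSn => /stabS[_ gn]; apply: IHu.
Qed.

Lemma stab_secw n g k : stab n g -> (forall u, size u = n -> stab k (secw g u)) -> stab (n + k) g.
Proof.
elim: n g => [|n IHn] g gn gk; first exact: (gk [::]).
have /stabS[g0 gn'] := gn; apply/stabS; split=> // x; apply: IHn => // u us.
by apply: (gk (x :: u)); rewrite /= us.
Qed.

Lemma stab_act n g : stab n g <-> forall u, size u = n -> act g u = u.
Proof.
split=> [gn u us|]; first by apply: act_St gn _; rewrite us.
elim: n g => [|n IHn] g gP; first exact: stab0.
apply/stabS; split=> [|x].
  have /(congr1 (head 0%R)) /= := gP (0%R :: nseq n 0%R) (congr1 succn (size_nseq _ _)).
  by rewrite add0r.
by apply: IHn => u us; have /= [_] := gP (x :: u) (congr1 succn us).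
Qed.

Lemma secwM_St n g h u : stab n g -> size u <= n -> secw (g * h) u = secw g u * secw h u.
Proof. by move=> gn us; rewrite secwM (act_St gn us). Qed.

Lemma secwV_St n g u : stab n g -> size u <= n -> secw g^-1 u = (secw g u)^-1.
Proof. by move=> gn us; rewrite secwV (act_St (nsubV gn) us). Qed.

Lemma secwJ_St n g h u : stab n g -> size u <= n ->
  secw (g ^ h) (act h u) = secw g u ^ secw h u.
Proof.
move=> gn us; rewrite conjgE secwM secwV actK secwM (act_St gn us).
by rewrite conjgE.
Qed.

Lemma secw_cat g u v : secw g (u ++ v) = secw (secw g u) v.
Proof. by elim: u g => //=. Qed.

Lemma secw_rcons g u x : secw g (rcons u x) = sec (secw g u) x.
Proof. by rewrite -cats1 secw_cat. Qed.

Lemma act_rcons g u x : act g (rcons u x) = rcons (act g u) (x + lab (secw g u))%R.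
Proof. by elim: u g => //= y u IHu g; rewrite IHu. Qed.

Lemma expp_St n g : stab n (g ^+ (p ^ n)).
Proof.
elim: n g => [|n IHn] g; first exact: stab0.
have gp0 : lab (g ^+ p) = 0%R by rewrite labX -mulr_natr (pchar_Fp_0 p_pr) mulr0.
rewrite expnS expgnA; apply/stabS; split=> [|x]; first by rewrite labX gp0 mul0rn.
by rewrite secX0.
Qed.

Section LevelPerm.
Variable n : nat.

Lemma act_tupleP g (u : n.-tuple 'F_p) : size (act g u) == n.
Proof. by rewrite size_act size_tuple. Qed.

Definition act_tuple g (u : n.-tuple 'F_p) : n.-tuple 'F_p := Tuple (act_tupleP g u).

Lemma act_tuple_inj g : injective (act_tuple g).
Proof. by move=> u v /(congr1 val) /= /(can_inj (actK g)) /val_inj. Qed.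

Definition lperm g : {perm n.-tuple 'F_p} := perm (@act_tuple_inj g).

Lemma lpermE g (u : n.-tuple 'F_p) : lperm g u = act_tuple g u. Proof. by rewrite permE. Qed.

Lemma lpermM g h : lperm (g * h) = lperm g * lperm h.
Proof. by apply/permP => u; rewrite permM !lpermE; apply/val_inj; rewrite /= actM. Qed.

Lemma lperm1 : lperm 1 = 1.
Proof. by apply/permP => u; rewrite lpermE perm1; apply/val_inj; rewrite /= act1. Qed.

Lemma lpermV g : lperm g^-1 = (lperm g)^-1.
Proof. by apply/esym/mulg1_eq; rewrite -lpermM mulgV lperm1. Qed.

Lemma lpermX g k : lperm (g ^+ k) = lperm g ^+ k.
Proof. by elim: k => [|k IHk]; rewrite ?lperm1 // !expgS lpermM IHk. Qed.

Lemma lperm_eq1 g : lperm g = 1 <-> stab n g.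
Proof.
split=> [g1|gn]; last first.
  by apply/permP => u; rewrite lpermE perm1; apply/val_inj; rewrite /= (act_St gn) // size_tuple.
apply/stab_act => u /eqP us; have := congr1 (fun s : {perm _} => val (s (Tuple us))) g1.
by rewrite /= lpermE perm1.
Qed.

Definition lgrp : {set {perm n.-tuple 'F_p}} :=
  [set s : {perm n.-tuple 'F_p} | `[< exists g, lperm g = s >]].

Lemma mem_lgrp g : lperm g \in lgrp.
Proof. by rewrite inE; apply/asboolP; exists g. Qed.

Lemma lgrpP (s : {perm n.-tuple 'F_p}) : reflect (exists g, lperm g = s) (s \in lgrp).
Proof. by rewrite inE; exact: asboolP. Qed.

Lemma lgrp_group : group_set lgrp.
Proof.
apply/group_setP; split; first by rewrite -lperm1 mem_lgrp.
by move=> _ _ /lgrpP[g <-] /lgrpP[h <-]; rewrite -lpermM mem_lgrp.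
Qed.

Canonical lgrp_grp := Group lgrp_group.

(** By Cauchy a prime dividing the order is the order of some [lperm g], and [expp_St] bounds that
    order by a power of p. *)
Lemma lgrp_pgroup : p.-group lgrp.
Proof.
apply/pgroupP => q q_pr /(Cauchy q_pr)[s /lgrpP[g <-] sq].
have : lperm g ^+ (p ^ n) = 1 by rewrite -lpermX; apply/lperm_eq1; exact: expp_St.
move/eqP; rewrite -order_dvdn sq (Euclid_dvdX _ _ q_pr) => /andP[].
by rewrite (dvdn_prime2 q_pr p_pr) => /eqP -> _; rewrite inE.
Qed.

(** The permutation group induced on level n is a finite p-group, hence nilpotent, and [gam k] maps
    into the terms of its lower central series. *)
Lemma gam_St : exists k, forall g, gam k g -> stab n g.
Proof.
have sub k g : gam k.+1 g -> lperm g \in 'L_k.+1(lgrp).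
  elim: k g => [|k IHk] g gk; first by rewrite lcn1 mem_lgrp.
  have Psub : [/\ (lperm 1 \in 'L_k.+2(lgrp)),
     (forall s t, lperm s \in 'L_k.+2(lgrp) -> lperm t \in 'L_k.+2(lgrp) ->
        lperm (s * t) \in 'L_k.+2(lgrp)),
     (forall s, lperm s \in 'L_k.+2(lgrp) -> lperm s^-1 \in 'L_k.+2(lgrp))
     & (forall s t, lperm s \in 'L_k.+2(lgrp) -> lperm (s ^ t) \in 'L_k.+2(lgrp))].
    split=> [|s t sL tL|s sL|s t sL].
    - by rewrite lperm1 group1.
    - by rewrite lpermM groupM.
    - by rewrite lpermV groupV.
    - rewrite conjgE !lpermM lpermV -conjgE memJ_norm //.
      by have /normal_norm/subsetP -> // := lcn_normal k.+2 lgrp_grp; exact: mem_lgrp.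
  case: Psub => P1 PM PV PJ; pose H := NSub P1 PM PV PJ.
  apply: (@ncomm_min _ _ _ H _ _ gk) => s t sk _ /=.
  rewrite commgEl lpermM conjgE !lpermM !lpermV -conjgE -commgEl.
  by rewrite lcnSn; apply: mem_commg; [exact: IHk | exact: mem_lgrp].
have /lcnP[k Lk] := pgroup_nil lgrp_pgroup; exists k.+1 => g /sub.
by rewrite Lk => /set1P /lperm_eq1.
Qed.

End LevelPerm.
End SelfSimilar.

Lemma commgMl (gT : groupType) (x y z : gT) : [~ x * y, z] = [~ x, z] ^ y * [~ y, z].
Proof. by rewrite !(commgEl, conjgE, gnorm). Qed.

Lemma commgMr (gT : groupType) (x y z : gT) : [~ x, y * z] = [~ x, z] * [~ x, y] ^ z.
Proof. by rewrite !(commgEl, conjgE, gnorm). Qed.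

(** * Copies of elements below a letter, and the congruence closure *)

Section Closure.
Variables (p : nat) (S : ssgroup p).
Implicit Types (g h s t : S) (x y : 'F_p) (J K M R : nsub S).
Local Notation p_pr := (ss_prime S).
Local Notation a := (rt S).

Lemma cl_subproof J :
  let P g := forall n, mulns J (stab S n) g in
  [/\ P 1, forall g h, P g -> P h -> P (g * h),
      forall g, P g -> P g^-1 & forall g h, P g -> P (g ^ h)].
Proof.
split=> [n|g h Pg Ph n|g Pg n|g h Pg n]; first exact: nsub1.
- exact: nsubM.
- exact: nsubV.
- exact: nsubJ.
Qed.

(* The closure of [J] in the congruence topology. *)
Definition cl J : nsub S :=
  let: And4 P1 PM PV PJ := cl_subproof J in NSub P1 PM PV PJ.

Lemma clP J g : cl J g <-> forall n, mulns J (stab S n) g.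
Proof. by rewrite /cl; case: cl_subproof. Qed.

Lemma sub_cl J g : J g -> cl J g.
Proof. by move=> Jg; apply/clP => n; exact: mulnsl. Qed.

Lemma clS J K : (forall g, J g -> K g) -> forall g, cl J g -> cl K g.
Proof.
move=> sJK g /clP Jg; apply/clP => n; apply: mulns_min (Jg n) => s Js.
  by apply: mulnsl; exact: sJK.
exact: mulnsr.
Qed.

Lemma cl_cl J g : cl (cl J) g -> cl J g.
Proof.
move=> /clP Jg; apply/clP => n; apply: mulns_min (Jg n) => s; first by move/clP.
exact: mulnsr.
Qed.

Lemma cl_min J K : (forall g, J g -> cl K g) -> forall g, cl J g -> cl K g.
Proof. by move=> JK g /(clS JK) /cl_cl. Qed.

Lemma cl_comm J K : (forall g h, J g -> K [~ g, h]) ->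
  forall g h, cl J g -> cl K [~ g, h].
Proof.
move=> JK g h /clP Jg; apply/clP => n; have /mulnsP[j [s [Jj sn ->]]] := Jg n.
rewrite commgMl; apply: nsubM; last by apply: mulnsr; exact: nsubRl.
by apply: nsubJ; apply: mulnsl; exact: JK.
Qed.

(** The element [s] is the copy of [t] acting on the subtree below [x], and trivial on the other
    subtrees. *)
Definition injp x t s :=
  [/\ lab s = 0%R, sec s x = t & forall y, y != x -> sec s y = 1].

Lemma injp_sec x t s y : injp x t s -> sec s y = if y == x then t else 1.
Proof. by case=> _ st s1; case: eqP => [->|/eqP/s1]. Qed.

Lemma injp_uniq x t s s' : injp x t s -> injp x t s' -> s = s'.
Proof.
move=> is_ is'; apply: sec_ext => [|y]; last by rewrite (injp_sec _ is_) (injp_sec _ is').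
by case: is_ => -> _ _; case: is' => ->.
Qed.

Lemma injp1 x : injp x 1 1.
Proof. by split=> [||y _]; rewrite ?lab1 ?sec1. Qed.

Lemma injpM x t s t' s' : injp x t s -> injp x t' s' -> injp x (t * t') (s * s').
Proof.
move=> [s0 st s1] [s'0 st' s'1]; split=> [||y yx].
- by rewrite labM s0 s'0 addr0.
- by rewrite secM0 // st st'.
- by rewrite secM0 // s1 // s'1 // mulg1.
Qed.

Lemma injpV x t s : injp x t s -> injp x t^-1 s^-1.
Proof.
move=> [s0 st s1]; split=> [||y yx]; first by rewrite labV s0 oppr0.
- by rewrite secV0 // st.
- by rewrite secV0 // s1 // invg1.
Qed.

Lemma injpX x t s n : injp x t s -> injp x (t ^+ n) (s ^+ n).
Proof.
move=> ist; elim: n => [|n IHn]; first exact: injp1.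
by rewrite !expgS; apply: injpM.
Qed.

Lemma injpJ x t s h : injp x t s -> injp (x + lab h)%R (t ^ sec h x) (s ^ h).
Proof.
move=> [s0 st s1]; split=> [||y yx]; first by rewrite labJ.
- by rewrite secJ // addrK st.
- by rewrite secJ // s1 ?conj1g // subr_eq.
Qed.

Lemma injpJ0 x t s h : lab h = 0%R -> injp x t s -> injp x (t ^ sec h x) (s ^ h).
Proof. by move=> h0 /(injpJ h); rewrite h0 addr0. Qed.

Lemma injpR x t s h : lab h = 0%R -> injp x t s -> injp x [~ t, sec h x] [~ s, h].
Proof. by move=> h0 ist; rewrite !commgEl; apply: injpM (injpV ist) (injpJ0 h0 ist). Qed.

Lemma injpC x y t s t' s' : x != y -> injp x t s -> injp y t' s' -> commute s s'.
Proof.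
move=> xy is_ is'; case: (is_) => s0 _ _; case: (is') => s'0 _ _.
apply: sec_ext => [|z]; first by rewrite !labM addrC.
rewrite !secM0 // (injp_sec _ is_) (injp_sec _ is').
by case: eqP => [->|_]; rewrite ?(negPf xy) ?mulg1 ?mul1g.
Qed.

Lemma injp_St x t s n : injp x t s -> stab S n t -> stab S n.+1 s.
Proof.
move=> ist tn; apply/stabS; split=> [|y]; first by case: ist.
by rewrite (injp_sec _ ist); case: eqP => // _; exact: nsub1.
Qed.

Lemma lab_rtX n : lab (a ^+ n) = n%:R%R.
Proof. by rewrite labX lab_rt. Qed.

Lemma lab_rtF x : lab (a ^+ x) = x.
Proof. by rewrite lab_rtX natr_Zp. Qed.

Lemma sec_rtX n x : sec (a ^+ n) x = 1.
Proof.
by elim: n x => [|n IHn] x; rewrite ?sec1 // expgS secM sec_rt IHn mulg1.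
Qed.

Lemma rt_p : a ^+ p = 1.
Proof.
by apply: sec_ext => [|x]; rewrite ?lab_rtX ?lab1 ?(pchar_Fp_0 p_pr) // sec_rtX sec1.
Qed.

Definition rtD := expgFD p_pr rt_p.
Definition rtN := expgFN p_pr rt_p.

Lemma rt_nat n : a ^+ (n%:R : 'F_p)%R = a ^+ n.
Proof. exact: (expgFnat p_pr rt_p). Qed.

Lemma injp_rt x y t s : injp x t s -> injp (x + y)%R t (s ^ (a ^+ y)).
Proof. by move=> /(injpJ (a ^+ y)); rewrite lab_rtF sec_rtX conjg1. Qed.

Lemma injp_rt_to x y t s : injp x t s -> injp y t (s ^ (a ^+ (y - x)%R)).
Proof. by move=> /(injp_rt (y - x)%R); rewrite addrC subrK. Qed.

(** For J = R this is the branching condition: multiplying copies at all letters realises every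
    element of the p-fold product of J ([injmap_prod]). *)
Definition injmap J R := forall t x, J t -> exists2 s, R s & injp x t s.

Lemma injmap_mem J R t x s : injmap J R -> J t -> injp x t s -> R s.
Proof. by move=> JR /(JR t x)[s' Rs' is'] /injp_uniq/(_ is') ->. Qed.

(** Conjugation by powers of a carries a copy from one letter to any other, so one letter is
    enough. *)
Lemma injmap0 J R x : (forall t, J t -> exists2 s, R s & injp x t s) -> injmap J R.
Proof.
move=> JR t y /JR[s Rs ist]; exists (s ^ (a ^+ (y - x)%R)); first exact: nsubJ.
exact: injp_rt_to.
Qed.

Lemma injmapS J R J' R' : (forall t, J' t -> J t) -> (forall t, R t -> R' t) ->
  injmap J R -> injmap J' R'.
Proof. by move=> sJ sR JR t x /sJ /(JR t x)[s /sR]; exists s. Qed.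

Lemma injmap_prod J R (j : 'F_p -> S) : injmap J R -> (forall x, J (j x)) ->
  exists s, [/\ R s, lab s = 0%R & forall x, sec s x = j x].
Proof.
move=> JR Jj; have /choice[f fP] : forall x, exists s, R s /\ injp x (j x) s.
  by move=> x; have [s] := JR _ x (Jj x); exists s.
exists (\prod_(x <- enum 'F_p) f x).
have f0 x : lab (f x) = 0%R by case: (fP x) => _ [].
split=> [||x]; [by apply: nsub_prod => x; case: (fP x) | exact: lab_prod0 |].
rewrite sec_prod0 //; have := enum_uniq 'F_p; have : x \in enum 'F_p by rewrite mem_enum.
elim: (enum 'F_p) => // y r IHr; rewrite inE big_cons => /orP[/eqP <-|xr] /andP[].
  move=> xr _; have -> : sec (f x) x = j x by case: (fP x) => _ [].
  rewrite big1_seq ?mulg1 // => z /andP[_ zr]; rewrite (injp_sec _ (fP z).2).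
  by case: eqP => // xz; move: xr; rewrite xz zr.
move=> yr ur; rewrite IHr // (injp_sec _ (fP y).2).
by case: eqP => [xy|_]; [move: yr; rewrite -xy xr | rewrite mul1g].
Qed.

(* An element whose sections are congruent to elements of [J] is congruent to
   a product of elements of [R]. *)
Lemma cl_inj J R s : injmap J R -> lab s = 0%R -> (forall y, cl J (sec s y)) -> cl R s.
Proof.
move=> JR s0 Js; apply/clP => n.
have /choice[f fP] : forall y, exists j, J j /\ stab S n (j^-1 * sec s y).
  move=> y; have /clP/(_ n)/mulnsP[j [k [Jj kn ->]]] := Js y.
  by exists j; rewrite mulKg.
have [r [Rr r0 rf]] := injmap_prod JR (fun x => (fP x).1).
apply/mulnsP; exists r, (r^-1 * s); rewrite mulVKg; split=> //.
apply: stab_sub; apply/stabS; split=> [|y]; first by rewrite labM labV r0 s0 oppr0 addr0.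
by rewrite secM0 ?labV ?r0 ?oppr0 // secV0 // rf; case: (fP y).
Qed.

Lemma cl_injp J R x t s : injmap J R -> injp x t s -> cl J t -> cl R s.
Proof.
move=> JR ist Jt; apply: cl_inj JR _ _ => [|y]; first by case: ist.
by rewrite (injp_sec _ ist); case: eqP => // _; exact: nsub1.
Qed.

Lemma cl_St J R c : injmap J R -> (forall g, stab S c g -> cl J g) ->
  forall g, stab S c.+1 g -> cl R g.
Proof. by move=> JR Jc g /stabS[g0 gc]; apply: cl_inj JR g0 _ => y; exact: Jc. Qed.

(* If [t] is congruent to its own copy one level deeper, then iterating pushes it
   into every level stabiliser. *)
Lemma cl_fix J x t s : injmap J J -> injp x t s ->
  (forall n, mulns J (stab S n) s -> mulns J (stab S n) t) -> cl J t.
Proof.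
move=> JJ ist st; apply/clP; elim=> [|n IHn]; first by apply: mulnsr; exact: stab0.
apply: st; have /mulnsP[j [k [Jj kn tE]]] := IHn.
have [j' Jj' ij] := JJ j x Jj.
apply/mulnsP; exists j', (j'^-1 * s); rewrite mulVKg; split=> //.
have := injpM (injpV ij) ist; rewrite tE mulKg => ik.
exact: injp_St ik kn.
Qed.

Lemma mulns_commS M i : 0 < i -> (forall g, gam i g -> mulns M (gam i.+1) g) ->
  forall j, i <= j -> forall g, gam j g -> mulns M (gam j.+1) g.
Proof.
move=> i_gt0 Mi j /subnK <-; elim: (j - i) => // d IHd g; rewrite addSn.
have : 0 < d + i by rewrite addn_gt0 i_gt0 orbT.
case: (d + i) IHd => // k IHd _.
apply: ncomm_min => s t /IHd/mulnsP[m [k' [Mm kg ->]]] _.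
rewrite commgMl; apply: nsubM; last by apply: mulnsr; exact: gamS.
by apply: nsubJ; apply: mulnsl; exact: nsubRl.
Qed.

(** The hypothesis propagates to all later terms, so [gam i] lies in the product of M with any
    [gam k]; for large k the latter is inside the given level stabiliser. *)
Lemma gam_absorb M i : 0 < i -> (forall g, gam i g -> mulns M (gam i.+1) g) ->
  forall g, gam i g -> cl M g.
Proof.
move=> i_gt0 Mi g gi; apply/clP => n; have [k kSt] := gam_St S n.
have Mk j : mulns M (gam (i + j)) g.
  elim: j => [|j IHj]; first by rewrite addn0; exact: mulnsr.
  have /mulnsP[m [h [Mm hj ->]]] := IHj.
  apply: nsubM; first exact: mulnsl.
  by rewrite addnS; apply: mulns_commS i_gt0 Mi _ (leq_addr _ _) _ hj.
apply: mulns_min (Mk k) => s; first exact: mulnsl.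
by move=> sk; apply: mulnsr; apply: kSt; apply: gam_le sk; exact: leq_addl.
Qed.

End Closure.

(** * Families of directed generators *)

Lemma directed_expp (p : nat) (S : ssgroup p) (b : S) (x0 : 'F_p) (e : 'F_p -> 'F_p) :
    lab b = 0%R -> (forall x, sec b x = if x == x0 then b else rt S ^+ e x) ->
  b ^+ p = 1.
Proof.
move=> b0 bE; apply: stab_res; elim=> [|n IHn]; first exact: stab0.
apply/stabS; split=> [|x]; first by rewrite labX b0 mul0rn.
rewrite secX0 // bE; case: eqP => // _.
by rewrite -expgnA mulnC expgnA rt_p expg1n; exact: nsub1.
Qed.

(** Here [fe i y] is the exponent of a at distance [y] from the letter [fpos i] where [fb i] repeats
    itself; the value at distance 0 is a dummy, normalised to 0. The induction principle [fam_ind]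
    expresses generation as a monoid, which is enough for generators of finite order. *)
Record family (p : nat) (S : ssgroup p) := Family {
  fI : finType;
  fb : fI -> S;
  fpos : fI -> 'F_p;
  fe : fI -> 'F_p -> 'F_p;
  fi0 : fI;
  fe0 : forall i, fe i 0%R = 0%R;
  fnz : forall i, exists t, fe i t != 0%R;
  lab_fb : forall i, lab (fb i) = 0%R;
  sec_fb : forall i x, sec (fb i) x =
    if x == fpos i then fb i else rt S ^+ fe i (x - fpos i)%R;
  fam_ind : forall P : S -> Prop, P 1 -> (forall g, P g -> P (g * rt S)) ->
    (forall g i, P g -> P (g * fb i)) -> forall g, P g }.

Section Family.
Variables (p : nat) (S : ssgroup p) (F : family S).
Implicit Types (g h s t : S) (x y : 'F_p) (C J K M R T : nsub S) (i j : fI F).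
Local Notation p_pr := (ss_prime S).
Local Notation a := (rt S).

(** The conjugate of [fb i] under the powers of a whose recursive section sits at the letter [x]. *)
Definition bx i x := fb i ^ (a ^+ (x - fpos i)%R).

Lemma lab_bx i x : lab (bx i x) = 0%R.
Proof. by rewrite labJ lab_fb. Qed.

Lemma sec_bx i x y :
  sec (bx i x) y = if y == x then fb i else a ^+ fe i (y - x)%R.
Proof.
rewrite secJ ?lab_fb // sec_rtX conjg1 lab_rtF sec_fb.
have -> : (y - (x - fpos i) = (y - x) + fpos i)%R by ring.
by rewrite addrK -[X in _ == X]add0r (inj_eq (addIr _)) subr_eq0.
Qed.

Lemma bx_pos i : bx i (fpos i) = fb i.
Proof. by rewrite /bx subrr conjg1. Qed.

Lemma bxJ i x y : bx i x ^ (a ^+ y) = bx i (x + y)%R.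
Proof. by rewrite -conjgM -rtD addrAC. Qed.

Lemma bx_rt i x : bx i x ^ a = bx i (x + 1)%R.
Proof. by rewrite -bxJ expgF1. Qed.

Lemma bx_to i x y : bx i y = bx i x ^ (a ^+ (y - x)%R).
Proof. by rewrite bxJ addrC subrK. Qed.

Lemma fb_p i : fb i ^+ p = 1.
Proof. exact: directed_expp (lab_fb i) (sec_fb i).
Qed.

Lemma bx_p i x : bx i x ^+ p = 1.
Proof. by rewrite -conjXg fb_p conj1g. Qed.

(** Follow a word for [h] in the generators: a factor [fb i] is the section at [x] of [bx i x], and
    a factor a is obtained from a [bx] placed at a distance where its exponent is invertible. *)
Lemma fractal h x : exists2 s, lab s = 0%R & sec s x = h.
Proof.
elim/(@fam_ind _ _ F): h => [|h [s s0 <-]|h i [s s0 <-]].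
- by exists 1; rewrite ?lab1 ?sec1.
- have [t et] := fnz (fi0 F); have tn : t != 0%R by apply: contraNneq et => ->; rewrite fe0.
  exists (s * bx (fi0 F) (x - t)%R ^+ (fe (fi0 F) t)^-1%R).
    by rewrite labM s0 labX lab_bx mul0rn addr0.
  rewrite secM0 // secX0 ?lab_bx // sec_bx -subr_eq0.
  have -> : (x - (x - t) = t)%R by ring.
  by rewrite (negPf tn) -(expgFM p_pr (rt_p S)) divff.
- exists (s * bx i x); first by rewrite labM s0 lab_bx addr0.
  by rewrite secM0 // sec_bx eqxx.
Qed.

(** Level transitivity with trivial section at [u], so that copies are carried from [u] to [v]
    unchanged. *)
Lemma act_trans (u v : seq 'F_p) : size u = size v ->
  exists2 g : S, act g u = v & secw g u = 1.
Proof.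
elim: u v => [|x u IHu] [|y v] //=; first by exists 1.
move=> [/IHu[g gu g1]]; have [s s0 sx] := fractal g x.
exists (s * a ^+ (y - x)%R); last by rewrite secM sx sec_rtX mulg1.
by rewrite labM s0 lab_rtF add0r addrC subrK secM sx sec_rtX mulg1 gu.
Qed.

(** The derived subgroup is the normal closure of the commutators of generators: if the generators
    commute modulo T, so does everything. *)
Lemma fam_ind_comm T : (forall i, T [~ a, fb i]) -> (forall i j, T [~ fb i, fb j]) ->
  forall g, gam 2 g -> T g.
Proof.
move=> Tab Tbb.
have cab i : commute (qpi T a) (qpi T (fb i)).
  by apply/commgP; rewrite -qpiR; apply/eqP/qpi_id.
have cbb i j : commute (qpi T (fb i)) (qpi T (fb j)).
  by apply/commgP; rewrite -qpiR; apply/eqP/qpi_id.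
have cg g c : commute (qpi T c) (qpi T a) ->
    (forall i, commute (qpi T c) (qpi T (fb i))) -> commute (qpi T c) (qpi T g).
  move=> ca cb; elim/(@fam_ind _ _ F): g => [|g IHg|g i IHg].
  - by rewrite qpi1; exact: commute1.
  - by rewrite qpiM; exact: commuteM.
  - by rewrite qpiM; exact: commuteM.
have ca g : commute (qpi T a) (qpi T g) by apply: (cg).
have cb g i : commute (qpi T (fb i)) (qpi T g) by apply: (cg) => //; apply: commute_sym.
apply: ncomm_min => g h _ _; apply/qpi_id; rewrite qpiR; apply/eqP/commgP.
by apply: (cg) => [|i]; apply: commute_sym.
Qed.

Lemma stab1_ind (P : S -> Prop) : P 1 -> (forall s i x, P s -> P (s * bx i x)) ->
  forall s, lab s = 0%R -> P s.
Proof.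
move=> P1 PM s s0.
(* Stripping the rooted part gives a claim for every element of the group, to which generation by a
   and the [fb i] applies. *)
suff: P (s * (a ^+ lab s)^-1) by rewrite s0 invg1 mulg1.
elim/(@fam_ind _ _ F): s {s0} => [|s IHs|s i IHs].
- by rewrite lab1 invg1 mulg1.
- by rewrite labM lab_rt rtD expgF1 invgM !mulgA mulgK.
- rewrite labM lab_fb addr0.
  have -> : s * fb i * (a ^+ lab s)^-1 = s * (a ^+ lab s)^-1 * bx i (fpos i - lab s)%R; last exact: PM.
  by rewrite -bxJ bx_pos rtN conjgE invgK !mulgA mulgVK.
Qed.

(* Any two generators of the level stabiliser commute modulo [T] as soon as the
   directed ones do, so [T] contains the derived subgroup of the stabiliser. *)
Lemma stab1_comm T : (forall i j x y, T [~ bx i x, bx j y]) ->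
  forall g, ncomm (stab S 1) (stab S 1) g -> T g.
Proof.
move=> Tbb.
have cg g c : lab g = 0%R -> (forall i x, commute (qpi T c) (qpi T (bx i x))) ->
    commute (qpi T c) (qpi T g).
  move=> g0 cb; apply: (stab1_ind (P := fun g => commute (qpi T c) (qpi T g))) g0.
    by rewrite qpi1; exact: commute1.
  by move=> s i x; rewrite qpiM => ?; exact: commuteM.
apply: ncomm_min => g h /stab1 g0 /stab1 h0; apply/qpi_id; rewrite qpiR; apply/eqP/commgP.
apply: (cg h) => // i x; apply: commute_sym; apply: (cg g) => // j y.
by apply/commgP; rewrite -qpiR; apply/eqP/qpi_id.
Qed.

(* Modulo [C] the group is nilpotent with cyclic abelianisation, hence abelian. *)
Lemma gam2_cyclic C n : (forall g, stab S n g -> C g) ->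
    (forall i, exists k : 'F_p, mulns C (gam 2) (fb i * (a ^+ k)^-1)) ->
  forall g, gam 2 g -> C g.
Proof.
move=> stabC cyc.
(* If [gam 2] lies in C times [gam k.+2], then modulo C times [gam k.+3] each [fb i] is a central
   element times a power of a, so the generators commute. *)
have CM k g : gam 2 g -> mulns C (gam k.+2) g.
  elim: k g => [|k IHk] g; first exact: mulnsr.
  pose M := mulns C (gam k.+3).
  have cent (y h : S) : gam k.+2 y -> commute (qpi M y) (qpi M h).
    by move=> gy; apply/commgP; rewrite -qpiR; apply/eqP/qpi_id/mulnsr/gamS.
  have bE i : exists y : S, exists2 m : 'F_p, gam k.+2 y & qpi M (fb i) = qpi M y * qpi M a ^+ m.
    have [m /mulnsP[c [y [Cc /IHk/mulnsP[c' [y' [Cc' gy' ->]]] bE]]]] := cyc i.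
    exists y', m => //; rewrite -[fb i](mulgVK (a ^+ m)) bE !qpiM qpiX.
    have -> : qpi M c = 1 by apply/qpi_id/mulnsl.
    by have -> : qpi M c' = 1; [apply/qpi_id/mulnsl | rewrite !mul1g].
  apply: fam_ind_comm => [i|i j]; apply/qpi_id; rewrite qpiR; apply/eqP/commgP.
    have [y [m gy ->]] := bE i; apply: commuteM; first by apply: commute_sym; exact: cent.
    exact: commuteX.
  have [y [m gy ->]] := bE i; have [y' [m' gy' ->]] := bE j.
  apply: commuteM; first by apply: commute_sym; rewrite -qpiX -qpiM; exact: cent.
  apply: commute_sym; apply: commuteM; last exact: commuteX2 (commute_refl _).
  by apply: commute_sym; rewrite -qpiX; exact: cent.
have [k kSt] := gam_St S n.
move=> g g2; have := CM k g g2; apply: mulns_min => // h hk.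
by apply: stabC; apply: kSt; apply: gam_le hk; rewrite -addn2 leq_addr.
Qed.

End Family.

(* The subgroup generated by [gam 2] and all [b a^-1]; when the defining vectors
   are constant, the quotient by it is generated by the image of [a]. *)
Definition kerF (p : nat) (S : ssgroup p) (F : family S) : nsub S :=
  nclo (fun z => gam 2 z \/ exists i : fI F, z = fb i * (rt S)^-1).

(** * Elements that centralise K modulo the elements with copies in R *)

Section Core.
Variables (p : nat) (S : ssgroup p) (F : family S).
Implicit Types (g h s t c : S) (x y : 'F_p) (i j : fI F).
Local Notation p_pr := (ss_prime S).
Local Notation a := (rt S).

Variables (K R : nsub S) (g : S) (n0 : nat).
Hypothesis KK : injmap K K.
Hypothesis g_lab : lab g != 0%R.
Hypothesis gR : forall t, K t -> R [~ t, g].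
Hypothesis KSt : forall t, K t -> stab S n0 t -> R t.

Lemma core_pull_subproof :
  let P t := K t /\ forall x s, injp x t s -> R s in
  [/\ P 1, forall s t, P s -> P t -> P (s * t), forall s, P s -> P s^-1
    & forall s t, P s -> P (s ^ t)].
Proof.
split=> [|s t [Ks Rs] [Kt Rt]|s [Ks Rs]|s t [Ks Rs]].
- split=> [|x s /injp_uniq/(_ (injp1 S x)) ->]; exact: nsub1.
- split=> [|x u iu]; first exact: nsubM.
  have [s' Ks' is_] := KK x Ks; have [t' Kt' it] := KK x Kt.
  rewrite (injp_uniq iu (injpM is_ it)); apply: nsubM; [exact: Rs is_|exact: Rt it].
- split=> [|x u /injpV iu]; first exact: nsubV.
  by apply: nsubVE; apply: (Rs x); rewrite invgK in iu.
- split=> [|x u iu]; first exact: nsubJ.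
  have [h h0 hx] := fractal F t x; have [s' Ks' is_] := KK x Ks.
  have := injpJ0 h0 is_; rewrite hx => /injp_uniq/(_ iu) <-.
  by apply: nsubJ; exact: Rs is_.
Qed.

Definition core_pull : nsub S :=
  let: And4 P1 PM PV PJ := core_pull_subproof in NSub P1 PM PV PJ.

Lemma core_pullP t : core_pull t <-> K t /\ forall x s, injp x t s -> R s.
Proof. by rewrite /core_pull; case: core_pull_subproof. Qed.

Lemma core_pull1 x t s : K t -> injp x t s -> R s -> core_pull t.
Proof.
move=> Kt is_ Rs; apply/core_pullP; split=> // y s' is'.
by rewrite (injp_uniq is' (injp_rt_to y is_)); exact: nsubJ.
Qed.

Lemma core_pull_inj : injmap core_pull R.
Proof.
move=> t x /core_pullP[Kt Rt]; have [s Ks is_] := KK x Kt.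
by exists s => //; exact: Rt is_.
Qed.

Lemma core_cent_subproof :
  let P c := forall t, K t -> core_pull [~ t, c] in
  [/\ P 1, forall s t, P s -> P t -> P (s * t), forall s, P s -> P s^-1
    & forall s t, P s -> P (s ^ t)].
Proof.
split=> [t _|s t Ps Pt u Ku|s Ps u Ku|s t Ps u Ku].
- by rewrite commg1; exact: nsub1.
- rewrite commgMr; apply: nsubM; [exact: Pt | by apply: nsubJ; exact: Ps].
- have -> : [~ u, s^-1] = ([~ u, s] ^ s^-1)^-1 by rewrite !(commgEl, conjgE, gnorm).
  by apply: nsubV; apply: nsubJ; exact: Ps.
- have -> : [~ u, s ^ t] = [~ u ^ t^-1, s] ^ t by rewrite conjRg conjgKV.
  by apply: nsubJ; apply: Ps; exact: nsubJ.
Qed.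

(** The centraliser of K modulo [core_pull]. The aim is to show that it is the whole group, or at
    least contains [kerF F]. *)
Definition core_cent : nsub S :=
  let: And4 P1 PM PV PJ := core_cent_subproof in NSub P1 PM PV PJ.

Lemma core_centP c : core_cent c <-> forall t, K t -> core_pull [~ t, c].
Proof. by rewrite /core_cent; case: core_cent_subproof. Qed.

Lemma core_centSt c : stab S n0 c -> core_cent c.
Proof.
move=> cn; apply/core_centP => t Kt.
have Kc : K [~ t, c] by exact: nsubRl.
apply/core_pullP; split=> // x s is_; apply: KSt; first exact: (injmap_mem KK Kc is_).
by apply: stab_sub; apply: injp_St is_ _; apply: nsubRr.
Qed.

(** Take a copy at [x] of a conjugate of t. Since g centralises K modulo R, conjugating it by g and
    then s, or by s and then g, gives the same result modulo R. Both results are copies at the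
    letter [x + lab g], of t conjugated by the two factors compared here. *)
Lemma core_shift s x : lab s = 0%R ->
  core_cent ((sec s x) ^ (sec g x) * (sec s (x + lab g)%R)^-1).
Proof.
move=> s0; set u := _ ^ _; set v := sec s (x + lab g)%R.
apply/core_centP => t Kt.
have -> : [~ t, u * v^-1] = ((t ^ v)^-1 * t ^ u) ^ v^-1 by rewrite !(commgEl, conjgE, gnorm).
apply: nsubJ; have Kt' : K (t ^ (sec g x)^-1) by exact: nsubJ.
have [tau Ktau itau] := KK x Kt'.
have i1 := injpJ s (injpJ g itau); rewrite conjgKV s0 addr0 -/v in i1.
have i2 := injpJ g (injpJ s itau); rewrite s0 addr0 in i2.
have tE : ((t ^ (sec g x)^-1) ^ sec s x) ^ sec g x = t ^ u.
  by rewrite -!conjgM /u conjgE !mulgA.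
rewrite tE in i2.
apply: core_pull1 (injpM (injpV i1) i2) _; first by apply: nsubM; [apply: nsubV|]; exact: nsubJ.
have cR w : K w -> qpi R (w ^ g) = qpi R w.
  move=> Kw; apply/esym/qpiP; exact: gR.
by apply/qpiP; rewrite qpiJ cR // -qpiJ cR //; exact: nsubJ.
Qed.

(** Applied to [bx i x] at its own position, [core_shift] identifies a conjugate of [fb i] with a
    power of a, so [gam2_cyclic] applies. *)
Lemma core_gam2 c : gam 2 c -> core_cent c.
Proof.
apply: (@gam2_cyclic _ _ F _ n0 core_centSt) => i; exists (fe i (lab g)); set x := fpos i.
have := core_shift x (lab_bx i x); rewrite !sec_bx eqxx.
have -> : (x + lab g == x)%R = false.
  by rewrite -[X in _ == X]addr0 (inj_eq (addrI _)) (negPf g_lab).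
rewrite [(x + _)%R]addrC addrK => Cg; set M := mulns _ _.
apply/qpi_id; have /qpi_id := mulnsl (gam 2) Cg; rewrite -/M !(qpiM _ _ (_ ^-1)) => <-.
congr (_ * _); apply/qpiP; apply: mulnsr.
by rewrite -commgEl; apply: (@gamS _ 1).
Qed.

Lemma core_shift2 s x : lab s = 0%R -> core_cent (sec s x * (sec s (x + lab g)%R)^-1).
Proof.
move=> s0; have /qpi_id := core_shift x s0; rewrite (qpiM _ _ (_ ^-1)) => C1.
apply/qpi_id; rewrite (qpiM _ _ (_ ^-1)) -C1; congr (_ * _); apply/qpiP; rewrite -commgEl.
by apply: core_gam2; apply: (@gamS _ 1).
Qed.

(** The comparison of sections puts differences of exponents of a into the centraliser. If a itself
    were not in it, all these differences would vanish, making [fe i] constant off 0; once a is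
    there, so are the [fb j]. *)
Lemma core_nonconst i (t t' : 'F_p) : t != 0%R -> t' != 0%R -> fe i t != fe i t' ->
  injmap (ncomm K nfull) R.
Proof.
move=> t0 t'0 ett'; apply: injmapS core_pull_inj => //.
have Ca : core_cent a.
  apply: contrapT => nCa.
  have shift u : u != 0%R -> (u + lab g)%R != 0%R -> fe i (u + lab g)%R = fe i u.
    move=> u0 ug; apply: contrapT => /eqP neq; apply: nCa; apply/qpi_id.
    have := core_shift2 u (lab_bx i 0%R).
    rewrite !sec_bx (negPf u0) (negPf ug) !subr0 -rtN -rtD => /qpi_id; rewrite qpiX.
    apply: (expgF_inv p_pr); first by rewrite -qpiX rt_p qpi1.
    by rewrite subr_eq0 eq_sym.
  (* A non-zero [u] is a multiple k of [lab g] with 0 < k < p, so walking from [lab g] to [u] in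
     steps of [lab g] never meets 0. *)
  have const u : u != 0%R -> fe i u = fe i (lab g).
    move=> u0; have -> : u = (lab g *+ (u / lab g : 'F_p))%R.
      by rewrite -mulr_natr natr_Zp mulrC divfK.
    have ug : (u / lab g)%R != 0%R by rewrite mulf_neq0 ?invr_eq0.
    have : 0 < (u / lab g : 'F_p)%R.
      by rewrite lt0n; apply: contraNneq ug => ug0; apply/eqP/val_inj.
    have := ltn_ord (u / lab g)%R; rewrite [X in _ < X](Fp_cast p_pr).
    elim: (nat_of_ord _) => // -[|n] IHn n_lt _; first by rewrite mulr1n.
    have nz k : 0 < k < p -> (lab g *+ k)%R != 0%R.
      move=> /andP[k0 kp]; rewrite -mulr_natr mulf_neq0 // -(dvdn_pcharf (pchar_Fp p_pr)).
      by rewrite gtnNdvd.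
    rewrite mulrSr shift ?IHn ?nz ?(ltnW n_lt) //.
    by rewrite -mulrSr nz.
  by case/negP: ett'; rewrite const // (const t').
have Cb j : core_cent (fb j).
  have := core_shift2 (fpos j) (lab_bx j (fpos j)); rewrite !sec_bx eqxx.
  have -> : (fpos j + lab g == fpos j)%R = false.
    by rewrite -[X in _ == X]addr0 (inj_eq (addrI _)) (negPf g_lab).
  move=> Cj; rewrite -[fb j](mulgVK (a ^+ fe j (fpos j + lab g - fpos j)%R)).
  by apply: nsubM => //; exact: nsubX.
have Call c : core_cent c.
  by elim/(@fam_ind _ _ F): c => [|c|c j] *; [exact: nsub1 | exact: nsubM | exact: nsubM].
by apply: ncomm_min => s c Ks _; have /core_centP := Call c; apply.
Qed.

(** With constant exponents the comparison of sections yields the elements [fb i * a^-1], which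
    together with [gam 2] generate [kerF F]. *)
Lemma core_const : (forall i (t : 'F_p), t != 0%R -> fe i t = 1%R) -> injmap (ncomm K (kerF F)) R.
Proof.
move=> e1; apply: injmapS core_pull_inj => // s.
apply: ncomm_min => {s}t c Kt Kc; suff /core_centP : core_cent c by apply.
apply: nclo_min Kc => {}c [|[i ->]]; first exact: core_gam2.
have := core_shift2 (fpos i) (lab_bx i (fpos i)); rewrite !sec_bx eqxx.
have -> : (fpos i + lab g == fpos i)%R = false.
  by rewrite -[X in _ == X]addr0 (inj_eq (addrI _)) (negPf g_lab).
by rewrite [(fpos i + _)%R]addrC addrK e1 // expgF1.
Qed.

End Core.

(** * Copies below vertices of level m, and reduction to the root *)

Section Words.
Variables (p : nat) (S : ssgroup p) (F : family S).
Implicit Types (g h s t : S) (x y : 'F_p) (u v : seq 'F_p).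

Definition injw u t s := stab S (size u) s /\
  forall v, size v = size u -> secw s v = if v == u then t else 1.

Lemma injw1 u : injw u 1 1.
Proof. by split=> [|v _]; rewrite ?secw1 ?if_same //; exact: nsub1. Qed.

Lemma injwM u t s t' s' : injw u t s -> injw u t' s' -> injw u (t * t') (s * s').
Proof.
move=> [sn st] [s'n s't']; split=> [|v vu]; first exact: nsubM.
by rewrite (secwM_St _ sn) ?vu // st // s't' //; case: eqP; rewrite ?mulg1.
Qed.

Lemma injwV u t s : injw u t s -> injw u t^-1 s^-1.
Proof.
move=> [sn st]; split=> [|v vu]; first exact: nsubV.
by rewrite (secwV_St sn) ?vu // st //; case: eqP; rewrite ?invg1.
Qed.

Lemma injwJ u t s h : injw u t s -> injw (act h u) (t ^ secw h u) (s ^ h).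
Proof.
move=> [sn st]; split=> [|v]; rewrite size_act; first exact: nsubJ.
move=> vu; rewrite -(actKV h v) (secwJ_St _ sn) ?size_act ?vu // st ?size_act //.
rewrite (inj_eq (can_inj (actK h))).
by case: eqP => [->|]; rewrite ?conj1g.
Qed.

Lemma injw_uniq u t s s' : injw u t s -> injw u t s' -> s = s'.
Proof.
move=> [sn st] [s'n s't]; apply: divg1_eq; apply: stab_res => n.
have : stab S (size u + n) (s * s'^-1).
  apply: stab_secw => [|v vu]; first by apply: nsubM => //; exact: nsubV.
  rewrite (secwM_St _ sn) ?vu // (secwV_St s'n) ?vu // st // s't // mulgV.
  exact: nsub1.
by apply: stab_le; exact: leq_addl.
Qed.

Lemma injw_cons x u t s s' : injw u t s -> injp x s s' -> injw (x :: u) t s'.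
Proof.
move=> [sn st] is'; split=> [|[|y v] //= [vu]]; first exact: injp_St is' sn.
rewrite (injp_sec _ is'); case: eqP => [->|xy].
  by rewrite st //; case: eqP => [->|uv]; [rewrite eqxx | case: eqP => // -[/uv]].
by rewrite secw1; case: eqP => // -[/xy].
Qed.

Lemma injw_St u t s n : injw u t s -> stab S n t -> stab S (size u + n) s.
Proof.
move=> [sn st] tn; apply: stab_secw => // v vu; rewrite st //.
by case: eqP => // _; exact: nsub1.
Qed.

Lemma injmap_injw (K : nsub S) u t : injmap K K -> K t -> exists2 s, K s & injw u t s.
Proof.
move=> KK Kt; elim: u => [|x u [s Ks is_]].
  by exists t => //; split=> [|[|//]]; first exact: stab0.
by have [s' Ks' is'] := KK s x Ks; exists s' => //; exact: injw_cons is_ is'.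
Qed.

Lemma injw_prod (A : nsub S) m (j : seq 'F_p -> S) :
    (forall u, size u = m -> exists2 s, A s & injw u (j u) s) ->
  exists s, [/\ A s, stab S m s & forall u, size u = m -> secw s u = j u].
Proof.
move=> Aj; have /choice[f fP] : forall u : m.-tuple 'F_p, exists s, A s /\ injw u (j u) s.
  by move=> u; have [s] := Aj u (size_tuple u); exists s.
pose r := enum {: m.-tuple 'F_p}.
have fm w : stab S m (f w) by case: (fP w) => _ []; rewrite size_tuple.
exists (\prod_(w <- r) f w); split; first by apply: nsub_prod => w; case: (fP w).
  exact: nsub_prod.
move=> v /eqP vm; pose w := Tuple vm; rewrite -[v]/(val w).
have fE z : secw (f z) (val w) = if w == z then j w else 1.
  case: (fP z) => _ [_ ->]; last by rewrite !size_tuple.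
  by rewrite (inj_eq val_inj); case: eqP => [->|].
have := enum_uniq {: m.-tuple 'F_p}; have : w \in r by rewrite mem_enum.
rewrite -/r; elim: r => // z r IHr; rewrite inE big_cons => /orP[/eqP wz|wr] /andP[zr uniqr].
  rewrite (secwM_St _ (fm z)) ?size_tuple // fE wz eqxx.
  suff -> : secw (\prod_(w <- r) f w) z = 1 by rewrite mulg1.
  elim: r zr {IHr uniqr} => [|z' r IHr]; first by rewrite big_nil secw1.
  rewrite inE big_cons negb_or => /andP[zz' zr].
  by rewrite (secwM_St _ (fm z')) ?size_tuple // IHr // -wz fE wz (negPf zz') mulg1.
rewrite (secwM_St _ (fm z)) ?size_tuple // fE IHr //.
by case: eqP zr => [<-|_]; [rewrite wr | rewrite mul1g].
Qed.

Section Reduction.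
Variables (A N K : nsub S) (m n0 : nat).
Hypothesis KK : injmap K K.
Hypothesis ASt : forall s, stab S n0 s -> A s.
Hypothesis NA : forall n h, N n -> A [~ n, h].
Hypothesis NSt : forall n, N n -> stab S m n.

Lemma red_subproof :
  let P t := K t /\ forall u, size u = m -> exists2 s, A s & injw u t s in
  [/\ P 1, forall s t, P s -> P t -> P (s * t), forall s, P s -> P s^-1
    & forall s t, P s -> P (s ^ t)].
Proof.
split=> [|s t [Ks As] [Kt At]|s [Ks As]|s t [Ks As]]; split; try by [exact: nsub1|exact: nsubM|exact: nsubV|exact: nsubJ].
- by move=> u um; exists 1; [exact: nsub1 | exact: injw1].
- move=> u um; have [s' As' is_] := As u um; have [t' At' it] := At u um.
  by exists (s' * t'); [exact: nsubM | exact: injwM].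
- move=> u um; have [s' As' is_] := As u um.
  by exists s'^-1; [exact: nsubV | exact: injwV].
- move=> u um; have [s' As' is_] := As u um.
  suff [h hu ht] : exists2 h : S, act h u = u & secw h u = t.
    by exists (s' ^ h); [exact: nsubJ | have := injwJ h is_; rewrite hu ht].
  elim: u {um is_} => [|x u [h hu ht]]; first by exists t.
  have [g g0 gx] := fractal F h x; exists g => /=; rewrite gx ?g0 ?addr0 ?hu //.
Qed.

(** In the application A is [N,G]. The subgroup [red] moves the problem from depth m to the root: a
    level stabiliser in its closure gives one in A, m levels deeper. *)
Definition red : nsub S :=
  let: And4 P1 PM PV PJ := red_subproof in NSub P1 PM PV PJ.

Lemma redP t : red t <-> K t /\ forall u, size u = m -> exists2 s, A s & injw u t s.
Proof. by rewrite /red; case: red_subproof. Qed.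

Lemma red1 u t s : size u = m -> K t -> injw u t s -> A s -> red t.
Proof.
move=> um Kt is_ As; apply/redP; split=> // v vm.
have [h hu h1] : exists2 h : S, act h u = v & secw h u = 1.
  by apply: (act_trans F); rewrite um.
exists (s ^ h); first exact: nsubJ.
by have := injwJ h is_; rewrite hu h1 conjg1.
Qed.

Lemma red_St t : K t -> stab S n0 t -> red t.
Proof.
move=> Kt tn; have [s Ks is_] := injmap_injw (nseq m 0%R) KK Kt.
apply: red1 (is_) _ => //; first by rewrite size_nseq.
apply: ASt; have := injw_St is_ tn; apply: stab_le; exact: leq_addl.
Qed.

(** As [n] fixes [u], the commutator with [n] of the copy of [t] at [u] is the copy of this
    commutator, and it lies in A by [NA]. *)
Lemma red_comm n u t : N n -> size u = m -> K t -> red [~ t, secw n u].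
Proof.
move=> Nn um Kt; have [s Ks is_] := injmap_injw u KK Kt.
have nu : act n u = u by apply: act_St (NSt Nn) _; rewrite um.
have := injwJ n is_; rewrite nu => /(injwM (injwV is_)) i1.
apply: red1 um _ i1 _; first exact: nsubRl.
by rewrite -commgEl -invgR; apply: nsubV; exact: NA.
Qed.

(** It is enough to approximate the sections up to [stab S n0], since A contains that stabiliser. *)
Lemma red_cl s : stab S m s -> (forall u, size u = m -> cl red (secw s u)) -> A s.
Proof.
move=> sm Rs; have /choice[f fP] : forall u, exists j,
    size u = m -> red j /\ stab S n0 (j^-1 * secw s u).
  move=> u; case: (eqVneq (size u) m) => [um|um]; last by exists 1 => us; rewrite us eqxx in um.
  have /clP/(_ n0)/mulnsP[j [k [Rj kn ->]]] := Rs _ um.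
  by exists j; rewrite mulKg.
have [r [Ar rm rf]] : exists s, [/\ A s, stab S m s & forall u, size u = m -> secw s u = f u].
  apply: injw_prod => u um; have [/redP[_ Ru] _] := fP u um; exact: Ru.
rewrite -(mulKVg r s); apply: nsubM => //; apply: ASt.
have : stab S (m + n0) (r^-1 * s).
  apply: stab_secw => [|u um]; first by apply: nsubM => //; exact: nsubV.
  rewrite (secwM_St _ (nsubV rm)) ?um // (secwV_St rm) ?um // rf //.
  by case: (fP u um).
by apply: stab_le; exact: leq_addl.
Qed.

Lemma red_concl c : (forall s, stab S c s -> cl red s) ->
  forall s, stab S (m + c) s -> A s.
Proof.
move=> Rc s sc; apply: red_cl; first by apply: stab_le sc; exact: leq_addr.
by move=> u um; apply: Rc; exact: secw_St sc um.
Qed.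

End Reduction.
End Words.

(** * Exponent vectors for G modulo [gam 2] and for St(1) modulo its derived subgroup *)

Section Exponents.
Variables (p : nat) (S : ssgroup p) (F : family S).
Implicit Types (g h s t c : S) (x y k : 'F_p) (i j : fI F).
Implicit Types (m : fI F -> 'F_p) (n : fI F -> 'F_p -> 'F_p).
Local Notation p_pr := (ss_prime S).
Local Notation a := (rt S).
Local Notation dSt := (ncomm (stab S 1) (stab S 1)).

Lemma dSt_gam2 g : dSt g -> gam 2 g.
Proof. by apply: ncomm_min => {}g h _ _; exact: (@gamS _ 1). Qed.

Lemma dSt_lab g : dSt g -> lab g = 0%R.
Proof. by move/dSt_gam2/gam2_lab. Qed.

Lemma dSt_sec g y : dSt g -> gam 2 (sec g y).
Proof.
have sub : [/\ lab (1 : S) = 0%R /\ (forall y, gam 2 (sec (1 : S) y)),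
    (forall s t, lab s = 0%R /\ (forall y, gam 2 (sec s y)) ->
       lab t = 0%R /\ (forall y, gam 2 (sec t y)) ->
       lab (s * t) = 0%R /\ (forall y, gam 2 (sec (s * t) y))),
    (forall s, lab s = 0%R /\ (forall y, gam 2 (sec s y)) ->
       lab s^-1 = 0%R /\ (forall y, gam 2 (sec s^-1 y))) &
    (forall s t, lab s = 0%R /\ (forall y, gam 2 (sec s y)) ->
       lab (s ^ t) = 0%R /\ (forall y, gam 2 (sec (s ^ t) y)))].
  split=> [|s t [s0 s2] [t0 t2]|s [s0 s2]|s t [s0 s2]]; split=> [|z].
  - exact: lab1.
  - by rewrite sec1; exact: nsub1.
  - by rewrite labM s0 t0 addr0.
  - by rewrite secM0 //; exact: nsubM.
  - by rewrite labV s0 oppr0.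
  - by rewrite secV0 //; exact: nsubV.
  - by rewrite labJ.
  - by rewrite secJ //; exact: nsubJ.
case: sub => H1 HM HV HJ; pose H := NSub H1 HM HV HJ.
move=> gd; suff : H g by case=> _; apply.
apply: ncomm_min gd => {}g h /stab1 g0 /stab1 h0; split=> [|z]; first exact: labR.
by rewrite secR0 //; exact: (@gamS _ 1).
Qed.

Definition kap m := \prod_i fb i ^+ m i.
Definition blk n x := \prod_i bx i x ^+ n i x.
Definition wd n := \prod_x blk n x.

(** These are relations rather than functions because an element is not assumed to determine its
    exponents. *)
Definition repB s n := qpi dSt s = qpi dSt (wd n).
Definition repA g k m := qpi (gam 2) g = qpi (gam 2) (a ^+ k * kap m).

Lemma lab_blk n x : lab (blk n x) = 0%R.
Proof. by apply: lab_prod0 => i; rewrite labX lab_bx mul0rn. Qed.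

Lemma lab_wd n : lab (wd n) = 0%R.
Proof. by apply: lab_prod0 => x; exact: lab_blk. Qed.

Lemma lab_kap m : lab (kap m) = 0%R.
Proof. by apply: lab_prod0 => i; rewrite labX lab_fb mul0rn. Qed.

Lemma dSt_commute s t : lab s = 0%R -> lab t = 0%R ->
  commute (qpi dSt s) (qpi dSt t).
Proof.
move=> s0 t0; apply/commgP; rewrite -qpiR; apply/eqP/qpi_id.
by apply: mem_ncomm; apply/stab1.
Qed.

Lemma gam2_commute s t : commute (qpi (gam 2) s) (qpi (gam 2) t).
Proof. by apply/commgP; rewrite -qpiR; apply/eqP/qpi_id; exact: (@gamS _ 1). Qed.

Lemma eq_repB s n n' : (forall i x, n i x = n' i x) -> repB s n -> repB s n'.
Proof.
move=> nn'; rewrite /repB => ->; congr (qpi _ _); apply: eq_bigr => x _.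
by apply: eq_bigr => i _; rewrite nn'.
Qed.

Lemma eq_repA s k m m' : (forall i, m i = m' i) -> repA s k m -> repA s k m'.
Proof.
move=> mm'; rewrite /repA => ->; congr (qpi _ (_ * _)).
by apply: eq_bigr => i _; rewrite mm'.
Qed.

Lemma repB1 : repB 1 (fun _ _ => 0%R).
Proof. by rewrite /repB /wd big1 // => x _; rewrite /blk big1. Qed.

Lemma repA1 : repA 1 0%R (fun=> 0%R).
Proof. by rewrite /repA /kap big1 // mulg1. Qed.

Lemma repBM s s' n n' : repB s n -> repB s' n' ->
  repB (s * s') (fun i x => n i x + n' i x)%R.
Proof.
rewrite /repB qpiM => -> ->; rewrite !qpi_prod.
rewrite -prodgM_commute; last by move=> x y _ _; apply: dSt_commute; exact: lab_blk.
apply: eq_bigr => x _; rewrite !qpi_prod -prodgM_commute.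
  by apply: eq_bigr => i _; rewrite !qpiX (expgFD p_pr) // -qpiX bx_p.
by move=> i j _ _; apply: dSt_commute; rewrite labX lab_bx mul0rn.
Qed.

Lemma repAM s s' k k' m m' : repA s k m -> repA s' k' m' ->
  repA (s * s') (k + k')%R (fun i => m i + m' i)%R.
Proof.
rewrite /repA qpiM => -> ->.
have kE : qpi (gam 2) (kap (fun i => (m i + m' i)%R)) =
    qpi (gam 2) (kap m) * qpi (gam 2) (kap m').
  rewrite !qpi_prod -prodgM_commute; last by move=> i j _ _; exact: gam2_commute.
  by apply: eq_bigr => i _; rewrite !qpiX (expgFD p_pr) // -qpiX fb_p.
rewrite !(qpiM _ (a ^+ _) (kap _)) rtD (qpiM _ (a ^+ _) (a ^+ _)) kE.
rewrite -!mulgA; congr (_ * _); rewrite !mulgA; congr (_ * _).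
exact: gam2_commute.
Qed.

Lemma repB_dSt s : dSt s -> repB s (fun _ _ => 0%R).
Proof. by move=> sd; rewrite /repB -repB1; apply/esym/qpiP; rewrite invg1 mul1g. Qed.

Lemma repA_gam2 s : gam 2 s -> repA s 0%R (fun=> 0%R).
Proof. by move=> sd; rewrite /repA -repA1; apply/esym/qpiP; rewrite invg1 mul1g. Qed.

Lemma repA_rt k : repA (a ^+ k) k (fun=> 0%R).
Proof. by rewrite /repA /kap big1 // mulg1. Qed.

Lemma repA_fb i : repA (fb i) 0%R (fun j => (j == i)%:R)%R.
Proof.
rewrite /repA mul1g /kap (big_only1 i) ?eqxx ?expgF1 // => j ji _.
by rewrite (negPf ji).
Qed.

Lemma repB_bx i x : repB (bx i x) (fun j y => ((j == i) && (y == x))%:R)%R.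
Proof.
rewrite /repB /wd (big_only1 x) // => [|y yx _]; last first.
  by rewrite /blk big1 // => j _; rewrite (negPf yx) andbF.
rewrite /blk (big_only1 i) ?eqxx ?expgF1 // => j ji _.
by rewrite (negPf ji).
Qed.

Lemma repBX s n r : repB s n -> repB (s ^+ r) (fun i x => n i x *+ r)%R.
Proof.
move=> sn; elim: r => [|r IHr]; first exact: repB1.
by rewrite expgS; apply: eq_repB (repBM sn IHr) => i x; rewrite mulrS.
Qed.

Lemma repAX s k m r : repA s k m -> repA (s ^+ r) (k *+ r)%R (fun i => m i *+ r)%R.
Proof.
move=> sn; elim: r => [|r IHr]; first exact: repA1.
by rewrite expgS mulrS; apply: eq_repA (repAM sn IHr) => i; rewrite mulrS.
Qed.

Lemma repBV s n : repB s n -> repB s^-1 (fun i x => - n i x)%R.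
Proof.
move=> sn; have s0 : repB (s ^+ p.-1 * s) (fun _ _ => 0%R).
  apply: eq_repB (repBM (repBX p.-1 sn) sn) => i x.
  by rewrite -mulrSr (prednK (prime_gt0 p_pr)) -mulr_natr (pchar_Fp_0 p_pr) mulr0.
have sV : qpi dSt s^-1 = qpi dSt (s ^+ p.-1).
  apply/esym/qpiP; move: s0; rewrite /repB -repB1 qpi1 => /qpi_id sd.
  by rewrite -invgM; apply: nsubV; rewrite -expgS expgSr.
rewrite /repB sV; apply: eq_repB (repBX p.-1 sn) => i x.
apply/eqP; rewrite -addr_eq0 -mulrSr (prednK (prime_gt0 p_pr)) -mulr_natr (pchar_Fp_0 p_pr).
by rewrite mulr0.
Qed.

Lemma repB_prod (I : Type) (r : seq I) (f : I -> S) (n : I -> fI F -> 'F_p -> 'F_p) :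
  (forall l, repB (f l) (n l)) ->
  repB (\prod_(l <- r) f l) (fun i x => \sum_(l <- r) n l i x)%R.
Proof.
move=> fn; elim: r => [|l r IHr].
  by rewrite big_nil; apply: eq_repB repB1 => i x; rewrite big_nil.
by rewrite big_cons; apply: eq_repB (repBM (fn l) IHr) => i x; rewrite big_cons.
Qed.

Lemma repA_prod (I : Type) (r : seq I) (f : I -> S) (k : I -> 'F_p)
    (m : I -> fI F -> 'F_p) :
  (forall l, repA (f l) (k l) (m l)) ->
  repA (\prod_(l <- r) f l) (\sum_(l <- r) k l)%R (fun i => \sum_(l <- r) m l i)%R.
Proof.
move=> fm; elim: r => [|l r IHr].
  by rewrite !big_nil; apply: eq_repA repA1 => i; rewrite big_nil.
rewrite !big_cons; apply: eq_repA (repAM (fm l) IHr) => i.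
by rewrite big_cons.
Qed.

Lemma repAJ s h k m : repA s k m -> repA (s ^ h) k m.
Proof.
rewrite /repA => <-; apply/esym/qpiP; rewrite -commgEl.
exact: (@gamS _ 1).
Qed.

Lemma repBJ s h n : lab s = 0%R -> lab h = 0%R -> repB s n -> repB (s ^ h) n.
Proof.
move=> s0 h0; rewrite /repB => <-; apply/esym/qpiP; rewrite -commgEl.
by apply: mem_ncomm; apply/stab1.
Qed.

Lemma repB_rt s n y : repB s n -> repB (s ^ (a ^+ y)) (fun i x => n i (x - y))%R.
Proof.
move=> sn; have : qpi dSt (s ^ (a ^+ y)) = qpi dSt (wd n ^ (a ^+ y)) by rewrite !qpiJ sn.
rewrite /repB => ->; rewrite -/(repB _ _) conjg_prod.
have fn x : repB (blk n x ^ (a ^+ y))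
    (fun i x' => \sum_j ((i == j) && (x' == x + y))%:R *+ (n j x))%R.
  rewrite conjg_prod; apply: repB_prod => i; rewrite conjXg bxJ.
  exact: repBX (repB_bx _ _).
apply: eq_repB (repB_prod _ fn) => i x'.
rewrite (bigD1 (x' - y)%R) //= [X in (_ + X)%R]big1 ?addr0 => [|x xx']; last first.
  by apply: big1 => j _; rewrite -subr_eq [X in _ && X]eq_sym (negPf xx') andbF mul0rn.
rewrite (bigD1 i) //= [X in (_ + X)%R]big1 ?addr0 => [|j ji]; last first.
  by rewrite eq_sym (negPf ji) mul0rn.
by rewrite subrK !eqxx /= natr_Zp.
Qed.

Lemma repB_exists s : lab s = 0%R -> exists n, repB s n.
Proof.
apply: (stab1_ind (P := fun s => exists n, repB s n)).
  by exists (fun _ _ => 0%R); exact: repB1.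
by move=> {}s i x [n sn]; eexists; apply: repBM sn (repB_bx i x).
Qed.

Lemma repA_exists g : exists m, repA g (lab g) m.
Proof.
elim/(@fam_ind _ _ F): g => [|g [m gm]|g i [m gm]].
- by exists (fun=> 0%R); rewrite lab1; exact: repA1.
- rewrite labM lab_rt; eexists; apply: repAM gm _.
  exact: (repA_rt 1%R).
- by rewrite labM lab_fb; eexists; apply: repAM gm (repA_fb i).
Qed.

Lemma repA_lab g k m : repA g k m -> lab g = k.
Proof.
move=> /qpiP/gam2_lab; rewrite labM labV labM lab_rtF lab_kap addr0.
by move/eqP; rewrite addrC subr_eq0 => /eqP.
Qed.

Lemma repA_inj g h k m : repA g k m -> repA h k m -> qpi (gam 2) g = qpi (gam 2) h.
Proof. by rewrite /repA => -> ->. Qed.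

Lemma repA0 g m : (forall i, m i = 0%R) -> repA g 0%R m -> gam 2 g.
Proof.
move=> m0 gm; apply/qpi_id; rewrite -(qpi1 (gam 2)).
by apply: repA_inj gm _; apply: eq_repA repA1.
Qed.

Lemma repB_repA s n : repB s n -> repA s 0%R (fun i => \sum_x n i x)%R.
Proof.
move=> sn; have : repA (wd n) 0%R (fun i => \sum_x n i x)%R.
  have fn x : repA (blk n x) (\sum_(j : fI F) 0)%R (fun i => \sum_j ((i == j)%:R *+ n j x))%R.
    apply: repA_prod => i; rewrite -[X in repA _ X](mul0rn _ (n i x)); apply: repAX.
    by apply: repAJ; exact: repA_fb.
  have := repA_prod (index_enum 'F_p) fn; rewrite [X in repA _ X]big1 => [|x _]; last by rewrite big1.
  apply: eq_repA => i; apply: eq_bigr => x _.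
  rewrite (bigD1 i) //= eqxx natr_Zp big1 ?addr0 // => j ji.
  by rewrite eq_sym (negPf ji) mul0rn.
rewrite /repA => <-; apply/qpiP; have /qpiP sw := sn.
exact: dSt_gam2.
Qed.

(** At the letter [y] the factor [bx i y] contributes [fb i], and every other [bx i x] the power
    [fe i (y - x)] of a. The label of a section is therefore a convolution of exponents with
    defining vectors. *)
Lemma repB_sec s n y : lab s = 0%R -> repB s n ->
  repA (sec s y) (\sum_x \sum_i n i x * fe i (y - x))%R (fun i => n i y).
Proof.
move=> s0 sn; have : repA (sec (wd n) y) (\sum_x \sum_i n i x * fe i (y - x))%R (fun i => n i y).
  rewrite /wd sec_prod0; last exact: lab_blk.
  have fn x : repA (sec (blk n x) y) (\sum_i n i x * fe i (y - x))%R
      (fun i => \sum_j ((i == j) && (x == y))%:R *+ n j x)%R.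
    rewrite /blk sec_prod0 => [|i]; last by rewrite labX lab_bx mul0rn.
    apply: repA_prod => i; rewrite secX0 ?lab_bx // sec_bx eq_sym.
    rewrite -[X in repA _ (X * _)%R]natr_Zp mulr_natl; apply: repAX.
    case: eqP => [->|_]; first by rewrite subrr fe0; apply: eq_repA (repA_fb i) => j; rewrite andbT.
    by apply: eq_repA (repA_rt _) => j; rewrite andbF.
  apply: eq_repA (repA_prod _ fn) => i.
  rewrite (bigD1 y) //= [X in (_ + X)%R]big1 ?addr0 => [|x xy]; last first.
    by apply: big1 => j _; rewrite (negPf xy) andbF mul0rn.
  rewrite (bigD1 i) //= [X in (_ + X)%R]big1 ?addr0 => [|j ji]; last first.
    by rewrite eq_sym (negPf ji) mul0rn.
  by rewrite !eqxx natr_Zp.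
rewrite /repA => <-; apply/qpiP.
have /qpiP sd := sn; have := dSt_sec y sd; rewrite secM0 ?labV ?s0 ?oppr0 //.
by rewrite secV0.
Qed.

Lemma repB_lab_sec s n y : lab s = 0%R -> repB s n ->
  lab (sec s y) = (\sum_x \sum_i n i x * fe i (y - x))%R.
Proof. by move=> s0 /(repB_sec y s0)/repA_lab. Qed.

(** The generator [[~ a, fb i]] moves one unit between neighbouring letters, [[~ fb i, fb j]] has
    zero exponents, and conjugation only shifts letters; so the sum over the letters is 0 for every
    i. *)
Lemma gam2_repB g : gam 2 g ->
  exists n, repB g n /\ forall i, (\sum_x n i x = 0)%R.
Proof.
pose P g := lab g = 0%R /\ exists n, repB g n /\ forall i, (\sum_x n i x = 0)%R.
have shift n i y : (\sum_x n i (x - y) = \sum_x n i x :> 'F_p)%R.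
  by rewrite [RHS](reindex_inj (addIr (- y)%R)).
have [P1 PM PV PJ] : [/\ P 1, (forall s t, P s -> P t -> P (s * t)),
    (forall s, P s -> P s^-1) & (forall s t, P s -> P (s ^ t))].
  split=> [|s t [s0 [n [sn n0]]] [t0 [n' [tn n'0]]]|s [s0 [n [sn n0]]]|s t [s0 [n [sn n0]]]].
  - split; first exact: lab1.
    by exists (fun _ _ => 0%R); split=> [|i]; [exact: repB1 | rewrite big1].
  - split; first by rewrite labM s0 t0 addr0.
    eexists; split; first exact: repBM sn tn.
    by move=> i; rewrite big_split /= n0 n'0 addr0.
  - split; first by rewrite labV s0 oppr0.
    by eexists; split; first exact: repBV sn; move=> i; rewrite sumrN n0 oppr0.
  - split; first by rewrite labJ.
    exists (fun i x => n i (x - lab t))%R; split; last by move=> i; rewrite (shift n).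
    have -> : s ^ t = (s ^ (a ^+ lab t)) ^ ((a ^+ lab t)^-1 * t) by rewrite -conjgM mulVKg.
    apply: repBJ; [by rewrite labJ | by rewrite labM labV lab_rtF addNr |].
    exact: repB_rt.
move=> g2; suff : P g by case.
apply: (@fam_ind_comm _ _ F (NSub P1 PM PV PJ)) g2 => [i|i j] /=.
  split; first exact: labR.
  exists (fun j x => - ((j == i) && (x == fpos i + 1))%:R + ((j == i) && (x == fpos i))%:R)%R.
  split; last first.
    have sumd (b : bool) (c : 'F_p) : (\sum_x (b && (x == c))%:R = b%:R :> 'F_p)%R.
      by rewrite (bigD1 c) //= eqxx andbT big1 ?addr0 // => x /negPf ->; rewrite andbF.
    by move=> j; rewrite big_split /= sumrN !sumd addNr.
  have -> : [~ a, fb i] = (bx i (fpos i + 1)%R)^-1 * bx i (fpos i).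
    by rewrite -bx_rt bx_pos !(commgEl, conjgE, gnorm).
  exact: repBM (repBV (repB_bx _ _)) (repB_bx _ _).
split; first exact: labR.
exists (fun _ _ => 0%R); split; last by move=> k; rewrite big1.
by apply: repB_dSt; apply: mem_ncomm; apply/stab1; exact: lab_fb.
Qed.

Lemma repA_repB g m : repA g 0%R m ->
  exists n, repB g n /\ forall i, (\sum_x n i x = m i)%R.
Proof.
move=> gm; pose n0 i x := ((x == fpos i)%:R * m i)%R.
have kn : repB (kap m) n0.
  apply: eq_repB (repB_prod (index_enum _) (f := fun i => fb i ^+ m i) _) => [i x|i]; last first.
    by rewrite -(bx_pos i); apply: repBX; exact: repB_bx.
  rewrite /= (bigD1 i) //= eqxx big1 ?addr0 => [|j ji]; last by rewrite eq_sym (negPf ji) mul0rn.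
  by rewrite /n0 -[in RHS](natr_Zp (m i)) mulr_natr.
have g2 : gam 2 ((kap m)^-1 * g) by apply/qpiP; rewrite gm mul1g.
have [n [gn ns]] := gam2_repB g2.
have := repBM kn gn; rewrite mulVKg => {}gn; eexists; split; first exact: gn.
move=> i; rewrite big_split /= ns addr0 /n0 -mulr_suml.
rewrite (bigD1 (fpos i)) //= eqxx big1 ?addr0 ?mul1r // => x xi.
by rewrite (negPf xi).
Qed.

(** When the combination of defining vectors vanishes, the rooted sections cancel and only the copy
    at [x] survives. *)
Lemma injp_blk n x : (forall y, \sum_i n i x * fe i y = 0)%R ->
  injp x (kap (n^~ x)) (blk n x).
Proof.
move=> nx; split=> [||y yx]; first exact: lab_blk.
  rewrite /blk sec_prod0 => [|i]; last by rewrite labX lab_bx mul0rn.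
  by apply: eq_bigr => i _; rewrite secX0 ?lab_bx // sec_bx eqxx.
rewrite /blk sec_prod0 => [|i]; last by rewrite labX lab_bx mul0rn.
transitivity (a ^+ (\sum_i n i x * fe i (y - x))%R); last by rewrite nx.
rewrite (expgF_sum p_pr (rt_p S)); apply: eq_bigr => i _.
by rewrite secX0 ?lab_bx // sec_bx (negPf yx) mulrC (expgFM p_pr (rt_p S)).
Qed.

End Exponents.

(** * Binomial moments, that is, expansions in powers of X - 1 over F_p *)

Section BinomialMoments.
Local Open Scope ring_scope.
Variable p : nat.
Hypothesis p_pr : prime p.
Implicit Types (f : 'F_p -> 'F_p) (x y t : 'F_p) (l : nat).

(* The coefficient of (X - 1)^l in the polynomial sum_t f(t) X^t. *)
Definition moment l f : 'F_p := \sum_t f t * 'C(t, l)%:R.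

Lemma binFp_add l k : (l < p)%N -> 'C(k + p, l)%:R = 'C(k, l)%:R :> 'F_p.
Proof.
move=> lp; rewrite -binomial.Vandermonde big_ord_recr /= subnn bin0 muln1 natrD natr_sum.
rewrite big1 ?add0r // => j _; apply/eqP; rewrite -(dvdn_pcharf (pchar_Fp p_pr)).
apply: dvdn_mull; apply: prime_dvd_bin => //.
by rewrite subn_gt0 ltn_ord /= (leq_ltn_trans (leq_subr _ _)).
Qed.

Lemma binFp_mod l k : (l < p)%N -> 'C(k %% p, l)%:R = 'C(k, l)%:R :> 'F_p.
Proof.
move=> lp; rewrite {2}(divn_eq k p); elim: (k %/ p)%N => [|q IHq]; first by rewrite add0n.
by rewrite IHq mulSn -addnA [(p + _)%N]addnC binFp_add.
Qed.

Lemma moment_shift l x f : (l < p)%N ->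
  moment l (fun y => f (y - x)) = \sum_(j < l.+1) moment j f * 'C(x, l - j)%:R.
Proof.
move=> lp; rewrite /moment (reindex_inj (addIr x)) /=.
under [RHS]eq_bigr do rewrite mulr_suml; rewrite exchange_big /=.
apply: eq_bigr => t _; rewrite addrK.
have -> : ((t + x) %% (Zp_trunc (pdiv p)).+2)%N = ((t + x) %% p)%N.
  by congr (_ %% _)%N; exact: Fp_cast.
rewrite binFp_mod // -binomial.Vandermonde natr_sum mulr_sumr.
by apply: eq_bigr => j _; rewrite natrM mulrA.
Qed.

Lemma moment_sum l (I : Type) (r : seq I) (v : I -> 'F_p -> 'F_p) :
  moment l (fun t => \sum_(i <- r) v i t) = \sum_(i <- r) moment l (v i).
Proof. by rewrite /moment exchange_big /=; apply: eq_bigr => t _; rewrite mulr_suml. Qed.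

Lemma momentZ l c f : moment l (fun t => c * f t) = c * moment l f.
Proof. by rewrite /moment mulr_sumr; apply: eq_bigr => t _; rewrite mulrA. Qed.

Lemma eq_moment l f f' : f =1 f' -> moment l f = moment l f'.
Proof. by move=> ff'; apply: eq_bigr => t _; rewrite ff'. Qed.

Lemma moment_neq0 f t : f t != 0 -> exists2 l, (l < p)%N & moment l f != 0.
Proof.
move=> ft; case: (@arg_maxnP _ t (fun t => f t != 0) (fun t => nat_of_ord t)) => // u fu umax.
exists u; first by rewrite -[X in (_ < X)%N](Fp_cast p_pr) ltn_ord.
rewrite /moment (bigD1 u) //= binn mulr1 big1 ?addr0 // => z zu.
have [/eqP ->|fz] := boolP (f z == 0); first by rewrite mul0r.
rewrite bin_small ?mulr0 // ltn_neqAle (umax z fz : (z <= u)%N) andbT.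
by apply: contra zu => /eqP /val_inj ->.
Qed.

Lemma moment_min f t : f t != 0 ->
  exists l, [/\ (l < p)%N, moment l f != 0 & forall j, (j < l)%N -> moment j f = 0].
Proof.
move=> /moment_neq0[l0 l0p fl0].
have ex : exists l, moment l f != 0 by exists l0.
exists (ex_minn ex); case: ex_minnP => l fl lmin; split=> // [|j jl].
  exact: leq_ltn_trans (lmin _ fl0) l0p.
by apply/eqP; apply: contraTT jl => /lmin; rewrite -leqNgt.
Qed.

(** Shifting multiplies by X^x, which is 1 modulo X - 1, so the lowest coefficient is unchanged. *)
Lemma moment_shift_low l x f : (l < p)%N -> (forall j, (j < l)%N -> moment j f = 0) ->
  moment l (fun y => f (y - x)) = moment l f.
Proof.
move=> lp f0; rewrite moment_shift // big_ord_recr /= subnn bin0 mulr1 big1 ?add0r // => j _.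
by rewrite f0 ?mul0r.
Qed.

(** The polynomial is a multiple c of (X - 1)^(p-1), and its constant coefficient [f 0] is c up to
    sign. *)
Lemma moment_last f : f 0 = 0 -> (forall j, (j < p.-1)%N -> moment j f = 0) -> forall t, f t = 0.
Proof.
move=> f0 fj t; apply/eqP/negPn/negP => /moment_min[l [lp /negP fl lmin]].
have lE : l = p.-1.
  apply/eqP; rewrite eqn_leq -ltnS prednK ?prime_gt0 // lp /= leqNgt.
  by apply/negP => /fj /eqP /fl.
(* Evaluation at X = 0, where X - 1 is -1. *)
have : \sum_(l < p) (-1) ^+ l * moment l f = f 0.
  under eq_bigr do rewrite mulr_sumr; rewrite exchange_big /= (bigD1 0) //=.
  have bE (u : 'F_p) : \sum_(l < p) (-1) ^+ l * (f u * 'C(u, l)%:R) = f u * (u == 0)%:R.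
    transitivity (f u * ((1 - 1) ^+ u)%R); last first.
      rewrite subrr expr0n; congr (_ * _%:R).
    rewrite exprDn mulr_sumr.
    have up : (u.+1 <= p)%N by rewrite -[X in (_ <= X)%N](Fp_cast p_pr) ltn_ord.
    rewrite [RHS](big_ord_widen p (fun i => f u * (1 ^+ (u - i) * (-1) ^+ i *+ 'C(u, i)))) //.
    rewrite [LHS](bigID (fun i : 'I_p => (i < u.+1)%N)) /= [X in _ + X]big1 ?addr0.
      by apply: eq_bigr => i _; rewrite expr1n mul1r -mulr_natr; ring.
    by move=> i; rewrite -leqNgt => ui; rewrite bin_small // !mulr0.
  rewrite bE eqxx mulr1 big1 ?addr0 // => u u0.
  by rewrite bE (negPf u0) mulr0.
rewrite f0 => /eqP; rewrite (bigD1 (Ordinal lp)) //= big1 ?addr0 => [|i il].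
  rewrite mulf_eq0 expf_eq0 oppr_eq0 oner_eq0 andbF /= => /eqP ml.
  by apply: fl; rewrite ml.
rewrite fj ?mulr0 // -lE ltn_neqAle -ltnS lE prednK ?prime_gt0 // ltn_ord andbT -lE.
by apply: contra il => /eqP il; apply/eqP/val_inj.
Qed.

(** The convolution is the product in F_p[X]/(X - 1)^p. By [moment_last] the order of vanishing of e
    at X = 1 is at most p - 2, so (X - 1)^2 divides N. *)
Lemma circulant2 (N e : 'F_p -> 'F_p) t : e 0 = 0 -> e t != 0 ->
    (forall y, \sum_x N x * e (y - x) = 0) ->
  \sum_x N x = 0 /\ \sum_x x * N x = 0.
Proof.
move=> e0 et Ne; have [l [lp el lmin]] := moment_min et.
have l1p : (l.+1 < p)%N.
  rewrite ltnNge; apply/negP => pl; case/negP: et; apply/eqP; apply: moment_last => // j jp.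
  by apply: lmin; apply: leq_trans jp _; rewrite -subn1 leq_subLR.
have mz j : (j < p)%N -> \sum_x N x * moment j (fun y => e (y - x)) = 0.
  move=> jp; transitivity (moment j (fun y => \sum_x N x * e (y - x))).
    by rewrite moment_sum; apply: eq_bigr => x _; rewrite momentZ.
  by rewrite /moment big1 // => y _; rewrite Ne mul0r.
have N0 : \sum_x N x = 0.
  have := mz l lp; under eq_bigr do rewrite moment_shift_low //.
  by rewrite -mulr_suml => /eqP; rewrite mulf_eq0 (negPf el) orbF => /eqP.
split=> //; have := mz l.+1 l1p.
under eq_bigr => x _.
  rewrite moment_shift // !big_ord_recr /= big1 => [|j _]; last by rewrite lmin ?mul0r.
  rewrite add0r subnn bin0 mulr1 subSnn bin1 natr_Zp mulrDr; over.
rewrite big_split /= -mulr_suml N0 mul0r addr0 => /eqP.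
under eq_bigr do rewrite mulrCA.
by rewrite -mulr_sumr mulf_eq0 (negPf el) /=; under eq_bigr do rewrite mulrC; move/eqP.
Qed.

End BinomialMoments.

(** * Combinations of defining vectors realised in deep stabilisers *)

Section SpanBound.
Variables (p : nat) (S : ssgroup p) (F : family S).
Local Notation p_pr := (ss_prime S).
Implicit Types (m : fI F -> 'F_p).

Definition evec (i : fI F) : 'rV['F_p]_(Zp_trunc (pdiv p)).+2 := (\row_t fe i t)%R.

Definition ecomb m : 'rV['F_p]_(Zp_trunc (pdiv p)).+2 := (\sum_i m i *: evec i)%R.

Lemma ecombE m t : ecomb m ord0 t = (\sum_i m i * fe i t)%R.
Proof. by rewrite summxE; apply: eq_bigr => i _; rewrite !mxE. Qed.

(** Each further level lowers the dimension of a space U containing the combinations. Let l be the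
    least order of a moment that is not identically 0 on U. This moment is invariant under shifts on
    U, so on [ecomb m] it equals the moment of the labels of the first-level sections, which are 0.
    Thus [ecomb m] lies in a proper subspace of U. *)
Lemma stab_ecomb (n : nat) (V : 'M['F_p]_(n, (Zp_trunc (pdiv p)).+2)) :
    (forall i, (evec i <= V)%MS) ->
  forall s m, stab S (\rank V).+1 s -> repA s 0%R m -> ecomb m = 0%R.
Proof.
move=> eV.
have bound k : exists n' (U : 'M['F_p]_(n', (Zp_trunc (pdiv p)).+2)),
    (\rank U <= \rank V - k)%N /\
    forall s m, stab S k.+1 s -> repA s 0%R m -> (ecomb m <= U)%MS.
  elim: k => [|k [n' [U [rU sU]]]].
    exists n, V; rewrite subn0; split=> // s m _ _.
    by apply: summx_sub => i _; apply: scalemx_sub.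
  have [U0|/rowV0Pn[u0 u0U u0n]] := eqVneq U 0%R.
    by exists n', U; rewrite U0 mxrank0; split=> // s m /stab_sub/sU; rewrite U0; apply.
  pose has_moment l := `[< exists2 v : 'rV['F_p]_(Zp_trunc (pdiv p)).+2, (v <= U)%MS & moment l (fun t => v ord0 t) != 0%R >].
  have ex : exists l, has_moment l.
    have [t u0t] : exists t, u0 ord0 t != 0%R.
      apply/existsP; apply: contraNT u0n; rewrite negb_exists => /forallP u0z.
      by apply/eqP/rowP => t; rewrite mxE; apply/eqP/negPn.
    have [l _ ml] := moment_neq0 p_pr u0t.
    by exists l; apply/asboolP; exists u0.
  case: (ex_minnP ex) => l /asboolP[v vU vl] lmin.
  have [l1 l1p ml1] : exists2 l1, (l1 < p)%N & has_moment l1.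
    have [t vt] : exists t, v ord0 t != 0%R.
      apply: contrapT => vz; case/negP: vl; rewrite /moment big1 // => t _.
      by have [->|vt] := eqVneq (v ord0 t) 0%R; [rewrite mul0r | case: vz; exists t].
    have [l1 l1p ml1] := moment_neq0 p_pr vt.
    by exists l1 => //; apply/asboolP; exists v.
  have lp : (l < p)%N := leq_ltn_trans (lmin _ ml1) l1p.
  have low (w : 'rV['F_p]_(Zp_trunc (pdiv p)).+2) j : (w <= U)%MS -> (j < l)%N -> moment j (fun t => w ord0 t) = 0%R.
    move=> wU jl; apply/eqP/negPn/negP => wj.
    have /lmin : has_moment j by apply/asboolP; exists w.
    by rewrite leqNgt jl.
  pose c : 'cV['F_p]_(Zp_trunc (pdiv p)).+2 := (\col_t 'C(t, l)%:R)%R.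
  have cE (w : 'rV['F_p]_(Zp_trunc (pdiv p)).+2) : (w *m c)%R ord0 ord0 = moment l (fun t => w ord0 t).
    by rewrite mxE; apply: eq_bigr => t _; rewrite mxE.
  exists _, (U :&: kermx c)%MS; split.
    have : (\rank (U :&: kermx c)%MS < \rank U)%N.
      apply: rank_ltmx; apply/andP; split; first exact: capmxSl.
      apply/negP => /submx_trans/(_ (capmxSr _ _)) /(submx_trans vU) /sub_kermxP vc.
      by move: vl; rewrite -cE vc mxE eqxx.
    move=> lt; rewrite subnS -ltnS; apply: leq_trans lt _.
    by rewrite (leq_trans rU) // leqSpred.
  move=> s m sSt sm; have s0 := stab_lab sSt.
  have [nn [sn ns]] := repA_repB sm.
  have secU x : (ecomb (nn^~ x) <= U)%MS.
    have /stabS[_ /(_ x) sx] := sSt.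
    apply: sU (sx) _; have := repB_sec x s0 sn.
    by rewrite -(repA_lab (repB_sec x s0 sn)) (stab_lab sx).
  have mE : ecomb m = (\sum_x ecomb (nn^~ x))%R.
    rewrite /ecomb exchange_big /=; apply: eq_bigr => i _.
    by rewrite -ns scaler_suml.
  rewrite mE sub_capmx; apply/andP; split; first exact: summx_sub.
  apply/sub_kermxP/rowP => z; rewrite ord1 cE [RHS]mxE.
  rewrite (eq_moment _ (f' := fun t => (\sum_x ecomb (nn^~ x) ord0 t)%R)); last first.
    by move=> t; rewrite summxE.
  rewrite moment_sum.
  transitivity (\sum_x moment l (fun y => ecomb (nn^~ x) ord0 (y - x)))%R.
    by apply: eq_bigr => x _; rewrite (moment_shift_low p_pr x lp) // => j; exact: low.
  rewrite -moment_sum /moment big1 // => y _.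
  have := repB_lab_sec y s0 sn; have /stabS[_ /(_ y) /stab_lab ->] := sSt.
  by move=> e0; under eq_bigr do rewrite ecombE; rewrite -e0 mul0r.
move=> s m ss sm; have [n' [U [rU sU]]] := bound (\rank V).
move: rU; rewrite subnn leqn0 mxrank_eq0 => /eqP U0.
have := sU s m ss sm; rewrite U0 => s0.
exact: submx0null s0.
Qed.

End SpanBound.

Lemma commg_centl (gT : groupType) (x y c : gT) :
  (forall u, commute c u) -> [~ x * c, y] = [~ x, y].
Proof.
move=> cc; have /commgP/eqP cy := cc y; rewrite commgMl cy mulg1.
by apply/conjg_fixP/commgP/commute_sym.
Qed.

Lemma commg_centr (gT : groupType) (x y c : gT) :
  (forall u, commute c u) -> [~ x, y * c] = [~ x, y].
Proof. by move=> cc; rewrite -[LHS]invgK invgR commg_centl // invgR. Qed.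

Lemma qpi_mem (gT : groupType) (J M : nsub gT) s t : (forall x, J x -> M x) ->
  qpi J s = qpi J t -> M s -> M t.
Proof. by move=> JM /qpiP/JM st Ms; rewrite -(mulKVg s t); exact: nsubM. Qed.

(** * Preimages under copying, and the derived subgroup of St(1) modulo [gam 3] *)

Section Pull.
Variables (p : nat) (S : ssgroup p) (F : family S).
Implicit Types (g h s t : S) (x y : 'F_p) (J K R : nsub S) (i j : fI F).
Local Notation a := (rt S).

Lemma pull_subproof R :
  let P t := exists2 s, R s & injp 0%R t s in
  [/\ P 1, forall s t, P s -> P t -> P (s * t), forall s, P s -> P s^-1
    & forall s t, P s -> P (s ^ t)].
Proof.
split=> [|s t [s' Rs is_] [t' Rt it]|s [s' Rs is_]|s t [s' Rs is_]].
- by exists 1; [exact: nsub1 | exact: injp1].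
- by exists (s' * t'); [exact: nsubM | exact: injpM].
- by exists s'^-1; [exact: nsubV | exact: injpV].
- have [h h0 ht] := fractal F t 0%R.
  by exists (s' ^ h); [exact: nsubJ | have := injpJ0 h0 is_; rewrite ht].
Qed.

(** The largest J with [injmap J R], by [pull_injmap] and [injmap_pull]. *)
Definition pull R : nsub S :=
  let: And4 P1 PM PV PJ := pull_subproof R in NSub P1 PM PV PJ.

Lemma pullP R t : pull R t <-> exists2 s, R s & injp 0%R t s.
Proof. by rewrite /pull; case: pull_subproof. Qed.

Lemma pull_injmap J R : (forall t, J t -> pull R t) -> injmap J R.
Proof. by move=> JR; apply: (@injmap0 _ _ _ _ 0%R) => t /JR/pullP. Qed.

Lemma injmap_pull J R t : injmap J R -> J t -> pull R t.
Proof. by move=> JR Jt; apply/pullP; exact: JR. Qed.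

Lemma pull_inj R t x s : pull R t -> injp x t s -> R s.
Proof.
move=> /pullP[s' Rs' is'] /injp_uniq/(_ (injp_rt_to x is')) ->.
exact: nsubJ.
Qed.

Lemma pull1 R x t s : injp x t s -> R s -> pull R t.
Proof.
move=> is_ Rs; apply/pullP; exists (s ^ (a ^+ (0 - x)%R)); first exact: nsubJ.
exact: injp_rt_to.
Qed.

(** By [fractal] some element of St(1) has any prescribed section at the letter, so copies of
    commutators are commutators of copies. Branching over [gam k] thus passes to [gam k.+1]. *)
Lemma injmap_ncomm J R : injmap J R -> injmap (ncomm J nfull) (ncomm R nfull).
Proof.
move=> JR; apply: pull_injmap; apply: ncomm_min => s t Js _.
have [s' Rs is_] := JR s 0%R Js; have [h h0 ht] := fractal F t 0%R.
have := injpR h0 is_; rewrite ht => ist.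
by apply: pull1 ist _; exact: mem_ncomm.
Qed.

Lemma injmap_gam k : 0 < k -> injmap (gam k : nsub S) (gam k) ->
  injmap (gam k.+1 : nsub S) (gam k.+1).
Proof. by case: k => // k _; exact: injmap_ncomm. Qed.

Lemma gam_central k c (u : quo (gam k.+1 : nsub S)) : gam k c -> commute (qpi (gam k.+1) c) u.
Proof.
move=> ck; have [v <-] := qpi_surj u; apply/commgP; rewrite -qpiR; apply/eqP/qpi_id.
exact: gamS.
Qed.

Lemma qpi3_comm g g' h h' : gam 2 (g^-1 * g') -> gam 2 (h^-1 * h') ->
  qpi (gam 3) [~ g, h] = qpi (gam 3) [~ g', h'].
Proof.
move=> gg hh; rewrite -(mulKVg g g') -(mulKVg h h') !qpiR !(qpiM _ g) !(qpiM _ h).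
rewrite commg_centl => [|u]; last exact: gam_central.
by rewrite commg_centr // => u; exact: gam_central.
Qed.

Lemma gam2_conj g h : gam 2 (g^-1 * g ^ h).
Proof. by rewrite -commgEl; exact: (@gamS _ 1). Qed.

Lemma qpi3_bx i j x y : qpi (gam 3) [~ bx i x, bx j y] = qpi (gam 3) [~ fb i, fb j].
Proof. by apply/esym/qpi3_comm; exact: gam2_conj. Qed.

Lemma injp_bxR i j x : injp x [~ fb i, fb j] [~ bx i x, bx j x].
Proof.
split=> [||y yx]; first exact: labR.
  by rewrite secR0 ?lab_bx // !sec_bx eqxx.
rewrite secR0 ?lab_bx // !sec_bx (negPf yx); apply/eqP/commgP.
exact: commuteX2 (commute_refl _).
Qed.

(** The copy at 0 is [[~ bx i 0, bx j 0]], which agrees with the original modulo [gam 3]. *)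
Lemma cl3_fb i j : injmap (gam 3 : nsub S) (gam 3) -> cl (gam 3) [~ fb i, fb j].
Proof.
move=> G3; apply: cl_fix G3 (injp_bxR i j 0%R) _ => n.
by apply: qpi_mem (qpi3_bx i j 0%R 0%R) => s; exact: mulnsl.
Qed.

Lemma cl3_dSt s : injmap (gam 3 : nsub S) (gam 3) ->
  ncomm (stab S 1) (stab S 1) s -> cl (gam 3) s.
Proof.
move=> G3; apply: (@stab1_comm _ _ F (cl (gam 3))) => i j x y.
have := cl3_fb i j G3; apply: qpi_mem (esym (qpi3_bx i j x y)) => t; exact: sub_cl.
Qed.

End Pull.

(** * Generators sharing one defining vector: augmentation and first moment *)

Section CommonVector.
Variables (p : nat) (S : ssgroup p) (F : family S) (e : 'F_p -> 'F_p).
Hypothesis fE : forall i y, fe (f := F) i y = e y.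
Implicit Types (g h s t : S) (x y : 'F_p) (J K R : nsub S) (i j : fI F).
Implicit Types (m : fI F -> 'F_p) (n : fI F -> 'F_p -> 'F_p).
Local Notation p_pr := (ss_prime S).
Local Notation a := (rt S).
Local Notation dSt := (ncomm (stab S 1) (stab S 1)).

Lemma e0 : e 0%R = 0%R.
Proof. by rewrite -(fE (fi0 F)) fe0. Qed.

Lemma e_nz : exists t : 'F_p, e t != 0%R.
Proof. by have [t et] := fnz (fi0 F); exists t; rewrite -(fE (fi0 F)). Qed.

(** [augn] and [dern] are the values at X = 1 of the polynomial with coefficients [\sum_i n i x] and
    of its derivative. *)
Definition augn n : 'F_p := (\sum_x \sum_i n i x)%R.
Definition dern n : 'F_p := (\sum_x x * \sum_i n i x)%R.

Lemma repB_lab s n y : lab s = 0%R -> repB s n ->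
  lab (sec s y) = (\sum_x (\sum_i n i x) * e (y - x))%R.
Proof.
move=> s0 sn; rewrite (repB_lab_sec y s0 sn); apply: eq_bigr => x _.
by rewrite mulr_suml; apply: eq_bigr => i _; rewrite fE.
Qed.

(** Two representations give the same labels of sections, so their difference is killed by
    convolution with e and [circulant2] applies. Hence [augf] and [derf] are well defined on
    St(1). *)
Lemma repB_augn_dern s n n' : lab s = 0%R -> repB s n -> repB s n' ->
  augn n = augn n' /\ dern n = dern n'.
Proof.
move=> s0 sn sn'; have [t et] := e_nz.
have [|] := @circulant2 _ p_pr (fun x => \sum_i n i x - \sum_i n' i x)%R e t e0 et.
  move=> y; under eq_bigr do rewrite mulrBl.
  by rewrite sumrB -(repB_lab y s0 sn) -(repB_lab y s0 sn') subrr.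
move=> aug der; split; apply/eqP; rewrite -subr_eq0; apply/eqP.
  by rewrite -[RHS]aug -sumrB.
by rewrite -[RHS]der -sumrB; apply: eq_bigr => x _; rewrite mulrBr.
Qed.

Definition repn s : fI F -> 'F_p -> 'F_p :=
  if pselect (exists n, repB s n) is left ex then projT1 (cid ex) else fun _ _ => 0%R.

Definition augf s := augn (repn s).
Definition derf s := dern (repn s).

Lemma repnP s : lab s = 0%R -> repB s (repn s).
Proof.
move=> s0; rewrite /repn; case: pselect => [ex|[]]; first by case: cid.
exact: repB_exists.
Qed.

Lemma augfE s n : lab s = 0%R -> repB s n -> augf s = augn n.
Proof. by move=> s0 sn; have [] := repB_augn_dern s0 (repnP s0) sn. Qed.

Lemma derfE s n : lab s = 0%R -> repB s n -> derf s = dern n.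
Proof. by move=> s0 sn; have [] := repB_augn_dern s0 (repnP s0) sn. Qed.

Lemma augf1 : augf 1 = 0%R.
Proof. by rewrite (augfE (lab1 S) (repB1 F)) /augn big1 // => x _; rewrite big1. Qed.

Lemma derf1 : derf 1 = 0%R.
Proof.
by rewrite (derfE (lab1 S) (repB1 F)) /dern big1 // => x _; rewrite big1 ?mulr0.
Qed.

Lemma lab_mul0 s t : lab s = 0%R -> lab t = 0%R -> lab (s * t) = 0%R.
Proof. by rewrite labM => -> ->; rewrite addr0. Qed.

Lemma augfM s t : lab s = 0%R -> lab t = 0%R -> augf (s * t) = (augf s + augf t)%R.
Proof.
move=> s0 t0; rewrite (augfE (lab_mul0 s0 t0) (repBM (repnP s0) (repnP t0))) /augf /augn.
by rewrite -big_split; apply: eq_bigr => x _; rewrite big_split.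
Qed.

Lemma derfM s t : lab s = 0%R -> lab t = 0%R -> derf (s * t) = (derf s + derf t)%R.
Proof.
move=> s0 t0; rewrite (derfE (lab_mul0 s0 t0) (repBM (repnP s0) (repnP t0))) /derf /dern.
by rewrite -big_split; apply: eq_bigr => x _; rewrite big_split mulrDr.
Qed.

Lemma augfV s : lab s = 0%R -> augf s^-1 = (- augf s)%R.
Proof.
move=> s0; have sV0 : lab s^-1 = 0%R by rewrite labV s0 oppr0.
by apply/eqP; rewrite -addr_eq0 -augfM // mulVg augf1.
Qed.

Lemma derfV s : lab s = 0%R -> derf s^-1 = (- derf s)%R.
Proof.
move=> s0; have sV0 : lab s^-1 = 0%R by rewrite labV s0 oppr0.
by apply/eqP; rewrite -addr_eq0 -derfM // mulVg derf1.
Qed.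

Lemma derf_prod (I : Type) (r : seq I) (f : I -> S) : (forall l, lab (f l) = 0%R) ->
  derf (\prod_(l <- r) f l) = (\sum_(l <- r) derf (f l))%R.
Proof.
move=> f0; elim: r => [|l r IHr]; first by rewrite !big_nil derf1.
by rewrite !big_cons derfM ?IHr // lab_prod0.
Qed.

Lemma derfX s k : lab s = 0%R -> derf (s ^+ k) = (derf s *+ k)%R.
Proof.
move=> s0; elim: k => [|k IHk]; first exact: derf1.
by rewrite expgS derfM ?IHk ?mulrS // labX s0 mul0rn.
Qed.

Lemma conjg_lab s h : exists2 h', lab h' = 0%R & s ^ h = (s ^ (a ^+ lab h)) ^ h'.
Proof.
exists ((a ^+ lab h)^-1 * h); first by rewrite labM labV lab_rtF addNr.
by rewrite -conjgM mulVKg.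
Qed.

Lemma augfJ s h : lab s = 0%R -> augf (s ^ h) = augf s.
Proof.
move=> s0; have [h' h'0 ->] := conjg_lab s h; have sa0 : lab (s ^ (a ^+ lab h)) = 0%R by rewrite labJ.
rewrite (augfE _ (repBJ sa0 h'0 (repB_rt (lab h) (repnP s0)))) ?labJ //.
by rewrite /augf /augn [RHS](reindex_inj (addIr (- lab h)%R)).
Qed.

Lemma derfJ s h : lab s = 0%R -> derf (s ^ h) = (derf s + lab h * augf s)%R.
Proof.
move=> s0; have [h' h'0 ->] := conjg_lab s h; have sa0 : lab (s ^ (a ^+ lab h)) = 0%R by rewrite labJ.
rewrite (derfE _ (repBJ sa0 h'0 (repB_rt (lab h) (repnP s0)))) ?labJ //.
rewrite /derf /dern /augf /augn (reindex_inj (addIr (lab h)%R)) mulr_sumr -big_split /=.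
by apply: eq_bigr => x _; rewrite addrK mulrDl.
Qed.

Lemma augf_gam2 g : gam 2 g -> augf g = 0%R.
Proof.
move=> g2; have [n [gn n0]] := gam2_repB F g2.
by rewrite (augfE (gam2_lab g2) gn) /augn exchange_big big1.
Qed.

Lemma augf_repA s m : repA s 0%R m -> augf s = (\sum_i m i)%R.
Proof.
move=> sm; have [n [sn nm]] := repA_repB sm.
by rewrite (augfE (repA_lab sm) sn) /augn exchange_big; apply: eq_bigr.
Qed.

Lemma augf_fb i : augf (fb i) = 1%R.
Proof.
rewrite (augf_repA (repA_fb i)) (bigD1 i) //= eqxx big1 ?addr0 // => j /negPf ->.
by [].
Qed.

Lemma derf_fb i : derf (fb i) = fpos i.
Proof.
rewrite -[fb i]bx_pos (derfE (lab_bx _ _) (repB_bx _ _)) /dern.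
rewrite (big_only1 (fpos i)) //= => [|x xi _].
  by rewrite (big_only1 i) ?eqxx ?mulr1 // => j ji _; rewrite (negPf ji).
by rewrite big1 ?mulr0 // => j _; rewrite (negPf xi) andbF.
Qed.

Lemma derf_fb_rt i y : derf [~ fb i, a ^+ y] = y.
Proof.
rewrite commgEl derfM ?derfV ?derfJ ?labJ ?labV ?lab_fb ?oppr0 //.
by rewrite augf_fb lab_rtF mulr1 addKr.
Qed.

Lemma stab2_augf_derf s : stab S 2 s -> augf s = 0%R /\ derf s = 0%R.
Proof.
move=> s2; have s0 := stab_lab s2; have [t et] := e_nz.
apply: (@circulant2 _ p_pr _ e t e0 et) => y.
have := repB_lab y s0 (repnP s0); have /stabS[_ /(_ y) /stab_lab ->] := s2.
by move=> <-.
Qed.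

Lemma derf_kap m : derf (kap m) = (\sum_i m i * fpos i)%R.
Proof.
rewrite derf_prod => [|i]; last by rewrite labX lab_fb mul0rn.
by apply: eq_bigr => i _; rewrite derfX ?lab_fb // derf_fb -mulr_natl natr_Zp.
Qed.

Lemma injp_blk0 n x : (\sum_i n i x = 0)%R -> injp x (kap (n^~ x)) (blk n x).
Proof.
move=> n0; apply: injp_blk => y; under eq_bigr do rewrite fE.
by rewrite -mulr_suml n0 mul0r.
Qed.

Lemma sec_wd0 n y : (forall x, \sum_i n i x = 0)%R -> sec (wd n) y = kap (n^~ y).
Proof.
move=> n0; rewrite /wd sec_prod0; last exact: lab_blk.
rewrite (big_only1 y) //=; first by case: (injp_blk0 (n0 y)).
by move=> x xy _; case: (injp_blk0 (n0 x)) => _ _ -> //; rewrite eq_sym.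
Qed.

Section Symmetric.
Hypothesis eN : forall y, e (- y)%R = e y.

(** For x distinct from y the commutator of [bx i x] and [bx j y] contributes e(x-y) - e(y-x), which
    is 0 by symmetry. *)
Lemma dSt_derf s : dSt s -> (\sum_y derf (sec s y) = 0)%R.
Proof.
pose P s := (lab s = 0 /\ forall y, gam 2 (sec s y))%R /\ (\sum_y derf (sec s y) = 0)%R.
have [P1 PM PV PJ] : [/\ P 1, (forall s t, P s -> P t -> P (s * t)),
    (forall s, P s -> P s^-1) & (forall s t, P s -> P (s ^ t))].
  split=> [|u v [[u0 u2] ud] [[v0 v2] vd]|u [[u0 u2] ud]|u v [[u0 u2] ud]].
  - split; first by split=> [|y]; rewrite ?lab1 // sec1; exact: nsub1.
    by rewrite big1 // => y _; rewrite sec1 derf1.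
  - split; first by split=> [|y]; [exact: lab_mul0 | rewrite secM0 //; exact: nsubM].
    under eq_bigr => y _ do rewrite secM0 // derfM ?(gam2_lab (u2 y)) ?(gam2_lab (v2 y)) //.
    by rewrite big_split /= ud vd addr0.
  - split; first by split=> [|y]; rewrite ?labV ?u0 ?oppr0 // secV0 //; exact: nsubV.
    under eq_bigr => y _ do rewrite secV0 // derfV ?(gam2_lab (u2 y)) //.
    by rewrite sumrN ud oppr0.
  - split; first by split=> [|y]; rewrite ?labJ // secJ //; exact: nsubJ.
    rewrite (reindex_inj (addIr (lab v))) -[RHS]ud; apply: eq_bigr => y _ /=.
    by rewrite secJ // addrK derfJ ?(gam2_lab (u2 _)) // augf_gam2 // mulr0 addr0.
move=> sd; suff : P s by case.
apply: (@stab1_comm _ _ F (NSub P1 PM PV PJ)) sd => i j x y.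
split; first split; first exact: labR.
  by move=> z; rewrite secR0 ?lab_bx //; exact: (@gamS _ 1).
have secE z : sec [~ bx i x, bx j y] z =
    [~ if z == x then fb i else a ^+ e (z - x)%R, if z == y then fb j else a ^+ e (z - y)%R].
  by rewrite secR0 ?lab_bx // !sec_bx !fE.
have aa k l : [~ a ^+ k, a ^+ l] = 1.
  by apply/eqP/commgP; exact: commuteX2 (commute_refl _).
have [xy|xy] := eqVneq x y.
  rewrite big1 // => z _; rewrite secE -xy; case: (z =P x) => _; last by rewrite aa derf1.
  rewrite (derfE (labR _ _) (repB_dSt F _)); last by apply: mem_ncomm; apply/stab1/lab_fb.
  by rewrite /dern big1 // => u _; rewrite big1 ?mulr0.
rewrite (bigD1 x) //= (bigD1 y) ?(eq_sym y) //= big1 ?addr0 => [|z /andP[zx zy]]; last first.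
  by rewrite secE (negPf zx) (negPf zy) aa derf1.
rewrite !secE !eqxx (negPf xy) eq_sym (negPf xy) derf_fb_rt -invgR derfV ?labR //.
by rewrite derf_fb_rt -(eN (y - x)%R) opprB subrr.
Qed.

(* For an element whose sections all lie in the kernel of [augf], the moments of
   the sections add up to a quantity that only depends on the column sums. *)
Lemma sum_derf_sec s n : lab s = 0%R -> repB s n -> (forall x, \sum_i n i x = 0)%R ->
  (\sum_y derf (sec s y) = \sum_i fpos i * \sum_y n i y)%R.
Proof.
move=> s0 sn n0; have /qpiP/dSt_derf sd := esym sn.
have sE y : sec s y = sec (wd n) y * sec ((wd n)^-1 * s) y.
  by rewrite -secM0 ?lab_wd // mulKVg.
have secw0 y : lab (sec (wd n) y) = 0%R by rewrite sec_wd0 // lab_kap.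
have secd0 y : lab (sec ((wd n)^-1 * s) y) = 0%R.
  by apply: gam2_lab; apply: dSt_sec; apply/qpiP/esym.
under eq_bigr => y _ do rewrite sE derfM // sec_wd0 // derf_kap.
rewrite big_split /= sd addr0 exchange_big; apply: eq_bigr => i _.
by rewrite mulr_sumr; apply: eq_bigr => y _; rewrite mulrC.
Qed.

Lemma sec_augf0 s n : lab s = 0%R -> repB s n -> (forall y, lab (sec s y) = 0%R) ->
  (forall y, augf (sec s y) = 0%R) -> forall x, (\sum_i n i x = 0)%R.
Proof.
move=> s0 sn sl sa x; rewrite -[RHS](sa x); apply/esym/augf_repA.
by have := repB_sec x s0 sn; rewrite -(repA_lab (repB_sec x s0 sn)) sl.
Qed.

(** In [gam 2] the column sums vanish, so the moments of the sections would add up to 0, but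
    [[~ fb i, a]] has moment 1. *)
Lemma not_injp_gam2 i x s : injp x [~ fb i, a] s -> ~ gam 2 s.
Proof.
move=> is_ s2; have [n [sn nc]] := gam2_repB F s2; have s0 := gam2_lab s2.
have z2 : gam 2 [~ fb i, a] by exact: (@gamS _ 1).
have n0 : forall x, (\sum_i n i x = 0)%R.
  apply: sec_augf0 s0 sn _ _ => y; rewrite (injp_sec _ is_); case: eqP => _.
  - exact: gam2_lab.
  - exact: lab1.
  - exact: augf_gam2.
  - exact: augf1.
have := sum_derf_sec s0 sn n0; rewrite [RHS]big1 => [|j _]; last by rewrite nc mulr0.
rewrite (bigD1 x) //= big1 => [|y yx]; last by rewrite (injp_sec _ is_) (negPf yx) derf1.
rewrite (injp_sec _ is_) eqxx addr0 -[a](expgF1 p a) derf_fb_rt.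
by move/eqP; rewrite oner_eq0.
Qed.

(** The block is conjugate to the copy [W] at 0 of [kap m]. If [kap m] and [W] agree modulo the
    elements with copies in [cl (gam 3)], then [W] is congruent to its own copy and [cl_fix]
    applies. *)
Lemma cl3_blk n x : injmap (gam 3 : nsub S) (gam 3) ->
  (\sum_i n i x = 0)%R -> (\sum_i fpos i * n i x = 0)%R -> cl (gam 3) (blk n x).
Proof.
move=> G3 n0 nd; pose m := n^~ x; pose W := blk (fun i _ => m i) 0%R.
have -> : blk n x = W ^ (a ^+ x).
  rewrite conjg_prod; apply: eq_bigr => i _.
  by rewrite conjXg bxJ add0r.
apply: nsubJ; have iW : injp 0%R (kap m) W by exact: (injp_blk0 (n := fun i _ => m i)).
pose D := pull F (cl (gam 3)).
have D3 t : gam 3 t -> D t.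
  by move/(injmap_pull F G3)/pullP => [s /sub_cl s3 is_]; apply/pullP; exists s.
have D2 (c : S) (u : quo D) : gam 2 c -> commute (qpi D c) u.
  move=> c2; have [v <-] := qpi_surj u; apply/commgP; rewrite -qpiR; apply/eqP/qpi_id.
  by apply: D3; exact: (@gamS _ 2).
(* The element [w] is the copy of [y]; its commutator with a suitable [bx] is the copy of
   [[~ y, a ^+ e t]] and lies in the derived subgroup of St(1). So [y] commutes with a modulo D. *)
have Dab i j : qpi D [~ bx i 0%R, a] = qpi D [~ bx j 0%R, a].
  have [t et] := e_nz; have tn : t != 0%R by apply: contraNneq et => ->; rewrite e0.
  pose y := (fb i)^-1 * fb j; pose w := (bx i 0%R)^-1 * bx j 0%R.
  have lw : lab w = 0%R by rewrite labM labV !lab_bx oppr0 addr0.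
  have iw : injp 0%R y w.
    split=> // [|z z0]; rewrite secM0 ?labV ?lab_bx ?oppr0 // secV0 ?lab_bx // !sec_bx ?eqxx //.
    by rewrite (negPf z0) !fE mulVg.
  have Dy : D [~ y, a ^+ e t].
    have := injpR (lab_bx i (- t)%R) iw.
    rewrite sec_bx fE eq_sym oppr_eq0 (negPf tn) sub0r opprK => id.
    apply: (pull1 F id); apply: (cl3_dSt F G3); apply: mem_ncomm; apply/stab1 => //.
    exact: lab_bx.
  have cya : commute (qpi D y) (qpi D a).
    have -> : a = (a ^+ e t) ^+ (e t)^-1%R.
      by rewrite -(expgFM p_pr (rt_p S)) divff // expgF1.
    by rewrite (qpiX _ (a ^+ e t)); apply: commuteX; apply/commgP; rewrite -qpiR; apply/eqP/qpi_id.
  have wy : gam 2 (y^-1 * w).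
    apply/qpiP; rewrite (qpiM _ (_ ^-1)) [RHS](qpiM _ (_ ^-1)) !qpiV.
    by congr (_^-1 * _); apply/qpiP; exact: gam2_conj.
  have -> : bx j 0%R = bx i 0%R * (y * (y^-1 * w)) by rewrite !mulKVg.
  rewrite !qpiR (qpiM _ _ (y * _)) commgMl (qpiM _ y) commg_centl => [|u]; last exact: D2.
  move/commgP/eqP: cya => ->; rewrite mulg1; apply/esym/conjg_fixP/commgP.
  by rewrite -!qpiM -qpiR; apply: D2; exact: (@gamS _ 1).
have [i0 _] : exists i : fI F, True by exists (fi0 F).
pose z := qpi D [~ bx i0 0%R, a].
have zc u : commute z u by apply: D2; exact: (@gamS _ 1).
have zX k i : qpi D [~ bx i 0%R, a ^+ k] = z ^+ k.
  elim: k => [|k IHk]; first by rewrite commg1.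
  rewrite expgS commgMr qpiM IHk expgSr qpiJ (Dab i i0) -/z; congr (_ * _).
  by apply/conjg_fixP/commgP.
have zp : z ^+ p = 1 by rewrite -(zX p i0) rt_p commg1.
(* Moving [fb i] from its position to 0 costs the power [fpos i] of [z]; the total exponent is the
   weighted sum, which is 0. *)
have kW : qpi D (kap m) = qpi D W.
  have -> : qpi D (kap m) = \prod_i (qpi D (bx i 0%R) ^+ m i * z ^+ (fpos i * m i)%R).
    rewrite qpi_prod; apply: eq_bigr => i _.
    have -> : fb i = bx i 0%R * [~ bx i 0%R, a ^+ fpos i].
      by rewrite -{1}(bx_pos i) (bx_to i 0%R) subr0 commgEl mulVKg.
    rewrite qpiX qpiM zX expgMn; last by apply/commute_sym/commute_sym/commuteX/commute_sym.
    by rewrite (expgFM p_pr zp).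
  rewrite prodgM_commute => [|i j _ _]; last by apply/commuteX/commute_sym.
  rewrite -(expgF_sum p_pr zp) nd expgF0 mulg1 qpi_prod.
  by apply: eq_bigr => i _; rewrite qpiX.
have /pullP[d d3 id] : D (W^-1 * kap m) by apply/qpiP/esym.
have := injpM iW (injpV id); rewrite invgM invgK mulKVg => iW'.
apply: cl_fix G3 iW' _ => n1 Wd; rewrite -(mulgVK d W); apply: nsubM => //.
by move/clP: d3.
Qed.

(** The first condition of [cl3_blk] holds because the sections have augmentation 0. The second is
    [sum_derf_sec] applied to each section, whose own sections still lie in St(2). *)
Lemma cl3_St4 s : injmap (gam 3 : nsub S) (gam 3) -> stab S 4 s -> cl (gam 3) s.
Proof.
move=> G3 s4; have s0 := stab_lab s4; have [n sn] := repB_exists F s0.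
have s3 y : stab S 3 (sec s y) by have /stabS[_] := s4.
have sl y : lab (sec s y) = 0%R by exact: stab_lab (s3 y).
have n0 : forall x, (\sum_i n i x = 0)%R.
  by apply: sec_augf0 s0 sn sl _ => y; have [] := stab2_augf_derf (stab_sub (s3 y)).
have nd y : (\sum_i fpos i * n i y = 0)%R.
  have := repB_sec y s0 sn; rewrite -(repA_lab (repB_sec y s0 sn)) sl => /repA_repB[n' [sn' nc]].
  have t2 z : stab S 2 (sec (sec s y) z) by have /stabS[_] := s3 y.
  have n'0 : forall x, (\sum_i n' i x = 0)%R.
    apply: sec_augf0 (sl y) sn' (fun z => stab_lab (t2 z)) _ => z.
    by have [] := stab2_augf_derf (t2 z).
  have := sum_derf_sec (sl y) sn' n'0; rewrite big1 => [|z _]; last by have [] := stab2_augf_derf (t2 z).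
  by under eq_bigr do rewrite nc; move=> <-.
rewrite -(mulKVg (wd n) s); apply: nsubM.
  by apply: nsub_prod => x; exact: cl3_blk.
by apply: (cl3_dSt F G3); apply/qpiP/esym.
Qed.

End Symmetric.
End CommonVector.

(** * Symmetric families of defining vectors *)

Section Scaling.
Variables (p : nat) (S : ssgroup p) (F : family S).
Implicit Types (g h s : S) (x y t : 'F_p) (i j : fI F).
Local Notation p_pr := (ss_prime S).
Local Notation a := (rt S).

(** The dividing line between the two parts of the theorem: branching over [gam 2] excludes it,
    branching over [gam 3] alone forces it. *)
Definition symmetric_family := exists2 e : 'F_p -> 'F_p, (forall y, e (- y) = e y)%R &
  forall i, exists c, forall y, (fe i y = c * e y)%R.

(** Replace each [fb i] by the power inverse to its factor; since [fb i] has order dividing p, the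
    same group is generated. *)
Lemma scale_family (e : 'F_p -> 'F_p) :
    (forall i, exists c, forall y, fe i y = c * e y)%R ->
  exists F' : family S, (forall (i : fI F') y, fe i y = e y) /\
    ((forall i j, i = j) -> forall i j : fI F', i = j).
Proof.
case/choice => c fE.
have c_nz i : c i != 0%R.
  by have [t] := fnz i; rewrite fE; apply: contraNneq => ->; rewrite mul0r.
pose b i := fb i ^+ (c i)^-1%R.
have e_0 : e 0%R = 0%R.
  by have /eqP := fe0 (fi0 F); rewrite fE mulf_eq0 (negPf (c_nz _)) => /eqP.
have e_nz i : exists t, e t != 0%R.
  by have [t et] := fnz (fi0 F); exists t; apply: contraNneq et => et; rewrite fE et mulr0.
have lab_b i : lab (b i) = 0%R by rewrite labX lab_fb mul0rn.
have sec_b i x : sec (b i) x = if x == fpos i then b i else a ^+ e (x - fpos i)%R.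
  rewrite secX0 ?lab_fb // sec_fb; case: eqP => // _.
  by rewrite -(expgFM p_pr (rt_p S)) fE mulrAC divff // mul1r.
have b_ind (P : S -> Prop) : P 1 -> (forall g, P g -> P (g * a)) ->
    (forall g i, P g -> P (g * b i)) -> forall g, P g.
  move=> P1 Pa Pb; apply: (fam_ind (f := F)) => // g i Pg.
  have -> : fb i = b i ^+ c i.
    by rewrite -(expgFM p_pr (fb_p i)) mulVf // expgF1.
  elim: (nat_of_ord (c i)) => [|k IHk]; first by rewrite mulg1.
  by rewrite expgSr mulgA; exact: Pb.
by exists (@Family p S (fI F) b (@fpos _ _ F) (fun=> e) (fi0 F) (fun=> e_0) e_nz lab_b sec_b b_ind).
Qed.

(** Vectors that are constant off 0 are multiples of a symmetric one. *)
Lemma not_symmetric_nonconst : ~ symmetric_family ->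
  exists i t t', [/\ t != 0%R, t' != 0%R & fe i t != fe i t'].
Proof.
move=> nsym; apply: contrapT => nex; apply: nsym.
exists (fun y => (y != 0)%:R)%R => [y|i]; first by rewrite oppr_eq0.
exists (fe i 1%R) => y; have [->|y0] := eqVneq y 0%R; first by rewrite fe0 mulr0.
rewrite mulr1; apply: contrapT => /eqP ney; apply: nex.
by exists i, y, 1%R; split=> //; exact: oner_neq0.
Qed.

Lemma not_symmetric : injmap (gam 2 : nsub S) (gam 2) -> ~ symmetric_family.
Proof.
move=> G2 [e eN /scale_family[F' [fE _]]].
have z2 : gam 2 [~ fb (fi0 F'), a] by exact: (@gamS _ 1).
have [s s2 is_] := G2 _ 0%R z2.
exact: (not_injp_gam2 fE eN is_).
Qed.

End Scaling.

(** * Level stabilisers inside the closure of [gam 3] *)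

Section Gamma3.
Variables (p : nat) (S : ssgroup p) (F : family S).
Implicit Types (g h s : S) (x y t : 'F_p) (i j : fI F) (m : fI F -> 'F_p).
Implicit Types (n : fI F -> 'F_p -> 'F_p).
Local Notation p_pr := (ss_prime S).
Local Notation a := (rt S).
Local Notation dSt := (ncomm (stab S 1) (stab S 1)).

Lemma qpi3X i k : qpi (gam 3) [~ fb i, a ^+ k] = qpi (gam 3) [~ fb i, a] ^+ k.
Proof.
elim: k => [|k IHk]; first by rewrite commg1 qpi1.
rewrite expgS commgMr qpiM IHk expgSr qpiJ; congr (_ * _).
by apply/conjg_fixP/commgP; apply: gam_central; exact: (@gamS _ 1).
Qed.

Lemma qpi3p i : qpi (gam 3) [~ fb i, a] ^+ p = 1.
Proof. by rewrite -qpi3X rt_p commg1 qpi1. Qed.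

Lemma qpi3_bxE i x :
  qpi (gam 3) (bx i x) = qpi (gam 3) (fb i) * qpi (gam 3) [~ fb i, a] ^+ (x - fpos i)%R.
Proof. by rewrite -qpi3X -qpiM commgEl mulKVg. Qed.

Section SingleGenerator.
Hypothesis single : forall i j, i = j.

Lemma dSt_gam3 s : dSt s -> gam 3 s.
Proof.
apply: (@stab1_comm _ _ F (gam 3)) => i j x y; apply/qpi_id.
by rewrite qpi3_bx (single i j) commgg qpi1.
Qed.

(** With one generator, s is modulo [gam 3] a power of b times a power of [b,a]; the exponents are
    determined by [augf] and [derf], which vanish on St(2). *)
Lemma stab2_gam3 s : stab S 2 s -> gam 3 s.
Proof.
move=> s2; have s0 := stab_lab s2; have [n sn] := repB_exists F s0.
pose i := fi0 F; have fE j y : fe j y = fe i y by rewrite (single j i).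
have [] := stab2_augf_derf fE s2; rewrite (augfE fE s0 sn) (derfE fE s0 sn) => aug der.
have sum1 (N : fI F -> 'F_p) : (\sum_j N j = N i)%R.
  by rewrite (big_only1 i) // => j ji; rewrite (single j i) eqxx in ji.
have prod1 (f : fI F -> S) : \prod_j f j = f i.
  by rewrite (big_only1 i) // => j ji; rewrite (single j i) eqxx in ji.
rewrite -(mulKVg (wd n) s); apply: nsubM; last by apply: dSt_gam3; apply/qpiP/esym.
apply/qpi_id; rewrite qpi_prod.
pose b := qpi (gam 3) (fb i); pose z := qpi (gam 3) [~ fb i, a].
have zc u : commute z u by apply: gam_central; exact: (@gamS _ 1).
have bp : b ^+ p = 1 by rewrite -qpiX fb_p qpi1.
have -> : \prod_x qpi (gam 3) (blk n x) =
    \prod_x (b ^+ n i x * z ^+ ((x - fpos i) * n i x)%R).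
  apply: eq_bigr => x _; rewrite /blk prod1 qpiX qpi3_bxE expgMn.
    by rewrite (expgFM p_pr (qpi3p i)).
  by apply/commute_sym/commute_sym/commuteX/commute_sym.
rewrite prodgM_commute => [|x y _ _]; last by apply/commuteX/commute_sym.
rewrite -(expgF_sum p_pr bp) -(expgF_sum p_pr (qpi3p i)).
have n0 : (\sum_x n i x = 0)%R.
  by rewrite -[RHS]aug; apply: eq_bigr => x _; rewrite sum1.
have d0 : (\sum_x (x - fpos i) * n i x = 0)%R.
  under eq_bigr do rewrite mulrBl.
  rewrite sumrB -mulr_sumr n0 mulr0 subr0 -[RHS]der.
  by apply: eq_bigr => x _; rewrite sum1.
by rewrite n0 d0 !expgF0 mulg1.
Qed.

End SingleGenerator.

Hypothesis G2 : injmap (gam 2 : nsub S) (gam 2).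

Let G3 : injmap (gam 3 : nsub S) (gam 3).
Proof. exact: injmap_gam G2. Qed.

(** As [ecomb m] is 0, the copy of [kap m] is the product of the corresponding [bx i 0], which
    agrees with [kap m] modulo [gam 2]. *)
Lemma cl2_ecomb w m : repA w 0%R m -> ecomb m = 0%R -> cl (gam 2) w.
Proof.
move=> wm em; rewrite -(mulKVg (kap m) w); apply: nsubM; last first.
  by apply: sub_cl; apply/qpiP/esym; rewrite wm expgF0 mul1g.
pose W := blk (fun i _ => m i) 0%R.
have iW : injp 0%R (kap m) W.
  by apply: (injp_blk (n := fun i _ => m i)) => y; rewrite -ecombE em mxE.
have WE : qpi (gam 2) W = qpi (gam 2) (kap m).
  rewrite /W /kap /blk !qpi_prod; apply: eq_bigr => i _; rewrite !qpiX; congr (_ ^+ _).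
  by apply/esym/qpiP; exact: gam2_conj.
by apply: cl_fix G2 iW _ => n; apply: qpi_mem WE => x; exact: mulnsl.
Qed.

(** Let [q j] be the class of the copy of [[~ fb j, a]]. Since [[~ bx j 0, bx k y]] is trivial
    modulo [cl (gam 3)], its two non-trivial sections give the relations [qE]. A non-trivial [q i]
    would then make the family symmetric, against [not_symmetric]. *)
Lemma injp_cl3 i x s : injp x [~ fb i, a] s -> cl (gam 3) s.
Proof.
move=> is_; have /choice[X iX] (j : fI F) : exists s, gam 2 s /\ injp 0%R [~ fb j, a] s.
  have [|s' s2 is'] := G2 (t := [~ fb j, a]) 0%R; first exact: (@gamS _ 1).
  by exists s'.
pose q j := qpi (cl (gam 3)) (X j).
have qc j u : commute (q j) u.
  have [v <-] := qpi_surj u; apply/commgP; rewrite -qpiR; apply/eqP/qpi_id/sub_cl.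
  by apply: gamS; case: (iX j).
have q_pow j y (k : nat) s' : injp y [~ fb j, a ^+ k] s' -> qpi (cl (gam 3)) s' = q j ^+ k.
  move=> is'; have [X2 iXj] := iX j.
  have := injp_rt_to 0%R is'; set s0 := _ ^ _ => is0.
  have -> : qpi (cl (gam 3)) s' = qpi (cl (gam 3)) s0.
    apply/qpiP; rewrite -commgEl; apply: sub_cl; apply: gamS.
    apply: (injmap_mem G2) is'; exact: (@gamS _ 1).
  rewrite -qpiX; apply/esym/qpiP; apply: sub_cl.
  apply: (injmap_mem G3) (injpM (injpV (injpX k iXj)) is0).
  by apply/qpiP; rewrite qpiX qpi3X.
have qp j : q j ^+ p = 1.
  have := q_pow j 0%R p 1; rewrite rt_p commg1 qpi1 => <- //; exact: injp1.
have qE j k y : q j ^+ fe k (- y)%R = q k ^+ fe j y.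
  have [->|y0] := eqVneq y 0%R; first by rewrite oppr0 !fe0 !expgF0.
  have d3 : cl (gam 3) [~ bx j 0%R, bx k y].
    by apply: (cl3_dSt F G3); apply: mem_ncomm; apply/stab1; exact: lab_bx.
  have [s1 s12 is1] := G2 (t := [~ fb j, a ^+ fe k (- y)%R]) 0%R (@gamS _ 1 _ _ I).
  have [s2 s22 is2] := G2 (t := [~ fb k, a ^+ fe j y]) y (@gamS _ 1 _ _ I).
  rewrite -(q_pow _ _ _ _ is1) -(q_pow _ _ _ _ is2).
  have sE : [~ bx j 0%R, bx k y] = s1 * s2^-1.
    have [l1 _ _] := is1; have [l2 _ _] := is2.
    apply: sec_ext; first by rewrite labR labM labV l1 l2 subrr.
    move=> z; rewrite secR0 ?lab_bx // secM0 // secV0 // !sec_bx.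
    rewrite (injp_sec _ is1) (injp_sec _ is2); have [->|z0] := eqVneq z 0%R.
      by rewrite eq_sym (negPf y0) sub0r invg1 mulg1.
    have [->|zy] := eqVneq z y; first by rewrite subr0 mul1g invgR.
    by rewrite invg1 mulg1; apply/eqP/commgP/commuteX2/commute_refl.
  have := d3; rewrite sE => /qpi_id; rewrite qpiM qpiV => s12E.
  by rewrite -[LHS](mulgVK (qpi (cl (gam 3)) s2)) s12E mul1g.
have [X2 iXi] := iX i; have q1 : q i = 1.
  apply: contrapT => qi1; apply: (not_symmetric (F := F) G2).
  have q_inj (k k' : 'F_p) : q i ^+ k = q i ^+ k' -> k = k'.
    move=> kk; apply/eqP; rewrite -subr_eq0; apply/negP => /negP nz; apply: qi1.
    apply: (expgF_inv p_pr (qp i)) nz _.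
    by rewrite (expgFD p_pr (qp i)) (expgFN p_pr (qp i)) kk mulgV.
  have eN y : fe i (- y)%R = fe i y by apply: q_inj; exact: qE.
  have [t et] := fnz i.
  exists (fe i) => // j; exists (fe j (- t) / fe i t)%R => y.
  have qj : q j = q i ^+ (fe j (- t) / fe i t)%R.
    rewrite (expgFM p_pr (qp i)) qE -(expgFM p_pr (qp j)) divff // expgF1 //.
  by apply: q_inj; rewrite -[y]opprK qE qj -(expgFM p_pr (qp i)) !eN.
by have := q_pow i x 1%N s; rewrite expg1 q1 expg1 => /(_ is_)/qpi_id.
Qed.

Lemma injmap_cl3 : injmap (gam 2 : nsub S) (cl (gam 3)).
Proof.
apply: (pull_injmap (F := F)); apply: (fam_ind_comm (F := F)) => [i|i j].
  have [|s s2 is_] := G2 (t := [~ fb i, a]) 0%R; first exact: (@gamS _ 1).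
  rewrite -invgR; apply: nsubV; apply: (pull1 F is_); exact: injp_cl3 is_.
apply: (pull1 F (injp_bxR i j 0%R)); apply: (cl3_dSt F G3).
by apply: mem_ncomm; apply/stab1; exact: lab_bx.
Qed.

Lemma stab_rank_cl3 (k : nat) (V : 'M['F_p]_(k, (Zp_trunc (pdiv p)).+2)) :
  (forall i, (evec i <= V)%MS) -> forall s, stab S (\rank V).+2 s -> cl (gam 3) s.
Proof.
move=> eV s sV; have s0 := stab_lab sV; have [n sn] := repB_exists F s0.
rewrite -(mulKVg (wd n) s); apply: nsubM; last first.
  by apply: (cl3_dSt F G3); apply/qpiP/esym.
apply: nsub_prod => x; have sx : stab S (\rank V).+1 (sec s x) by have /stabS[_] := sV.
have nx : repA (sec s x) 0%R (n^~ x).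
  by have := repB_sec x s0 sn; rewrite -(repA_lab (repB_sec x s0 sn)) (stab_lab sx).
have ex := stab_ecomb eV sx nx.
have ix : injp x (kap (n^~ x)) (blk n x).
  by apply: injp_blk => y; rewrite -ecombE ex mxE.
apply: cl_cl; apply: (cl_injp injmap_cl3 ix).
apply: cl2_ecomb ex; by rewrite /repA expgF0 mul1g.
Qed.

End Gamma3.

(** * From closures of lower central terms to A; groups branching over [gam 2] *)

Section CaseI.
Variables (p : nat) (S : ssgroup p) (F : family S).
Variables (A N : nsub S) (m n0 : nat).
Hypothesis ASt : forall s : S, stab S n0 s -> A s.
Hypothesis NA : forall n h : S, N n -> A [~ n, h].
Hypothesis NSt : forall n : S, N n -> stab S m n.
Variables (n1 : S) (u1 : seq 'F_p).
Hypotheses (Nn1 : N n1) (size_u1 : size u1 = m) (lab_n1 : lab (secw n1 u1) != 0%R).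

Lemma stab_nonconst k c : 0 < k -> injmap (gam k : nsub S) (gam k) ->
    (exists (i : fI F) (t t' : 'F_p), [/\ t != 0%R, t' != 0%R & fe i t != fe i t']) ->
    (forall s : S, stab S c s -> cl (gam k.+1) s) ->
  forall s : S, stab S (m + c.+1) s -> A s.
Proof.
case: k => // k _ KK [i [t [t' [t0 t'0 et]]]] cSt.
move=> s; apply: (red_concl (F := F) (c := c.+1) (K := gam k.+1) ASt) => {}s.
apply: cl_St cSt s.
apply: (core_nonconst (g := secw n1 u1) (n0 := n0) KK lab_n1 _ _ t0 t'0 et) => s sK.
  exact (red_comm F KK NA NSt Nn1 size_u1 sK).
exact (red_St F m KK ASt sK).
Qed.

Hypothesis G2 : injmap (gam 2 : nsub S) (gam 2).

Lemma stab_caseI (k : nat) (V : 'M['F_p]_(k, (Zp_trunc (pdiv p)).+2)) :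
    (forall i : fI F, (evec i <= V)%MS) ->
  forall s, stab S (m + (\rank V + 3)) s -> A s.
Proof.
move=> eV; rewrite addnC -[_ + 3]/(_ + 2.+1) !addnS addn0 addnC.
apply: (stab_nonconst (k := 2)) => //; last exact: stab_rank_cl3.
exact: not_symmetric_nonconst (not_symmetric (F := F) G2).
Qed.

Lemma stab_caseI_single : (forall i j : fI F, i = j) ->
  forall s, stab S (m + 3) s -> A s.
Proof.
move=> single; apply: (stab_nonconst (k := 2)) => //.
  exact: not_symmetric_nonconst (not_symmetric (F := F) G2).
by move=> s s2; apply: sub_cl; exact: (stab2_gam3 single).
Qed.

End CaseI.

(** * Branching over [gam 3]: either branching over [gam 2] or symmetry *)

Section Dichotomy.
Variables (p : nat) (S : ssgroup p) (F : family S).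
Hypothesis p_odd : odd p.
Hypothesis G3 : injmap (gam 3 : nsub S) (gam 3).
Implicit Types (g h s : S) (x y t : 'F_p) (i j k : fI F).
Implicit Types (v : fI F -> 'F_p -> 'F_p).
Local Notation p_pr := (ss_prime S).
Local Notation a := (rt S).
Local Notation Z := (fun i : fI F => qpi (gam 3) [~ fb i, a]).

Let Zc i u : commute (Z i) u.
Proof. by apply: gam_central; exact: (@gamS _ 1). Qed.

(* [zsum v] says that [v] lists the sections of an element of [gam 2], in terms of the
   classes of the [[fb i, a]] modulo [gam 3]. *)
Definition zvec v x := \prod_i Z i ^+ v i x.
Definition zsum v := exists s, gam 2 s /\ forall x, qpi (gam 3) (sec s x) = zvec v x.

Definition dl j y : fI F -> 'F_p -> 'F_p := fun i x => ((i == j) && (x == y))%:R%R.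

Lemma zvecD v v' x : zvec (fun i x => v i x + v' i x)%R x = zvec v x * zvec v' x.
Proof.
rewrite /zvec -prodgM_commute => [|i j _ _]; last by apply: commuteX; apply: commute_sym; apply: commuteX.
by apply: eq_bigr => i _; rewrite (expgFD p_pr (qpi3p i)).
Qed.

Lemma zvec0 v x : (forall i, v i x = 0%R) -> zvec v x = 1.
Proof. by move=> v0; rewrite /zvec big1 // => i _; rewrite v0 expgF0. Qed.

Lemma zvec_dl (c : 'F_p) j y x : zvec (fun i x => c * dl j y i x)%R x = if x == y then Z j ^+ c else 1.
Proof.
rewrite /zvec (big_only1 j) // => [|i ij _]; last first.
  have -> : dl j y i x = 0%R by rewrite /dl (negPf ij).
  by rewrite mulr0 expgF0.
have -> : dl j y j x = (x == y)%:R%R by rewrite /dl eqxx.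
by case: eqP => _; rewrite ?mulr1 ?mulr0 ?expgF0.
Qed.

Lemma eq_zsum v v' : (forall i x, v i x = v' i x) -> zsum v -> zsum v'.
Proof.
move=> vv [s [s2 sv]]; exists s; split=> // x; rewrite sv.
by apply: eq_bigr => i _; rewrite vv.
Qed.

Lemma zsum0 v : (forall i x, v i x = 0%R) -> zsum v.
Proof.
by move=> v0; exists 1; split=> [|x]; [exact: nsub1 | rewrite sec1 qpi1 zvec0].
Qed.

Lemma zsumD v v' : zsum v -> zsum v' -> zsum (fun i x => v i x + v' i x)%R.
Proof.
move=> [s [s2 sv]] [s' [s'2 sv']]; exists (s * s'); split=> [|x]; first exact: nsubM.
by rewrite secM0 ?gam2_lab // qpiM sv sv' zvecD.
Qed.

Lemma zsumZ c v : zsum v -> zsum (fun i x => c * v i x)%R.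
Proof.
move=> sv; rewrite -[c]natr_Zp; elim: (nat_of_ord c) => [|k IHk].
  by apply: zsum0 => i x; rewrite mul0r.
by apply: eq_zsum (zsumD sv IHk) => i x; rewrite -natr1; ring.
Qed.

Lemma zsumB v v' : zsum v -> zsum v' -> zsum (fun i x => v i x - v' i x)%R.
Proof.
by move=> sv /(zsumZ (-1)%R) sv'; apply: eq_zsum (zsumD sv sv') => i x; rewrite mulN1r.
Qed.

Lemma zsum_div c v : c != 0%R -> zsum (fun i x => c * v i x)%R -> zsum v.
Proof.
by move=> c0 /(zsumZ c^-1%R); apply: eq_zsum => i x; rewrite mulKf.
Qed.

Lemma zsum_shift y v : zsum v -> zsum (fun i x => v i (x - y))%R.
Proof.
move=> [s [s2 sv]]; exists (s ^ (a ^+ y)); split=> [|x]; first exact: nsubJ.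
by rewrite (secJ _ _ (gam2_lab s2)) sec_rtX conjg1 lab_rtF sv.
Qed.

Lemma zsum_rel j k y :
  zsum (fun i x => fe k (- y)%R * dl j 0 i x - fe j y * dl k y i x)%R.
Proof.
have [->|y0] := eqVneq y 0%R.
  by apply: zsum0 => i x; rewrite oppr0 !fe0 !mul0r subr0.
exists [~ bx j 0%R, bx k y]; split=> [|x]; first exact: (@gamS _ 1).
have -> : zvec (fun i x => fe k (- y)%R * dl j 0 i x - fe j y * dl k y i x)%R x =
    (if x == 0%R then Z j ^+ fe k (- y)%R else 1) * (if x == y then Z k ^+ (- fe j y)%R else 1).
  rewrite -!zvec_dl -zvecD; apply: eq_bigr => i _; congr (_ ^+ _).
  by rewrite mulNr.
rewrite secR0 ?lab_bx // !sec_bx; have [->|x0] := eqVneq x 0%R.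
  by rewrite eq_sym (negPf y0) sub0r mulg1 qpi3X.
have [->|xy] := eqVneq x y.
  by rewrite subr0 mul1g -invgR qpiV qpi3X (expgFN p_pr (qpi3p k)).
rewrite mulg1; apply/qpi_id.
have -> : [~ a ^+ fe j (x - 0)%R, a ^+ fe k (x - y)%R] = 1; last exact: nsub1.
by apply/eqP/commgP/commuteX2/commute_refl.
Qed.

(** Branching over [gam 3] allows the sections to be corrected, so that agreement modulo [gam 3]
    becomes equality. *)
Lemma zsum_pull i x : zsum (dl i x) -> pull F (gam 2) [~ fb i, a].
Proof.
move=> [s [s2 sv]].
have [|r [r3 r0 rx]] := injmap_prod G3 (j := fun y => (sec s y)^-1 * (if y == x then [~ fb i, a] else 1)).
  move=> y; apply/qpiP; rewrite sv.
  have := zvec_dl 1%R i x y; rewrite (expgF1 p) => E.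
  have -> : zvec (dl i x) y = if y == x then Z i else 1.
    by rewrite -E; apply: eq_bigr => j _; rewrite mul1r.
  by case: eqP => // _; rewrite qpi1.
have s0 := gam2_lab s2; apply: (pull1 F (x := x) (s := s * r)).
  by split=> [|| y /negPf yx]; rewrite ?secM0 // ?rx ?eqxx ?yx ?mulKVg // labM s0 r0 addr0.
by apply: nsubM => //; exact: gam_sub.
Qed.

Lemma zsum_dl i x y : zsum (dl i x) -> zsum (dl i y).
Proof.
move/(zsum_shift (y - x)%R); apply: eq_zsum => j z; rewrite /dl.
have -> : (z - (y - x) = z - y + x)%R by ring.
by rewrite -[X in _ && (_ == X)]add0r (inj_eq (addIr _)) subr_eq0.
Qed.

Lemma zsum_all i : zsum (dl i 0%R) -> forall j, zsum (dl j 0%R).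
Proof.
move=> zi j; have [t et] := fnz i; apply: (zsum_div et).
have := zsumD (zsum_rel j i (- t)%R) (zsumZ (fe j (- t)%R) (zsum_dl (- t)%R zi)).
by apply: eq_zsum => k x; rewrite opprK subrK.
Qed.

(** Chain p shifted copies of the relation: the far letter p*y returns to 0, with coefficients c^p =
    c and d^p = d. *)
Lemma zsum_tel i c d y : zsum (fun j x => c * dl i 0 j x - d * dl i y j x)%R ->
  zsum (fun j x => (c - d) * dl i 0 j x)%R.
Proof.
move=> zi; suff zl l : zsum (fun j x => c ^+ l * dl i 0 j x - d ^+ l * dl i (y *+ l) j x)%R.
  apply: eq_zsum (zl p) => j x.
  have fermat t : (t ^+ p = t)%R.
    by rewrite -[t]natr_Zp -natrX -(Fp_nat_mod p_pr) (fermat_little _ p_pr) Fp_nat_mod ?p_pr.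
  rewrite !fermat -mulr_natr.
  have -> : (p%:R = 0 :> 'F_p)%R by rewrite -(Fp_nat_mod p_pr) modnn.
  by rewrite mulr0 mulrBl.
elim: l => [|l IHl]; first by apply: zsum0 => j x; rewrite !expr0 mulr0n subrr.
apply: eq_zsum (zsumD (zsumZ c IHl) (zsumZ (d ^+ l)%R (zsum_shift (y *+ l)%R zi))) => j x.
have -> : dl i 0%R j (x - y *+ l)%R = dl i (y *+ l)%R j x by rewrite /dl subr_eq0.
have -> : dl i y j (x - y *+ l)%R = dl i (y *+ l.+1)%R j x.
  by rewrite /dl subr_eq -mulrS.
by rewrite !exprS; ring.
Qed.

(** One realised delta function gives them all and hence branching over [gam 2]. If none is
    realised, [zsum_tel] equates the coefficients of every two-term relation, which forces symmetry
    and proportionality. *)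
Lemma symmetric_dichotomy : ~ symmetric_family F -> injmap (gam 2 : nsub S) (gam 2).
Proof.
move=> nsym; suff [i zi] : exists i, zsum (dl i 0%R).
  apply: (pull_injmap (F := F)); apply: (fam_ind_comm (F := F)) => [j|j k].
    by rewrite -invgR; apply: nsubV; apply: zsum_pull (zsum_all zi j).
  by apply: (pull1 F (injp_bxR j k 0%R)); exact: (@gamS _ 1).
apply: contrapT => nz; have ztel i c d y :
    zsum (fun j x => c * dl i 0 j x - d * dl i y j x)%R -> c = d.
  move/zsum_tel => zi; apply/eqP; rewrite -subr_eq0; apply/negP => /negP cd; apply: nz.
  by exists i; exact: zsum_div zi.
have eN i y : fe i (- y)%R = fe i y by exact: ztel (zsum_rel i i y).
(* The relations for t and -t identify letters at distance 2t, and as p is odd the multiples of 2t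
   are all letters. *)
have flip k y : zsum (fun i x => dl k 0 i x - dl k y i x)%R.
  have [t et] := fnz k; have tn : (2%:R * t != 0)%R.
    rewrite mulf_neq0 //; last by apply: contraNneq et => ->; rewrite fe0.
    by rewrite -(dvdn_pcharf (pchar_Fp p_pr)) (dvdn_prime2 p_pr) //; apply/eqP => p2; have := p_odd; rewrite p2.
  have zt : zsum (fun i x => dl k 0 i x - dl k (2%:R * t) i x)%R.
    apply: (zsum_div et).
    have := zsum_shift t (zsumB (zsum_rel k k t) (zsum_rel k k (- t)%R)).
    apply: eq_zsum => i x; rewrite !opprK !eN.
    have -> : dl k (- t)%R i (x - t)%R = dl k 0%R i x.
      by rewrite /dl -[X in _ && (_ == X)]add0r (inj_eq (addIr _)).
    have -> : dl k t i (x - t)%R = dl k (2%:R * t)%R i x by rewrite /dl subr_eq; congr ((_ && (_ == _))%:R)%R; ring.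
    ring.
  have zl l : zsum (fun i x => dl k 0 i x - dl k ((2%:R * t) *+ l) i x)%R.
    elim: l => [|l IHl]; first by apply: zsum0 => i x; rewrite mulr0n subrr.
    apply: eq_zsum (zsumD IHl (zsum_shift ((2%:R * t) *+ l)%R zt)) => i x.
    have -> : dl k 0%R i (x - (2%:R * t) *+ l)%R = dl k ((2%:R * t) *+ l)%R i x by rewrite /dl subr_eq0.
    have -> : dl k (2%:R * t)%R i (x - (2%:R * t) *+ l)%R = dl k ((2%:R * t) *+ l.+1)%R i x.
      by rewrite /dl subr_eq -mulrS.
    ring.
  have := zl (y / (2%:R * t))%R; apply: eq_zsum => i x.
  by rewrite -mulr_natr natr_Zp mulrC divfK.
(* Using [flip], all relations move to the letter 0, where eliminating index j leaves a multiple of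
   a delta function; its coefficient must vanish. *)
have minor j k y y' : (fe k y * fe j y' = fe k y' * fe j y)%R.
  have rel0 x : zsum (fun i z => fe k x * dl j 0 i z - fe j x * dl k 0 i z)%R.
    apply: eq_zsum (zsumB (zsum_rel j k x) (zsumZ (fe j x) (flip k x))) => i z.
    by rewrite eN; ring.
  apply: (@ztel k _ _ 0%R).
  apply: eq_zsum (zsumB (zsumZ (fe k y') (rel0 y)) (zsumZ (fe k y) (rel0 y'))) => i z.
  ring.
have [t et] := fnz (fi0 F).
apply: nsym; exists (fe (fi0 F)) => // k; exists (fe k t / fe (fi0 F) t)%R => y.
by rewrite mulrAC -minor mulfK.
Qed.

End Dichotomy.

(** * Centres modulo a normal subgroup *)

Lemma commgVl (gT : groupType) (x y : gT) : [~ x^-1, y] = ([~ x, y] ^ x^-1)^-1.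
Proof. by rewrite !(commgEl, conjgE, gnorm). Qed.

Section RelativeCentre.
Variables (gT : groupType) (J : nsub gT).
Implicit Types (s t g : gT).

Lemma ncent_subproof :
  let P t := forall g, J [~ t, g] in
  [/\ P 1, forall s t, P s -> P t -> P (s * t), forall s, P s -> P s^-1
    & forall s t, P s -> P (s ^ t)].
Proof.
split=> [g|s t Ps Pt g|s Ps g|s t Ps g].
- by rewrite comm1g; exact: nsub1.
- by rewrite commgMl; apply: nsubM; [exact/nsubJ/Ps | exact: Pt].
- by rewrite commgVl; apply/nsubV/nsubJ.
- have -> : [~ s ^ t, g] = [~ s, g ^ t^-1] ^ t by rewrite conjRg conjgKV.
  exact: nsubJ.
Qed.

Definition ncent : nsub gT :=
  let: And4 P1 PM PV PJ := ncent_subproof in NSub P1 PM PV PJ.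

Lemma ncentP t : ncent t <-> forall g, J [~ t, g].
Proof. by rewrite /ncent; case: ncent_subproof. Qed.

Lemma qpi_commute s t : J [~ s, t] <-> commute (qpi J s) (qpi J t).
Proof.
split=> [Jst|/commgP/eqP]; last by rewrite -qpiR => /qpi_id.
by apply/commgP; rewrite -qpiR; apply/eqP/qpi_id.
Qed.

End RelativeCentre.

Lemma ncent_gen (p : nat) (S : ssgroup p) (F : family S) (J : nsub S) (t : S) :
  J [~ t, rt S] -> (forall i : fI F, J [~ t, fb i]) -> ncent J t.
Proof.
move=> ta tb; apply/ncentP => g; apply/qpi_commute.
elim/(@fam_ind _ _ F): g => [|g IHg|g i IHg].
- by rewrite qpi1; exact: commute1.
- by rewrite qpiM; apply: commuteM => //; exact/qpi_commute.
- by rewrite qpiM; apply: commuteM => //; exact/qpi_commute.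
Qed.

(** * A common symmetric vector that is not constant: the closure of [gam 4] *)

Section SymmetricNonconstant.
Variables (p : nat) (S : ssgroup p) (F : family S) (e : 'F_p -> 'F_p).
Hypothesis fE : forall i y, fe (f := F) i y = e y.
Hypothesis eN : forall y, e (- y)%R = e y.
Hypothesis G3 : injmap (gam 3 : nsub S) (gam 3).
Hypothesis nonconst : exists t t' : 'F_p, [/\ t != 0, t' != 0 & e t != e t']%R.
Implicit Types (g h s : S) (x y q : 'F_p) (i j : fI F).
Local Notation p_pr := (ss_prime S).
Local Notation a := (rt S).
Local Notation dSt := (ncomm (stab S 1) (stab S 1)).

Let G4 : injmap (gam 4 : nsub S) (gam 4).
Proof. exact: injmap_gam G3. Qed.

(** Otherwise e would be constant along steps of q avoiding 0, hence constant off 0. *)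
Lemma exists_unequal_shift :
  exists q x, [/\ q != 0, x != 0, x != q, e q != 0 & e x != e (x - q)]%R.
Proof.
apply: contrapT => none; have [q eq] := e_nz fE.
have q0 : q != 0%R by apply: contraNneq eq => ->; rewrite (e0 fE).
have shift x : x != 0%R -> x != q -> e x = e (x - q)%R.
  by move=> x0 xq; apply: contrapT => /eqP ex; apply: none; exists q, x.
have mult l : (q *+ l != 0 -> e (q *+ l) = e q)%R.
  elim: l => [|l IHl]; first by rewrite eqxx.
  have [ql|ql] := eqVneq (q *+ l)%R 0%R; first by rewrite mulrS ql addr0.
  have qlE : (q *+ l.+1 - q = q *+ l)%R by rewrite mulrS addrAC subrr add0r.
  by move=> ql1; rewrite shift ?qlE ?IHl // -subr_eq0 qlE.
have const (t : 'F_p) : t != 0%R -> e t = e q.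
  move=> t0; have tE : t = (q *+ (t / q)%R)%R.
    by rewrite -mulr_natr natr_Zp mulrC divfK.
  by rewrite tE mult -?tE.
by have [t [t' [t0 t'0]]] := nonconst; rewrite !const // eqxx.
Qed.

Lemma sec_bxR i q y : sec [~ bx i 0%R, bx i q] y =
  if y == 0%R then if q == 0%R then 1 else [~ fb i, a ^+ e q]
  else if y == q then [~ fb i, a ^+ e q]^-1 else 1.
Proof.
rewrite secR0 ?lab_bx // !sec_bx !fE; have [->|y0] := eqVneq y 0%R.
  rewrite [0%R == q]eq_sym sub0r eN; case: eqP => // _.
  by rewrite commgg.
have [->|yq] := eqVneq y q; first by rewrite subr0 invgR.
by apply/eqP/commgP/commuteX2/commute_refl.
Qed.

Lemma gam3_bxR i q : gam 3 [~ bx i 0%R, bx i q].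
Proof. by apply/qpi_id; rewrite qpi3_bx commgg qpi1. Qed.

Local Notation P := (pull F (cl (gam 4 : nsub S))).

Lemma gam4_pull g : gam 4 g -> P g.
Proof. by move/(injmap_pull F G4)/pullP => [s /sub_cl s4 is_]; apply/pullP; exists s. Qed.

(** The commutator of [[~ bx i 0, bx i q]], an element of [gam 3], with [s] lies in [gam 4]. It is a
    product of copies at 0 and q of elements of [gam 3], and bringing the second to 0 changes it
    only by [gam 4]. *)
Lemma pull_rel i q s : q != 0%R -> lab s = 0%R ->
  P ([~ [~ fb i, a ^+ e q], sec s 0%R] * [~ [~ fb i, a ^+ e q]^-1, sec s q]).
Proof.
move=> q0 s0; set c := [~ fb i, _]; have c2 : gam 2 c by exact: (@gamS _ 1).
have [w0 w03 iw0] := G3 0%R (@gamS _ 2 _ (sec s 0%R) c2).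
have [wq wq3 iwq] := G3 q (@gamS _ 2 _ (sec s q) (nsubV c2)).
have hE : [~ [~ bx i 0%R, bx i q], s] = w0 * wq.
  have [l0 _ _] := iw0; have [lq _ _] := iwq.
  apply: sec_ext; first by rewrite labR labM l0 lq addr0.
  move=> y; rewrite secR0 ?labR // secM0 // (injp_sec _ iw0) (injp_sec _ iwq) sec_bxR.
  have [->|y0] := eqVneq y 0%R; first by rewrite [0%R == q]eq_sym (negPf q0) mulg1.
  by have [->|yq] := eqVneq y q; rewrite mul1g // comm1g.
have h4 : gam 4 (w0 * wq) by rewrite -hE; apply: gamS; exact: gam3_bxR.
apply: (pull1 F (injpM iw0 (injp_rt_to 0%R iwq))); apply: sub_cl.
have -> : w0 * wq ^ (a ^+ (0 - q)%R) = w0 * wq * [~ wq, a ^+ (0 - q)%R].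
  by rewrite commgEl -mulgA mulKVg.
by apply: nsubM => //; exact: gamS.
Qed.

(** In [pull_rel], [bx i x] with unequal exponents at the two letters shows that
    [[~ fb i, a ^+ e q]] commutes with a modulo P, and [bx j 0] then shows that it commutes with
    [fb j]. So [gam 2] is central modulo P. *)
Lemma injmap_cl4 : injmap (gam 3 : nsub S) (cl (gam 4)).
Proof.
have P3 (u : quo P) t : gam 3 t -> commute (qpi P t) u.
  move=> t3; have [v <-] := qpi_surj u; apply/qpi_commute/gam4_pull; exact: gamS.
have [q [x [q0 x0 xq eq ex]]] := exists_unequal_shift.
have Ca i : commute (qpi P [~ fb i, a ^+ e q]) (qpi P a).
  have := pull_rel i q0 (lab_bx i x); have : gam 2 [~ fb i, a ^+ e q] by exact: (@gamS _ 1).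
  move: [~ fb i, a ^+ e q] => c c2; pose w := [~ qpi P c, qpi P a].
  have wc u : commute w u by rewrite /w -qpiR; apply: P3; exact: gamS.
  have wX k : [~ qpi P c, qpi P a ^+ k] = w ^+ k.
    elim: k => [|k IHk]; first by rewrite commg1.
    rewrite expgS commgMr IHk expgSr; congr (_ * _).
    by apply/conjg_fixP/commgP.
  have wp : w ^+ p = 1 by rewrite -wX -qpiX rt_p qpi1 commg1.
  rewrite !sec_bx !fE [0%R == x]eq_sym (negPf x0).
  rewrite [q == x]eq_sym (negPf xq) sub0r eN -[(q - x)%R]opprB eN => /qpi_id.
  rewrite qpiM !qpiR qpiV !qpiX wX.
  have -> : [~ (qpi P c)^-1, qpi P a ^+ e (x - q)%R] = (w ^+ e (x - q)%R)^-1.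
    rewrite commgVl wX; congr (_^-1); apply/conjg_fixP/commgP/commute_sym/commuteX.
    exact: commute_sym.
  rewrite -(expgFN p_pr wp) -(expgFD p_pr wp) => /(expgF_inv p_pr wp) w1.
  by apply/commgP; rewrite -/w w1 // subr_eq0.
have Cb i j : commute (qpi P [~ fb i, a ^+ e q]) (qpi P (fb j)).
  have := pull_rel i q0 (lab_bx j 0%R); rewrite !sec_bx eqxx (negPf q0) => Pcb.
  apply/qpi_commute; rewrite -[X in nmem P X](mulgK ([~ [~ fb i, a ^+ e q]^-1, a ^+ fe j (q - 0)%R])).
  apply: nsubM => //; apply: nsubV; apply/qpi_commute; rewrite qpiV qpiX.
  by apply: commuteX; apply: commute_sym; apply: commuteV; apply: commute_sym.
have cz i : ncent P [~ fb i, a].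
  have c_cent : ncent P [~ fb i, a ^+ e q].
    by apply: (ncent_gen (F := F)) => [|j]; apply/qpi_commute.
  have : qpi (gam 3) ([~ fb i, a ^+ e q] ^+ (e q)^-1%R) = qpi (gam 3) [~ fb i, a].
    by rewrite qpiX qpi3X -(expgFM p_pr (qpi3p i)) divff // expgF1.
  move=> zE; apply: qpi_mem zE _ => [t t3|]; last exact: nsubX.
  by apply/ncentP => g; apply/gam4_pull/gamS.
have gz t : gam 2 t -> ncent P t.
  apply: (fam_ind_comm (F := F)) => [i|i j]; first by rewrite -invgR; exact: nsubV.
  apply/ncentP => g; have t3 : gam 3 [~ [~ fb i, fb j], g] by apply: gamS; exact: (@gamS _ 1).
  have [s s3 is_] := G3 0%R t3; apply: (pull1 F is_); apply: (cl_injp G4 is_).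
  by apply: (cl_comm (J := gam 3)) (cl3_fb i j G3) => ? ?; exact: gamS.
apply: (pull_injmap (F := F)) => t; apply: ncomm_min => s g s2 _.
by move: g; apply/ncentP; exact: gz.
Qed.

Lemma cl4_St5 s : stab S 5 s -> cl (gam 4) s.
Proof.
move=> s5; apply: cl_cl; move: s s5; apply: cl_St injmap_cl4 _ => s.
exact: (cl3_St4 fE eN).
Qed.

Section SingleGenerator.
Hypothesis single : forall i j, i = j.
Local Notation i0 := (fi0 F).
Local Notation pi := (qpi (cl (gam 4 : nsub S))).
Local Notation b := (fb i0).
Local Notation z := [~ b, a].

Lemma pi_central c u : gam 3 c -> commute (pi c) u.
Proof.
move=> c3; have [v <-] := qpi_surj u; apply/qpi_commute/sub_cl; exact: gamS.
Qed.

Lemma pi_conj c g : gam 3 c -> pi (c ^ g) = pi c.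
Proof. by move=> c3; rewrite qpiJ; apply/conjg_fixP/commgP/pi_central. Qed.

Lemma pi_sec s s' : lab s = 0%R -> lab s' = 0%R ->
  (forall y, qpi (gam 3) (sec s y) = qpi (gam 3) (sec s' y)) -> pi s = pi s'.
Proof.
move=> s0 s'0 ss'; apply/qpiP/cl_cl; apply: (cl_inj injmap_cl4).
  by rewrite labM labV s0 s'0 oppr0 addr0.
by move=> y; rewrite secM0 ?labV ?s0 ?oppr0 // secV0 //; apply/sub_cl/qpiP.
Qed.

Lemma pi_commX k : pi [~ b, z ^+ k] = pi [~ b, z] ^+ k.
Proof.
elim: k => [|k IHk]; first by rewrite commg1 qpi1.
rewrite expgSr commgMr qpiM pi_conj ?IHk ?expgS // -invgR.
by apply/nsubV/gamS/nsubX; exact: (@gamS _ 1).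
Qed.

Lemma commg_gam3 c : gam 3 c -> pi [~ b, c] = 1.
Proof. by move=> c3; rewrite -invgR; apply/qpi_id/nsubV/sub_cl/gamS. Qed.

(** After conjugation the second entry is b times [b,a^q], and modulo [gam 4] only the commutator
    with z^q remains. *)
Lemma pi_bxR q : pi [~ bx i0 0%R, bx i0 q] = pi [~ b, z] ^+ q.
Proof.
rewrite -(pi_conj (a ^+ fpos i0) (gam3_bxR i0 q)) conjRg !bxJ add0r bx_pos.
have -> : bx i0 (q + fpos i0)%R = b * [~ b, a ^+ q] by rewrite /bx addrK commgEl mulKVg.
rewrite commgMr commgg conj1g mulg1 -pi_commX.
have /qpiP u3 : qpi (gam 3) (z ^+ q) = qpi (gam 3) [~ b, a ^+ q] by rewrite qpiX qpi3X.
rewrite -[[~ b, a ^+ q]](mulKVg (z ^+ q)) commgMr qpiM commg_gam3 // mul1g pi_conj //.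
by rewrite -invgR; apply/nsubV/gamS/nsubX; exact: (@gamS _ 1).
Qed.

Lemma pi_bzp : pi [~ b, z] ^+ p = 1.
Proof. by rewrite -pi_commX commg_gam3 //; apply/qpi_id; rewrite qpiX qpi3p. Qed.

Lemma qpi3_sec_bxR q y : qpi (gam 3) (sec [~ bx i0 0%R, bx i0 q] y) =
  qpi (gam 3) z ^+ (e q * ((y == 0)%:R - (y == q)%:R))%R.
Proof.
rewrite sec_bxR; have [->|y0] := eqVneq y 0%R.
  rewrite [0%R == q]eq_sym; case: eqP => _; first by rewrite subrr mulr0 expgF0 qpi1.
  by rewrite subr0 mulr1 qpi3X.
case: eqP => _; last by rewrite subrr mulr0 expgF0 qpi1.
by rewrite sub0r mulrN1 qpiV qpi3X (expgFN p_pr (qpi3p i0)).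
Qed.

Lemma pi_telescope q k : exists s, [/\ lab s = 0%R, pi s = pi [~ b, z] ^+ q ^+ k &
  forall y, qpi (gam 3) (sec s y) =
    qpi (gam 3) z ^+ (e q * ((y == 0)%:R - (y == q *+ k)%:R))%R].
Proof.
elim: k => [|k [s [s0 sk sE]]].
  exists 1; split=> [||y]; rewrite ?lab1 ?qpi1 //.
  by rewrite mulr0n subrr mulr0 expgF0 sec1 qpi1.
pose h := [~ bx i0 0%R, bx i0 q]; have h0 : lab h = 0%R by exact: labR.
exists (s * h ^ (a ^+ (q *+ k)%R)); split=> [||y].
- by rewrite labM s0 labJ h0 addr0.
- by rewrite qpiM sk pi_conj ?pi_bxR ?expgSr //; exact: gam3_bxR.
rewrite secM0 // secJ // sec_rtX conjg1 lab_rtF qpiM sE qpi3_sec_bxR.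
rewrite -(expgFD p_pr (qpi3p i0)) -mulrDr subr_eq0 subr_eq -mulrS.
by rewrite addrA subrK.
Qed.

(** By [pi_sec] the class modulo [cl (gam 4)] depends only on sections modulo [gam 3]. A telescoped
    product of commutators at distance q, raised to the power e(q')/e(q), has the same sections as
    the commutator at distance q'. The exponents of [b,z] differ by the factor e(q')/e(q), which is
    not 1 for suitable q and q'. *)
Lemma cl4_bz : cl (gam 4) [~ b, z].
Proof.
have [q [q' [q0 q'0 eqq' eq]]] : exists q q', [/\ q != 0, q' != 0, e q != e q' & e q != 0]%R.
  have [t [t' [t0 t'0 ett']]] := nonconst; have [et|et] := eqVneq (e t) 0%R; last by exists t, t'.
  by exists t', t; rewrite eq_sym in ett'; split=> //; rewrite -et.
pose r := (e q' / e q)%R; apply/qpi_id.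
have [s [s0 sk sE]] := pi_telescope q (q' / q)%R.
have qk : (q *+ (q' / q)%R = q')%R by rewrite -mulr_natr natr_Zp mulrC divfK.
have : pi (s ^+ r) = pi [~ bx i0 0%R, bx i0 q'].
  apply: pi_sec => [||y]; [by rewrite labX s0 mul0rn | exact: labR |].
  rewrite secX0 // qpiX sE qk qpi3_sec_bxR -(expgFM p_pr (qpi3p i0)).
  by rewrite mulrAC [(e q * r)%R]mulrC divfK.
rewrite qpiX sk pi_bxR -!(expgFM p_pr pi_bzp) [(q * _)%R]mulrC divfK // => CE.
apply: (expgF_inv p_pr pi_bzp) (_ : (q' * r - q')%R != 0%R) _.
  rewrite -[X in (_ - X)%R]mulr1 -mulrBr mulf_neq0 // subr_eq0.
  by apply: contraNneq eqq' => r1; rewrite -[e q']mulr1 -(mulfV eq) mulrCA -/r r1 mulr1.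
by rewrite (expgFD p_pr pi_bzp) (expgFN p_pr pi_bzp) CE mulgV.
Qed.

Lemma dSt_cl4 s : dSt s -> cl (gam 4) s.
Proof.
apply: (@stab1_comm _ _ F (cl (gam 4))) => i j x y; rewrite (single i i0) (single j i0).
have -> : [~ bx i0 x, bx i0 y] = [~ bx i0 0%R, bx i0 (y - x)%R] ^ (a ^+ x).
  by rewrite conjRg !bxJ add0r subrK.
apply: nsubJ; apply/qpi_id; rewrite pi_bxR.
by have /qpi_id -> := cl4_bz; rewrite expg1n.
Qed.

(** With one generator the vanishing augmentations of the sections are the exponents themselves, so
    s lies in the derived subgroup of St(1). *)
Lemma cl4_St3 s : stab S 3 s -> cl (gam 4) s.
Proof.
move=> s3; have s0 := stab_lab s3; have [n sn] := repB_exists F s0.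
have s2 y : stab S 2 (sec s y) by have /stabS[_] := s3.
have n0 : forall x, (\sum_i n i x = 0)%R.
  apply: (sec_augf0 fE) s0 sn (fun y => stab_lab (s2 y)) _ => y.
  by have [] := stab2_augf_derf fE (s2 y).
have ni i x : n i x = 0%R.
  rewrite -(n0 x) (big_only1 i) // => j ji; by rewrite (single j i) eqxx in ji.
apply: dSt_cl4; apply/qpi_id; rewrite sn; apply/qpi_id.
apply: nsub_prod => x; apply: nsub_prod => i; rewrite ni expgF0; exact: nsub1.
Qed.

End SingleGenerator.
End SymmetricNonconstant.

(** * The constant vector: the closure of [[gam 3], [kerF F]] *)

Definition cst p (y : 'F_p) : 'F_p := (y != 0)%:R%R.

Section Constant.
Variables (p : nat) (S : ssgroup p) (F : family S).
Hypothesis fE : forall i y, fe (f := F) i y = cst y.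
Hypothesis p_odd : odd p.
Hypothesis G3 : injmap (gam 3 : nsub S) (gam 3).
Implicit Types (g h k s t w : S) (x y : 'F_p) (i j : fI F).
Local Notation p_pr := (ss_prime S).
Local Notation a := (rt S).
Local Notation K := (kerF F).
Local Notation J := (ncomm (gam 3) K).
Local Notation Jc := (cl J).
Local Notation pi := (qpi Jc).
Local Notation z i := [~ fb (f := F) i, a].

Lemma cstN y : cst (- y)%R = cst y.
Proof. by rewrite /cst oppr_eq0. Qed.

Lemma cst1 y : y != 0%R -> a ^+ cst y = a.
Proof. by rewrite /cst => ->; rewrite expgF1. Qed.

Lemma kerF_gam2 g : gam 2 g -> K g.
Proof. by move=> g2; apply: mem_nclo; left. Qed.

Lemma kerF_fb i : qpi K (fb i) = qpi K a.
Proof.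
rewrite -[fb i](mulgVK a) qpiM.
have /qpi_id -> : K (fb i * a^-1) by apply: mem_nclo; right; exists i.
by rewrite mul1g.
Qed.

Lemma kerF_bx i x : qpi K (bx i x) = qpi K a.
Proof.
rewrite -(kerF_fb i); apply/esym/qpiP/kerF_gam2; exact: gam2_conj.
Qed.

(** Modulo K every [fb i] equals a, and the sections of [bx i y] are [fb i] or a. *)
Lemma kerF_sec s x : lab s = 0%R -> qpi K (sec s x) = qpi K s.
Proof.
move=> s0; suff [] : lab s = 0%R /\ qpi K (sec s x) = qpi K s by [].
apply: (stab1_ind (F := F) (P := fun s => lab s = 0%R /\ qpi K (sec s x) = qpi K s)) s0.
  by rewrite lab1 sec1.
move=> {}s i y [s0 sE]; rewrite labM s0 lab_bx addr0 secM0 // (qpiM _ s) (qpiM _ (sec s x)) sE; split=> //.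
congr (_ * _); rewrite kerF_bx sec_bx fE; have [_|yx] := eqVneq x y; first exact: kerF_fb.
by rewrite cst1 // subr_eq0.
Qed.

Lemma gam3_commute t k : gam 3 t -> K k -> commute (pi t) (pi k).
Proof. by move=> t3 kK; apply/qpi_commute/sub_cl; exact: mem_ncomm. Qed.

Lemma gam3_abelian s t : gam 3 s -> gam 3 t -> commute (pi s) (pi t).
Proof. by move=> s3 t3; apply: gam3_commute => //; exact/kerF_gam2/gam_sub. Qed.

Lemma pi_comm_kerF t g h : gam 3 t -> qpi K g = qpi K h -> pi [~ t, g] = pi [~ t, h].
Proof.
move=> t3 /qpiP gh; rewrite -(mulKVg g h) commgMr [RHS]qpiM [X in _ * X]qpiJ.
have /qpi_id -> : Jc [~ t, g^-1 * h] by apply: sub_cl; exact: mem_ncomm.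
by rewrite mul1g; apply/esym/conjg_fixP/commgP/gam3_commute => //; exact: nsubRl.
Qed.

Lemma pi_conj_kerF t g h : gam 3 t -> qpi K g = qpi K h -> pi (t ^ g) = pi (t ^ h).
Proof.
move=> t3 gh; have tg u : t ^ u = t * [~ t, u] by rewrite commgEl mulKVg.
by rewrite (tg g) (tg h) (qpiM _ t) (pi_comm_kerF t3 gh) -qpiM.
Qed.

Lemma injmap_J : injmap J J.
Proof.
apply: (pull_injmap (F := F)); apply: ncomm_min => t k t3 kK.
have [s s3 is_] := G3 0%R t3; have [h h0 hk] := fractal F k 0%R.
have := injpR h0 is_; rewrite hk => ist; apply: pull1 ist _; apply: mem_ncomm => //.
by apply/qpi_id; rewrite -(kerF_sec 0%R h0) hk; apply/qpi_id.
Qed.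

Definition inj0 t : S :=
  if pselect (exists s, injp 0%R t s) is left ex then projT1 (cid ex) else 1.

(** On [gam 3] this is a homomorphism compatible with conjugation ([thM], [thJ]) that kills [Jc]
    ([th_Jc]). The goal is that it kills every copy [inj0 t], i.e. that copying twice leads into
    [Jc]. *)
Definition th t := pi (inj0 t).

Lemma inj0P t : gam 3 t -> injp 0%R t (inj0 t).
Proof.
move=> t3; rewrite /inj0; case: pselect => [ex|[]]; first by case: cid.
by have [s _ is_] := G3 0%R t3; exists s.
Qed.

Lemma inj0_gam3 t : gam 3 t -> gam 3 (inj0 t).
Proof. by move=> t3; exact: injmap_mem G3 t3 (inj0P t3). Qed.

Lemma thE t s : gam 3 t -> injp 0%R t s -> th t = pi s.
Proof. by move=> t3 is_; congr pi; exact: injp_uniq (inj0P t3) is_. Qed.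

Lemma thM s t : gam 3 s -> gam 3 t -> th (s * t) = th s * th t.
Proof.
by move=> s3 t3; rewrite -qpiM; apply: thE (injpM (inj0P s3) (inj0P t3)); exact: nsubM.
Qed.

Lemma thV t : gam 3 t -> th t^-1 = (th t)^-1.
Proof.
by move=> t3; rewrite -qpiV; apply: thE (injpV (inj0P t3)); exact: nsubV.
Qed.

Lemma thX t n : gam 3 t -> th (t ^+ n) = th t ^+ n.
Proof.
by move=> t3; rewrite -qpiX; apply: thE (injpX n (inj0P t3)); exact: nsubX.
Qed.

Lemma thJ t g : gam 3 t -> th (t ^ g) = th t ^ pi g.
Proof.
move=> t3; have [h h0 hg] := fractal F g 0%R.
have := injpJ0 h0 (inj0P t3); rewrite hg => ih.
rewrite (thE _ ih); last exact: nsubJ.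
by rewrite -qpiJ; apply: pi_conj_kerF; [exact: inj0_gam3 | rewrite -(kerF_sec 0%R h0) hg].
Qed.

Lemma thR t g : gam 3 t -> th [~ t, g] = [~ th t, pi g].
Proof.
by move=> t3; rewrite commgEl thM ?thV ?thJ //; [exact: nsubV | exact: nsubJ].
Qed.

Lemma th_Jc t : gam 3 t -> Jc t -> th t = 1.
Proof. by move=> t3 tJ; apply/qpi_id; exact: cl_injp injmap_J (inj0P t3) tJ. Qed.

Lemma th_kerF t k : gam 3 t -> K k -> commute (th t) (pi k).
Proof. by move=> t3; apply: gam3_commute; exact: inj0_gam3. Qed.

(* The commutator of an element supported on the letters [0] and [y], with an element of the
   level stabiliser. *)
Lemma pi_comm2 H c c' y s : gam 2 c -> gam 2 c' -> y != 0%R -> lab H = 0%R ->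
    (forall x, sec H x = if x == 0%R then c else if x == y then c' else 1) -> lab s = 0%R ->
  pi [~ H, s] = th [~ c, sec s 0%R] * th [~ c', sec s y] ^ pi (a ^+ y).
Proof.
move=> c2 c'2 y0 H0 HE s0.
have c3 : gam 3 [~ c, sec s 0%R] by exact: gamS.
have c'3 : gam 3 [~ c', sec s y] by exact: gamS.
have i0 := inj0P c3; have := injp_rt y (inj0P c'3); rewrite add0r => iy.
rewrite -qpiJ -qpiM; congr pi; have [l0 _ _] := i0; have [ly _ _] := iy.
apply: sec_ext; first by rewrite labR labM l0 ly addr0.
move=> x; rewrite secR0 // secM0 // (injp_sec _ i0) (injp_sec _ iy) HE.
have [->|x0] := eqVneq x 0%R; first by rewrite [0%R == y]eq_sym (negPf y0) mulg1.
by have [->|xy] := eqVneq x y; rewrite mul1g // comm1g.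
Qed.

Lemma two_nz : (2%:R != 0 :> 'F_p)%R.
Proof.
rewrite -(dvdn_pcharf (pchar_Fp p_pr)) (dvdn_prime2 p_pr) //.
by apply/eqP => p2; have := p_odd; rewrite p2.
Qed.

Lemma N1_neq1 : (-1 != 1 :> 'F_p)%R.
Proof. by rewrite -subr_eq0 -opprD oppr_eq0 two_nz. Qed.

Lemma sec_bxN1 i x : (x == 0%R) || (x == 1%R) -> sec (bx i (-1)%R) x = a.
Proof.
move=> x01; have xN : x != (-1)%R.
  by case/orP: x01 => /eqP->; rewrite eq_sym ?oppr_eq0 ?oner_neq0 ?N1_neq1.
by rewrite sec_bx (negPf xN) fE cst1 // subr_eq0.
Qed.

Lemma gam2_z i : gam 2 (z i).
Proof. exact: (@gamS _ 1). Qed.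

Lemma gam3_z i g : gam 3 [~ z i, g].
Proof. exact/gamS/gam2_z. Qed.

Lemma th_zV c g : gam 2 c -> th [~ c^-1, g] = (th [~ c, g])^-1.
Proof.
move=> c2; have c3 : gam 3 [~ c, g] by exact: gamS.
rewrite commgVl thV ?thJ //; last exact: nsubJ.
congr (_^-1); apply/conjg_fixP/commgP/th_kerF => //.
by apply: kerF_gam2; exact: nsubV.
Qed.

Lemma pi_bxR1 i s : lab s = 0%R -> pi [~ [~ bx i 0%R, bx i 1%R], s] =
  th [~ z i, sec s 0%R] * (th [~ z i, sec s 1%R])^-1 ^ pi a.
Proof.
move=> s0; rewrite (@pi_comm2 _ (z i) (z i)^-1 1%R) ?oner_neq0 ?labR //.
- by rewrite expgF1 th_zV //; exact: gam2_z.
- exact: gam2_z.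
- exact/nsubV/gam2_z.
- move=> x; rewrite (sec_bxR fE cstN) (negPf (oner_neq0 _)).
  by rewrite (cst1 (oner_neq0 _)).
Qed.

(** Commutators of [[~ bx i 0, bx i 1]] with [bx j 0] and [bx j (-1)] agree modulo [Jc], as the
    latter two agree modulo K; they differ only in the section used at 0, which is [fb j] or a. *)
Lemma th_zb i j : th [~ z i, fb j] = th [~ z i, a].
Proof.
have := pi_bxR1 i (lab_bx j (-1)%R); rewrite !sec_bxN1 ?eqxx ?orbT // => H1.
have := pi_bxR1 i (lab_bx j 0%R).
rewrite !sec_bx eqxx (negPf (oner_neq0 _)) fE subr0 (cst1 (oner_neq0 _)).
rewrite (pi_comm_kerF (gam3_bxR i 1%R) (etrans (kerF_bx j 0%R) (esym (kerF_bx j (-1)%R)))) H1.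
by move/mulIg.
Qed.

Local Notation Zc := (ncent Jc).

Lemma gam3_centre w : gam 3 w -> Jc [~ w, a] -> Zc w.
Proof.
move=> w3 wa; apply: (ncent_gen (F := F)) => // i; apply/qpi_id.
by rewrite (pi_comm_kerF w3 (kerF_fb i)); apply/qpi_id.
Qed.

Lemma Jc_centre w : Jc w -> Zc w.
Proof. by move=> wJ; apply/ncentP => g; exact: nsubRl. Qed.

(** With t = [[z,b],a], the commutator [H,a] is computed from the sections of H and from H being a
    conjugate of [z,b]^-1. The comparison shows that t is congruent to a conjugate of its own copy,
    so t lies in [Jc] and the class of the copy of [z,a] commutes with a. *)
Lemma th_za_centre i : Zc (inj0 [~ z i, a]).
Proof.
have A3 := gam3_z i a; have w3 := inj0_gam3 A3; apply: gam3_centre => //.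
set A := [~ z i, a]; pose c := [~ z i, fb i]; have c3 : gam 3 c := gam3_z i (fb i).
pose t := [~ c, a]; have t3 : gam 3 t by exact: nsubRl.
pose H := [~ bx i 0%R, bx i 1%R]; have H3 : gam 3 H := gam3_bxR i 1%R.
have thAa : [~ th A, pi a] = th t by rewrite (thR _ c3) th_zb.
have Ha : pi [~ H, a] = (th t)^-1.
  rewrite -(pi_comm_kerF H3 (kerF_bx i (-1)%R)) pi_bxR1 ?lab_bx // !sec_bxN1 ?eqxx ?orbT //.
  rewrite -thAa -/A (commgEl (th A)) invgM invgK conjVg; apply: commuteV.
    by rewrite -qpiJ; apply: gam3_abelian => //; exact: nsubJ.
have HE : H = (c^-1) ^ (a ^+ (- fpos i)%R).
  apply: (canRL (conjgKV _)); rewrite -rtN opprK conjRg !bxJ add0r bx_pos invgR.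
  by rewrite addrC -bx_rt bx_pos; rewrite -[fb i ^ a](mulKVg (fb i)) -commgEl commgMr commgg conj1g mulg1.
have tE : pi (t ^ (a ^+ (- fpos i)%R)) = th t.
  have ag : a ^ (a ^+ (- fpos i)%R) = a by apply/conjg_fixP/commgP/commuteX/commute_refl.
  have HA : [~ H, a] = [~ c^-1, a] ^ (a ^+ (- fpos i)%R) by rewrite conjRg ag -HE.
  rewrite -[RHS]invgK -Ha HA commgVl -/t conjVg (qpiV _ (_ ^ _)) invgK !(qpiJ _ (_ ^ _)).
  rewrite qpiJ (qpiJ _ t c^-1); congr (_ ^ _); apply/esym/conjg_fixP/commgP.
  by apply: gam3_abelian => //; exact: nsubV.
have tJ : Jc t.
  apply: cl_fix injmap_J (inj0P t3) _ => n tn; apply: (@nsubJE _ _ _ (a ^+ (- fpos i)%R)).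
  by apply: qpi_mem (esym tE) tn => g /clP.
by apply/qpi_id; rewrite (qpiR _ (inj0 A)) -/(th A) thAa th_Jc.
Qed.

Local Notation P := (pull F Zc).

Lemma inj0_centre t : gam 3 t -> Zc t -> P t.
Proof.
move=> t3 tZ; apply: (pull1 F (inj0P t3)); have w3 := inj0_gam3 t3; apply: gam3_centre => //.
apply/qpi_id; rewrite (qpiR _ (inj0 t)) -/(th t) -thR // th_Jc //; first exact: nsubRl.
by have /ncentP := tZ.
Qed.

Lemma z_ncent i : ncent P (z i).
Proof.
have Pa : P [~ z i, a] by apply: (pull1 F (inj0P (gam3_z i a))); exact: th_za_centre.
apply: (ncent_gen (F := F)) => // j; apply: (pull1 F (inj0P (gam3_z i (fb j)))).
by apply: qpi_mem (esym (th_zb i j)) (th_za_centre i) => g; exact: Jc_centre.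
Qed.

Lemma cl3_comm_kerF c g h : gam 2 c -> cl (gam 3) c -> qpi K g = qpi K h ->
  pi [~ c, g] = pi [~ c, h].
Proof.
move=> c2 c3 /qpiP gh; rewrite -(mulKVg g h) commgMr [RHS]qpiM [X in _ * X]qpiJ.
have /qpi_id -> : Jc [~ c, g^-1 * h].
  apply/clP => n; have /clP/(_ n)/mulnsP[c' [u [c'3 un ->]]] := c3.
  rewrite commgMl; apply: nsubM; first by apply: nsubJ; apply: mulnsl; exact: mem_ncomm.
  by apply: mulnsr; exact: nsubRl.
by rewrite mul1g; apply/esym/conjg_fixP/commgP/gam3_commute => //; exact: gamS.
Qed.

(** If the positions agree, the commutator is its own copy and lies in [Jc]. Otherwise its sections
    are [z i] and the inverse of [z j], to which [z_ncent] applies. *)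
Lemma fbb_ncent i j : ncent P [~ fb i, fb j].
Proof.
set c := [~ fb i, fb j]; have c2 : gam 2 c by exact: (@gamS _ 1).
have [rij|rij] := eqVneq (fpos i) (fpos j).
  have ic := injp_bxR i j (fpos i); rewrite {3}rij !bx_pos in ic.
  have cJ : Jc c by exact: cl_fix injmap_J ic _.
  apply/ncentP => g; have c3 : gam 3 [~ c, g] by exact: gamS.
  apply: (pull1 F (inj0P c3)); apply: Jc_centre; apply/qpi_id.
  by apply: th_Jc => //; exact: nsubRl.
have cZ s : lab s = 0%R -> Zc [~ c, s].
  move=> s0; have /ncentP/(_ (sec s (fpos i))) := z_ncent i.
  have /nsubV/ncentP/(_ (sec s (fpos j))) := z_ncent j.
  set t' := [~ _, sec s (fpos j)] => Pt'; set t := [~ _, sec s (fpos i)] => Pt.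
  have t3 : gam 3 t by exact: gam3_z.
  have t'3 : gam 3 t' by apply: gamS; apply: nsubV; exact: gam2_z.
  have [w _ iw] := G3 (fpos i) t3; have [w' _ iw'] := G3 (fpos j) t'3.
  have -> : [~ c, s] = w * w'.
    have [l0 _ _] := iw; have [l'0 _ _] := iw'.
    apply: sec_ext; first by rewrite labR labM l0 l'0 addr0.
    move=> x; rewrite secR0 ?labR // secM0 // (injp_sec _ iw) (injp_sec _ iw').
    rewrite secR0 ?lab_fb // !sec_fb !fE; have [->|xi] := eqVneq x (fpos i).
      by rewrite (negPf rij) mulg1 cst1 // subr_eq0.
    have [->|xj] := eqVneq x (fpos j).
      by rewrite mul1g cst1 ?subr_eq0 1?eq_sym // /t' invgR.
    have -> : [~ a ^+ cst (x - fpos i)%R, a ^+ cst (x - fpos j)%R] = 1.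
      by apply/eqP/commgP/commuteX2/commute_refl.
    by rewrite comm1g mulg1.
  by apply: nsubM; [exact: pull_inj Pt iw | exact: pull_inj Pt' iw'].
have ca : Zc [~ c, a].
  have := cZ (fb i) (lab_fb i); apply: qpi_mem (cl3_comm_kerF c2 (cl3_fb i j G3) (kerF_fb i)) => g.
  exact: Jc_centre.
apply: (ncent_gen (F := F)) => [|k]; apply: inj0_centre => //; try exact: gamS.
by apply: cZ; exact: lab_fb.
Qed.

Lemma injmap_centre : injmap (gam 3 : nsub S) Zc.
Proof.
apply: (pull_injmap (F := F)); apply: ncomm_min => t g t2 _.
suff: ncent P t by move/ncentP.
apply: (fam_ind_comm (F := F)) t2 => [i|i j]; last exact: fbb_ncent.
by rewrite -invgR; apply: nsubV; exact: z_ncent.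
Qed.

Lemma th_centre t u : gam 3 t -> commute (th t) u.
Proof.
move=> t3; have [v <-] := qpi_surj u; apply/qpi_commute.
move: v; apply/ncentP; exact: injmap_mem injmap_centre t3 (inj0P t3).
Qed.

Lemma th_conj t u : gam 3 t -> th t ^ u = th t.
Proof. by move=> t3; apply/conjg_fixP/commgP/th_centre. Qed.

Lemma injmap_gam4_Jc : injmap (gam 4 : nsub S) Jc.
Proof.
apply: injmapS (injmap_ncomm F injmap_centre) => //.
by apply: ncomm_min => t g /ncentP tZ _; exact: tZ.
Qed.

Lemma th_gam4 t : gam 4 t -> th t = 1.
Proof.
move=> t4; have t3 : gam 3 t := gam_sub t4.
by apply/qpi_id; exact: injmap_mem injmap_gam4_Jc t4 (inj0P t3).
Qed.

Lemma th_fbb i j g : th [~ [~ fb i, fb j], g] = 1.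
Proof.
have c3 : gam 3 [~ [~ fb i, fb j], g] by apply: gamS; exact: (@gamS _ 1).
apply/qpi_id/cl_cl; apply: cl_injp injmap_gam4_Jc (inj0P c3) _.
by apply: (cl_comm (J := gam 3)) (cl3_fb i j G3) => ? ?; exact: gamS.
Qed.

(** Since [th] kills [gam 4], this is bilinear and alternating. *)
Definition form g h := th [~ [~ g, h], a].

Lemma gam2R g h : gam 2 [~ g, h].
Proof. exact: (@gamS _ 1). Qed.

Lemma th_comm_M t t' : gam 2 t -> gam 2 t' -> th [~ t * t', a] = th [~ t, a] * th [~ t', a].
Proof.
move=> t2 t'2; have t3 : gam 3 [~ t, a] by exact: gamS.
rewrite commgMl thM; [|exact: nsubJ|exact: gamS].
by rewrite thJ // th_conj.
Qed.

Lemma th_comm_J t g : gam 2 t -> th [~ t ^ g, a] = th [~ t, a].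
Proof.
move=> t2; rewrite -[t ^ g](mulKVg t) -commgEl th_comm_M //; last exact: nsubRl.
by rewrite [X in _ * X]th_gam4 ?mulg1 //; apply: gamS; exact: gamS.
Qed.

Lemma formMl g g' h : form (g * g') h = form g h * form g' h.
Proof.
rewrite /form commgMl th_comm_M ?th_comm_J //; try exact: gam2R.
by apply: nsubJ; exact: gam2R.
Qed.

Lemma formMr g h h' : form g (h * h') = form g h' * form g h.
Proof.
rewrite /form commgMr th_comm_M ?th_comm_J //; try exact: gam2R.
by apply: nsubJ; exact: gam2R.
Qed.

Lemma th1 : th 1 = 1.
Proof. by apply: th_gam4; exact: nsub1. Qed.

Lemma formVl g h : form g^-1 h = (form g h)^-1.
Proof.
apply: (mulgI (form g h)); rewrite -formMl !mulgV /form comm1g comm1g.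
exact: th1.
Qed.

Lemma formVr g h : form g h^-1 = (form g h)^-1.
Proof.
apply: (mulgI (form g h)); rewrite -formMr mulgV mulVg /form commg1 comm1g.
exact: th1.
Qed.

Lemma form_aa : form a a = 1.
Proof. by rewrite /form commgg comm1g th1. Qed.

Lemma form_fbb i j : form (fb i) (fb j) = 1.
Proof. exact: th_fbb. Qed.

Lemma form_swap g h : form h g = (form g h)^-1.
Proof.
rewrite /form -(invgR g h); apply: (mulgI (th [~ [~ g, h], a])); rewrite mulgV.
by rewrite -th_comm_M ?mulgV ?comm1g ?th1 //; [exact: gam2R | apply: nsubV; exact: gam2R].
Qed.

Local Notation E i := (form (fb i) a).

Lemma form_p i : E i ^+ p = 1.
Proof.
suff EX n : form (fb i) (a ^+ n) = E i ^+ n by rewrite -EX rt_p /form commg1 comm1g th1.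
elim: n => [|n IHn]; first by rewrite expg0 /form commg1 comm1g th1.
by rewrite expgS formMr IHn -expgSr.
Qed.

Lemma form_comm g h u : commute (form g h) u.
Proof. by apply: th_centre; apply: gamS; exact: gam2R. Qed.

(** Commutators of u with St(1) have sections in [gam 3] and are central by [injmap_centre]; a is no
    exception, because on [gam 3] it acts modulo [Jc] as any [fb i] does. *)
Lemma sections_ncent u : gam 3 u -> (forall x, gam 2 (sec u x)) -> ncent Zc u.
Proof.
move=> u3 u2; have u0 := gam2_lab (gam_sub u3).
have Zus s : lab s = 0%R -> Zc [~ u, s].
  move=> s0.
  have [|s' [s'Z s'0 s'E]] := injmap_prod injmap_centre (j := fun x => [~ sec u x, sec s x]).
    by move=> x; exact: gamS.
  suff -> : [~ u, s] = s' by [].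
  by apply: sec_ext => [|x]; [rewrite labR s'0 | rewrite secR0 // s'E].
apply: (ncent_gen (F := F)) => [|i]; last exact/Zus/lab_fb.
have := Zus _ (lab_fb (fi0 F)); apply: qpi_mem (pi_comm_kerF u3 (kerF_fb _)) => g.
exact: Jc_centre.
Qed.

Local Notation zeta i := [~ bx (F := F) i 0%R, a].

Lemma sec_zeta i x : sec (zeta i) x =
  if x == 0%R then (fb i)^-1 * a else if x == 1%R then a^-1 * fb i else 1.
Proof.
rewrite commgEl bx_rt add0r secM0 ?labV ?lab_bx ?oppr0 // secV0 ?lab_bx // !sec_bx !fE.
have [->|x0] := eqVneq x 0%R.
  by rewrite eq_sym (negPf (oner_neq0 _)) cst1 // subr_eq0 eq_sym oner_neq0.
rewrite subr0 cst1 //; have [_|x1] := eqVneq x 1%R; first by [].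
by rewrite cst1 ?mulVg // subr_eq0.
Qed.

(** Modulo [Zc] the commutator depends only on [bx i 0] modulo K, which is the same for all i; for i
    = j it is trivial. *)
Lemma zeta_comm_centre i j : Zc [~ zeta j, zeta i].
Proof.
set t := zeta j; have t2 : gam 2 t by exact: gam2R.
pose m := [~ t, a^-1]; have m3 : gam 3 m by exact: gamS.
have tE (k : fI F) : qpi Zc [~ t, zeta k] = qpi Zc ([~ m, bx k 0%R] ^ a).
  set b := bx k 0%R; have b0 : lab b = 0%R by exact: lab_bx.
  have U u : commute (qpi Zc [~ t, b]) u.
    have [v <-] := qpi_surj u; apply/qpi_commute; move: v; apply/ncentP.
    apply: sections_ncent; first exact: gamS.
    by move=> x; apply: dSt_sec; apply: mem_ncomm; apply/stab1 => //; exact: gam2_lab.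
  have -> : [~ t, zeta k] = [~ t * m, b] ^ a * [~ t, b^-1] ^ (b ^ a).
    rewrite (commgEl b a) commgMr; congr (_ * _).
    by rewrite /m (commgEl t a^-1) mulKVg conjRg conjgKV.
  have -> : [~ t, b^-1] = ([~ t, b] ^ b^-1)^-1 by rewrite !(commgEl, conjgE, gnorm).
  have UJ u : qpi Zc [~ t, b] ^ u = qpi Zc [~ t, b] by apply/conjg_fixP/commgP/U.
  rewrite commgMl (qpiM _ (_ ^ a)) !(qpiJ _ _ a) (qpiM _ ([~ t, b] ^ m)) (qpiJ _ [~ t, b] m) UJ.
  rewrite (qpiJ _ _ (b ^ a)) (qpiV _ (_ ^ b^-1)) (qpiJ _ [~ t, b] b^-1) UJ conjVg UJ conjMg UJ.
  by rewrite (U (qpi Zc [~ m, b] ^ qpi Zc a)) mulgK.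
apply/qpi_id; rewrite tE.
have bij : qpi K (bx i 0%R) = qpi K (bx j 0%R) by rewrite !kerF_bx.
have /qpiP/Jc_centre/qpiP mE := pi_comm_kerF m3 bij.
by rewrite qpiJ mE -qpiJ -tE commgg qpi1.
Qed.

(** The commutator of the two zetas is central; commuting it with an element whose sections at 0 and
    1 are a gives (E i / E j)^2 = 1, and p is odd. *)
Lemma form_const i j : E i = E j.
Proof.
have ZX := zeta_comm_centre i j; set X := [~ zeta j, zeta i] in ZX.
have XE x : sec X x = if x == 0%R then [~ (fb j)^-1 * a, (fb i)^-1 * a]
    else if x == 1%R then [~ a^-1 * fb j, a^-1 * fb i] else 1.
  rewrite secR0 ?labR // !sec_zeta; case: eqP => // _; case: eqP => // _.
  by rewrite commgg.
have := @pi_comm2 X _ _ 1%R (bx i (-1)%R) (gam2R _ _) (gam2R _ _) (oner_neq0 _) (labR _ _) XE (lab_bx _ _).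
have /ncentP/(_ (bx i (-1)%R))/qpi_id -> := ZX.
rewrite !sec_bxN1 ?eqxx ?orbT // th_conj; last by apply: gamS; exact: gam2R.
rewrite -!/(form _ _) !formMl !formMr !formVl !formVr !form_aa !form_fbb !invgK !(form_swap (fb _) a).
rewrite !mulg1 !mul1g !invgK => E1; pose u := E i * (E j)^-1.
have up : u ^+ p = 1.
  rewrite expgMn; last by apply: commuteV; exact: form_comm.
  by rewrite expVgn !form_p invg1 mulg1.
have u2 : u ^+ (2%:R : 'F_p)%R = 1.
  rewrite (expgFnat p_pr up) expgS expg1 [RHS]E1 /u; congr (_ * _).
  by apply: commuteV; exact: form_comm.
have := expgF_inv p_pr up two_nz u2; rewrite /u => /(congr1 (mulg^~ (E j))).
by rewrite mulgKV mul1g.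
Qed.

Local Notation i0 := (fi0 F).
Local Notation E0 := (E i0).
Local Notation w := (inj0 [~ z i0, a]).

Lemma gam3_w : gam 3 w.
Proof. exact/inj0_gam3/gam3_z. Qed.

Lemma pw_subproof : let P t := gam 3 t /\ exists l : 'F_p, th t = E0 ^+ l in
  [/\ P 1, forall s t, P s -> P t -> P (s * t), forall s, P s -> P s^-1
    & forall s t, P s -> P (s ^ t)].
Proof.
have Ep := form_p i0; split=> [|s t [s3 [l sl]] [t3 [l' tl]]|s [s3 [l sl]]|s t [s3 [l sl]]].
- by split; [exact: nsub1 | exists 0%R; rewrite th1].
- split; first exact: nsubM.
  by exists (l + l')%R; rewrite thM // sl tl (expgFD p_pr Ep).
- split; first exact: nsubV.
  by exists (- l)%R; rewrite thV // sl (expgFN p_pr Ep).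
- by split; [exact: nsubJ | exists l; rewrite thJ // th_conj].
Qed.

Definition pw : nsub S :=
  let: And4 P1 PM PV PJ := pw_subproof in NSub P1 PM PV PJ.

Lemma pwP t : pw t <-> gam 3 t /\ exists l : 'F_p, th t = E0 ^+ l.
Proof. by rewrite /pw; case: pw_subproof. Qed.

(** On the generators [[~ z i, a]] and [[~ z i, fb j]] of [gam 3] the value is [E0], and on
    commutators with [[~ fb i, fb j]] it is 1. *)
Lemma th_pw t : gam 3 t -> exists l : 'F_p, th t = E0 ^+ l.
Proof.
suff : gam 3 t -> pw t by move=> h /h/pwP[].
apply: ncomm_min => {}t g t2 _; suff: ncent pw t by move/ncentP.
apply: (fam_ind_comm (F := F)) t2 => [i|i j].
  rewrite -invgR; apply: nsubV; apply: (ncent_gen (F := F)) => [|j]; apply/pwP.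
    by split; [exact: gam3_z | exists 1%R; rewrite expgF1; exact: form_const].
  split; [exact: gam3_z | exists 1%R; rewrite expgF1 th_zb; exact: form_const].
apply/ncentP => h; apply/pwP; split; first by apply: gamS; exact: gam2R.
by exists 0%R; rewrite th_fbb expgF0.
Qed.

(* Either [theta] kills the generator of its own image or that generator is fixed up to a
   unit, in which case it is trivial anyway. *)
Lemma th_w : th w = 1.
Proof.
have Ep := form_p i0; have [l wl] := th_pw gam3_w.
have [l0|l0] := eqVneq l 0%R; first by rewrite wl l0 expgF0.
suff wJ : Jc w by exact: th_Jc gam3_w wJ.
apply: cl_fix injmap_J (inj0P gam3_w) _ => n; set M := mulns J (stab S n) => wM.
have JM g : Jc g -> M g by move/clP/(_ n).
have wlM : M (w ^+ l) by apply: qpi_mem JM _ wM; rewrite qpiX.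
have wp : qpi M w ^+ p = 1.
  by rewrite -qpiX; apply/qpi_id/JM/qpi_id; rewrite qpiX.
by apply/qpi_id; apply: (expgF_inv p_pr wp) l0 _; rewrite -qpiX; apply/qpi_id.
Qed.

Lemma th_inj0 t : gam 3 t -> th (inj0 t) = 1.
Proof.
move=> t3; have [l tl] := th_pw t3; have w3 := gam3_w.
have t'3 := inj0_gam3 t3; have wl3 : gam 3 (w ^+ l) by exact: nsubX.
rewrite -(mulKVg (w ^+ l) (inj0 t)) thM ?thX ?th_w ?expg1n ?mul1g //; last first.
  by apply: nsubM => //; exact: nsubV.
apply: th_Jc; first by apply: nsubM => //; exact: nsubV.
by apply/qpiP; rewrite qpiX; exact: esym tl.
Qed.

(** St(4) lies in the closure of [gam 3], and two copyings, one level each, take [gam 3] into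
    [Jc]. *)
Lemma cl_kerF_St6 s : stab S 6 s -> Jc s.
Proof.
have i2 : injmap (pull F Jc) Jc.
  by apply: (pull_injmap (F := F)).
have i1 : injmap (gam 3 : nsub S) (pull F Jc).
  apply: (@injmap0 _ _ _ _ 0%R) => t t3; exists (inj0 t); last exact: inj0P.
  apply: (pull1 F (inj0P (inj0_gam3 t3))); apply/qpi_id; exact: th_inj0.
move=> s6; apply: cl_cl; move: s s6; apply: cl_St i2 _; apply: cl_St i1 _ => s.
exact: (cl3_St4 fE cstN).
Qed.


End Constant.

Lemma prodg_perm (gT : groupType) (I : eqType) (f : I -> gT) (r r' : seq I) :
  (forall i j, commute (f i) (f j)) -> perm_eq r r' ->
  \prod_(i <- r) f i = \prod_(i <- r') f i.
Proof.
move=> fc rr'; pose P s := \prod_(i <- r) f i = \prod_(i <- s) f i.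
apply: (@catCA_perm_ind _ P) rr' _ => [s1 s2 s3|]; last by [].
rewrite /P !big_cat /= !mulgA => ->; congr (_ * _).
apply: (big_ind (fun u => commute u _)) => [|u v uc vc|i _].
- by apply: commute_sym; exact: commute1.
- by apply/commute_sym/commuteM; exact: commute_sym.
- by apply: (big_ind (fun u => commute _ u)) => [|u v|j _]; [exact: commute1 | exact: commuteM | exact: fc].
Qed.

Lemma prodg_shift (gT : groupType) p (f : 'F_p -> gT) (l : 'F_p) :
  (forall x y, commute (f x) (f y)) -> \prod_x f (x - l)%R = \prod_x f x.
Proof.
move=> fc; rewrite -[LHS](big_map (fun x => x - l)%R predT f).
apply: prodg_perm => //; apply: uniq_perm; rewrite ?map_inj_uniq ?index_enum_uniq //.
  exact: addIr.
move=> x; rewrite mem_index_enum; apply/mapP; exists (x + l)%R; rewrite ?mem_index_enum //.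
by rewrite addrK.
Qed.

Section ConjCentre.
Variables (gT : groupType) (M : nsub gT) (y : gT).

Lemma jcent_subproof :
  let P t := forall g, M [~ t, y ^ g] in
  [/\ P 1, forall s t, P s -> P t -> P (s * t), forall s, P s -> P s^-1
    & forall s t, P s -> P (s ^ t)].
Proof.
split=> [g|s t Ps Pt g|s Ps g|s t Ps g].
- by rewrite comm1g; exact: nsub1.
- by rewrite commgMl; apply: nsubM; [exact/nsubJ/Ps | exact: Pt].
- by rewrite commgVl; apply/nsubV/nsubJ.
- have -> : [~ s ^ t, y ^ g] = [~ s, y ^ (g * t^-1)] ^ t by rewrite conjRg -conjgM mulgVK.
  exact: nsubJ.
Qed.

Definition jcent : nsub gT :=
  let: And4 P1 PM PV PJ := jcent_subproof in NSub P1 PM PV PJ.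

Lemma jcentP t : jcent t <-> forall g, M [~ t, y ^ g].
Proof. by rewrite /jcent; case: jcent_subproof. Qed.

End ConjCentre.

(** * A single generator with constant vector does not branch over [gam 3] *)

Section ConstantSingle.
Variables (p : nat) (S : ssgroup p) (F : family S).
Hypothesis fE : forall i y, fe (f := F) i y = cst y.
Hypothesis p_odd : odd p.
Hypothesis single : forall i j : fI F, i = j.
Implicit Types (g h k s t : S) (x y l : 'F_p).
Local Notation p_pr := (ss_prime S).
Local Notation a := (rt S).
Local Notation i0 := (fi0 F).
Local Notation b := (fb i0).
Local Notation K := (kerF F).
Local Notation M := (ncomm (gam 2) K).

(** K is generated by [gam 2], central in it modulo M, and by the conjugates of y = b a^-1, which
    agree modulo [gam 2]. *)
Lemma kerF_commute k k' : K k -> K k' -> commute (qpi M k) (qpi M k').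
Proof.
pose y := b * a^-1; have yK : K y by apply: mem_nclo; right; exists i0.
have Mr c t : gam 2 c -> K t -> M [~ c, t] by exact: mem_ncomm.
have Ml c t : gam 2 c -> K t -> M [~ t, c].
  by move=> c2 tK; rewrite -invgR; apply: nsubV; exact: Mr.
have Ky t : K t -> jcent M y t.
  apply: nclo_min => u [u2|[i ->]]; apply/jcentP => g; first by apply: Mr => //; exact: nsubJ.
  rewrite (single i i0) -/y -[y ^ g](mulKVg y) -commgEl commgMr commgg conj1g mulg1.
  by apply: Ml => //; exact: (@gamS _ 1).
move=> kK k'K; apply/qpi_commute.
suff : jcent M k' k by move/jcentP/(_ 1); rewrite conjg1.
move: kK; apply: nclo_min => u [u2|[i ->]]; apply/jcentP => g; first by apply: Mr => //; exact: nsubJ.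
rewrite (single i i0) -/y -invgR; apply: nsubV.
by have /Ky/jcentP/(_ 1) := nsubJ g k'K; rewrite conjg1.
Qed.

Lemma qpi_conj_kerF k g h : K k -> qpi K g = qpi K h -> qpi M (k ^ g) = qpi M (k ^ h).
Proof.
move=> kK /qpiP gh; rewrite -(mulKVg g h) conjgM [RHS]qpiJ.
by apply/esym/conjg_fixP/commgP/kerF_commute => //; exact: nsubJ.
Qed.

Lemma kerF_sec_const g x : qpi K (sec g x) = qpi K (sec g 0%R).
Proof.
pose h := g * (a ^+ lab g)^-1.
have h0 : lab h = 0%R by rewrite labM labV lab_rtF subrr.
have secE y : sec g y = sec h y by rewrite secM secV sec_rtX invg1 mulg1.
by rewrite !secE !(kerF_sec fE).
Qed.

Lemma prodsec_subproof :
  let P s := [/\ lab s = 0%R, forall x, K (sec s x) & qpi M (\prod_x sec s x) = 1] in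
  [/\ P 1, forall s t, P s -> P t -> P (s * t), forall s, P s -> P s^-1
    & forall s t, P s -> P (s ^ t)].
Proof.
split=> [|s t [s0 sK sM] [t0 tK tM]|s [s0 sK sM]|s t [s0 sK sM]].
- split=> [|x|]; rewrite ?lab1 ?sec1 //; first exact: nsub1.
  by rewrite big1 ?qpi1 // => x _; rewrite sec1.
- split=> [|x|]; first by rewrite labM s0 t0 addr0.
    by rewrite secM0 //; exact: nsubM.
  rewrite qpi_prod; under eq_bigr do rewrite secM0 // qpiM.
  rewrite prodgM_commute => [|x y _ _]; last exact: kerF_commute.
  by rewrite -!qpi_prod sM tM mulg1.
- split=> [|x|]; first by rewrite labV s0 oppr0.
    by rewrite secV0 //; exact: nsubV.
  apply: (mulgI (qpi M (\prod_x sec s x))); rewrite {2}sM mul1g.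
  rewrite [qpi M (\prod_x sec s x)]qpi_prod [X in _ * X]qpi_prod.
  rewrite -prodgM_commute => [|x y _ _]; last first.
    by apply: kerF_commute => //; rewrite secV0 //; exact: nsubV.
  by rewrite big1 // => x _; rewrite secV0 // qpiV mulgV.
- split=> [|x|]; first by rewrite labJ.
    by rewrite secJ //; exact: nsubJ.
  rewrite qpi_prod; under eq_bigr do rewrite secJ // (qpi_conj_kerF (sK _) (kerF_sec_const t _)).
  rewrite (prodg_shift (f := fun x => qpi M (sec s x ^ sec t 0%R))) => [|x y].
    by under eq_bigr do rewrite qpiJ; rewrite -conjg_prod -qpi_prod sM conj1g.
  by apply: kerF_commute; exact: nsubJ.
Qed.

Definition prodsec : nsub S :=
  let: And4 P1 PM PV PJ := prodsec_subproof in NSub P1 PM PV PJ.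

Lemma prodsecP s : prodsec s <->
  [/\ lab s = 0%R, forall x, K (sec s x) & qpi M (\prod_x sec s x) = 1].
Proof. by rewrite /prodsec; case: prodsec_subproof. Qed.

Local Notation zeta := [~ bx i0 0%R, a].

Lemma kerF_y : K (a^-1 * b).
Proof.
apply: (@nsubJE _ _ _ a^-1); rewrite conjgE invgK !mulgA mulgV mul1g; apply: mem_nclo; right.
by exists i0.
Qed.

(** The generator has inverse sections at 0 and 1. The condition survives conjugation by t, because
    all sections of t act alike on K modulo M. *)
Lemma gam2_prodsec s : gam 2 s -> prodsec s.
Proof.
apply: (fam_ind_comm (F := F)) => [i|i j]; last by rewrite (single i j) commgg; exact: nsub1.
rewrite (single i i0) -invgR; apply: nsubV.
apply: (@nsubJE _ _ _ (a ^+ (0 - fpos i0)%R)).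
have -> : [~ b, a] ^ (a ^+ (0 - fpos i0)%R) = zeta.
  rewrite conjRg; congr [~ _, _].
  by apply/conjg_fixP/commgP/commuteX/commute_refl.
have kK := kerF_y; have k'K : K (b^-1 * a) by have := nsubV kK; rewrite invgM invgK.
apply/prodsecP; split=> [|x|]; first exact: labR.
  by rewrite (sec_zeta fE); do 2?[case: eqP => _] => //; exact: nsub1.
rewrite qpi_prod.
have -> : \prod_(x : 'F_p) qpi M (sec zeta x) = \prod_(x : 'F_p) ((if x == 0%R then qpi M (b^-1 * a) else 1)
    * (if x == 1%R then qpi M (a^-1 * b) else 1)).
  apply: eq_bigr => x _; rewrite (sec_zeta fE); have [->|x0] := eqVneq x 0%R.
    by rewrite eq_sym (negPf (oner_neq0 _)) mulg1.
  by case: eqP; rewrite ?mul1g ?qpi1.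
rewrite prodgM_commute => [|x y _ _]; last first.
  case: eqP => _; case: eqP => _; try exact: commute1; first exact: kerF_commute.
  by apply: commute_sym; exact: commute1.
rewrite (big_only1 0%R) //= => [|x /negPf-> //].
rewrite (big_only1 1%R) //= => [|x /negPf-> //].
by rewrite -qpiM mulgA mulgK mulVg qpi1.
Qed.

Definition rest g := (a ^+ lab g)^-1 * g.
Definition mA g := augf F (rest g).
Definition mD g := derf F (rest g).
Definition chi g : 'F_p := (lab g + mA g)%R.

Lemma lab_rest g : lab (rest g) = 0%R.
Proof. by rewrite labM labV lab_rtF addNr. Qed.

Lemma restM g h : rest (g * h) = rest g ^ (a ^+ lab h) * rest h.
Proof. by rewrite /rest labM rtD invgM conjgE !mulgA mulgK. Qed.

Lemma mAM g h : mA (g * h) = (mA g + mA h)%R.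
Proof. by rewrite /mA restM (augfM fE) ?labJ ?lab_rest // (augfJ fE) ?lab_rest. Qed.

Lemma mDM g h : mD (g * h) = (mD g + lab h * mA g + mD h)%R.
Proof.
by rewrite /mD restM (derfM fE) ?labJ ?lab_rest // (derfJ fE) ?lab_rest // lab_rtF.
Qed.

Lemma chiM g h : chi (g * h) = (chi g + chi h)%R.
Proof. by rewrite /chi labM mAM; ring. Qed.

Lemma mA1 : mA 1 = 0%R.
Proof. by rewrite /mA /rest lab1 invg1 mul1g (augf1 fE). Qed.

Lemma mD1 : mD 1 = 0%R.
Proof. by rewrite /mD /rest lab1 invg1 mul1g (derf1 fE). Qed.

Lemma mAV g : mA g^-1 = (- mA g)%R.
Proof. by apply/eqP; rewrite -addr_eq0 -mAM mulVg mA1. Qed.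

Lemma chi_a : chi a = 1%R.
Proof. by rewrite /chi /mA /rest lab_rt expgF1 mulVg (augf1 fE) addr0. Qed.

Lemma mA_b : mA b = 1%R.
Proof. by rewrite /mA /rest lab_fb invg1 mul1g (augf_fb fE). Qed.

Lemma chiV g : chi g^-1 = (- chi g)%R.
Proof. by rewrite /chi labV mAV opprD. Qed.

Lemma chi_subproof :
  let P s := chi s = 0%R in
  [/\ P 1, forall s t, P s -> P t -> P (s * t), forall s, P s -> P s^-1
    & forall s t, P s -> P (s ^ t)].
Proof.
split=> [|s t s0 t0|s s0|s t s0].
- by rewrite /chi lab1 mA1 addr0.
- by rewrite chiM s0 t0 addr0.
- by rewrite chiV s0 oppr0.
- by rewrite conjgE !chiM chiV s0 add0r addNr.
Qed.

Lemma chi_kerF k : K k -> chi k = 0%R.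
Proof.
pose Kc := let: And4 P1 PM PV PJ := chi_subproof in NSub P1 PM PV PJ.
have KcE s : Kc s = (chi s = 0%R) by rewrite /Kc; case: chi_subproof.
rewrite -KcE; apply: nclo_min => u [|[i ->]].
  apply: ncomm_min => g h _ _; rewrite KcE commgEl conjgE !chiM !chiV; ring.
by rewrite KcE (single i i0) chiM chiV chi_a /chi lab_fb mA_b add0r subrr.
Qed.

Lemma chi_qpi g h : qpi K g = qpi K h -> chi g = chi h.
Proof.
move/qpiP/chi_kerF; rewrite chiM chiV => /eqP.
by rewrite addrC subr_eq0 => /eqP.
Qed.

Lemma lab_kerF k : K k -> lab k = (- mA k)%R.
Proof. by move/chi_kerF => /eqP; rewrite addr_eq0 => /eqP. Qed.

Local Notation half := (2%:R^-1 : 'F_p)%R.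
(** The quadratic term absorbs the cross term of [mDM], making this additive on K, where [lab] is
    [- mA]. *)
Definition mU g : 'F_p := (mD g + half * mA g ^+ 2)%R.

Lemma half2 : (half + half = 1)%R.
Proof. by rewrite -mulr2n -[LHS]mulr_natl divff //; exact: (two_nz S). Qed.

Lemma mUM k k' : K k -> K k' -> mU (k * k') = (mU k + mU k')%R.
Proof.
move=> kK k'K; rewrite /mU mDM mAM (lab_kerF k'K).
have -> : (mD k + - mA k' * mA k + mD k' + half * (mA k + mA k') ^+ 2 =
  mD k + half * mA k ^+ 2 + (mD k' + half * mA k' ^+ 2) + (half + half - 1) * (mA k * mA k'))%R.
  by ring.
by rewrite half2 subrr mul0r addr0.
Qed.

Lemma mUV k : K k -> mU k^-1 = (- mU k)%R.
Proof.
move=> kK; apply/eqP; rewrite -addr_eq0 -mUM ?mulVg //; last exact: nsubV.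
by rewrite /mU mD1 mA1 expr0n mulr0 addr0.
Qed.

Lemma mAJ k g : mA (k ^ g) = mA k.
Proof. by rewrite conjgE !mAM mAV; ring. Qed.

Lemma mUJ k g : K k -> mU (k ^ g) = (mU k + chi g * mA k)%R.
Proof.
move=> kK; have mDV : mD g^-1 = (lab g * mA g - mD g)%R.
  have := mDM g^-1 g; rewrite mulVg mD1 mAV => /eqP; rewrite eq_sym addr_eq0 => /eqP E.
  have -> : mD g^-1 = (mD g^-1 + lab g * - mA g + lab g * mA g)%R by ring.
  by rewrite E addrC.
rewrite /mU mAJ conjgE !mDM mDV mAV labM (lab_kerF kK) /chi.
by ring.
Qed.

Definition sV0 s : 'F_p := (\sum_x mA (sec s x))%R.
Definition sV1 s : 'F_p := (\sum_x x * mA (sec s x))%R.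
Definition sU0 s : 'F_p := (\sum_x mU (sec s x))%R.
(** The second-order coefficient is chosen so that conjugation by g adds [chi g * sV1 s] ([sTJ]);
    hence [sT] vanishes on M. *)
Definition sT s : 'F_p :=
  (\sum_x (x * mU (sec s x) + half * x * (x - 1) * mA (sec s x)))%R.

Lemma vanish_subproof :
  let P k := [/\ K k, mA k = 0 & mU k = 0]%R in
  [/\ P 1, forall s t, P s -> P t -> P (s * t), forall s, P s -> P s^-1
    & forall s t, P s -> P (s ^ t)].
Proof.
split=> [|s t [sK s0 sU] [tK t0 tU]|s [sK s0 sU]|s t [sK s0 sU]].
- by split; [exact: nsub1 | exact: mA1 | rewrite /mU mD1 mA1 expr0n mulr0 addr0].
- by split; [exact: nsubM | rewrite mAM s0 t0 addr0 | rewrite mUM // sU tU addr0].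
- by split; [exact: nsubV | rewrite mAV s0 oppr0 | rewrite mUV // sU oppr0].
- by split; [exact: nsubJ | rewrite mAJ | rewrite mUJ // s0 sU mulr0 addr0].
Qed.

Lemma vanish_comm k : M k -> mA k = 0%R /\ mU k = 0%R.
Proof.
pose V := let: And4 P1 PM PV PJ := vanish_subproof in NSub P1 PM PV PJ.
have VE s : V s = [/\ K s, mA s = 0 & mU s = 0]%R by rewrite /V; case: vanish_subproof.
suff MV : M k -> V k by move/MV; rewrite VE => -[].
apply: ncomm_min => c h c2 hK; have cK : K c by exact: kerF_gam2.
have c'K : K c^-1 by exact: nsubV.
rewrite VE commgEl; split; first by apply: nsubM => //; exact: nsubJ.
  by rewrite mAM mAV mAJ addNr.
by rewrite mUM ?mUV ?mUJ ?(chi_kerF hK) ?mul0r ?addr0 ?addNr //; exact: nsubJ.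
Qed.

Lemma gam2_sV0_sU0 s : gam 2 s -> sV0 s = 0%R /\ sU0 s = 0%R.
Proof.
move/gam2_prodsec/prodsecP => [s0 sK /qpi_id/vanish_comm[A0 U0]].
have KX (r : seq 'F_p) : K (\prod_(x <- r) sec s x) by exact: nsub_prod.
split; [rewrite -[RHS]A0 | rewrite -[RHS]U0]; rewrite /sV0 /sU0.
  by elim: (index_enum _) => [|x r IHr]; rewrite ?big_nil ?mA1 // !big_cons mAM IHr.
elim: (index_enum _) => [|x r IHr]; last by rewrite !big_cons mUM ?IHr.
by rewrite !big_nil /mU mD1 mA1 expr0n mulr0 addr0.
Qed.

Lemma gam2_secK s x : gam 2 s -> K (sec s x).
Proof. by case/gam2_prodsec/prodsecP. Qed.

Lemma chi_sec g x : chi (sec g x) = (chi g - lab g)%R.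
Proof.
pose h := g * (a ^+ lab g)^-1.
have h0 : lab h = 0%R by rewrite labM labV lab_rtF subrr.
have -> : sec g x = sec h x by rewrite secM secV sec_rtX invg1 mulg1.
rewrite (chi_qpi (kerF_sec fE x h0)) chiM chiV; congr (_ - _)%R.
by rewrite /chi /mA /rest lab_rtF mulVg (augf1 fE) addr0.
Qed.

Lemma sec_conj_half g x s : gam 2 s ->
  mA (sec (s ^ g) x) = mA (sec s (x - lab g)%R) /\
  mU (sec (s ^ g) x) =
    (mU (sec s (x - lab g)%R) + (chi g - lab g) * mA (sec s (x - lab g)%R))%R.
Proof.
move=> s2; rewrite (secJ _ _ (gam2_lab s2)) mAJ mUJ ?chi_sec //; exact: gam2_secK.
Qed.

Lemma sV1J s g : gam 2 s -> sV1 (s ^ g) = sV1 s.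
Proof.
move=> s2; rewrite /sV1 (reindex_inj (addIr (lab g))).
under eq_bigr => x _ do rewrite (sec_conj_half g _ s2).1 addrK mulrDl.
by rewrite big_split /= -mulr_sumr -/(sV0 s) (gam2_sV0_sU0 s2).1 mulr0 addr0.
Qed.

Lemma sTJ s g : gam 2 s -> sT (s ^ g) = (sT s + chi g * sV1 s)%R.
Proof.
move=> s2; have [V0 U0] := gam2_sV0_sU0 s2.
rewrite /sT (reindex_inj (addIr (lab g))) /=.
pose l := lab g; pose n := (chi g - l)%R.
under eq_bigr => x _ do rewrite (sec_conj_half g _ s2).1 (sec_conj_half g _ s2).2 addrK.
rewrite (eq_bigr (fun x => (x * mU (sec s x) + half * x * (x - 1) * mA (sec s x))
  + (l * mU (sec s x) + (n + (half + half) * l) * (x * mA (sec s x))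
  + (l * n + half * (l * (l - 1))) * mA (sec s x)))%R) => [|x _]; last by rewrite /n /l; ring.
rewrite !big_split /= -!mulr_sumr -/(sU0 s) -/(sV1 s) -/(sV0 s) V0 U0 half2 /n.
by ring.
Qed.

Lemma sV1M s t : gam 2 s -> gam 2 t -> sV1 (s * t) = (sV1 s + sV1 t)%R.
Proof.
move=> s2 t2; rewrite /sV1 -big_split /=; apply: eq_bigr => x _.
by rewrite secM0 ?gam2_lab // mAM mulrDr.
Qed.

Lemma sTM s t : gam 2 s -> gam 2 t -> sT (s * t) = (sT s + sT t)%R.
Proof.
move=> s2 t2; rewrite /sT -big_split /=; apply: eq_bigr => x _.
rewrite secM0 ?gam2_lab // mAM mUM; [ring | exact: gam2_secK | exact: gam2_secK].
Qed.

Lemma sV1_1 : sV1 1 = 0%R.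
Proof. by rewrite /sV1 big1 // => x _; rewrite sec1 mA1 mulr0. Qed.

Lemma mU1 : mU 1 = 0%R.
Proof. by rewrite /mU mD1 mA1 expr0n mulr0 addr0. Qed.

Lemma sT_1 : sT 1 = 0%R.
Proof. by rewrite /sT big1 // => x _; rewrite sec1 mA1 mU1 !mulr0 addr0. Qed.

Lemma sV1V s : gam 2 s -> sV1 s^-1 = (- sV1 s)%R.
Proof.
by move=> s2; apply/eqP; rewrite -addr_eq0 -sV1M ?mulVg ?sV1_1 //; exact: nsubV.
Qed.

Lemma sTV s : gam 2 s -> sT s^-1 = (- sT s)%R.
Proof.
by move=> s2; apply/eqP; rewrite -addr_eq0 -sTM ?mulVg ?sT_1 //; exact: nsubV.
Qed.

Lemma sT_subproof :
  let P k := [/\ gam 2 k, sV1 k = 0 & sT k = 0]%R in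
  [/\ P 1, forall s t, P s -> P t -> P (s * t), forall s, P s -> P s^-1
    & forall s t, P s -> P (s ^ t)].
Proof.
split=> [|s t [s2 s0 sU] [t2 t0 tU]|s [s2 s0 sU]|s t [s2 s0 sU]].
- by split; [exact: nsub1 | exact: sV1_1 | exact: sT_1].
- by split; [exact: nsubM | rewrite sV1M // s0 t0 addr0 | rewrite sTM // sU tU addr0].
- by split; [exact: nsubV | rewrite sV1V // s0 oppr0 | rewrite sTV // sU oppr0].
- by split; [exact: nsubJ | rewrite sV1J | rewrite sTJ // s0 sU mulr0 addr0].
Qed.

Lemma sT_comm k : M k -> sT k = 0%R.
Proof.
pose V := let: And4 P1 PM PV PJ := sT_subproof in NSub P1 PM PV PJ.
have VE s : V s = [/\ gam 2 s, sV1 s = 0 & sT s = 0]%R by rewrite /V; case: sT_subproof.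
suff MV : M k -> V k by move/MV; rewrite VE => -[].
apply: ncomm_min => c h c2 hK.
have c'2 : gam 2 c^-1 by exact: nsubV.
have ch2 : gam 2 (c ^ h) by exact: nsubJ.
rewrite VE commgEl; split; first exact: nsubM.
  by rewrite sV1M // sV1V // sV1J // addNr.
by rewrite sTM // sTV // sTJ // (chi_kerF hK) mul0r addr0 addNr.
Qed.

(** If the copy of t = [zeta,a] were in [gam 3], the product of its sections, which is t, would lie
    in M. But [sT t] is [sV1 zeta], which is 1. *)
Lemma constant_single_false : ~ injmap (gam 3 : nsub S) (gam 3).
Proof.
move=> G3; have z2 : gam 2 zeta by exact: (@gamS _ 1).
have t3 : gam 3 [~ zeta, a] by exact: gamS.
have [s s3 is_] := G3 _ 0%R t3.
have := gam2_prodsec (gam_sub s3) => /prodsecP[_ _ /qpi_id].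
rewrite (big_only1 0%R) //= => [|x x0]; last by rewrite (injp_sec _ is_) (negPf x0).
have [_ -> _] := is_; move/sT_comm.
rewrite commgEl sTM ?sTV ?sTJ ?chi_a //; [|exact: nsubV|exact: nsubJ].
(* The section at 0 has weight 0, so only the section a^-1 b at the letter 1 counts. *)
rewrite mul1r addKr /sV1 (big_only1 1%R) //= => [|x x1]; last first.
  rewrite (sec_zeta fE) (negPf x1); have [->|_] := eqVneq x 0%R; first by rewrite mul0r.
  by rewrite mA1 mulr0.
rewrite (sec_zeta fE) eqxx (negPf (oner_neq0 _)) mul1r mAM mAV mA_b.
move/eqP; rewrite /mA /rest lab_rt expgF1 mulVg (augf1 fE) oppr0 add0r.
by rewrite (negPf (oner_neq0 _)).
Qed.

End ConstantSingle.

(** * Groups branching over [gam 3] but not over [gam 2] *)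

Section CaseII.
Variables (p : nat) (S : ssgroup p) (F : family S).
Hypothesis p_odd : odd p.
Hypothesis G3 : injmap (gam 3 : nsub S) (gam 3).
Hypothesis nG2 : ~ injmap (gam 2 : nsub S) (gam 2).
Variables (A N : nsub S) (m n0 : nat).
Hypothesis ASt : forall s : S, stab S n0 s -> A s.
Hypothesis NA : forall n h : S, N n -> A [~ n, h].
Hypothesis NSt : forall n : S, N n -> stab S m n.
Variables (n1 : S) (u1 : seq 'F_p).
Hypotheses (Nn1 : N n1) (size_u1 : size u1 = m) (lab_n1 : lab (secw n1 u1) != 0%R).

(* After rescaling its generators, the family has a single symmetric defining vector, which
   is either non-constant or the indicator of the non-zero elements. *)
Lemma normal_form : exists (F' : family S) (e : 'F_p -> 'F_p),
  [/\ forall (i : fI F') y, fe i y = e y, forall y, e (- y)%R = e y,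
      (forall i j : fI F, i = j) -> forall i j : fI F', i = j
    & (exists t t' : 'F_p, [/\ t != 0, t' != 0 & e t != e t']%R) \/ e =1 @cst p].
Proof.
have [e eN fE] : symmetric_family F.
  by apply: contrapT => nsym; apply: nG2; apply: symmetric_dichotomy nsym.
have [nc|nc] := pselect (exists t t' : 'F_p, [/\ t != 0, t' != 0 & e t != e t']%R).
  by have [F' [F'E F's]] := scale_family fE; exists F', e; split=> //; left.
have [|F' [F'E F's]] := @scale_family _ _ F (@cst p); last first.
  by exists F', (@cst p); split=> //; [exact: cstN | right].
move=> i; exists (fe i 1%R) => y; have [c fc] := fE i; rewrite !fc /cst.
have [->|y0] := eqVneq y 0%R; first by rewrite mulr0 -fc fe0.
rewrite mulr1; congr (_ * _)%R; apply: contrapT => /eqP ey; apply: nc.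
by exists y, 1%R; split=> //; exact: oner_neq0.
Qed.

Lemma nonconst_fe (F' : family S) (e : 'F_p -> 'F_p) : (forall (i : fI F') y, fe i y = e y) ->
  (exists t t' : 'F_p, [/\ t != 0, t' != 0 & e t != e t']%R) ->
  exists (i : fI F') (t t' : 'F_p), [/\ t != 0%R, t' != 0%R & fe i t != fe i t'].
Proof. by move=> fE [t [t' [t0 t'0 et]]]; exists (fi0 F'), t, t'; rewrite !fE. Qed.

Lemma stab_caseII s : stab S (m + 7) s -> A s.
Proof.
have [F' [e [fE eN _ [nc|/funext eE]]]] := normal_form.
  (* In the non-constant case level m + 6 already suffices. *)
  move=> s7; have s6 : stab S (m + 5.+1) s by apply: stab_le s7; rewrite leq_add2l.
  move: s s6 {s7}; apply: (stab_nonconst (k := 3) ASt NA NSt Nn1 size_u1 lab_n1) => //.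
    exact: nonconst_fe fE nc.
  exact: (cl4_St5 fE eN G3 nc).
subst e; move: s => s; apply: (red_concl (F := F') (c := 7) (K := gam 3) ASt) => {}s.
have i1 : injmap (ncomm (gam 3) (kerF F')) (red F' A (gam 3) m).
  apply: (core_const (g := secw n1 u1) (n0 := n0) G3 lab_n1) => [t t3|t t3 tn|i t t0].
  - exact (red_comm F' G3 NA NSt Nn1 size_u1 t3).
  - exact (red_St F' m G3 ASt t3 tn).
  - by rewrite fE /cst t0.
apply: cl_St i1 _ s; exact: (cl_kerF_St6 fE p_odd G3).
Qed.

Lemma stab_caseII_single : (forall i j : fI F, i = j) -> forall s, stab S (m + 4) s -> A s.
Proof.
have [F' [e [fE eN F's [nc|/funext eE]]]] := normal_form => single; last first.
  by subst e; case: (constant_single_false fE p_odd (F's single) G3).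
apply: (stab_nonconst (k := 3) ASt NA NSt Nn1 size_u1 lab_n1) => //.
  exact: nonconst_fe fE nc.
exact: (cl4_St3 fE eN G3 nc (F's single)).
Qed.

End CaseII.

Lemma gam_absorb_cl (p : nat) (S : ssgroup p) (M : nsub S) i : 0 < i ->
    (forall g, gam i g -> cl (mulns M (gam i.+1)) g) ->
  forall g, gam i g -> cl M g.
Proof.
move=> i_gt0 Mi g gi; apply/clP => n; pose Mn := mulns M (stab S n).
suff /clP/(_ n) : cl Mn g by apply: mulns_min => // s; exact: mulnsr.
apply: (gam_absorb i_gt0) gi => {}g /Mi/clP/(_ n); apply: mulns_min => s.
  apply: mulns_min => {}s sM; last exact: mulnsr.
  by apply: mulnsl; exact: mulnsl.
by move=> sn; apply: mulnsl; exact: mulnsr.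
Qed.

(** * One directed generator: commutators modulo [gam 4] *)

Section Single.
Variables (p : nat) (S : ssgroup p) (F : family S).
Hypothesis single : forall i j : fI F, i = j.
Implicit Types (g h c d s : S) (T M : nsub S).
Local Notation p_pr := (ss_prime S).
Local Notation a := (rt S).
Local Notation i0 := (fi0 F).
Local Notation b := (fb i0).
Local Notation z := [~ b, a].

Lemma single_ncent T g : T [~ g, a] -> T [~ g, b] -> ncent T g.
Proof. by move=> ga gb; apply: (ncent_gen (F := F)) => // i; rewrite (single i i0). Qed.

Lemma single_gam2 T : T z -> forall g, gam 2 g -> T g.
Proof.
move=> Tz; apply: (fam_ind_comm (F := F)) => [i|i j].
  by rewrite (single i i0) -invgR; exact: nsubV.
by rewrite (single i j) commgg; exact: nsub1.
Qed.

Lemma single_gam3 T : T [~ z, a] -> T [~ z, b] -> forall g, gam 3 g -> T g.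
Proof.
move=> Ta Tb; apply: ncomm_min => g h g2 _; suff: ncent T g by move/ncentP.
by apply: single_gam2 g2; exact: single_ncent.
Qed.

Lemma single_gam4 T : ncent T [~ z, a] -> ncent T [~ z, b] -> forall g, gam 4 g -> T g.
Proof.
move=> Ta Tb; apply: ncomm_min => g h g3 _; suff: ncent T g by move/ncentP.
exact: single_gam3 g3.
Qed.

Lemma gam2_powz g : gam 2 g -> exists k : 'F_p, qpi (gam 3) g = qpi (gam 3) z ^+ k.
Proof.
have zp := qpi3p i0; pose P g := exists k : 'F_p, qpi (gam 3) g = qpi (gam 3) z ^+ k.
have zc u : commute (qpi (gam 3) z) u by apply: gam_central; exact: (@gamS _ 1).
have [P1 PM PV PJ] : [/\ P 1, (forall s t, P s -> P t -> P (s * t)),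
    (forall s, P s -> P s^-1) & (forall s t, P s -> P (s ^ t))].
  split=> [|s t [k sk] [l tl]|s [k sk]|s t [k sk]].
  - by exists 0%R; rewrite qpi1.
  - by exists (k + l)%R; rewrite qpiM sk tl (expgFD p_pr zp).
  - by exists (- k)%R; rewrite qpiV sk (expgFN p_pr zp).
  - exists k; rewrite qpiJ sk; apply/conjg_fixP/commgP; apply: commute_sym.
    by apply: commuteX; apply: commute_sym.
by move/(single_gam2 (T := NSub P1 PM PV PJ)); apply; exists 1%R; rewrite expgF1.
Qed.

Lemma gam2_comm c d : gam 2 c -> gam 2 d -> gam 4 [~ c, d].
Proof.
move=> c2 d2.
have zg u : gam 2 u -> gam 4 [~ z, u].
  case/gam2_powz => k; rewrite -qpiX => /esym/qpiP u3.
  rewrite -(mulKVg (z ^+ k) u) commgMr; apply: nsubM.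
    by rewrite -invgR; apply: nsubV; exact: gamS.
  apply: nsubJ; have -> : [~ z, z ^+ k] = 1 by apply/eqP/commgP/commuteX/commute_refl.
  exact: nsub1.
have [k] := gam2_powz c2; rewrite -qpiX => /esym/qpiP c3.
rewrite -(mulKVg (z ^+ k) c) commgMl; apply: nsubM; last exact: gamS.
apply: nsubJ; elim: (nat_of_ord k) => [|n IHn]; first by rewrite comm1g; exact: nsub1.
by rewrite expgS commgMl; apply: nsubM => //; apply: nsubJ; exact: zg.
Qed.

Section ModuloGamma4.
Variable T : nsub S.
Hypothesis T4 : forall g, gam 4 g -> T g.

Lemma gam3_central c u : gam 3 c -> commute (qpi T c) u.
Proof. by move=> c3; have [v <-] := qpi_surj u; apply/qpi_commute/T4/gamS. Qed.

Lemma qpi_zM g h : qpi T [~ z, g * h] = qpi T [~ z, g] * qpi T [~ z, h].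
Proof.
have z3 u : gam 3 [~ z, u] by apply: gamS; exact: (@gamS _ 1).
rewrite commgMr qpiM qpiJ; have -> : qpi T [~ z, g] ^ qpi T h = qpi T [~ z, g].
  by apply/conjg_fixP/commgP/gam3_central.
exact/commute_sym/gam3_central.
Qed.

Lemma qpi_zX g n : qpi T [~ z, g ^+ n] = qpi T [~ z, g] ^+ n.
Proof.
elim: n => [|n IHn]; first by rewrite commg1 qpi1.
by rewrite !expgS qpi_zM IHn.
Qed.

Lemma qpi_zp g : g ^+ p = 1 -> qpi T [~ z, g] ^+ p = 1.
Proof. by rewrite -qpi_zX => ->; rewrite commg1 qpi1. Qed.

(** Modulo [gam 4] the map g -> [z,g] is a homomorphism that kills [gam 2]. *)
Lemma qpi_z_repA g k m : repA g k m ->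
  qpi T [~ z, g] = qpi T [~ z, a] ^+ k * qpi T [~ z, b] ^+ m i0.
Proof.
move=> gm; have /esym/qpiP u2 := gm.
rewrite -(mulKVg (a ^+ k * kap m) g) qpi_zM.
have /qpi_id -> : T [~ z, (a ^+ k * kap m)^-1 * g].
  by apply/T4/gam2_comm => //; exact: (@gamS _ 1).
rewrite mulg1 qpi_zM qpi_zX; congr (_ * _).
have -> : kap m = b ^+ m i0.
  rewrite /kap (big_only1 i0) // => j ji; by rewrite (single j i0) eqxx in ji.
exact: qpi_zX.
Qed.

End ModuloGamma4.

Section Root.
Variables (A N : nsub S) (n0 : nat).
Hypothesis ASt : forall s : S, stab S n0 s -> A s.
Hypothesis NA : forall n h : S, N n -> A [~ n, h].
Variables (n1 : S).
Hypotheses (Nn1 : N n1) (lab_n1 : lab n1 != 0%R).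

(** Here n1 moves the first level, so [n1,b] in A is modulo [gam 3] an invertible power of z. Thus
    [gam 2] lies in A times [gam 3], and [gam_absorb] concludes. *)
Lemma stab2_root s : stab S 2 s -> A s.
Proof.
move=> /(stab2_gam3 single)/gam_sub s2.
suff /clP/(_ n0) : cl A s by apply: mulns_min.
apply: (gam_absorb (i := 2)) s2 => // {}s; set T := mulns A (gam 3).
have T3 g : gam 3 g -> T g by exact: mulnsr.
apply: (single_gam2 (T := T)).
have zp : qpi T z ^+ p = 1.
  by rewrite -qpiX; apply/qpi_id/T3/qpi_id; rewrite qpiX qpi3p.
have /qpi_id nb : T [~ n1, b] by apply: mulnsl; exact: NA.
have [m nm] := repA_exists F n1.
have nE : qpi T [~ n1, b] = qpi T [~ a ^+ lab n1, b].
  apply/qpiP/T3/qpiP; have -> : qpi (gam 3) [~ n1, b] = qpi (gam 3) [~ a ^+ lab n1 * kap m, b].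
    by apply: (@qpi3_comm p) => //; [exact/qpiP | rewrite mulVg; exact: nsub1].
  rewrite commgMl qpiM qpiJ.
  have -> : [~ kap m, b] = 1.
    rewrite /kap (big_only1 i0) // => [|j ji]; last by rewrite (single j i0) eqxx in ji.
    by apply/eqP/commgP; apply: commute_sym; apply: commuteX.
  rewrite qpi1 mulg1; apply/conjg_fixP/commgP/gam_central; exact: (@gamS _ 1).
apply/qpi_id; apply: (expgF_inv p_pr zp) lab_n1 _.
have -> : qpi T z ^+ lab n1 = qpi T [~ b, a ^+ lab n1].
  by rewrite -qpiX; apply/qpiP/T3/qpiP; rewrite qpiX qpi3X.
by rewrite -invgR qpiV -nE nb invg1.
Qed.

End Root.
End Single.

(** * The Fabrykowski-Gupta group, and the case p different from 3 *)

Section FabrykowskiGupta.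
Variables (p : nat) (S : ssgroup p) (F : family S).
Hypothesis single : forall i j : fI F, i = j.
Hypothesis p_odd : odd p.
Hypothesis fE : forall (i : fI F) y, fe i y = (y == 1%R)%:R%R.
Implicit Types (g h c d s : S) (T M : nsub S).
Local Notation p_pr := (ss_prime S).
Local Notation a := (rt S).
Local Notation i0 := (fi0 F).
Local Notation b := (fb i0).
Local Notation z := [~ b, a].

Lemma injp_fg : injp 1%R [~ a, b] [~ bx i0 0%R, bx i0 1%R].
Proof.
split=> [||y y1]; first exact: labR.
  rewrite secR0 ?lab_bx // !sec_bx (negPf (oner_neq0 _)) eqxx fE subr0 eqxx.
  by rewrite (expgF1 p).
rewrite secR0 ?lab_bx // !sec_bx (negPf y1) !fE; have [->|y0] := eqVneq y 0%R.
  by rewrite sub0r (negPf (N1_neq1 S p_odd)) expgF0 commg1.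
by apply/eqP/commgP/commuteX2/commute_refl.
Qed.

Lemma injmap_fg : injmap (gam 2 : nsub S) (gam 2).
Proof.
apply: (pull_injmap (F := F)) => g; apply: (single_gam2 single).
have := injpV injp_fg; rewrite invgR => iz; apply: pull1 iz _.
by apply: nsubV; exact: (@gamS _ 1).
Qed.

Lemma fg_nonconst : exists (i : fI F) (t t' : 'F_p), [/\ t != 0%R, t' != 0%R & fe i t != fe i t'].
Proof.
exists i0, 1%R, (-1)%R; rewrite oppr_eq0 oner_neq0; split=> //.
by rewrite !fE eqxx (negPf (N1_neq1 S p_odd)) oner_neq0.
Qed.

(** Neither 2 nor -2 is 1 in F_p, so [bx 0] and [bx 2] commute, and [pi_bxR] gives [b,z]^2 = 1
    modulo the closure. *)
Lemma cl4_bz_fg : p != 3 -> cl (gam 4) [~ b, z].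
Proof.
move=> p3; apply/qpi_id; apply: (expgF_inv p_pr (pi_bzp F)) (two_nz S p_odd) _.
rewrite -pi_bxR; apply/qpi_id; suff -> : [~ bx i0 0%R, bx i0 2%:R%R] = 1 by exact: nsub1.
have two1 : (2%:R != 1 :> 'F_p)%R by rewrite -subr_eq0 (_ : _ - _ = 1)%R ?oner_neq0 //; ring.
have N21 : (- 2%:R != 1 :> 'F_p)%R.
  rewrite eq_sym -subr_eq0 opprK (_ : 1 + 2%:R = 3%:R)%R; last by ring.
  by rewrite -(dvdn_pcharf (pchar_Fp p_pr)) (dvdn_prime2 p_pr).
apply: sec_ext; first by rewrite labR lab1.
move=> y; rewrite sec1 secR0 ?lab_bx // !sec_bx !fE; have [->|y0] := eqVneq y 0%R.
  by rewrite eq_sym (negPf (two_nz S p_odd)) sub0r (negPf N21) expgF0 commg1.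
have [->|y2] := eqVneq y 2%:R%R; first by rewrite subr0 (negPf two1) expgF0 comm1g.
by apply/eqP/commgP/commuteX2/commute_refl.
Qed.

Section Conclusion.
Variables (A N : nsub S) (m n0 : nat).
Hypothesis ASt : forall s : S, stab S n0 s -> A s.
Hypothesis NA : forall n h : S, N n -> A [~ n, h].
Hypothesis NSt : forall n : S, N n -> stab S m n.
Variables (n1 : S) (u1 : seq 'F_p).
Hypotheses (Nn1 : N n1) (size_u1 : size u1 = m) (lab_n1 : lab (secw n1 u1) != 0%R).
Local Notation R := (red F A (gam 2) m).

Lemma red_z n u : N n -> size u = m -> R [~ z, secw n u].
Proof.
move=> Nn um; have z2 : gam 2 z by exact: (@gamS _ 1).
exact (red_comm F injmap_fg NA NSt Nn um z2).
Qed.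

Lemma inj3_red : injmap (gam 3 : nsub S) R.
Proof.
have [i [t [t' [t0 t'0 et]]]] := fg_nonconst.
apply: (core_nonconst (g := secw n1 u1) (n0 := n0) injmap_fg lab_n1 _ _ t0 t'0 et) => s sK.
  exact (red_comm F injmap_fg NA NSt Nn1 size_u1 sK).
exact (red_St F m injmap_fg ASt sK).
Qed.

Lemma stab_fg_red : (forall g, gam 3 g -> cl R g) -> forall s, stab S (m + 2) s -> A s.
Proof.
move=> R3 s; apply: (red_concl (F := F) (c := 2) (K := gam 2) ASt) => {}s s2.
exact/R3/(stab2_gam3 single).
Qed.

(** Modulo R, [gam 4] and closure, [z,b] is trivial and z commutes with the section of n1; the label
    of that section is invertible, so [z,a] is trivial too. *)
Lemma stab_fg_large : p != 3 -> forall s, stab S (m + 2) s -> A s.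
Proof.
move=> p3; apply: stab_fg_red => g; apply: gam_absorb_cl => // {}g.
set T := cl _; have T4 h : gam 4 h -> T h by move=> h4; apply: sub_cl; exact: mulnsr.
have zb : T [~ z, b].
  rewrite -invgR; apply: nsubV; have := cl4_bz_fg p3; apply: clS => h h4; exact: mulnsr.
apply: (single_gam3 single) => //.
have zn : T [~ z, secw n1 u1] by apply: sub_cl; apply: mulnsl; exact: red_z.
have [e ne] := repA_exists F (secw n1 u1).
have := qpi_z_repA single T4 ne; move/qpi_id: zn => ->; move/qpi_id: zb => ->.
rewrite expg1n mulg1 => /esym za; apply/qpi_id.
exact: (expgF_inv p_pr (qpi_zp F T4 (rt_p S)) lab_n1 za).
Qed.

End Conclusion.
End FabrykowskiGupta.

(** * Modules of F_p-valued functions on a level *)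

Section LevelFunctions.
Variables (p : nat) (S : ssgroup p) (F : family S).
Implicit Types (g s : S) (u : seq 'F_p) (nu mu : seq 'F_p -> 'F_p).
Implicit Types (Om : (seq 'F_p -> 'F_p) -> Prop).
Local Notation p_pr := (ss_prime S).

Definition lsum m nu : 'F_p := (\sum_(t : m.-tuple 'F_p) nu t)%R.

Lemma eq_lsum m nu nu' : (forall u, size u = m -> nu u = nu' u) -> lsum m nu = lsum m nu'.
Proof. by move=> nn; apply: eq_bigr => t _; rewrite nn ?size_tuple. Qed.

Lemma lsum0 nu : lsum 0 nu = nu [::].
Proof.
rewrite /lsum (big_only1 [tuple]) // => t; by rewrite [t]tuple0 eqxx.
Qed.

Lemma lsumS m nu : lsum m.+1 nu = lsum m (fun u => \sum_i nu (rcons u i))%R.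
Proof.
rewrite /lsum pair_bigA /=.
pose h (x : m.-tuple 'F_p * 'F_p) : m.+1.-tuple 'F_p := [tuple of rcons x.1 x.2].
rewrite (reindex h) //; apply: onW_bij; apply: inj_card_bij => [[t i] [t' i']|].
  by move/(congr1 val) => /= /rcons_inj[/val_inj-> ->].
by rewrite card_prod !card_tuple expnS mulnC.
Qed.

Lemma lsumD m nu nu' : lsum m (fun u => nu u + nu' u)%R = (lsum m nu + lsum m nu')%R.
Proof. exact: big_split. Qed.

Lemma lsumZ m c nu : lsum m (fun u => c * nu u)%R = (c * lsum m nu)%R.
Proof. by rewrite /lsum mulr_sumr. Qed.

Lemma lsum_act m g nu : lsum m (fun u => nu (act g u)) = lsum m nu.
Proof.
rewrite /lsum [RHS](reindex_inj (@act_tuple_inj _ S m g)).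
by apply: eq_bigr.
Qed.

Record submodule m Om : Prop := Submodule {
  sm_ext : forall nu nu', (forall u, size u = m -> nu u = nu' u) -> Om nu -> Om nu';
  sm_0 : Om (fun=> 0%R);
  sm_D : forall nu nu', Om nu -> Om nu' -> Om (fun u => nu u + nu' u)%R;
  sm_Z : forall c nu, Om nu -> Om (fun u => c * nu u)%R;
  sm_act : forall g nu, Om nu -> Om (fun u => nu (act g u)) }.

Section FixedPoint.
Variables (m : nat) (Om : (seq 'F_p -> 'F_p) -> Prop).
Hypothesis OmP : submodule m Om.
Local Notation T := (m.-tuple 'F_p).
Local Notation V := {ffun T -> 'F_p}.

Let ev (f : V) u : 'F_p := if insub u is Some t then f t else 0%R.

Let ev_tuple f (t : T) : ev f t = f t.
Proof. by rewrite /ev valK. Qed.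

Let ev_size f u (um : size u == m) : ev f u = f (Tuple um).
Proof. by rewrite /ev insubT. Qed.

Definition lact (f : V) (s : {perm T}) : V := [ffun t => f (s^-1 t)].

Lemma lact_is_action : is_action [set: {perm T}] lact.
Proof.
split=> [s f f' /ffunP ff|f s s' _ _]; apply/ffunP => t.
  by have := ff (s t); rewrite !ffunE permK.
by rewrite !ffunE invMg permM.
Qed.

Canonical laction := Action lact_is_action.

(** A finite p-group acting on a non-zero F_p-space fixes a non-zero vector, and by level
    transitivity a fixed function is constant. *)
Lemma submodule_const nu u : Om nu -> size u = m -> nu u != 0%R -> Om (fun=> 1%R).
Proof.
move=> Onu um nu0; pose X : {set V} := [set f | `[< Om (ev f) >]].
have XP f : reflect (Om (ev f)) (f \in X) by rewrite inE; exact: asboolP.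
have addX f f' : f \in X -> f' \in X -> (f + f')%R \in X.
  move=> /XP Of /XP Of'; apply/XP; apply: (sm_ext OmP) (sm_D OmP Of Of') => v /eqP vm.
  by rewrite !ev_size ffunE.
pose f0 : V := [ffun t : T => nu t].
have f0X : f0 \in X.
  by apply/XP; apply: (sm_ext OmP) Onu => v /eqP vm; rewrite ev_size ffunE.
have f0n : f0 != 0%R.
  have um' : size u == m by exact/eqP.
  apply: contraNneq nu0 => /ffunP/(_ (Tuple um')); rewrite !ffunE /= => ->.
  by [].
(* Translation by the non-zero [f0] has order dividing p and no fixed point on X. *)
have pX : p %| #|X|.
  pose tau := perm (@addrI _ f0).
  have tauX n f : (tau ^+ n) f = (f0 *+ n + f)%R.
    elim: n => [|n IHn]; first by rewrite expg0 perm1 mulr0n add0r.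
    by rewrite expgSr permM IHn permE mulrS addrA.
  have taup : p.-group <[tau]>.
    rewrite /pgroup -orderE; apply: (@pnat_dvd _ (p ^ 1)); last by rewrite pnatX pnat_id ?p_pr.
    rewrite expn1 order_dvdn; apply/eqP/permP => f; rewrite tauX perm1.
    suff -> : (f0 *+ p = 0)%R by rewrite add0r.
    apply/ffunP => t; rewrite ffunMnE !ffunE -mulr_natr.
    by rewrite -(Fp_nat_mod p_pr) modnn mulr0.
  have act_tau : [acts <[tau]>, on X | 'P].
    rewrite cycle_subG !inE /=; apply/subsetP => f fX.
    by rewrite inE /= apermE permE; exact: addX.
  have := pgroup_fix_mod taup act_tau.
  suff -> : 'Fix_(X | 'P)(<[tau]>) = set0 by rewrite cards0 mod0n => /eqP.
  apply/setP => f; rewrite in_setI in_set0; apply/negP => /andP[_ /afixP ffix].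
  have := ffix tau (cycle_id _); rewrite /= apermE permE => /(congr1 (fun f' : V => f' - f)%R).
  by rewrite addrK subrr; exact/eqP.
have actX : [acts lgrp S m, on X | laction].
  apply/subsetP => s /lgrpP[g <-]; rewrite !inE; apply/subsetP => f /XP Of.
  rewrite inE; apply/XP; apply: (sm_ext OmP) (sm_act OmP g^-1 Of) => v /eqP vm.
  have vm' : size (act g^-1 v) == m by rewrite size_act.
  rewrite (ev_size _ vm') ev_size ffunE -lpermV lpermE; congr (f _).
  exact: val_inj.
have := pgroup_fix_mod (lgrp_pgroup S m) actX; rewrite (eqP pX) => /esym/eqP fixX.
pose o : V := 0%R; have fix0 : o \in 'Fix_(X | laction)(lgrp S m).
  rewrite in_setI; apply/andP; split.
    by apply/XP; apply: (sm_ext OmP) (sm_0 OmP) => v /eqP vm; rewrite ev_size ffunE.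
  by apply/afixP => s _; apply/ffunP => t; rewrite !ffunE.
have [f] : exists f, f \in 'Fix_(X | laction)(lgrp S m) :\ o.
  apply/set0Pn; rewrite -card_gt0; have := cardsD1 o 'Fix_(X | laction)(lgrp S m).
  rewrite fix0 lt0n => fixE; apply/eqP => card0; move: fixX; rewrite fixE card0 addn0.
  by rewrite modn_small ?prime_gt1 ?p_pr.
rewrite in_setD1 in_setI => /andP[fn0 /andP[/XP Of /afixP ffix]].
have [t0 ft0] : exists t0, f t0 != 0%R.
  apply: contrapT => nex; case/negP: fn0; apply/eqP/ffunP => t; rewrite ffunE.
  by apply/eqP; apply: contrapT => ft; apply: nex; exists t; exact/negP.
have fc t : f t = f t0.
  have [g gt _] := act_trans F (etrans (size_tuple t) (esym (size_tuple t0))).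
  have := ffix _ (mem_lgrp m g) => /ffunP/(_ t0); rewrite ffunE => <-; congr (f _).
  rewrite -lpermV lpermE; apply: val_inj => /=; rewrite -gt.
  by rewrite actK.
apply: (sm_ext OmP) (sm_Z OmP (f t0)^-1%R Of) => v /eqP vm.
by rewrite ev_size fc mulVf.
Qed.

End FixedPoint.
End LevelFunctions.

Section LevelFull.
Variables (p : nat) (S : ssgroup p) (F : family S).
Implicit Types (g s : S) (u : seq 'F_p) (nu mu : seq 'F_p -> 'F_p).
Local Notation p_pr := (ss_prime S).
Variables (m : nat) (Om : (seq 'F_p -> 'F_p) -> Prop).
Hypothesis OmP : submodule S m Om.
Local Notation T := (m.-tuple 'F_p).

Let row_of nu : 'rV['F_p]_#|{: T}| := (\row_(i < #|{: T}|) nu (enum_val i : T))%R.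
Let fun_of (v : 'cV['F_p]_#|{: T}|) u : 'F_p :=
  if insub u is Some t then v (enum_rank (t : T)) ord0 else 0%R.

Let fun_of_tuple v (t : T) : fun_of v t = v (enum_rank t) ord0.
Proof. by rewrite /fun_of valK. Qed.

Let fun_ofK nu u : size u = m -> fun_of (row_of nu)^T%R u = nu u.
Proof.
by move/eqP=> um; rewrite -[u]/(val (Tuple um)) fun_of_tuple !mxE enum_rankK.
Qed.

Lemma perp_submodule :
  submodule S m (fun mu => forall nu, Om nu -> lsum m (fun u => nu u * mu u)%R = 0%R).
Proof.
split=> [mu mu' mm Pmu nu Onu|nu _|mu mu' Pmu Pmu' nu Onu|c mu Pmu nu Onu|g mu Pmu nu Onu].
- by rewrite -(Pmu _ Onu); apply: eq_lsum => u um; rewrite mm.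
- by rewrite /lsum big1 // => t _; rewrite mulr0.
- rewrite -[RHS]addr0 -{1}(Pmu _ Onu) -(Pmu' _ Onu) -lsumD.
  by apply: eq_lsum => u _; rewrite mulrDr.
- rewrite -(mulr0 c) -(Pmu _ Onu) -lsumZ; apply: eq_lsum => u _; exact: mulrCA.
- rewrite -(Pmu _ (sm_act OmP g^-1 Onu)) -[RHS](@lsum_act _ S _ g).
  by apply: eq_lsum => u _; rewrite actK.
Qed.

Lemma perp_exists nu' : ~ Om nu' -> exists mu, (forall nu, Om nu ->
  lsum m (fun u => nu u * mu u)%R = 0%R) /\ exists2 u, size u = m & mu u != 0%R.
Proof.
move=> nO; pose X := [set v : 'rV['F_p]_#|{: T}| | `[< Om (fun_of v^T)%R >]].
pose B : 'M['F_p]_(#|X|, #|{: T}|) := (\matrix_(k < #|X|) enum_val k)%R.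
have sub nu : Om nu -> (row_of nu <= B)%MS.
  move=> Onu; have nX : row_of nu \in X.
    by rewrite inE; apply/asboolP; apply: (sm_ext OmP) Onu => u um; rewrite fun_ofK.
  have -> : row_of nu = row (enum_rank_in nX (row_of nu)) B by rewrite rowK enum_rankK_in.
  exact: row_sub.
have nsub : ~~ (row_of nu' <= B)%MS.
  apply/negP => /submxP[D nuE]; apply: nO; apply: (sm_ext OmP) (_ : Om (fun_of (row_of nu')^T%R)).
    by move=> u um; exact: fun_ofK.
  rewrite nuE mulmx_sum_row.
  pose P (v : 'rV['F_p]_#|{: T}|) := Om (fun_of v^T%R).
  apply: (big_ind P) => [|v w Pv Pw|k _]; rewrite /P.
  - by apply: (sm_ext OmP) (sm_0 OmP) => u /eqP um; rewrite -[u]/(val (Tuple um)) fun_of_tuple !mxE.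
  - apply: (sm_ext OmP) (sm_D OmP Pv Pw) => u /eqP um.
    by rewrite -[u]/(val (Tuple um)) !fun_of_tuple !mxE.
  - have : Om (fun_of (row k B)^T%R) by rewrite rowK; have := enum_valP k; rewrite inE => /asboolP.
    move/(sm_Z OmP (D ord0 k)); apply: (sm_ext OmP) => u /eqP um.
    by rewrite -[u]/(val (Tuple um)) !fun_of_tuple !mxE.
rewrite submxE in nsub; have /rV0Pn[j nj] := nsub.
have pairE nu : lsum m (fun u => nu u * fun_of (col j (cokermx B)) u)%R =
    (row_of nu *m cokermx B)%R ord0 j.
  rewrite !mxE (reindex (@enum_rank T)) /=; last exact: onW_bij (@enum_rank_bij T).
  by apply: eq_bigr => t _; rewrite fun_of_tuple !mxE enum_rankK.
exists (fun_of (col j (cokermx B))); split=> [nu /sub|].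
  by rewrite pairE submxE => /eqP ->; rewrite mxE.
apply: contrapT => nex; case/eqP: nj; rewrite -pairE /lsum big1 // => t _.
suff -> : fun_of (col j (cokermx B)) t = 0%R by rewrite mulr0.
by apply: contrapT => /eqP tn; apply: nex; exists t => //; exact: size_tuple.
Qed.

(** Dual to [submodule_const]: if Om is proper, its annihilator is a non-zero submodule and so
    contains the constants, which forces all sums over the level to be 0. *)
Lemma submodule_full nu nu' : Om nu -> lsum m nu != 0%R -> Om nu'.
Proof.
move=> Onu nun; apply: contrapT => /perp_exists[mu [Pmu [u um mun]]].
have := submodule_const F perp_submodule Pmu um mun => /(_ _ Onu) nu0.
by case/eqP: nun; rewrite -[RHS]nu0; apply: eq_lsum => v _; rewrite mulr1.
Qed.

End LevelFull.

Lemma sumF3 (f : 'F_3 -> 'F_3) : (\sum_i f i = f 0 + f 1 + f (- 1))%R.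
Proof.
rewrite !big_ord_recl big_ord0 addr0 addrA; congr (f _ + f _ + f _)%R; exact: val_inj.
Qed.

Lemma mul3F3 (x : 'F_3) : (3%:R * x = 0)%R.
Proof. by rewrite (_ : 3%:R = 0)%R ?mul0r //; apply: val_inj. Qed.

(** * The obstruction for p = 3 and its descent through the levels *)

Section Ternary.
Variables (S : ssgroup 3) (F : family S).
Hypothesis single : forall i j : fI F, i = j.
Hypothesis fE : forall (i : fI F) y, fe i y = (y == 1%R)%:R%R.
Implicit Types (g h s t : S) (u v : seq 'F_3) (nu mu phi : seq 'F_3 -> 'F_3) (chi : S -> 'F_3).
Local Notation a := (rt S).
Local Notation i0 := (fi0 F).
Local Notation b := (fb i0).

Definition ghom chi := forall g h, chi (g * h) = (chi g + chi h)%R.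

Lemma ghom1 chi : ghom chi -> chi 1 = 0%R.
Proof. by move=> ch; have := ch 1 1; rewrite mulg1 => /eqP; rewrite -subr_eq subrr => /eqP. Qed.

Lemma ghomV chi g : ghom chi -> chi g^-1 = (- chi g)%R.
Proof. by move=> ch; apply/eqP; rewrite -addr_eq0 -ch mulVg ghom1. Qed.

Lemma ghom_eq chi chi' : ghom chi -> ghom chi' -> chi a = chi' a -> chi b = chi' b -> chi =1 chi'.
Proof.
move=> ch ch' ea eb; apply: (@fam_ind _ _ F) => [|g gE|g i gE].
- by rewrite !ghom1.
- by rewrite ch ch' gE ea.
- by rewrite ch ch' gE (single i i0) eb.
Qed.

Lemma ghom_neq0 chi g : ghom chi -> chi g != 0%R -> chi a = 0%R -> chi b = 0%R -> False.
Proof.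
move=> ch g0 a0 b0; case/eqP: g0; have h0 : ghom (fun=> 0%R) by move=> ? ?; rewrite addr0.
exact: ghom_eq ch h0 a0 b0 g.
Qed.

Definition hsum chi g : 'F_3 := (\sum_i chi (sec g i))%R.
Definition hmom chi g : 'F_3 := (\sum_i i * chi (sec g i))%R.

Lemma hsum_hom chi : ghom chi -> ghom (hsum chi).
Proof.
move=> ch g h; rewrite /hsum [X in (_ + X)%R](reindex_inj (addIr (lab g))) -big_split /=.
by apply: eq_bigr => i _; rewrite secM ch.
Qed.

Lemma sec_fb_fg x : sec b x = if x == fpos i0 then b else if x == (fpos i0 + 1)%R then a else 1.
Proof.
by rewrite sec_fb fE; case: eqP => // _; rewrite subr_eq addrC; case: eqP => _.
Qed.

Lemma sum_b chi (c : 'F_3 -> 'F_3) : ghom chi ->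
  (\sum_i c i * chi (sec b i) = c (fpos i0) * chi b + c (fpos i0 + 1) * chi a)%R.
Proof.
move=> ch; have r1 : (fpos i0 + 1 != fpos i0)%R.
  by rewrite -subr_eq0 addrAC subrr add0r oner_neq0.
rewrite (bigD1 (fpos i0)) //= (bigD1 (fpos i0 + 1)%R) //= big1 => [|i /andP[ir ir1]].
  by rewrite !sec_fb_fg !eqxx (negPf r1) addr0.
by rewrite sec_fb_fg (negPf ir) (negPf ir1) ghom1 // mulr0.
Qed.

Lemma hsum_a chi : ghom chi -> hsum chi a = 0%R.
Proof. by move=> ch; rewrite /hsum big1 // => i _; rewrite sec_rt ghom1. Qed.

Lemma hsum_b chi : ghom chi -> hsum chi b = (chi a + chi b)%R.
Proof.
move=> ch; have := sum_b (fun=> 1%R) ch; rewrite !mul1r addrC => <-.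
by apply: eq_bigr => i _; rewrite mul1r.
Qed.

Lemma hsum0 chi g : ghom chi -> (chi a + chi b = 0)%R -> hsum chi g = 0%R.
Proof.
move=> ch ab; have h0 : ghom (fun=> 0%R) by move=> ? ?; rewrite addr0.
by apply: (ghom_eq (hsum_hom ch) h0); rewrite ?hsum_a ?hsum_b.
Qed.

Lemma hmom_hom chi : ghom chi -> (chi a + chi b = 0)%R -> ghom (hmom chi).
Proof.
move=> ch ab g h; have := hsum0 h ch ab; rewrite /hsum => hs.
have -> : hmom chi h = (\sum_i (i + lab g) * chi (sec h (i + lab g)))%R.
  by rewrite /hmom (reindex_inj (addIr (lab g))).
have hs' : (\sum_i lab g * chi (sec h (i + lab g)) = 0)%R.
  by rewrite -mulr_sumr (reindex_inj (addIr (- lab g))%R); under eq_bigr do rewrite /= subrK; rewrite hs mulr0.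
rewrite -[RHS]subr0 -[X in (_ - X)%R]hs' /hmom -big_split -sumrB /=.
by apply: eq_bigr => i _; rewrite secM ch; ring.
Qed.

Lemma hmom_a chi : ghom chi -> hmom chi a = 0%R.
Proof. by move=> ch; rewrite /hmom big1 // => i _; rewrite sec_rt ghom1 // mulr0. Qed.

Lemma hmom_b chi : ghom chi -> (chi a + chi b = 0)%R -> hmom chi b = chi a.
Proof.
move=> ch ab; rewrite /hmom (sum_b id ch) mulrDl mul1r addrA -mulrDr [(chi b + _)%R]addrC ab.
by rewrite mulr0 add0r.
Qed.

Lemma lsum_hom m chi g : ghom chi -> chi a = 0%R -> lsum m (fun u => chi (secw g u)) = chi g.
Proof.
move=> ch ca; elim: m => [|m IHm]; first by rewrite lsum0.
rewrite lsumS -[RHS]IHm; apply: eq_lsum => u _.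
under eq_bigr do rewrite secw_rcons.
by apply: (ghom_eq (hsum_hom ch) ch); rewrite ?hsum_a ?hsum_b // ca add0r.
Qed.

Lemma lsumS_hom m chi g : ghom chi ->
  lsum m.+1 (fun u => chi (secw g u)) = hsum chi g.
Proof.
move=> ch; rewrite lsumS -(lsum_hom m g (hsum_hom ch) (hsum_a ch)).
by apply: eq_lsum => u _; apply: eq_bigr => i _; rewrite secw_rcons.
Qed.

Lemma fix_secw u h : exists2 g, act g u = u & secw g u = h.
Proof.
elim: u => [|x u [g gu gh]]; first by exists h.
have [s s0 sx] := fractal F g x; exists s; last by rewrite /= sx.
by rewrite /= s0 addr0 sx gu.
Qed.

(** Two non-zero cocycles played against each other: Om contains the cocycle of [chi] up to the
    coboundary of [phi], and the linear form [f] fails to be invariant exactly by pairing with the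
    cocycle of [chi']. *)
Record obstruction m (Om : (seq 'F_3 -> 'F_3) -> Prop) (f : (seq 'F_3 -> 'F_3) -> 'F_3)
    (phi : seq 'F_3 -> 'F_3) (chi chi' : S -> 'F_3) : Prop := Obstruction {
  ob_sm : submodule S m Om;
  ob_ext : forall nu nu', Om nu -> (forall u, size u = m -> nu u = nu' u) -> f nu = f nu';
  ob_D : forall nu nu', Om nu -> Om nu' -> f (fun u => nu u + nu' u)%R = (f nu + f nu')%R;
  ob_Z : forall c nu, Om nu -> f (fun u => c * nu u)%R = (c * f nu)%R;
  ob_act : forall g nu, Om nu -> f (fun u => nu (act g u)) =
    (f nu + lsum m (fun u => nu (act g u) * chi' (secw g u)))%R;
  ob_mem : forall g, Om (fun u => chi (secw g u) + phi u - phi (act g u))%R;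
  ob_chi : ghom chi;
  ob_chi' : ghom chi';
  ob_nz : exists g, chi g != 0%R;
  ob_nz' : exists g, chi' g != 0%R }.

Lemma obstruction0 Om f phi chi chi' : ~ obstruction 0 Om f phi chi chi'.
Proof.
case=> OmP f_ext _ _ f_act memO _ _ [g g0] [h h0].
pose o u := (chi (secw g u) + phi u - phi (act g u))%R; have Og : Om o := memO g.
have := f_act h _ Og; rewrite lsum0 /= (f_ext _ o (sm_act OmP h Og)); last by case.
rewrite /o /= addrK => /eqP; rewrite -[X in X == _]addr0 (inj_eq (addrI _)) eq_sym.
by rewrite mulf_eq0 (negPf g0) (negPf h0).
Qed.

Section Step.
Variables (m : nat) (Om : (seq 'F_3 -> 'F_3) -> Prop) (f : (seq 'F_3 -> 'F_3) -> 'F_3).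
Variables (phi : seq 'F_3 -> 'F_3) (chi chi' : S -> 'F_3).
Hypothesis ob : obstruction m.+1 Om f phi chi chi'.

Let OmP := ob_sm ob.
Let ch := ob_chi ob.
Let ch' := ob_chi' ob.
Let om g := (fun u => chi (secw g u) + phi u - phi (act g u))%R.

(** Om contains the constants, on which f is invariant; applied to b this makes the sum of the
    cocycle of [chi'] vanish. *)
Lemma caseA : (chi' a + chi' b = 0)%R.
Proof.
apply: contrapT => /eqP c0; have [g g0] := ob_nz ob.
pose u := nseq m.+1 (0%R : 'F_3); have [h hu hg] := fix_secw u g.
have om0 : om h u != 0%R by rewrite /om hg hu addrK.
have O1 := submodule_const F OmP (ob_mem ob h) (size_nseq _ _) om0.
have := ob_act ob b O1; under eq_lsum do rewrite mul1r.
rewrite (lsumS_hom m b ch') hsum_b // => /eqP.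
by rewrite -[X in X == _]addr0 (inj_eq (addrI _)) eq_sym (negPf c0).
Qed.

(** Otherwise the cocycle of b has non-zero sum and Om is everything. A delta function at u fixed by
    h, where h has section g at u, then gives [chi' g = 0] for all g. *)
Lemma caseB : (chi a + chi b = 0)%R.
Proof.
apply: contrapT => /eqP c0; have [g g0] := ob_nz' ob.
have Oall nu : Om nu.
  apply: (submodule_full F OmP _ (ob_mem ob b)); rewrite -/(om b).
  have -> : lsum m.+1 (om b) = (lsum m.+1 (fun u => chi (secw b u)) + lsum m.+1 phi
      - lsum m.+1 (fun u => phi (act b u)))%R by rewrite /lsum -sumrN -!big_split.
  by rewrite lsum_act addrK (lsumS_hom m b ch) hsum_b.
have [u /eqP um] : exists u : seq 'F_3, size u = m.+1 by exists (nseq m.+1 0%R); exact: size_nseq.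
have [h hu hg] := fix_secw u g.
pose d v : 'F_3 := (v == u)%:R%R.
have dE v : d (act h v) = d v.
  by rewrite /d -{1}hu (inj_eq (can_inj (actK h))).
have := ob_act ob h (Oall d); rewrite (ob_ext ob (nu' := d)) // => /eqP.
rewrite -[X in X == _]addr0 (inj_eq (addrI _)) eq_sym /lsum.
rewrite (bigD1 (Tuple um)) //= dE {1}/d eqxx mul1r hg big1 ?addr0 ?(negPf g0) // => t tu.
by rewrite dE /d -val_eqE /= in tu *; rewrite (negPf tu) mul0r.
Qed.

Definition lS nu u : 'F_3 := (\sum_i nu (rcons u i))%R.
Definition lD nu u : 'F_3 := (\sum_i i * nu (rcons u i))%R.
Definition up mu (w : seq 'F_3) : 'F_3 := mu (take m w).

Lemma up_rcons mu u i : size u = m -> up mu (rcons u i) = mu u.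
Proof. by move=> um; rewrite /up -cats1 take_size_cat. Qed.

Lemma lS_act nu g u : lS (fun w => nu (act g w)) u = lS nu (act g u).
Proof.
rewrite /lS [RHS](reindex_inj (addIr (lab (secw g u)))).
by apply: eq_bigr => i _; rewrite act_rcons.
Qed.

Lemma lD_act nu g u :
  lD (fun w => nu (act g w)) u = (lD nu (act g u) - lab (secw g u) * lS nu (act g u))%R.
Proof.
rewrite /lD /lS [X in (X - _)%R](reindex_inj (addIr (lab (secw g u)))).
rewrite [X in (_ - _ * X)%R](reindex_inj (addIr (lab (secw g u)))) mulr_sumr -sumrB /=.
by apply: eq_bigr => i _; rewrite act_rcons; ring.
Qed.

Lemma rcons_case (P : seq 'F_3 -> Prop) :
  (forall u i, size u = m -> P (rcons u i)) -> forall w, size w = m.+1 -> P w.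
Proof.
move=> Pr w; case/lastP: w => // u i; rewrite size_rcons => -[um]; exact: Pr.
Qed.

(** For s the copy of [bx 0, a] below u, the cocycle of [chi] is [chi a] times the indicator of u,
    whatever the last letter is; its sum over level m is non-zero. *)
Lemma up_Om mu : Om (up mu).
Proof.
have upP : submodule S m (fun mu => Om (up mu)).
  split=> [nu nu' nn|| nu nu'|c nu|g nu].
  - by apply: (sm_ext OmP); apply: rcons_case => u i um; rewrite !up_rcons // nn.
  - exact: sm_0 OmP.
  - exact: (sm_D OmP).
  - exact: (sm_Z OmP).
  - move/(sm_act OmP g); apply: (sm_ext OmP); apply: rcons_case => u i um.
    by rewrite act_rcons !up_rcons ?size_act.
have ca0 : chi a != 0%R.
  apply/negP => /eqP ca; have [g g0] := ob_nz ob; apply: (ghom_neq0 ch g0 ca).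
  by have := caseB; rewrite ca add0r.
have [u um] : exists u : seq 'F_3, size u = m by exists (nseq m 0%R); exact: size_nseq.
pose t := [~ bx i0 0%R, a].
have odd3 : odd 3 by [].
have t2 : gam 2 t by exact: (@gamS _ 1).
have [s s2 [sm sE]] := injmap_injw u (injmap_fg single odd3 fE) t2.
rewrite um in sm.
pose d v : 'F_3 := (chi a * (v == u)%:R)%R.
apply: (submodule_full F upP (nu := d)) => /=; last first.
  rewrite lsumZ /lsum (big_only1 (Tuple (introT eqP um))) ?eqxx ?mulr1 //= => v.
  by rewrite -val_eqE /= => /negPf ->.
apply: (sm_ext OmP) (ob_mem ob s); apply: rcons_case => v i vm.
have sv : secw s v = if v == u then t else 1 by apply: sE; rewrite um.
have lv : lab (secw s v) = 0%R by rewrite sv; case: eqP => _; [exact: gam2_lab | exact: lab1].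
rewrite up_rcons // act_rcons (act_St sm) ?vm // lv addr0 addrK secw_rcons sv /d.
case: eqP => _; last by rewrite sec1 ghom1 // mulr0.
rewrite mulr1 /t commgEl bx_rt add0r secM0 ?labV ?lab_bx ?oppr0 // secV0 ?lab_bx //.
rewrite ch ghomV // !sec_bx !fE.
have cb : chi b = (- chi a)%R by apply/eqP; rewrite -addr_eq0 addrC caseB.
have ia : forall k : 'F_3, chi (a ^+ k) = (k * chi a)%R.
  move=> k; rewrite -[k in RHS]natr_Zp; elim: (nat_of_ord k) => [|n IHn]; first by rewrite mul0r ghom1.
  by rewrite expgS ch IHn -natr1; ring.
have i3 : [\/ i = 0, i = 1 | i = -1]%R.
  case: i => [[|[|[|//]]] ?]; [constructor 1|constructor 2|constructor 3]; exact: val_inj.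
case: i3 => ->.
- rewrite eqxx (_ : (0 == 1 :> 'F_3)%R = false) //.
  by rewrite (_ : (0 - 1 == 1 :> 'F_3)%:R = 0 :> 'F_3)%R // ia mul0r addr0 cb opprK.
- rewrite eqxx (_ : (1 == 0 :> 'F_3)%R = false) //.
  rewrite (_ : (1 - 0 == 1 :> 'F_3)%:R = 1 :> 'F_3)%R // ia mul1r cb.
  have -> : (- chi a + - chi a = chi a - 3%:R * chi a)%R by ring.
  by rewrite mul3F3 subr0.
- rewrite (_ : (-1 == 0 :> 'F_3)%R = false) // (_ : (-1 == 1 :> 'F_3)%R = false) //.
  rewrite (_ : (-1 - 0 == 1 :> 'F_3)%:R = 0 :> 'F_3)%R //.
  rewrite (_ : (-1 - 1 == 1 :> 'F_3)%:R = 1 :> 'F_3)%R // !ia.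
  by rewrite mul0r oppr0 add0r mul1r.
Qed.

Lemma f_up : exists th, forall mu, f (up mu) = (th * lsum m mu)%R.
Proof.
have [u um] : exists u : seq 'F_3, size u = m by exists (nseq m 0%R); exact: size_nseq.
pose d v : 'F_3 := (v == u)%:R%R; exists (f (up d)); set th := f _ => mu.
have d1 : lsum m d = 1%R.
  rewrite /lsum (big_only1 (Tuple (introT eqP um))) /d ?eqxx //= => v.
  by rewrite -val_eqE /= => /negPf ->.
have KP : submodule S m (fun mu => f (up mu) = th * lsum m mu)%R.
  split=> [nu nu' nn fnu||nu nu' fnu fnu'|c nu fnu|g nu fnu].
  - rewrite -(eq_lsum nn) -fnu; apply: (ob_ext ob); first exact: up_Om.
    by apply: rcons_case => v i vm; rewrite !up_rcons // nn.
  - have := ob_Z ob 0%R (up_Om d); rewrite mul0r => f0.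
    rewrite /lsum big1 // mulr0 -[RHS]f0; apply: (ob_ext ob); first exact: up_Om.
    by move=> v _; rewrite mul0r.
  - by rewrite lsumD mulrDr -fnu -fnu'; exact: (ob_D ob (up_Om _) (up_Om _)).
  - by rewrite lsumZ mulrCA -fnu; exact: (ob_Z ob c (up_Om _)).
  - rewrite (lsum_act (S := S)) -fnu; transitivity (f (fun w => up nu (act g w))).
      apply: (ob_ext ob); first exact: up_Om.
      by apply: rcons_case => v i vm; rewrite act_rcons !up_rcons ?size_act.
    rewrite (ob_act ob g (up_Om _)) lsumS.
    rewrite (@eq_lsum _ m _ (fun=> 0%R)) => [|v vm]; first by rewrite /lsum big1 ?addr0.
    under eq_bigr do rewrite act_rcons up_rcons ?size_act // secw_rcons.
    by rewrite -mulr_sumr -/(hsum chi' _) (hsum0 _ ch' caseA) mulr0.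
by apply: (submodule_full F KP _ (_ : _ d)); rewrite d1 ?mulr1 ?oner_neq0.
Qed.

Lemma F3_case (i : 'F_3) : [\/ i = 0, i = 1 | i = -1]%R.
Proof.
case: i => [[|[|[|//]]] ?]; [constructor 1|constructor 2|constructor 3]; exact: val_inj.
Qed.

(** In characteristic 3, three values with sum 0 form an affine function of the letter. *)
Lemma lS_eq0 nu u i : lS nu u = 0%R -> nu (rcons u i) = (nu (rcons u 0) - i * lD nu u)%R.
Proof.
rewrite /lS /lD !sumF3 => s0; have [->|->|->] := F3_case i; first by ring.
- move: s0 (mul3F3 (nu (rcons u 1%R))); set x := nu _; set y := nu _; set w := nu _ => s0 y3.
  transitivity (x - 1 * (0 * x + 1 * y + -1 * w) - (x + y + w) + 3%:R * y)%R; first by ring.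
  by rewrite s0 y3 subr0 addr0.
- move: s0 (mul3F3 (nu (rcons u (-1)%R))); set x := nu _; set y := nu _; set w := nu _ => s0 w3.
  transitivity (x - -1 * (0 * x + 1 * y + -1 * w) - (x + y + w) + 3%:R * w)%R; first by ring.
  by rewrite s0 w3 subr0 addr0.
Qed.

Section CaseC.
Variable th : 'F_3.
Hypothesis f_upE : forall mu, f (up mu) = (th * lsum m mu)%R.

(** Subtracting the value of f on the part independent of the last letter makes this depend only on
    the slope ([fval_eq]), so f descends to [f1]. *)
Definition fval nu : 'F_3 := (f nu - th * lsum m (fun u => nu (rcons u 0%R)))%R.

Definition lowers nu mu := [/\ Om nu, forall u, size u = m -> lS nu u = 0%R &
  forall u, size u = m -> lD nu u = mu u].

Lemma fval_eq nu nu' mu : lowers nu mu -> lowers nu' mu -> fval nu = fval nu'.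
Proof.
move=> [On Sn Dn] [On' Sn' Dn']; pose d u := (nu (rcons u 0) - nu' (rcons u 0))%R.
have -> : fval nu = (f (fun w => nu' w + up d w) - th * lsum m (fun u => nu (rcons u 0)))%R.
  congr (_ - _)%R; apply: (ob_ext ob On); apply: rcons_case => u i um.
  by rewrite up_rcons // (lS_eq0 i (Sn u um)) (lS_eq0 i (Sn' u um)) Dn // Dn' // /d; ring.
rewrite (ob_D ob On' (up_Om d)) f_upE /fval -addrA; congr (_ + _)%R.
have -> : lsum m d = (lsum m (fun u => nu (rcons u 0)) - lsum m (fun u => nu' (rcons u 0)))%R.
  by rewrite /lsum -sumrB.
ring.
Qed.

Definition Om1 mu := exists nu, lowers nu mu.

Definition f1 mu : 'F_3 :=
  if pselect (Om1 mu) is left ex then fval (projT1 (cid ex)) else 0%R.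

Lemma f1E nu mu : lowers nu mu -> f1 mu = fval nu.
Proof.
move=> low; rewrite /f1; case: pselect => [ex|[]]; last by exists nu.
by case: cid => nu' low'; exact: fval_eq low' low.
Qed.

Lemma lowersD nu nu' mu mu' : lowers nu mu -> lowers nu' mu' ->
  lowers (fun w => nu w + nu' w)%R (fun u => mu u + mu' u)%R.
Proof.
move=> [On Sn Dn] [On' Sn' Dn']; split=> [|u um|u um]; first exact (sm_D OmP On On').
  by rewrite /lS big_split /= -/(lS nu u) -/(lS nu' u) Sn // Sn' // addr0.
rewrite -Dn // -Dn' // /lD -big_split /=; apply: eq_bigr => i _; ring.
Qed.

Lemma lowersZ c nu mu : lowers nu mu -> lowers (fun w => c * nu w)%R (fun u => c * mu u)%R.
Proof.
move=> [On Sn Dn]; split=> [|u um|u um]; first exact (sm_Z OmP c On).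
  by rewrite /lS -mulr_sumr -/(lS nu u) Sn // mulr0.
rewrite -Dn // /lD mulr_sumr; apply: eq_bigr => i _; ring.
Qed.

Lemma lowers_act g nu mu : lowers nu mu ->
  lowers (fun w => nu (act g w)) (fun u => mu (act g u)).
Proof.
move=> [On Sn Dn]; split=> [|u um|u um]; first exact (sm_act OmP g On).
  by rewrite lS_act Sn // size_act.
by rewrite lD_act Sn ?size_act // mulr0 subr0 Dn // size_act.
Qed.

Lemma lowers_ext nu mu mu' : (forall u, size u = m -> mu u = mu' u) ->
  lowers nu mu -> lowers nu mu'.
Proof. by move=> mm [On Sn Dn]; split=> // u um; rewrite -mm ?Dn. Qed.

Lemma lowers0 : lowers (fun=> 0%R) (fun=> 0%R).
Proof.
split=> [|u _|u _]; first exact: sm_0 OmP; first by rewrite /lS big1.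
by rewrite /lD big1 // => i _; rewrite mulr0.
Qed.

Definition chi1' g : 'F_3 := (th * lab g - hmom chi' g)%R.

Lemma fval_act g nu mu : lowers nu mu -> fval (fun w => nu (act g w)) =
  (fval nu + lsum m (fun u => mu (act g u) * chi1' (secw g u)))%R.
Proof.
move=> [On Sn Dn]; rewrite /fval (ob_act ob g On) lsumS.
have -> : lsum m (fun u => \sum_i nu (act g (rcons u i)) * chi' (secw g (rcons u i)))%R =
    lsum m (fun u => - (mu (act g u) * hmom chi' (secw g u)))%R.
  apply: eq_lsum => u um; rewrite -Dn ?size_act //.
  have hs := hsum0 (secw g u) ch' caseA.
  have -> : (\sum_i nu (act g (rcons u i)) * chi' (secw g (rcons u i)) =
      nu (rcons (act g u) (lab (secw g u))) * hsum chi' (secw g u)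
      - lD nu (act g u) * hmom chi' (secw g u))%R.
    rewrite /hsum /hmom !mulr_sumr -sumrB; apply: eq_bigr => i _; rewrite act_rcons secw_rcons.
    have S0 : lS nu (act g u) = 0%R by rewrite Sn // size_act.
    by rewrite (lS_eq0 (i + lab (secw g u))%R S0) (lS_eq0 (lab (secw g u)) S0); ring.
  by rewrite hs mulr0 sub0r.
have -> : lsum m (fun u => nu (act g (rcons u 0)))%R =
    (lsum m (fun u => nu (rcons u 0)) - lsum m (fun u => mu (act g u) * lab (secw g u)))%R.
  rewrite -(lsum_act m g (fun u => nu (rcons u 0%R))) /lsum -sumrB; apply: eq_bigr => u _.
  have S0 : lS nu (act g u) = 0%R by rewrite Sn // size_act size_tuple.
  rewrite act_rcons add0r (lS_eq0 (lab (secw g u)) S0).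
  by rewrite Dn ?size_act ?size_tuple // mulrC.
have -> : lsum m (fun u => mu (act g u) * chi1' (secw g u))%R =
    (th * lsum m (fun u => mu (act g u) * lab (secw g u))
     + lsum m (fun u => - (mu (act g u) * hmom chi' (secw g u))))%R.
  by rewrite -lsumZ -lsumD; apply: eq_lsum => u _; rewrite /chi1'; ring.
ring.
Qed.

Lemma chi1'_hom : ghom chi1'.
Proof. by move=> g h; rewrite /chi1' labM (hmom_hom ch' caseA); ring. Qed.

Lemma chi1'_nz : exists g, chi1' g != 0%R.
Proof.
exists b; rewrite /chi1' lab_fb mulr0 sub0r oppr_eq0 hmom_b ?caseA //.
apply/negP => /eqP ca; have [g g0] := ob_nz' ob; apply: (ghom_neq0 ch' g0 ca).
by have := caseA; rewrite ca add0r.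
Qed.

Lemma obstruction_step phi1 chi1 : ghom chi1 -> (exists g, chi1 g != 0%R) ->
    (forall g, Om1 (fun u => chi1 (secw g u) + phi1 u - phi1 (act g u))%R) ->
  obstruction m Om1 f1 phi1 chi1 chi1'.
Proof.
move=> ch1 nz1 mem1; split=> //.
- split=> [mu mu' mm [nu low]||mu mu' [nu low] [nu' low']|c mu [nu low]|g mu [nu low]].
  + by exists nu; exact: lowers_ext low.
  + by exists (fun=> 0%R); exact: lowers0.
  + by eexists; exact: lowersD low low'.
  + by eexists; exact: lowersZ c _ _ low.
  + by eexists; exact: lowers_act low.
- by move=> mu mu' [nu low] mm; rewrite (f1E low) (f1E (lowers_ext mm low)).
- move=> mu mu' [nu low] [nu' low']; have [On _ _] := low; have [On' _ _] := low'.
  rewrite (f1E low) (f1E low') (f1E (lowersD low low')) /fval (ob_D ob On On') lsumD; ring.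
- move=> c mu [nu low]; have [On _ _] := low.
  rewrite (f1E low) (f1E (lowersZ c low)) /fval (ob_Z ob c On) lsumZ; ring.
- by move=> g mu [nu low]; rewrite (f1E low) (f1E (lowers_act g low)) (fval_act g low).
- exact: chi1'_hom.
- exact: chi1'_nz.
Qed.

Lemma lD_om g u : lD (om g) u = (hmom chi (secw g u) + lD phi u - lD phi (act g u)
   + lab (secw g u) * lS phi (act g u))%R.
Proof.
have -> : lD (om g) u = (hmom chi (secw g u) + lD phi u - lD (fun w => phi (act g w)) u)%R.
  rewrite /lD /hmom -big_split -sumrB /=; apply: eq_bigr => i _.
  by rewrite /om secw_rcons; ring.
by rewrite lD_act; ring.
Qed.

Lemma lS_om g u : lS (om g) u = (lS phi u - lS phi (act g u))%R.
Proof.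
have -> : lS (om g) u = (hsum chi (secw g u) + lS phi u - lS (fun w => phi (act g w)) u)%R.
  rewrite /lS /hsum -big_split -sumrB /=; apply: eq_bigr => i _.
  by rewrite /om secw_rcons.
by rewrite lS_act (hsum0 _ ch caseB) add0r.
Qed.

(** If all of Om sums to 0 over the last letter, [lS phi] is a constant c and slopes of the old
    cocycle belong to [hmom chi + c * lab]. Otherwise some nu in Om has all these sums equal to 1,
    and the slopes of its coboundaries give the cocycle of [lab]. *)
Lemma obstruction_next : exists phi1 chi1, obstruction m Om1 f1 phi1 chi1 chi1'.
Proof.
have [S0|nS0] := pselect (forall nu u, Om nu -> size u = m -> lS nu u = 0%R).
  have phi_c g u : size u = m -> lS phi (act g u) = lS phi u.
    move=> um; have /eqP := S0 _ u (ob_mem ob g) um; rewrite -/(om g) lS_om subr_eq0.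
    by move/eqP.
  pose c := lS phi (nseq m 0%R).
  have phi_cE u : size u = m -> lS phi u = c.
    move=> um; have [g gu _] := act_trans F (etrans um (esym (size_nseq m (0%R : 'F_3)))).
    by rewrite /c -gu phi_c.
  exists (lD phi), (fun g => hmom chi g + c * lab g)%R; apply: obstruction_step.
  - by move=> g h; rewrite (hmom_hom ch caseB) labM; ring.
  - exists b; rewrite lab_fb mulr0 addr0 (hmom_b ch caseB).
    apply/negP => /eqP ca; have [g g0] := ob_nz ob; apply: (ghom_neq0 ch g0 ca).
    by have := caseB; rewrite ca add0r.
  - move=> g; exists (om g); split=> [|u um|u um]; first exact: ob_mem ob g.
      exact: S0 (ob_mem ob g) um.
    by rewrite lD_om phi_cE ?size_act //; ring.
have [nu1 [u1 [On1 u1m nu1n]]] : exists nu u, [/\ Om nu, size u = m & lS nu u != 0%R].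
  apply: contrapT => nex; apply: nS0 => nu u On um; apply: contrapT => /eqP nn.
  by apply: nex; exists nu, u.
have SP : submodule S m (fun mu => exists2 nu, Om nu & forall u, size u = m -> lS nu u = mu u).
  split=> [mu mu' mm [nu On nuE]||mu mu' [nu On nuE] [nu' On' nuE']|c mu [nu On nuE]|g mu [nu On nuE]].
  - by exists nu => // u um; rewrite nuE ?mm.
  - exists (fun=> 0%R); first exact: sm_0 OmP.
    by move=> u _; rewrite /lS big1.
  - exists (fun w => nu w + nu' w)%R; first exact (sm_D OmP On On').
    by move=> u um; rewrite /lS big_split /= -/(lS nu u) -/(lS nu' u) nuE // nuE'.
  - exists (fun w => c * nu w)%R; first exact (sm_Z OmP c On).
    by move=> u um; rewrite /lS -mulr_sumr -/(lS nu u) nuE.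
  - exists (fun w => nu (act g w)); first exact (sm_act OmP g On).
    by move=> u um; rewrite lS_act nuE // size_act.
have [|nu On nuE] := submodule_const F SP (nu := lS nu1) _ u1m nu1n; first by exists nu1.
exists (lD nu), (@lab _ S); apply: obstruction_step.
- exact: labM.
- by exists a; rewrite lab_rt oner_neq0.
- move=> g; exists (fun w => nu w + -1 * nu (act g w))%R; split=> [|u um|u um].
  + apply: (sm_D OmP On); exact (sm_Z OmP (-1)%R (sm_act OmP g On)).
  + rewrite /lS big_split /= -mulr_sumr -/(lS nu u) -/(lS (fun w => nu (act g w)) u).
    by rewrite lS_act !nuE ?size_act //; ring.
  + have -> : lD (fun w => nu w + -1 * nu (act g w))%R u =
        (lD nu u - lD (fun w => nu (act g w)) u)%R.
      by rewrite /lD -sumrB; apply: eq_bigr => i _; ring.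
    by rewrite lD_act nuE ?size_act //; ring.
Qed.

End CaseC.
End Step.

Lemma obstruction_false m Om f phi chi chi' : ~ obstruction m Om f phi chi chi'.
Proof.
elim: m Om f phi chi chi' => [|m IHm] Om f phi chi chi'; first exact: obstruction0.
move=> ob; have [th thE] := f_up ob; have [phi1 [chi1 /IHm]] := obstruction_next ob thE.
by [].
Qed.

End Ternary.

(** * The Fabrykowski-Gupta group for p = 3 and m > 0 *)

Section TernaryConclusion.
Variables (S : ssgroup 3) (F : family S).
Hypothesis single : forall i j : fI F, i = j.
Hypothesis fE : forall (i : fI F) y, fe i y = (y == 1%R)%:R%R.
Variables (A N : nsub S) (m n0 : nat).
Hypothesis ASt : forall s : S, stab S n0 s -> A s.
Hypothesis NA : forall n h : S, N n -> A [~ n, h].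
Hypothesis NSt : forall n : S, N n -> stab S m n.
Variables (n1 : S) (u1 : seq 'F_3).
Hypotheses (Nn1 : N n1) (size_u1 : size u1 = m) (lab_n1 : lab (secw n1 u1) != 0%R).
Hypothesis m_gt0 : 0 < m.
Implicit Types (g h s t : S) (u v w : seq 'F_3) (k l : 'F_3).
Local Notation p_pr := (ss_prime S).
Local Notation a := (rt S).
Local Notation i0 := (fi0 F).
Local Notation b := (fb i0).
Local Notation z := [~ b, a].
Local Notation R := (red F A (gam 2) m).

Let odd3 : odd 3 := isT.
Let z2 : gam 2 z := @gamS _ 1 _ _ I.

Definition c0 := [~ bx i0 0%R, bx i0 (-1)%R].

Lemma c0_inj : injp 0%R z c0.
Proof.
split=> [||y y0]; first exact: labR.
  by rewrite secR0 ?lab_bx // !sec_bx !fE eqxx (_ : (0 == -1 :> 'F_3)%R = false).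
rewrite secR0 ?lab_bx // !sec_bx !fE (negPf y0); have [->|yN] := eqVneq y (-1)%R.
  by rewrite (_ : (-1 - 0 == 1 :> 'F_3)%R = false) // expg0 comm1g.
by apply/eqP/commgP/commuteX2/commute_refl.
Qed.

Lemma c0_gam3 : gam 3 c0.
Proof. exact: gam3_bxR. Qed.

Lemma zb_c0 : qpi (cl (gam 4)) [~ z, b] = qpi (cl (gam 4)) c0.
Proof. by rewrite pi_bxR (expgFN p_pr (pi_bzp F)) (expgF1 3) -qpiV invgR. Qed.

Lemma red_n n u t : N n -> size u = m -> gam 2 t -> R [~ t, secw n u].
Proof. move=> Nn um t2; exact (red_comm F (injmap_fg single odd3 fE) NA NSt Nn um t2). Qed.

Lemma c0_red s : lab s = 0%R -> R [~ c0, s].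
Proof.
move=> s0; have := injpR s0 c0_inj; apply: injmap_mem (inj3_red single odd3 fE ASt NA NSt Nn1 size_u1 lab_n1) _.
exact: gamS.
Qed.

(** Modulo R, [c0] commutes with St(1), since its commutators there are copies of elements of
    [gam 3], and with a section of n1 of invertible label. *)
Lemma c0_ncent : ncent R c0.
Proof.
apply: (single_ncent single); last exact/c0_red/lab_fb.
have c2 : gam 2 c0 by exact: gam_sub c0_gam3.
have := red_n Nn1 size_u1 c2; set n := secw n1 u1; set l := lab n.
have -> : n = a ^+ l * ((a ^+ l)^-1 * n) by rewrite mulKVg.
rewrite commgMr => Rn.
have Rl : R [~ c0, a ^+ l].
  apply: (@nsubJE _ _ _ ((a ^+ l)^-1 * n)).
  rewrite -[X in nmem R X](mulKg [~ c0, (a ^+ l)^-1 * n]); apply: nsubM => //.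
  by apply/nsubV/c0_red; rewrite labM labV lab_rtF addNr.
apply/qpi_commute; have -> : a = (a ^+ l) ^+ l^-1%R.
  by rewrite -(expgFM p_pr (rt_p S)) divff // (expgF1 3).
by rewrite (qpiX _ (a ^+ l)); apply: commuteX; apply/qpi_commute.
Qed.

Lemma za_c0 (T : nsub S) : (forall g, gam 4 g -> T g) -> (forall g, R g -> T g) ->
  (forall g, cl T g -> T g) -> exists k, qpi T [~ z, a] = qpi T c0 ^+ k.
Proof.
move=> T4 TR Tcl; have [e ne] := repA_exists F (secw n1 u1).
have zb : qpi T [~ z, b] = qpi T c0.
  apply/qpiP/Tcl; apply: (clS T4); apply/qpiP; exact: zb_c0.
have := qpi_z_repA single T4 ne; have /TR/qpi_id -> := red_n Nn1 size_u1 z2.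
rewrite zb; set l := lab _; set C := qpi T c0; set X := qpi T _ => E.
have Xp : X ^+ 3 = 1 by exact: (qpi_zp F T4 (rt_p S)).
have Cp : C ^+ 3 = 1 by rewrite /C -zb; exact: (qpi_zp F T4 (fb_p i0)).
exists (- e i0 / l)%R; rewrite (expgFM p_pr Cp) (expgFN p_pr Cp).
have -> : (C ^+ e i0)^-1 = X ^+ l by apply: (mulIg (C ^+ e i0)); rewrite mulVg -E.
by rewrite -(expgFM p_pr Xp) divff // (expgF1 3).
Qed.

(** Modulo R and [gam 4], up to closure, [z,a] and [z,b] are powers of [c0], which is central modulo
    R; so [gam 4] is absorbed. *)
Lemma gam4_cl g : gam 4 g -> cl R g.
Proof.
apply: gam_absorb_cl => // {}g; set T := cl _.
have TR h : R h -> T h by move=> Rh; apply: sub_cl; exact: mulnsl.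
have Tc : ncent T c0.
  by apply/ncentP => h; apply: TR; have /ncentP := c0_ncent.
have cent (h r : S) : cl (mulns R (gam 4)) r -> T [~ r, h].
  apply: cl_comm => {}r {}h /mulnsP[r' [r4 [Rr' gr4 ->]]].
  rewrite commgMl; apply: nsubM; last by apply: mulnsr; exact: gamS.
  by apply: nsubJ; apply: mulnsl; exact: nsubRl.
have T4 t k : qpi (cl (mulns R (gam 4))) t = qpi (cl (mulns R (gam 4))) (c0 ^+ k) -> ncent T t.
  move/esym/qpiP => tr; rewrite -(mulKVg (c0 ^+ k) t); apply: nsubM; first exact: nsubX.
  by apply/ncentP => h; exact: cent.
apply: (single_gam4 single).
  have [h h4|h Rh|h|k] := @za_c0 (cl (mulns R (gam 4))).
  - by apply: sub_cl; exact: mulnsr.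
  - by apply: sub_cl; exact: mulnsl.
  - exact: cl_cl.
  - by rewrite -qpiX => /T4.
apply: (T4 _ 1%R); rewrite (expgF1 3); apply/qpiP.
have /qpiP := zb_c0; apply: clS => h h4; exact: mulnsr.
Qed.

Lemma gam3_cl : cl R c0 -> forall g, gam 3 g -> cl R g.
Proof.
move=> c0R; apply: (single_gam3 single).
  have [k] := za_c0 gam4_cl (fun g => @sub_cl _ _ R g) (fun g => @cl_cl _ _ R g).
  by move/qpi_id: c0R => ->; rewrite expg1n => /qpi_id.
by apply: qpi_mem (esym zb_c0) c0R => g; apply: cl_min; exact: gam4_cl.
Qed.

Section Nontrivial.
Hypothesis c0_notin : ~ cl R c0.
Local Notation pi := (qpi (cl R)).
Local Notation C := (pi c0).
Local Notation Z := (pi z).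

Lemma pi_zb : pi [~ z, b] = C.
Proof. by apply/qpiP; have /qpiP := zb_c0; apply: cl_min; exact: gam4_cl. Qed.

Lemma Cp : C ^+ 3 = 1.
Proof. by rewrite -pi_zb; exact: (qpi_zp F gam4_cl (fb_p i0)). Qed.

Lemma C_inj k l : C ^+ k = C ^+ l -> k = l.
Proof.
move=> kl; apply/eqP; rewrite -subr_eq0; apply/negP => /negP nz; apply: c0_notin.
apply/qpi_id; apply: (expgF_inv p_pr Cp nz).
by rewrite (expgFD p_pr Cp) (expgFN p_pr Cp) kl mulgV.
Qed.

Lemma C_central (q : quo (cl R)) : commute C q.
Proof. by apply: (gam3_central gam4_cl); exact: c0_gam3. Qed.

Lemma CX_central k (q : quo (cl R)) : commute (C ^+ k) q.
Proof. by apply: commute_sym; apply: commuteX; apply: commute_sym; exact: C_central. Qed.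

Lemma CX_conj k (q : quo (cl R)) : (C ^+ k) ^ q = C ^+ k.
Proof. exact/conjg_fixP/commgP/CX_central. Qed.

Lemma pi_za : exists k, pi [~ z, a] = C ^+ k.
Proof. exact: za_c0 gam4_cl (fun g => @sub_cl _ _ R g) (fun g => @cl_cl _ _ R g). Qed.

Lemma chi_exists g : exists k, pi [~ z, g] = C ^+ k.
Proof.
have [e ge] := repA_exists F g; have [k ka] := pi_za.
exists (k * lab g + e i0)%R; rewrite (qpi_z_repA single gam4_cl ge) ka pi_zb.
by rewrite (expgFD p_pr Cp) (expgFM p_pr Cp).
Qed.

Definition zchi g := projT1 (cid (chi_exists g)).

Lemma zchiE g : pi [~ z, g] = C ^+ zchi g.
Proof. by rewrite /zchi; case: cid. Qed.

Lemma zchi_hom : ghom zchi.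
Proof.
move=> g h; apply: C_inj.
by rewrite (expgFD p_pr Cp) -!zchiE (qpi_zM F gam4_cl).
Qed.

Lemma zchi_b : zchi b = 1%R.
Proof. by apply: C_inj; rewrite -zchiE pi_zb (expgF1 3). Qed.

Lemma zchi_repA g k e : repA g k e -> zchi g = (k * zchi a + e i0)%R.
Proof.
move=> ge; apply: C_inj; rewrite -zchiE (qpi_z_repA single gam4_cl ge) pi_zb zchiE.
by rewrite (expgFD p_pr Cp) [(k * _)%R]mulrC (expgFM p_pr Cp).
Qed.

Lemma zchi_secw n u : N n -> size u = m -> zchi (secw n u) = 0%R.
Proof.
move=> Nn um; apply: C_inj; rewrite -zchiE expgF0; apply/qpi_id/sub_cl.
exact: red_n Nn um z2.
Qed.

(** Consider the section of n1 at the parent of u1, which exists because m > 0. Its child sections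
    lie in the kernel of [zchi], which relates its exponents at successive letters by the factor
    [- zchi a]; going round three letters gives that factor cube 1. *)
Lemma zchi_a : zchi a = (-1)%R.
Proof.
case/lastP: u1 size_u1 lab_n1 => [|v x]; first by move=> /= m0; have := m_gt0; rewrite -m0.
rewrite size_rcons secw_rcons => vm; set n := secw n1 v.
have n_0 : lab n = 0%R.
  by apply/stab1; apply: (secw_St (n := size v)) => //; rewrite addn1 vm; exact: NSt.
have [e ne] := repB_exists F n_0.
have sum1 (f : fI F -> 'F_3) : (\sum_j f j = f i0)%R.
  by rewrite (big_only1 i0) // => j ji; rewrite (single j i0) eqxx in ji.
have labE y : lab (sec n y) = e i0 (y - 1)%R.
  rewrite (repB_lab_sec y n_0 ne) (big_only1 (y - 1)%R) //= => [|x' xy _].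
    by rewrite sum1 fE subKr eqxx mulr1.
  rewrite sum1 fE [(y - x' == 1)%R](_ : _ = false) ?mulr0 //; apply: contraNF xy => /eqP <-.
  by rewrite subKr.
have rel y : (e i0 (y - 1) * zchi a + e i0 y = 0)%R.
  rewrite -labE -[RHS](zchi_secw Nn1 (u := rcons v y)) ?size_rcons ?vm //.
  rewrite secw_rcons -/n.
  by have := repB_sec y n_0 ne; rewrite -(repB_lab_sec y n_0 ne) => /zchi_repA ->.
rewrite labE => ex0; have step y : e i0 (y + 1)%R = (- zchi a * e i0 y)%R.
  have := rel (y + 1)%R; rewrite addrK => /eqP; rewrite addr_eq0 => /eqP E.
  by rewrite -[LHS]opprK -E; ring.
have cyc : (e i0 (x - 1) = (- zchi a) ^+ 3 * e i0 (x - 1))%R.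
  have x3 : (x - 1 + 1 + 1 + 1 = x - 1)%R.
    by rewrite -[RHS]addr0 -[X in _ = (_ + X)%R](mul3F3 1%R); ring.
  by rewrite -{1}x3 !step; ring.
have c1 : ((- zchi a) ^+ 3 = 1)%R by apply: (mulIf ex0); rewrite mul1r -cyc.
by have [E|E|E] := F3_case (zchi a); rewrite E // in c1 *.
Qed.

Lemma Z_conj s : Z ^ pi s = Z * C ^+ zchi s.
Proof. by rewrite -qpiJ -zchiE -qpiM commgEl mulKVg. Qed.

(** Expand [b,a^3] = 1 as z z^a z^(a^2) and use that C is central of order dividing 3. *)
Lemma Zp : Z ^+ 3 = 1.
Proof.
have Za : pi (z ^ a) = Z * C^-1.
  by rewrite qpiJ Z_conj zchi_a (expgFN p_pr Cp) (expgF1 3).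
have Cc (q : quo (cl R)) : commute C^-1 q.
  by apply: commute_sym; apply: commuteV; apply: commute_sym; exact: C_central.
have CJ (q : quo (cl R)) : C^-1 ^ q = C^-1 by exact/conjg_fixP/commgP/Cc.
have Zaa : pi (z ^ (a * a)) = Z * C^-1 * C^-1.
  by rewrite conjgM (qpiJ _ (z ^ a)) Za conjMg CJ -qpiJ Za.
have : pi (z * z ^ a * z ^ (a * a)) = 1.
  have <- : [~ b, a * (a * a)] = z * z ^ a * z ^ (a * a) by rewrite commgMr commgMr.
  have -> : a * (a * a) = 1 by exact: rt_p.
  by rewrite commg1 qpi1.
rewrite (qpiM _ (z * z ^ a)) (qpiM _ z (z ^ a)) Za Zaa !mulgA.
rewrite -(mulgA (Z * Z) C^-1 Z) (Cc Z) !mulgA => E.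
have C3 : C^-1 * C^-1 * C^-1 = 1.
  have -> : C^-1 * C^-1 * C^-1 = (C ^+ 3)^-1 by rewrite -expVgn !expgS expg0 mulg1 mulgA.
  by rewrite Cp invg1.
have : Z * Z * Z * (C^-1 * C^-1 * C^-1) = 1 by rewrite !mulgA.
by rewrite C3 mulg1 !expgS expg0 mulg1 mulgA.
Qed.

Lemma gam3_C g : gam 3 g -> exists k, pi g = C ^+ k.
Proof.
pose P g := exists k, pi g = C ^+ k.
have [P1 PM PV PJ] : [/\ P 1, (forall s t, P s -> P t -> P (s * t)),
    (forall s, P s -> P s^-1) & (forall s t, P s -> P (s ^ t))].
  split=> [|s t [k sk] [l tl]|s [k sk]|s t [k sk]].
  - by exists 0%R; rewrite qpi1.
  - by exists (k + l)%R; rewrite qpiM sk tl (expgFD p_pr Cp).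
  - by exists (- k)%R; rewrite qpiV sk (expgFN p_pr Cp).
  - by exists k; rewrite qpiJ sk CX_conj.
apply: (single_gam3 single (T := NSub P1 PM PV PJ)); first exact: pi_za.
by exists 1%R; rewrite (expgF1 3) pi_zb.
Qed.

Lemma ZC_exists t : gam 2 t -> exists kl : 'F_3 * 'F_3, pi t = Z ^+ kl.1 * C ^+ kl.2.
Proof.
case/(gam2_powz single) => k; rewrite -qpiX => /esym/qpiP/gam3_C[l lE].
by exists (k, l); rewrite -(mulKVg (z ^+ k) t) (qpiM _ (z ^+ k)) qpiX lE.
Qed.

Lemma ZX_conj k s : (Z ^+ k) ^ pi s = Z ^+ k * C ^+ (zchi s * k)%R.
Proof.
rewrite conjXg Z_conj expgMn; last by apply: commute_sym; exact: CX_central.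
by rewrite -(expgFM p_pr Cp).
Qed.

Lemma ZC_conj k l s : (Z ^+ k * C ^+ l) ^ pi s = Z ^+ k * C ^+ (l + k * zchi s)%R.
Proof.
by rewrite conjMg ZX_conj CX_conj -mulgA -(expgFD p_pr Cp) addrC [(k * _)%R]mulrC.
Qed.

Lemma ZC_uniq k l k' l' : Z ^+ k * C ^+ l = Z ^+ k' * C ^+ l' -> k = k' /\ l = l'.
Proof.
move=> E; have := congr1 (fun q => q ^ pi b) E.
rewrite !ZC_conj zchi_b !mulr1 !(expgFD p_pr Cp) !mulgA E => /mulgI/C_inj kk.
by split=> //; move: E; rewrite kk => /mulgI/C_inj.
Qed.

(** Coordinates of [gam 2] modulo [cl R] with respect to Z and C, unique by [ZC_uniq]; the default
    value is never met on [gam 2]. *)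
Definition zc t : 'F_3 * 'F_3 :=
  if pselect (exists kl : 'F_3 * 'F_3, pi t = Z ^+ kl.1 * C ^+ kl.2) is left ex
  then projT1 (cid ex) else (0, 0)%R.
Local Notation der t := (zc t).1.
Local Notation eps t := (zc t).2.

Lemma zcP t : gam 2 t -> pi t = Z ^+ der t * C ^+ eps t.
Proof.
by move=> t2; rewrite /zc; case: pselect => [ex|[]]; [case: cid | exact: ZC_exists].
Qed.

Lemma zcE t k l : gam 2 t -> pi t = Z ^+ k * C ^+ l -> der t = k /\ eps t = l.
Proof. by move=> /zcP -> /ZC_uniq. Qed.

Lemma zcM s t : gam 2 s -> gam 2 t ->
  der (s * t) = (der s + der t)%R /\ eps (s * t) = (eps s + eps t)%R.
Proof.
move=> s2 t2; apply: zcE; first exact: nsubM.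
rewrite qpiM (zcP s2) (zcP t2) (expgFD p_pr Zp) (expgFD p_pr Cp) !mulgA.
by congr (_ * _); rewrite -!mulgA; congr (_ * _); exact: CX_central.
Qed.

Lemma zc1 : der 1 = 0%R /\ eps 1 = 0%R.
Proof. by apply: zcE; [exact: nsub1 | rewrite qpi1 !expgF0 mulg1]. Qed.

Lemma zcV t : gam 2 t -> der t^-1 = (- der t)%R /\ eps t^-1 = (- eps t)%R.
Proof.
move=> t2; have [d1 e1] := zcM (nsubV t2) t2; have [d0 e0] := zc1.
by rewrite mulVg in d1 e1; split; apply/eqP; rewrite -addr_eq0 -?d1 -?e1 ?d0 ?e0.
Qed.

Lemma zcJ t s : gam 2 t -> der (t ^ s) = der t /\ eps (t ^ s) = (eps t + der t * zchi s)%R.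
Proof.
move=> t2; apply: zcE; first exact: nsubJ.
by rewrite qpiJ (zcP t2) ZC_conj.
Qed.

Lemma secwJV (Y g : S) w : stab S m Y -> size w = m ->
  secw (Y ^ g^-1) w = secw Y (act g w) ^ (secw g w)^-1.
Proof.
move=> Ym wm; have := @secwJ_St _ _ m Y g^-1 (act g w) Ym.
rewrite size_act wm leqnn actK secwV => -> //.
by rewrite actK.
Qed.

Lemma secw_one (u : seq 'F_3) : secw (1 : S) u = 1. Proof. exact: secw1. Qed.

Definition Cw (c : seq 'F_3 -> 'F_3) := exists Y, [/\ A Y, stab S m Y &
  forall u, size u = m -> pi (secw Y u) = C ^+ c u].

Lemma Cw_submodule : submodule S m Cw.
Proof.
have CwD c c' : Cw c -> Cw c' -> Cw (fun u => c u + c' u)%R.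
  move=> [Y [AY Ym YE]] [Y' [AY' Y'm YE']]; exists (Y * Y'); split; [exact: nsubM..|] => u um.
  by rewrite (secwM_St _ Ym) ?um // qpiM YE // YE' // (expgFD p_pr Cp).
have Cw_ext c c' : (forall u, size u = m -> c u = c' u) -> Cw c -> Cw c'.
  by move=> cc [Y [AY Ym YE]]; exists Y; split=> // u um; rewrite YE ?cc.
have Cw0 : Cw (fun=> 0%R).
  by exists 1; split; [exact: nsub1..|] => u um; rewrite secw1 qpi1.
split=> // [k c Cc|g c [Y [AY Ym YE]]].
  rewrite -[k]natr_Zp; elim: (nat_of_ord k) => [|n IHn].
    by apply: Cw_ext Cw0 => u _; rewrite mul0r.
  by apply: Cw_ext (CwD _ _ Cc IHn) => u _; rewrite -natr1; ring.
exists (Y ^ g^-1); split; [exact: nsubJ..|] => u um.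
by rewrite secwJV // qpiJ YE ?size_act // CX_conj.
Qed.

(** Otherwise every function is realised, in particular the delta function at u1, which puts a copy
    of [c0] into A and [c0] into R. *)
Lemma Cw_lsum c : Cw c -> lsum m c = 0%R.
Proof.
move=> Cc; apply: contrapT => /eqP c_nz; apply: c0_notin; apply: sub_cl.
have c2 : gam 2 c0 by exact: gam_sub c0_gam3.
have [Y [AY Ym YE]] := submodule_full F Cw_submodule (fun u => (u == u1)%:R)%R Cc c_nz.
have [s s2 is_] := injmap_injw u1 (injmap_fg single odd3 fE) c2.
apply: (red1 F (A := A) size_u1 c2 is_); have [sm sE] := is_; rewrite size_u1 in sm sE.
rewrite -(mulKVg Y s); apply: nsubM => //; apply: (red_cl (F := F) (K := gam 2) ASt).
  exact (nsubM (nsubV Ym) sm).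
move=> u um; rewrite (secwM_St _ (nsubV Ym)) ?um // (secwV_St Ym) ?um // sE //.
apply/qpiP; rewrite YE //; case: eqP => _; first by rewrite (expgF1 3).
by rewrite qpi1 expgF0.
Qed.

Definition Nk (k : seq 'F_3 -> 'F_3) := exists2 n, N n &
  forall u, size u = m -> qpi (gam 2) (secw n u) = qpi (gam 2) (a * b) ^+ k u.

Lemma abp : qpi (gam 2) (a * b) ^+ 3 = 1.
Proof.
rewrite qpiM expgMn; last exact: gam2_commute.
by rewrite -!qpiX (rt_p S) (fb_p i0) qpi1 mulg1.
Qed.

Lemma Nk_submodule : submodule S m Nk.
Proof.
have NkD c c' : Nk c -> Nk c' -> Nk (fun u => c u + c' u)%R.
  move=> [Y NY YE] [Y' NY' YE']; exists (Y * Y') => [|u um]; first exact: nsubM.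
  by rewrite (secwM_St _ (NSt NY)) ?um // qpiM YE // YE' // (expgFD p_pr abp).
have Nk_ext c c' : (forall u, size u = m -> c u = c' u) -> Nk c -> Nk c'.
  by move=> cc [Y NY YE]; exists Y => // u um; rewrite YE ?cc.
have Nk0 : Nk (fun=> 0%R).
  by exists 1 => [|u um]; [exact: nsub1 | rewrite secw1 qpi1].
split=> // [k c Cc|g c [Y NY YE]].
  rewrite -[k]natr_Zp; elim: (nat_of_ord k) => [|n IHn].
    by apply: Nk_ext Nk0 => u _; rewrite mul0r.
  by apply: Nk_ext (NkD _ _ Cc IHn) => u _; rewrite -natr1; ring.
exists (Y ^ g^-1) => [|u um]; first exact: nsubJ.
rewrite (secwJV _ (NSt NY) um) qpiJ YE ?size_act //; apply/conjg_fixP/commgP.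
by rewrite -qpiX; exact: gam2_commute.
Qed.

(** Modulo [gam 2] the level-m sections of N lie in the kernel of [zchi], the powers of ab, so
    [submodule_const] provides the constant function 1. *)
Lemma exists_ab : exists2 n, N n &
  forall u, size u = m -> qpi (gam 2) (secw n u) = qpi (gam 2) (a * b).
Proof.
have Nk1 : Nk (fun u => lab (secw n1 u)).
  exists n1 => // u um; have [e ne] := repA_exists F (secw n1 u); rewrite ne.
  have := zchi_repA ne; rewrite zchi_secw // zchi_a mulrN1 addrC => /esym/eqP.
  rewrite subr_eq0 => /eqP E; rewrite [in RHS]qpiM expgMn; last exact: gam2_commute.
  rewrite qpiM -!qpiX; congr (_ * _); congr (qpi _ _).
  by rewrite /kap (big_only1 i0) ?E // => j ji; rewrite (single j i0) eqxx in ji.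
have [n Nn nE] := submodule_const F Nk_submodule Nk1 size_u1 lab_n1.
by exists n => // u um; rewrite nE // (expgF1 3).
Qed.

Definition Om nu := exists Y, [/\ A Y, stab S m Y &
  forall u, size u = m -> gam 2 (secw Y u) /\ der (secw Y u) = nu u].

Lemma Om_eps nu Y Y' : A Y -> A Y' -> stab S m Y -> stab S m Y' ->
  (forall u, size u = m -> gam 2 (secw Y u) /\ der (secw Y u) = nu u) ->
  (forall u, size u = m -> gam 2 (secw Y' u) /\ der (secw Y' u) = nu u) ->
  lsum m (fun u => eps (secw Y u)) = lsum m (fun u => eps (secw Y' u)).
Proof.
move=> AY AY' Ym Y'm YE YE'; apply/esym/eqP; rewrite -subr_eq0; apply/eqP.
have <- : lsum m (fun u => eps (secw Y' u) - eps (secw Y u))%R =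
    (lsum m (fun u => eps (secw Y' u)) - lsum m (fun u => eps (secw Y u)))%R.
  by rewrite /lsum -sumrB.
apply: Cw_lsum; exists (Y^-1 * Y'); split.
- by apply: nsubM => //; exact: nsubV.
- by apply: nsubM => //; exact: nsubV.
move=> u um; have [y2 yd] := YE u um; have [y'2 y'd] := YE' u um.
rewrite (secwM_St _ (nsubV Ym)) ?um // (secwV_St Ym) ?um //.
have yV2 := nsubV y2; rewrite (zcP (nsubM yV2 y'2)).
have [-> ->] := zcM yV2 y'2; have [-> ->] := zcV y2.
by rewrite yd y'd addNr expgF0 mul1g addrC.
Qed.

(** Two realisations of [nu] differ by powers of C with total exponent 0 ([Cw_lsum]), so the choice
    does not matter. *)
Definition fOm nu : 'F_3 :=
  if pselect (Om nu) is left ex then lsum m (fun u => eps (secw (projT1 (cid ex)) u)) else 0%R.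

Lemma fOmE nu Y : A Y -> stab S m Y ->
  (forall u, size u = m -> gam 2 (secw Y u) /\ der (secw Y u) = nu u) ->
  fOm nu = lsum m (fun u => eps (secw Y u)).
Proof.
move=> AY Ym YE; rewrite /fOm; case: pselect => [ex|[]]; last by exists Y.
by case: cid => Y' [AY' Y'm YE'] /=; exact: (Om_eps AY' AY Y'm Ym YE' YE).
Qed.

Definition abchi g : 'F_3 := der [~ a * b, g].

Lemma abchi_hom : ghom abchi.
Proof.
move=> g h; have g2 (k : S) : gam 2 [~ a * b, k] by exact: (@gamS _ 1).
rewrite /abchi commgMr; have [-> _] := zcM (g2 h) (nsubJ h (g2 g)).
by have [-> _] := zcJ h (g2 g); rewrite addrC.
Qed.

Lemma abchi_a : abchi a = 1%R.
Proof.
have [|d1 _] // := @zcE z 1%R 0%R z2; first by rewrite (expgF1 3) expgF0 mulg1.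
by rewrite /abchi commgMl commgg conj1g mul1g d1.
Qed.

Lemma ternary_contradiction : False.
Proof.
have [n Nn nE] := exists_ab; have nm := NSt Nn.
pose ga u := (a * b)^-1 * secw n u.
have ga2 u : size u = m -> gam 2 (ga u) by move=> um; apply/qpiP; rewrite nE.
pose phi u := (- der (ga u))%R.
have ghomN (chi : S -> 'F_3) : ghom chi -> ghom (fun g => - chi g)%R.
  by move=> ch g h; rewrite ch opprD.
have [] : obstruction m Om fOm phi (fun g => - abchi g)%R (fun g => - zchi g)%R -> False.
  exact: (obstruction_false single fE).
split.
- split=> [nu nu' nn [Y [AY Ym YE]]||nu nu' [Y [AY Ym YE]] [Y' [AY' Y'm YE']]|c nu [Y [AY Ym YE]]|g nu [Y [AY Ym YE]]].
  + by exists Y; split=> // u um; rewrite -nn //; exact: YE.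
  + by exists 1; split; [exact: nsub1..|] => u um; rewrite secw1; split; [exact: nsub1 | case: zc1].
  + exists (Y * Y'); split; [exact: nsubM..|] => u um; have [y2 yd] := YE u um; have [y'2 y'd] := YE' u um.
    rewrite (secwM_St _ Ym) ?um //; split; first exact: nsubM.
    by have [-> _] := zcM y2 y'2; rewrite yd y'd.
  + exists (Y ^+ c); split; [exact: nsubX..|] => u um; have [y2 yd] := YE u um.
    rewrite -[c in (c * _)%R]natr_Zp; elim: (nat_of_ord c) => [|k [IH2 IHd]].
      by rewrite secw1 mul0r; split; [exact: nsub1 | case: zc1].
    rewrite expgS (secwM_St _ Ym) ?um //; split; first exact: nsubM.
    by have [-> _] := zcM y2 IH2; rewrite IHd yd -natr1; ring.
  + exists (Y ^ g^-1); split; [exact: nsubJ..|] => u um.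
    have [|y2 yd] := YE (act g u); first by rewrite size_act.
    rewrite secwJV //; split; first exact: nsubJ.
    by have [-> _] := zcJ (secw g u)^-1 y2.
- move=> nu nu' [Y [AY Ym YE]] nn; rewrite (fOmE AY Ym YE); apply/esym; apply: (fOmE AY Ym) => u um.
  by rewrite -nn //; exact: YE.
- move=> nu nu' [Y [AY Ym YE]] [Y' [AY' Y'm YE']].
  rewrite (fOmE AY Ym YE) (fOmE AY' Y'm YE') (@fOmE _ (Y * Y')); [|exact: nsubM..|].
    rewrite -lsumD; apply: eq_lsum => u um; rewrite (secwM_St _ Ym) ?um //.
    by have [_ ->] := zcM (YE u um).1 (YE' u um).1.
  move=> u um; have [y2 yd] := YE u um; have [y'2 y'd] := YE' u um.
  rewrite (secwM_St _ Ym) ?um //; split; first exact: nsubM.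
  by have [-> _] := zcM y2 y'2; rewrite yd y'd.
- move=> c nu [Y [AY Ym YE]]; rewrite (fOmE AY Ym YE).
  have YX (k : nat) u : size u = m -> [/\ gam 2 (secw (Y ^+ k) u),
      der (secw (Y ^+ k) u) = (k%:R * nu u)%R & eps (secw (Y ^+ k) u) = (k%:R * eps (secw Y u))%R].
    move=> um; have [y2 yd] := YE u um; elim: k => [|k [IH2 IHd IHe]].
      by rewrite secw1 !mul0r; have [-> ->] := zc1; split=> //; exact: nsub1.
    rewrite expgS (secwM_St _ Ym) ?um //; have [-> ->] := zcM y2 IH2; rewrite IHd IHe yd -natr1.
    by split; [exact: nsubM | ring | ring].
  rewrite (@fOmE _ (Y ^+ c)); [|exact: nsubX..|].
    by rewrite -lsumZ; apply: eq_lsum => u um; have [_ _ ->] := YX c u um; rewrite natr_Zp.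
  by move=> u um; have [y2 -> _] := YX c u um; rewrite natr_Zp.
- move=> g nu [Y [AY Ym YE]]; rewrite (fOmE AY Ym YE) (@fOmE _ (Y ^ g^-1)); [|exact: nsubJ..|].
    rewrite -(lsum_act m g (fun u => eps (secw Y u))) -lsumD; apply: eq_lsum => u um.
    have [|y2 yd] := YE (act g u); first by rewrite size_act.
    rewrite secwJV //; have [_ ->] := zcJ (secw g u)^-1 y2.
    by rewrite yd (ghomV _ zchi_hom).
  move=> u um; have [|y2 yd] := YE (act g u); first by rewrite size_act.
  rewrite secwJV //; split; first exact: nsubJ.
  by have [-> _] := zcJ (secw g u)^-1 y2.
(* All level-m sections of n are ab times an element of [gam 2]; the first factor yields the cocycle
   of [abchi], the second the coboundary of [phi]. *)
- move=> g; exists [~ n, g^-1]; split; [exact: NA | exact: nsubRl |] => u um.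
  have gu_m : size (act g u) = m by rewrite size_act.
  have g2 (k : S) : gam 2 [~ a * b, k] by exact: (@gamS _ 1).
  have nuE v : secw n v = a * b * ga v by rewrite mulKVg.
  have -> : secw [~ n, g^-1] u =
      (ga u)^-1 * [~ a * b, (secw g u)^-1] * ga (act g u) ^ (secw g u)^-1.
    rewrite commgEl (secwM_St _ (nsubV nm)) ?um // (secwV_St nm) ?um // secwJV //.
    by rewrite !nuE invgM conjMg commgEl !mulgA.
  have u2 := nsubV (ga2 u um); have gu2 := ga2 _ gu_m.
  have k2 := g2 (secw g u)^-1; have gJ2 := nsubJ (secw g u)^-1 gu2.
  split; first by apply: nsubM => //; exact: nsubM.
  have [-> _] := zcM (nsubM u2 k2) gJ2; have [-> _] := zcM u2 k2.
  have [-> _] := zcJ (secw g u)^-1 gu2; have [-> _] := zcV (ga2 u um).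
  by rewrite -/(abchi _) (ghomV _ abchi_hom) /phi; ring.
- exact/ghomN/abchi_hom.
- exact/ghomN/zchi_hom.
- by exists a; rewrite abchi_a oppr_eq0 oner_neq0.
- by exists b; rewrite zchi_b oppr_eq0 oner_neq0.
Qed.

End Nontrivial.
Lemma stab_fg_ternary s : stab S (m + 2) s -> A s.
Proof.
apply: (stab_fg_red single ASt); apply: gam3_cl.
by apply: contrapT; exact: ternary_contradiction.
Qed.

End TernaryConclusion.

Import classical_sets cardinality Defs.
Local Open Scope classical_set_scope.

(** * Subgroups given as sets, turned into group types *)

Section SetSubgroups.
Variable gT : groupType.
Implicit Types (G H K N A : set gT) (x y g h : gT).

Lemma subgroupP H : subgroup H <-> H 1 /\ forall x y, H x -> H y -> H (x * y^-1).
Proof.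
split=> -[H1 HM]; split; rewrite ?inE // in H1 *.
  by move=> x y Hx Hy; have := HM x y; rewrite !inE; apply.
by move=> x y; rewrite !inE; exact: HM.
Qed.

Lemma sg1 H : subgroup H -> H 1. Proof. by case/subgroupP. Qed.

Lemma sgV H x : subgroup H -> H x -> H x^-1.
Proof. by case/subgroupP => H1 HM Hx; have := HM _ _ H1 Hx; rewrite mul1g. Qed.

Lemma sgM H x y : subgroup H -> H x -> H y -> H (x * y).
Proof.
by move=> Hs Hx Hy; rewrite -[y]invgK; have [_] := (subgroupP H).1 Hs; apply => //; exact: sgV.
Qed.

Lemma sgJ H x y : subgroup H -> H x -> H y -> H (x ^ y).
Proof. by move=> Hs Hx Hy; rewrite conjgE; apply: sgM => //; [exact: sgV | exact: sgM]. Qed.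

Lemma sgX H x n : subgroup H -> H x -> H (x ^+ n).
Proof.
move=> Hs Hx; elim: n => [|n IHn]; first exact: sg1.
by rewrite expgS; exact: sgM.
Qed.

Lemma gen_subgroup A : subgroup (generated_subgroup A).
Proof.
apply/subgroupP; split=> [H [Hs AH]|x y Ax Ay H HP]; first exact: sg1.
by have [Hs _] := HP; apply: sgM => //; [exact: Ax | apply: sgV => //; exact: Ay].
Qed.

Lemma mem_gen A x : A x -> generated_subgroup A x.
Proof. exact: sub_gen_smallest. Qed.

Lemma gen_sub A H : subgroup H -> A `<=` H -> generated_subgroup A `<=` H.
Proof. exact: smallest_sub. Qed.

Lemma comm_normal N G : subgroup G -> normal_in N G -> normal_in (commutator_subgroup N G) G.
Proof.
move=> Gs [Ns NG NJ]; split; first exact: gen_subgroup.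
  apply: gen_sub => // _ [h Nh [k Gk <-]]; rewrite commgEl.
  by apply: sgM => //; [apply: sgV => //; exact: NG | apply: sgJ => //; exact: NG].
move=> n g + Gg; pose H := [set x | commutator_subgroup N G (x ^ g)].
have Hs : subgroup H.
  apply/subgroupP; split=> [|x y]; first by rewrite /H /= conj1g; exact: sg1 (gen_subgroup _).
  rewrite /H /= conjMg conjVg => Hx Hy.
  by apply: sgM (gen_subgroup _) Hx _; exact: sgV (gen_subgroup _) Hy.
apply: (gen_sub Hs) => _ [h Nh [k Gk <-]]; rewrite /H /= conjRg; apply: mem_gen.
by exists (h ^ g); [exact: NJ | exists (k ^ g) => //; exact: sgJ].
Qed.

Lemma full_normal G : subgroup G -> normal_in G G.
Proof. by move=> Gs; split=> // x y Gx Gy; exact: sgJ. Qed.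

Definition subg_type G (Gs : subgroup G) : Type := {x : gT | G x}.

Section SubgType.
Variables (G : set gT) (Gs : subgroup G).
Local Notation sT := (subg_type Gs).

HB.instance Definition _ := gen_eqMixin sT.
HB.instance Definition _ := gen_choiceMixin sT.

Definition sg_mul (x y : sT) : sT := exist _ (sval x * sval y) (sgM Gs (svalP x) (svalP y)).
Definition sg_inv (x : sT) : sT := exist _ (sval x)^-1 (sgV Gs (svalP x)).
Definition sg_one : sT := exist _ 1 (sg1 Gs).

Lemma sg_inj (x y : sT) : sval x = sval y -> x = y.
Proof. by case: x y => [x px] [y py] /= xy; exact: eq_exist. Qed.

Lemma sg_mulA : associative sg_mul.
Proof. by move=> x y t; apply: sg_inj; exact: mulgA. Qed.
Lemma sg_mul1 : left_id sg_one sg_mul.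
Proof. by move=> x; apply: sg_inj; exact: mul1g. Qed.
Lemma sg_mulr1 : right_id sg_one sg_mul.
Proof. by move=> x; apply: sg_inj; exact: mulg1. Qed.
Lemma sg_mulV : left_inverse sg_one sg_inv sg_mul.
Proof. by move=> x; apply: sg_inj; exact: mulVg. Qed.
Lemma sg_mulrV : right_inverse sg_one sg_inv sg_mul.
Proof. by move=> x; apply: sg_inj; exact: mulgV. Qed.

HB.instance Definition _ := isGroup.Build sT sg_mulA sg_mul1 sg_mulr1 sg_mulV sg_mulrV.

Lemma svalM (x y : sT) : sval (x * y) = sval x * sval y. Proof. by []. Qed.
Lemma svalV (x : sT) : sval x^-1 = (sval x)^-1. Proof. by []. Qed.
Lemma sval1 : sval (1 : sT) = 1. Proof. by []. Qed.
Lemma svalR (x y : sT) : sval [~ x, y] = [~ sval x, sval y].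
Proof. by rewrite !commgEl !conjgE. Qed.
Lemma svalJ (x y : sT) : sval (x ^ y) = sval x ^ sval y.
Proof. by rewrite !conjgE. Qed.
Lemma svalX (x : sT) n : sval (x ^+ n) = sval x ^+ n.
Proof. by elim: n => // n IHn; rewrite !expgS svalM IHn. Qed.

Lemma nsub_of_subproof N : normal_in N G ->
  let P (x : sT) := N (sval x) in
  [/\ P 1, forall s t, P s -> P t -> P (s * t), forall s, P s -> P s^-1
    & forall s t, P s -> P (s ^ t)].
Proof.
move=> [Ns NG NJ]; split=> [|s t|s|s t].
- exact: sg1.
- exact: sgM.
- exact: sgV.
- by move=> Ps; rewrite svalJ; apply: NJ => //; exact: svalP.
Qed.

Definition nsub_of N (NG : normal_in N G) : nsub sT :=
  let: And4 P1 PM PV PJ := nsub_of_subproof NG in NSub P1 PM PV PJ.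

Lemma nsub_ofP N (NG : normal_in N G) (x : sT) : nsub_of NG x <-> N (sval x).
Proof. by rewrite /nsub_of; case: nsub_of_subproof. Qed.

Lemma comm_sval N (H : nsub sT) : normal_in N G -> (forall x : sT, H x <-> N (sval x)) ->
  forall x : sT, ncomm H nfull x <-> commutator_subgroup N G (sval x).
Proof.
move=> NG HN x; split.
  have CG := comm_normal Gs NG => Hx; apply/(nsub_ofP CG).
  move: x Hx; apply: ncomm_min => s t Hs _; apply/(nsub_ofP CG); rewrite svalR.
  by apply: mem_gen; exists (sval s); [exact/HN | exists (sval t) => //; exact: svalP].
pose M := [set y | exists2 s : sT, ncomm H nfull s & sval s = y].
have Ms : subgroup M.
  apply/subgroupP; split=> [|_ _ [s Hs <-] [t Ht <-]]; first by exists 1; [exact: nsub1 |].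
  by exists (s * t^-1) => //; apply: nsubM => //; exact: nsubV.
have CM : commutator_subgroup N G `<=` M.
  apply: gen_sub => // _ [h Nh [k Gk <-]]; have [_ NsG _] := NG.
  exists [~ (exist _ h (NsG _ Nh) : sT), (exist _ k Gk : sT)]; last by rewrite svalR.
  by apply: mem_ncomm => //; exact/HN.
by move=> /CM[s Hs /sg_inj <-].
Qed.

Lemma gam2_sval (x : sT) : gam 2 x <-> commutator_subgroup G G (sval x).
Proof. by apply: comm_sval; [exact: full_normal | split=> // _; exact: svalP]. Qed.

Lemma gam3_sval (x : sT) : gam 3 x <-> lower_central 3 G (sval x).
Proof. by apply: comm_sval; [exact: comm_normal (full_normal Gs) | exact: gam2_sval]. Qed.

End SubgType.

(** Each coset of H is H times a coset of K. *)
Lemma finite_index_sub G H K : subgroup G -> subgroup H -> H `<=` G -> K `<=` H ->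
  finite_index K G -> finite_index H G.
Proof.
move=> Gs Hs HG KH [Ks KG Kfin]; split=> //.
pose F (C : set gT) := [set x | exists2 k, H k & exists2 c, C c & x = k * c].
apply: sub_finite_set (finite_image F Kfin) => _ [g Gg <-].
exists [set k * g | k in K]; first by exists g.
apply/seteqP; split=> x.
  move=> [k Hk [_ [k' Kk' <-] ->]]; exists (k * k'); last by rewrite mulgA.
  by apply: sgM => //; exact: KH.
move=> [k Hk <-]; exists k => //; exists g => //.
by exists 1; [exact: sg1 | rewrite mul1g].
Qed.

End SetSubgroups.

(** * Sections of concrete tree automorphisms *)

Section Sections.
Variable p : nat.
Implicit Types (g h : treeAut p) (u v : seq 'I_p).

Lemma autM g h u : (g * h) u = h (g u). Proof. by []. Qed.
Lemma aut1 u : (1 : treeAut p) u = u. Proof. by []. Qed.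
Lemma autKV g u : g^-1 (g u) = u. Proof. exact: aut_invK. Qed.
Lemma autVK g u : g (g^-1 u) = u. Proof. exact: aut_Kinv. Qed.

Lemma sectionM g h u : section (g * h) u = section g u * section h (g u).
Proof.
apply: treeAutP => v; have := sectionE (g * h) u v.
rewrite !autM (sectionE g) (sectionE h) => /eqP.
by rewrite eqseq_cat ?size_aut // => /andP[_ /eqP <-].
Qed.

Lemma section1 u : section 1 u = 1.
Proof.
apply: treeAutP => v; have /eqP := sectionE 1 u v.
by rewrite !aut1 eqseq_cat // => /andP[_ /eqP <-].
Qed.

Lemma sectionV g u : section g^-1 u = (section g (g^-1 u))^-1.
Proof.
apply: (mulIg (section g (g^-1 u))); rewrite mulVg.
by rewrite -(sectionM g^-1 g) mulVg section1.
Qed.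

Lemma section_rooted (x : 'I_p) : section (rooted p) [:: x] = 1.
Proof. by apply: treeAutP => v; rewrite /= /section_fun /= drop0. Qed.

End Sections.

(** * The concrete groups as instances of [ssgroup] and [family] *)

Section GeneratedGroup.
Variables (p : nat) (p_pr : prime p) (I : finType) (J : I -> nat) (ev : I -> 'rV['F_p]_p.-1).
Implicit Types (x y : 'F_p) (g h : treeAut p) (u v : seq 'I_p) (i : I).

Definition egs : set (treeAut p) :=
  generated_subgroup (rooted p |` [set b | exists i, b = directed (J i) (ev i)]).

Definition let_of x : 'I_p := cast_ord (Fp_cast p_pr) x.
Definition of_let (y : 'I_p) : 'F_p := cast_ord (esym (Fp_cast p_pr)) y.

Lemma let_ofK : cancel let_of of_let. Proof. exact: cast_ordK. Qed.
Lemma of_letK : cancel of_let let_of. Proof. exact: cast_ordKV. Qed.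

Lemma let_of0 : let_of 0%R = 0%N :> nat. Proof. by []. Qed.

Lemma egs_rooted : egs (rooted p). Proof. by apply: mem_gen; left. Qed.

Lemma egs_directed i : egs (directed (J i) (ev i)).
Proof. by apply: mem_gen; right; exists i. Qed.

Lemma egs_subgroup : subgroup egs. Proof. exact: gen_subgroup. Qed.

Lemma directed_root1 j e (x : 'I_p) : directed j e [:: x] = [:: x].
Proof. by rewrite /=; case: insub => [k|] //; rewrite aut_root. Qed.

Lemma rooted_root1 x : rooted p [:: let_of x] = [:: let_of (x + 1)%R].
Proof.
have -> : (x + 1 = x.+1%:R)%R by rewrite -[x in LHS]natr_Zp natr1.
rewrite /=; congr [:: _]; apply: val_inj.
transitivity (nat_of_ord (x.+1%:R : 'F_p)%R); last by [].
by rewrite val_Fp_nat.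
Qed.

Lemma egs_cyclic g : egs g -> exists l, forall x, g [:: let_of x] = [:: let_of (x + l)%R].
Proof.
pose P := [set g : treeAut p | exists l, forall x, g [:: let_of x] = [:: let_of (x + l)%R]].
suff : egs `<=` P by apply.
apply: gen_sub.
  apply/subgroupP; split=> [|g' h [l gl] [k hk]].
    by exists 0%R => x; rewrite addr0.
  exists (l - k)%R => x; rewrite autM gl; apply: (can_inj (autKV h)).
  by rewrite autVK hk addrA subrK.
move=> _ [->|[i ->]]; first by exists 1%R => x; exact: rooted_root1.
by exists 0%R => x; rewrite directed_root1 addr0.
Qed.

Lemma egs_section g (y : 'I_p) : egs g -> egs (section g [:: y]).
Proof.
move=> Gg; have Es := egs_subgroup.
pose P := [set g : treeAut p | egs g /\ forall y' : 'I_p, egs (section g [:: y'])].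
suff /(_ g Gg)[_] : egs `<=` P by apply.
apply: gen_sub.
  apply/subgroupP; split=> [|g' h [Gg' gs] [Gh hs]].
    by split=> [|x]; rewrite ?section1; exact: (sg1 Es).
  split=> [|c']; first by apply: (sgM Es) => //; exact: (sgV Es).
  have sz u : size u = 1%N -> exists c : 'I_p, u = [:: c] by case: u => [|c []] // _; exists c.
  rewrite sectionM sectionV; apply: (sgM Es); first exact: gs.
  apply: (sgV Es).
  by have [|c ->] := sz (h^-1 (g' [:: c'])); [rewrite !size_aut | exact: hs].
move=> _ [->|[i ->]]; split=> [|x].
- exact: egs_rooted.
- by rewrite section_rooted; exact: (sg1 Es).
- exact: egs_directed.
rewrite -/(psi _ x) psi_directed; case: insub => [k|]; last exact: egs_directed.
exact: (sgX _ Es egs_rooted).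
Qed.

Local Notation sT := (subg_type egs_subgroup).
Implicit Types s t : sT.

Definition elab s : 'F_p := projT1 (cid (egs_cyclic (svalP s))).

Lemma elabE s x : sval s [:: let_of x] = [:: let_of (x + elab s)%R].
Proof. by rewrite /elab; case: cid. Qed.

Lemma elab_eq s l : sval s [:: let_of 0%R] = [:: let_of l] -> elab s = l.
Proof. by rewrite elabE add0r => -[/val_inj]. Qed.

Definition esec s x : sT := exist _ _ (egs_section (let_of x) (svalP s)).

Lemma elabM s t : elab (s * t) = (elab s + elab t)%R.
Proof. by apply: elab_eq; rewrite svalM autM elabE add0r elabE. Qed.

Lemma esecM s t x : esec (s * t) x = esec s x * esec t (x + elab s)%R.
Proof. by apply: sg_inj; rewrite svalM /= sectionM elabE. Qed.

Lemma fixes_levelP n s : fixes_level elab esec n s <-> forall u, size u = n -> sval s u = u.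
Proof.
elim: n s => [|n IHn] s; first by split=> // _ [|//] _; exact: aut_root.
split=> [[s0 sn] [|x u] // [un]|sn].
  rewrite -cat1s sectionE -[x in LHS]of_letK elabE s0 addr0 of_letK.
  by congr (_ ++ _); rewrite -[x]of_letK; exact: (IHn _).1 (sn (of_let x)) u un.
have fix1 x u : size u = n ->
    sval s [:: let_of x] = [:: let_of x] /\ section (sval s) [:: let_of x] u = u.
  move=> un; have := sn (let_of x :: u); rewrite -cat1s sectionE /= un => /(_ erefl)/eqP.
  by rewrite -[_ :: u]cat1s eqseq_cat ?size_aut // => /andP[/eqP -> /eqP ->].
split=> [|x]; first by apply: elab_eq; exact: (fix1 0%R (nseq n (let_of 0%R)) (size_nseq _ _)).1.
by apply/IHn => u un; exact: (fix1 x u un).2.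
Qed.

Lemma egs_res s : (forall n, fixes_level elab esec n s) -> s = 1.
Proof.
move=> sn; apply: sg_inj; apply: treeAutP => u.
exact: (fixes_levelP _ _).1 (sn (size u)) u erefl.
Qed.

Definition ert : sT := exist _ _ egs_rooted.

Lemma elab_rt : elab ert = 1%R.
Proof. by apply: elab_eq; rewrite rooted_root1 add0r. Qed.

Lemma esec_rt x : esec ert x = 1.
Proof. by apply: sg_inj; exact: section_rooted. Qed.

Definition egs_ssgroup : ssgroup p :=
  @SSGroup p sT p_pr elab esec elabM esecM egs_res ert elab_rt esec_rt.

Local Notation S := egs_ssgroup.

Lemma stab_egs n (s : S) : stab S n s <-> forall u, size u = n -> sval s u = u.
Proof. by rewrite stabE; exact: fixes_levelP. Qed.

Hypothesis ev_nz : forall i, ev i != 0%R.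
Variable i0 : I.

Definition edir i : S := exist _ _ (egs_directed i).
(** The letter x with J i + x = -1 modulo p, where the directed automorphism repeats itself. *)
Definition epos i : 'F_p := (-1 - (J i)%:R)%R.
(** Coordinate k of the defining vector, counted from 0, belongs to distance k + 1, distance 0 being
    the recursive position. *)
Definition eexp i x : 'F_p :=
  if x == 0%R then 0%R else if insub (x : nat).-1 is Some k then ev i ord0 k else 0%R.

Lemma eexp0 i : eexp i 0%R = 0%R. Proof. by rewrite /eexp eqxx. Qed.

Lemma p_gt0 : 0 < p. Proof. exact: prime_gt0. Qed.

Lemma natF n : n < p -> (n%:R : 'F_p)%R = n :> nat.
Proof. by move=> np; rewrite val_Fp_nat // modn_small. Qed.

Lemma pF : (p%:R = 0 :> 'F_p)%R.
Proof. by apply: val_inj; rewrite /= val_Fp_nat // modnn. Qed.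

Lemma eexpS i (k : 'I_p.-1) : eexp i (k.+1%:R)%R = ev i ord0 k.
Proof.
have kp : k.+1 < p by rewrite -[p in X in _ < X](prednK p_gt0) ltnS.
have kE := natF kp; rewrite /eexp -val_eqE /= kE /=.
by rewrite (insubT (fun n => n < p.-1) (ltn_ord k)) /=; congr (ev i ord0 _); exact: val_inj.
Qed.

Lemma eexp_nz i : exists x, eexp i x != 0%R.
Proof.
have /rV0Pn[k ek] := ev_nz i; by exists (k.+1%:R)%R; rewrite eexpS.
Qed.

Lemma elab_dir i : elab (edir i) = 0%R.
Proof. by apply: elab_eq; exact: directed_root1. Qed.

Lemma esec_dir i x : esec (edir i) x =
  if x == epos i then edir i else ert ^+ eexp i (x - epos i)%R.
Proof.
apply: sg_inj; have -> : sval (esec (edir i) x) = psi (directed (J i) (ev i)) (let_of x) by [].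
rewrite psi_directed; set w := ((J i + let_of x) %% p)%N.
have wE : (x - epos i = w.+1%:R)%R.
  rewrite -natr1 /w Fp_nat_mod // natrD /epos.
  have -> : ((let_of x)%:R = x :> 'F_p)%R by exact: natr_Zp.
  ring.
rewrite -subr_eq0 wE; have [wp|wp] := ltnP w p.-1.
  rewrite (insubT (fun n => n < p.-1) wp) /=.
  have wp1 : w.+1 < p by rewrite -[p in X in _ < X](prednK p_gt0) ltnS.
  by rewrite -val_eqE /= natF //= svalX (eexpS i (Sub w wp)).
rewrite insubF ?ltnNge ?wp //; have -> : w.+1 = p; last by rewrite pF eqxx.
apply/eqP; rewrite eqn_leq ltn_mod p_gt0 /= -[p in X in X <= _](prednK p_gt0) ltnS.
exact: wp.
Qed.

(** Inverses of generators are their (p-1)st powers, so generation as a group gives generation as a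
    monoid. *)
Lemma egs_ind (P : S -> Prop) : P 1 -> (forall g : S, P g -> P (g * ert)) ->
  (forall (g : S) i, P g -> P (g * edir i)) -> forall g : S, P g.
Proof.
move=> P1 Pa Pb.
have pow (c : S) : (forall g : S, P g -> P (g * c)) -> c ^+ p = 1 ->
    forall g : S, P g -> P (g * c^-1).
  move=> Pc cp g Pg; have -> : c^-1 = c ^+ p.-1.
    by apply: (mulgI c); rewrite mulgV -expgS prednK ?p_gt0.
  elim: p.-1 => [|n IHn]; first by rewrite mulg1.
  by rewrite expgSr mulgA; exact: Pc.
pose Q := [set h : treeAut p | exists2 s : S, sval s = h &
  (forall g : S, P g -> P (g * s)) /\ (forall g : S, P g -> P (g * s^-1))].
have QE : egs `<=` Q.
  apply: gen_sub.
    apply/subgroupP; split=> [|_ _ [s <- [sP sV]] [t <- [tP tV]]].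
      by exists 1 => //; split=> g Pg; rewrite ?invg1 mulg1.
    exists (s * t^-1) => //; split=> g Pg; first by rewrite mulgA; exact/tV/sP.
    by rewrite invgM invgK mulgA; exact/sV/tP.
  move=> _ [->|[i ->]].
    by exists ert => //; split=> //; apply: pow => //; exact: (rt_p S).
  exists (edir i) => //; split=> [g|]; first exact: Pb.
  apply: pow => [g|]; first exact: Pb.
  exact: (@directed_expp p S (edir i) (epos i) (fun x => eexp i (x - epos i)%R) (elab_dir i) (esec_dir i)).
move=> g; have [s sg [sP _]] := QE _ (svalP g).
by rewrite -[g](sg_inj sg) -[s]mul1g; exact: sP.
Qed.

Definition egs_family : family S :=
  @Family p S I edir epos eexp i0 eexp0 eexp_nz elab_dir esec_dir egs_ind.

End GeneratedGroup.

(** * Transfer of hypotheses and conclusions to the concrete groups *)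

Section Translation.
Variables (p : nat) (p_pr : prime p) (I : finType) (J : I -> nat) (ev : I -> 'rV['F_p]_p.-1).
Hypothesis ev_nz : forall i, ev i != 0%R.
Variable i0 : I.
Local Notation G := (egs J ev).
Local Notation S := (egs_ssgroup p_pr J ev).
Local Notation F := (egs_family p_pr J ev_nz i0).
Local Notation Gs := (egs_subgroup J ev).

Lemma injmap_of_branch K (Kn : nsub S) : (forall s : S, Kn s <-> K (sval s)) ->
  regular_branch G K -> injmap Kn Kn.
Proof.
move=> KnE [[Ks _ _] _ _ br] t x Kt; pose k y := if y == let_of p_pr x then sval t else 1.
have [|g [[Gg g1] Kg] gk] := br k.
  by rewrite /k => y /=; case: eqP => _; [exact/KnE | exact: sg1].
pose s : S := exist _ g Gg; exists s; first exact/KnE.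
have s0 : lab s = 0%R.
  by apply: (stab1 s).1; apply: (stab_egs 1 s).2; exact: g1.
have sE y : sec s y = (if y == x then t else 1 : S).
  apply: sg_inj; have -> : sval (sec s y) = psi g (let_of p_pr y) by [].
  rewrite gk /k (inj_eq (can_inj (let_ofK p_pr))); by case: eqP.
by split=> // [|y /negPf yx]; rewrite sE ?eqxx ?yx.
Qed.

(** Finite index, transitivity and self-similarity are inherited from the branching over the third
    term. *)
Lemma branch_of_injmap : regular_branch G (lower_central 3 G) ->
  injmap (gam 2 : nsub S) (gam 2) -> regular_branch G (commutator_subgroup G G).
Proof.
move=> [fin3 tr ss _] G2; have [C2s C2G _] := comm_normal Gs (full_normal Gs).
split=> //.
  have C3C2 : lower_central 3 G `<=` commutator_subgroup G G.
    move=> g g3; have Gg : G g by have [_ + _] := fin3; apply.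
    pose s : S := exist _ g Gg; have s3 : gam 3 s by apply/gam3_sval.
    exact: (gam2_sval s).1 (gam_sub s3).
  exact: finite_index_sub Gs C2s C2G C3C2 fin3.
move=> k kC; pose j x : S := exist _ (k (let_of p_pr x)) (C2G _ (kC (let_of p_pr x))).
have [x|s [s2 s0 sE]] := injmap_prod G2 (j := j); first exact: (gam2_sval (j x)).2 (kC _).
exists (sval s).
  split; last exact: (gam2_sval s).1.
  by split; [exact: svalP | apply: (stab_egs 1 s).1; apply: (stab1 s).2].
apply/funext => y; have := congr1 sval (sE (of_let p_pr y)).
by rewrite /= of_letK.
Qed.

Section Normal.
Variables (N : set (treeAut p)) (m : nat).
Hypotheses (NG : normal_in N G).
Hypothesis cong : congruence_subgroup (commutator_subgroup N G) G.
Hypothesis NSt : N `<=` St G m.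
Hypothesis Nmax : forall k : nat, N `<=` St G k -> (k <= m)%N.

Definition nsN : nsub S := nsub_of Gs NG.
Definition nsA : nsub S := nsub_of Gs (comm_normal Gs NG).

Lemma nsA_St : exists n0, forall s : S, stab S n0 s -> nsA s.
Proof.
have [_ _ [n0 _ nA]] := cong; exists n0 => s /stab_egs sn; apply/nsub_ofP; apply: nA.
by split=> //; exact: svalP.
Qed.

Lemma nsA_comm (n h : S) : nsN n -> nsA [~ n, h].
Proof.
move/nsub_ofP => Nn; apply/nsub_ofP; rewrite svalR; apply: mem_gen.
by exists (sval n) => //; exists (sval h) => //; exact: svalP.
Qed.

Lemma nsN_St (n : S) : nsN n -> stab S m n.
Proof. by move/nsub_ofP/NSt => [_ nm]; exact/stab_egs. Qed.

(** If every section at level m had label 0, N would fix level m + 1, against the maximality of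
    m. *)
Lemma nsN_max : exists (n : S) (u : seq 'F_p),
  [/\ nsN n, size u = m & lab (secw n u) != 0%R].
Proof.
apply: contrapT => nex; suff /Nmax : N `<=` St G m.+1 by rewrite ltnn.
move=> g Ng; have Gg : G g by have [_ + _] := NG; apply.
split=> //; pose s : S := exist _ g Gg; apply: (stab_egs _ s).1.
have sN : nsN s by exact/nsub_ofP.
rewrite -addn1; apply: stab_secw (nsN_St sN) _ => u um; apply/stab1.
by apply: contrapT => /eqP su; apply: nex; exists s, u.
Qed.

Lemma stab_sub_comm c : (forall s : S, stab S c s -> nsA s) ->
  St G c `<=` commutator_subgroup N G.
Proof.
move=> cA g [Gg gc]; pose s : S := exist _ g Gg.
by apply: (nsub_ofP (comm_normal Gs NG) s).1; apply: cA; exact/stab_egs.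
Qed.

Lemma egs_caseI (V : 'M['F_p]_p.-1) : (forall i, (ev i <= V)%MS) ->
  regular_branch G (commutator_subgroup G G) ->
  St G (m + \rank V + 3) `<=` commutator_subgroup N G.
Proof.
move=> eV /(injmap_of_branch (@gam2_sval _ _ Gs)) G2; apply: stab_sub_comm.
have [n0 ASt] := nsA_St; have [n1 [u1 [Nn1 um1 ln1]]] := nsN_max.
(* Multiplication by L pads a defining vector with a zero at distance 0, and does not increase the
   rank. *)
pose L : 'M['F_p]_(p.-1, (Zp_trunc (pdiv p)).+2) :=
  (\matrix_(k < p.-1, x < (Zp_trunc (pdiv p)).+2) (x == k.+1%:R :> 'F_p)%:R)%R.
have evE (i : fI F) : evec i = (ev i *m L)%R.
  apply/rowP => x; rewrite !mxE; have [->|x0] := eqVneq x (0%R : 'F_p).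
    rewrite fe0 big1 // => k _; rewrite !mxE -val_eqE /= natF ?mulr0 //.
    by rewrite -[p in X in _ < X](prednK (p_gt0 p_pr)) ltnS.
  have kp : (x : nat).-1 < p.-1.
    have xp : x < p by rewrite -[p in X in _ < X](Fp_cast p_pr) ltn_ord.
    by rewrite -ltnS (prednK (p_gt0 p_pr)) prednK // lt0n.
  have xE : x = ((Ordinal kp).+1%:R : 'F_p)%R.
    by rewrite /= prednK ?lt0n // natr_Zp.
  rewrite (bigD1 (Ordinal kp)) //= !mxE big1 => [|k kk].
    by rewrite -xE eqxx mulr1 addr0 [in LHS]xE; exact: eexpS.
  rewrite !mxE -val_eqE /= natF //; last by rewrite -[p in X in _ < X](prednK (p_gt0 p_pr)) ltnS.
  rewrite [_ == _ :> nat](_ : _ = false) ?mulr0 //; apply: contraNF kk => /eqP xk.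
  by apply/eqP/val_inj; rewrite /= xk.
have eL (i : fI F) : (evec i <= (V *m L)%R)%MS by rewrite evE; exact: submxMr.
move=> s sm; apply: (stab_caseI ASt nsA_comm nsN_St Nn1 um1 ln1 G2 eL).
by apply: stab_le sm; rewrite -addnA leq_add2l leq_add2r; exact: mxrankM_maxl.
Qed.

Lemma egs_caseI_single : (forall i j : I, i = j) ->
  regular_branch G (commutator_subgroup G G) ->
  St G (m + 3) `<=` commutator_subgroup N G.
Proof.
move=> single /(injmap_of_branch (@gam2_sval _ _ Gs)) G2; apply: stab_sub_comm.
have [n0 ASt] := nsA_St; have [n1 [u1 [Nn1 um1 ln1]]] := nsN_max.
exact: (@stab_caseI_single _ S F _ _ _ _ ASt nsA_comm nsN_St _ _ Nn1 um1 ln1 G2 single).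
Qed.

Lemma egs_caseII : odd p -> regular_branch G (lower_central 3 G) ->
  ~ regular_branch G (commutator_subgroup G G) ->
  St G (m + 7) `<=` commutator_subgroup N G.
Proof.
move=> p_odd br3 nbr2; apply: stab_sub_comm.
have G3 := injmap_of_branch (@gam3_sval _ _ Gs) br3.
have nG2 : ~ injmap (gam 2 : nsub S) (gam 2) by move/(branch_of_injmap br3).
have [n0 ASt] := nsA_St; have [n1 [u1 [Nn1 um1 ln1]]] := nsN_max.
exact: (@stab_caseII _ S F p_odd G3 nG2 _ _ _ _ ASt nsA_comm nsN_St _ _ Nn1 um1 ln1).
Qed.

Lemma egs_caseII_single : odd p -> (forall i j : I, i = j) ->
  regular_branch G (lower_central 3 G) ->
  ~ regular_branch G (commutator_subgroup G G) ->
  St G (m + 4) `<=` commutator_subgroup N G.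
Proof.
move=> p_odd single br3 nbr2; apply: stab_sub_comm.
have G3 := injmap_of_branch (@gam3_sval _ _ Gs) br3.
have nG2 : ~ injmap (gam 2 : nsub S) (gam 2) by move/(branch_of_injmap br3).
have [n0 ASt] := nsA_St; have [n1 [u1 [Nn1 um1 ln1]]] := nsN_max.
exact: (@stab_caseII_single _ S F p_odd G3 nG2 _ _ _ _ ASt nsA_comm nsN_St _ _ Nn1 um1 ln1 single).
Qed.

End Normal.
End Translation.

Lemma stab_fg (p : nat) (S : ssgroup p) (F : family S) (A N : nsub S) (m n0 : nat)
    (n1 : S) (u1 : seq 'F_p) : odd p -> (forall i j : fI F, i = j) ->
    (forall (i : fI F) y, fe i y = (y == 1%R)%:R%R) ->
    (forall s : S, stab S n0 s -> A s) -> (forall n h : S, N n -> A [~ n, h]) ->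
    (forall n : S, N n -> stab S m n) -> N n1 -> size u1 = m -> lab (secw n1 u1) != 0%R ->
  forall s : S, stab S (m + 2) s -> A s.
Proof.
move=> p_odd single fE ASt NA NSt Nn1 um1 ln1.
have [p3|p3] := eqVneq p 3; last first.
  exact: (stab_fg_large single p_odd fE ASt NA NSt Nn1 um1 ln1).
subst p; have [m0|m_gt0] := posnP m; last first.
  by move=> s; apply: (stab_fg_ternary single fE ASt NA NSt Nn1 um1 ln1 m_gt0).
rewrite m0 in um1 *; move=> s; rewrite add0n; apply: (stab2_root single ASt NA Nn1).
by rewrite (size0nil um1) in ln1.
Qed.

Lemma egs_GGS (p : nat) (e : 'rV['F_p]_p.-1) :
  GGS e = egs (fun _ : unit => 0%N) (fun=> e).
Proof.
rewrite /GGS /egs; congr (generated_subgroup (_ `|` _)); apply/seteqP; split=> b.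
  by move=> ->; exists tt.
by case=> _ ->.
Qed.

Lemma egs_multiEGS (p : nat) (r : 'I_p -> 'I_p) (E : forall j : 'I_p, 'M['F_p]_(r j, p.-1)) :
  multiEGS E = egs (fun i : {j : 'I_p & 'I_(r j)} => tag i : nat)
    (fun i => row (tagged i) (E (tag i))).
Proof.
rewrite /multiEGS /egs; congr (generated_subgroup (_ `|` _)); apply/seteqP; split=> b.
  by case=> j [i ->]; exists (Tagged (fun j => 'I_(r j)) i).
by case=> -[j i] ->; exists j, i.
Qed.

Definition fg_vec (p : nat) : 'rV['F_p]_p.-1 := (\row_(k < p.-1) (k == 0 :> nat)%:R)%R.

Lemma egs_fg (p : nat) (N : set (treeAut p)) (m : nat) : prime p ->
    let G := egs (fun _ : unit => 0%N) (fun=> fg_vec p) in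
    normal_in N G -> congruence_subgroup (commutator_subgroup N G) G ->
    N `<=` St G m -> (forall k : nat, N `<=` St G k -> (k <= m)%N) -> odd p ->
  St G (m + 2) `<=` commutator_subgroup N G.
Proof.
move=> p_pr G NG cong NSt Nmax p_odd.
have p1 : 0 < p.-1 by rewrite -ltnS prednK ?prime_gt1 ?prime_gt0.
have e0 (_ : unit) : fg_vec p != 0%R.
  by apply/rV0Pn; exists (Ordinal p1); rewrite mxE oner_eq0.
pose F := egs_family p_pr (fun _ : unit => 0%N) e0 tt.
apply: (stab_sub_comm (p_pr := p_pr) (NG := NG)).
have [n0 ASt] := nsA_St p_pr NG cong.
have [n1 [u1 [Nn1 um1 ln1]]] := nsN_max p_pr NG NSt Nmax.
apply: (stab_fg (F := F) p_odd _ _ ASt (nsA_comm (NG := NG)) (nsN_St (NG := NG) NSt) Nn1 um1 ln1).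
  by case=> -[].
move=> i y; have [->|y0] := eqVneq y 0%R; first by rewrite fe0 eq_sym oner_eq0.
rewrite /= /eexp (negPf y0).
have yp : (y : nat).-1 < p.-1.
  have xp : y < p by rewrite -[p in X in _ < X](Fp_cast p_pr) ltn_ord.
  by rewrite -ltnS (prednK (p_gt0 p_pr)) prednK // lt0n.
rewrite (insubT (fun n => n < p.-1) yp) mxE /=; congr (nat_of_bool _)%:R%R.
by rewrite -[y == 1%R]val_eqE /= -(prednK (n := y)) // lt0n.
Qed.

Theorem theorem1p1 (p : nat) (r : 'I_p -> 'I_p)
    (E : forall j : 'I_p, 'M['F_p]_(r j, p.-1))
    (G N : set (treeAut p)) (m : nat) :
  prime p -> odd p ->
  multiEGS_data E -> G = multiEGS E ->
  normal_in N G ->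
  congruence_subgroup (commutator_subgroup N G) G ->
  N `<=` St G m -> (forall k : nat, N `<=` St G k -> (k <= m)%N) ->
  [/\ (regular_branch G (commutator_subgroup G G) ->
         St G (m + rdot E + 3) `<=` commutator_subgroup N G),
      (regular_branch G (lower_central 3 G) ->
       ~ regular_branch G (commutator_subgroup G G) ->
         St G (m + 7) `<=` commutator_subgroup N G),
      (is_GGS G ->
         (regular_branch G (commutator_subgroup G G) ->
            St G (m + 3) `<=` commutator_subgroup N G) /\
         (regular_branch G (lower_central 3 G) ->
          ~ regular_branch G (commutator_subgroup G G) ->
            St G (m + 4) `<=` commutator_subgroup N G)) &
      (G = FabrykowskiGupta p -> St G (m + 2) `<=` commutator_subgroup N G)].
Proof.
move=> p_pr p_odd [[j0 rj0] rfE] GE NG cong NSt Nmax.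
have unit1 (i j : unit) : i = j by case: i; case: j.
pose ev (i : {j : 'I_p & 'I_(r j)}) : 'rV['F_p]_p.-1 := row (tagged i) (E (tag i)).
have ev_nz i : ev i != 0%R.
  apply/negP => /eqP ei0; have := row_free_inj (rfE (tag i)).
  move/(_ 1%N (delta_mx ord0 (tagged i)) 0%R); rewrite -rowE mul0mx => /(_ ei0).
  by move/matrixP/(_ ord0 (tagged i))/eqP; rewrite !mxE !eqxx oner_eq0.
have ev_rdot i : (ev i <= \sum_j <<E j>>)%MS.
  apply: submx_trans (row_sub _ _) _.
  by apply: (sumsmx_sup (tag i)) => //; rewrite genmxE.
pose i0 : {j : 'I_p & 'I_(r j)} := Tagged (fun j => 'I_(r j)) (Ordinal rj0).
split.
- rewrite GE egs_multiEGS in NG cong NSt Nmax * => br.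
  exact: (egs_caseI p_pr ev_nz i0 NG cong NSt Nmax ev_rdot br).
- rewrite GE egs_multiEGS in NG cong NSt Nmax * => br3 nbr2.
  exact: (egs_caseII p_pr ev_nz i0 NG cong NSt Nmax p_odd br3 nbr2).
(* The given generating system is replaced by one with a single directed generator, indexed by
   [unit]. *)
- move=> [e /eqP e0 GGSE]; rewrite GGSE egs_GGS in NG cong NSt Nmax *.
  split=> [br|br3 nbr2].
    exact: (egs_caseI_single p_pr (fun=> e0) tt NG cong NSt Nmax unit1 br).
  exact: (egs_caseII_single p_pr (fun=> e0) tt NG cong NSt Nmax p_odd unit1 br3 nbr2).
- move=> GGSE; rewrite GGSE /FabrykowskiGupta egs_GGS in NG cong NSt Nmax *.
  exact: (egs_fg p_pr NG cong NSt Nmax p_odd).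
Qed.
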